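(* There exists a (global) optimal control of the optimal control problem (P): there is a feasible pair $(\bar z,\bar g)\in H^1_\star(I;H_0^1(\Omega))\times H^1_\star(I;L^2(\Omega))$ such that $J(\bar z,\bar g)\le J(z,g)$ for all feasible pairs $(z,g)$.
   Context: $\Omega\subset\mathbb R^d$ is a bounded Lipschitz domain, $T>0$, $I=(0,T)$. $H_0^1(\Omega)$ carries the scalar product $\int_\Omega\nabla z\cdot\nabla w\,dx$, and $\Delta:H_0^1(\Omega)\to H^{-1}(\Omega)$ is the distributional Laplacian. For a Hilbert space $H$, $H^1_\star(I;H)=\{v\in H^1(I;H):v(0)=0\}$. State equation: $z\in H^1_\star(I;H_0^1(\Omega))$ solves the state equation for $g$ if $\Delta z(t)+g(t)\in\partial\mathcal D(\dot z(t))$ in $H^{-1}(\Omega)$ for a.a. $t\in I$, where $\mathcal D:H_0^1(\Omega)\to\mathbb R$, $\mathcal D(v)=\int_\Omega|v|\,dx$, and $\partial\mathcal D$ is its convex subdifferential. It is known that for each $g\in H^1(I;H^{-1}(\Omega))$ with $\|g(0)\|_{L^\infty(\Omega)}\le1$ there is a unique such $z$. Objective: $J(z,g)=j_1(z)+j_2(z(T))+\frac12\|g\|^2_{H^1(I;L^2(\Omega))}$, where $j_1:L^2(I;H_0^1(\Omega))\to\mathbb R$ and $j_2:H_0^1(\Omega)\to\mathbb R$ are continuously Fréchet differentiable and bounded from below. Problem (P): minimize $J(z,g)$ over $z\in H^1_\star(I;H_0^1(\Omega))$, $g\in H^1(I;L^2(\Omega))$ subject to the state equation and $g(0)=0$.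 Feasible pairs are those satisfying these constraints. *)

(* Defs.v *)
From HB Require Import structures.
From mathcomp Require Import all_boot all_order all_algebra.
From mathcomp Require Import all_classical all_reals all_analysis.

Set Implicit Arguments.
Unset Strict Implicit.
Unset Printing Implicit Defensive.

Import Order.TTheory GRing.Theory Num.Theory.
Import numFieldNormedType.Exports.

Local Open Scope classical_set_scope.
Local Open Scope ring_scope.

(* The sigma-algebra of R^n generated by the coordinates; since R is second
   countable it is the Borel sigma-algebra. *)
Fact rV_display : measure_display. Proof. by []. Qed.

Section measurable_rV.
Context {R : realType} {n : nat}.

Definition rV_coord (i : 'I_n) (x : 'rV[R]_n) : measurableTypeR R := x 0 i.

Let rV_set0 : g_sigma_preimage rV_coord set0.
Proof. exact: sigma_algebra0. Qed.

Let rV_setC A : g_sigma_preimage rV_coord A -> g_sigma_preimage rV_coord (~` A).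
Proof. exact: sigma_algebraC. Qed.

Let rV_bigcup (F : _^nat) : (forall i, g_sigma_preimage rV_coord (F i)) ->
  g_sigma_preimage rV_coord (\bigcup_i (F i)).
Proof. exact: sigma_algebra_bigcup. Qed.

HB.instance Definition _ := @isMeasurable.Build rV_display
  'rV[R]_n (g_sigma_preimage rV_coord) rV_set0 rV_setC rV_bigcup.
End measurable_rV.

Definition rV_cons {R : realType} {n : nat} (p : R * 'rV[R]_n) : 'rV[R]_n.+1 :=
  row_mx (p.1)%:M p.2.

(* Lebesgue measure on R^n, as the n-fold product of [lebesgue_measure] carried
   over to row vectors; restricted to Borel sets, like [lebesgue_measure]. *)
Fixpoint lebesgue_rV {R : realType} (n : nat) : set 'rV[R]_n -> \bar R :=
  match n with
  | 0 => \d_(0 : 'rV[R]_0)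
  | m.+1 => pushforward (lebesgue_measure \x lebesgue_rV (n := m))%E rV_cons
  end.
Arguments lebesgue_rV {R} n _.


Section lebesgue_rV_measure.
Context {R : realType}.

Lemma measurable_rV_coord (n : nat) (i : 'I_n) :
  measurable_fun setT (@rV_coord R n i).
Proof.
move=> _ A mA; rewrite setTI; apply: sub_sigma_algebra => /=.
rewrite -bigcup_seq /=; exists i => /=; first by rewrite mem_index_enum.
by exists A => //; rewrite setTI.
Qed.

Lemma measurable_fun_rV d (T : measurableType d) (n : nat) (f : T -> 'rV[R]_n) :
  (forall i, measurable_fun setT (rV_coord i \o f)) -> measurable_fun setT f.
Proof.
move=> mf; apply: (@measurability _ _ _ _ _ _
  (\big[setU/set0]_(i < n) preimage_set_system setT (@rV_coord R n i)
          measurable)) => //.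
move=> _ [B + <-]; rewrite -bigcup_seq => -[i _ [A mA <-]].
by rewrite !setTI -comp_preimage -[X in measurable X]setTI; exact: mf.
Qed.

Definition rV_uncons (n : nat) (x : 'rV[R]_n.+1) : R * 'rV[R]_n :=
  (x 0 0, rsubmx (x : 'rV_(1 + n))).

Lemma rV_consK (n : nat) : cancel (@rV_cons R n) (@rV_uncons n).
Proof.
move=> -[x y]; rewrite /rV_cons /rV_uncons /= row_mxKr; congr pair.
by rewrite mxE; case: splitP => // j _; rewrite ord1 mxE mulr1n.
Qed.

Lemma rV_unconsK (n : nat) : cancel (@rV_uncons n) (@rV_cons R n).
Proof.
move=> x; rewrite /rV_cons /rV_uncons /=.
rewrite (_ : (x 0 0)%:M = lsubmx (x : 'rV_(1 + n)));
  first exact: (@hsubmxK R 1 1 n x).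
by rewrite [RHS]mx11_scalar mxE; congr (x _ _)%:M; apply/val_inj.
Qed.

Lemma measurable_rV_uncons (n : nat) : measurable_fun setT (@rV_uncons n).
Proof.
apply: measurable_fun_pair; first exact: (measurable_rV_coord (0 : 'I_n.+1)).
apply: measurable_fun_rV => i.
rewrite (_ : _ \o _ = rV_coord (rshift 1 i)); first exact: measurable_rV_coord.
by apply/funext => x; rewrite /rV_coord /= mxE.
Qed.

Lemma measurable_rV_cons (n : nat) :
  measurable_fun setT (@rV_cons R n).
Proof.
apply: measurable_fun_rV => i.
case: (splitP (i : 'I_(1 + n))) => j ij.
  rewrite (_ : _ \o _ = fst); first exact: measurable_fst.
  apply/funext => -[x y] /=; rewrite /rV_coord /rV_cons /= mxE.
  case: splitP => k; rewrite ij; first by rewrite !ord1 mxE mulr1n.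
  by rewrite ord1.
rewrite (_ : _ \o _ = rV_coord j \o snd).
  by apply: measurableT_comp => //; exact: measurable_rV_coord.
apply/funext => -[x y] /=; rewrite /rV_coord /rV_cons /= mxE.
case: splitP => k; rewrite ij; first by rewrite ord1.
by rewrite !add1n => -[jk]; congr (y _ _); apply/val_inj.
Qed.

Definition is_sfmeasure d (T : measurableType d) (mu : set T -> \bar R) :=
  [/\ mu set0 = 0%E, forall A, (0 <= mu A)%E, semi_sigma_additive mu
    & sigma_finite setT mu].

Lemma pushforward_sfmeasure d1 d2 (T1 : measurableType d1)
    (T2 : measurableType d2) (m : {measure set T1 -> \bar R})
    (f : T1 -> T2) (g : T2 -> T1) : sigma_finite setT m ->
    measurable_fun setT f -> measurable_fun setT g -> cancel f g ->
  is_sfmeasure (pushforward m f).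
Proof.
move=> [F FT Foo] mf mg fK.
pose p := @measure_function_pushforward__canonical__measure_function_Measure
  _ _ _ _ R m _ mf.
split.
- exact: (measure0 p).
- by move=> A; exact: (measure_ge0 p).
- exact: (@measure_semi_sigma_additive _ _ _ p).
exists (fun k => g @^-1` F k).
  by rewrite -preimage_bigcup -FT preimage_setT.
move=> k; have [mF Fk] := Foo k; split.
  by rewrite -[X in measurable X]setTI; exact: mg.
rewrite /pushforward -comp_preimage (_ : _ \o _ = id) //.
by apply/funext => x; rewrite /= fK.
Qed.

Let lebesgue_rV_sfmeasure (n : nat) : is_sfmeasure (lebesgue_rV n).
Proof.
elim: n => [|n [mu0 mu_ge0 mu_sadd mu_sfin]] /=.
  split.
  - by rewrite measure0.
  - by move=> A.
  - exact: measure_semi_sigma_additive.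
  - exact: sigma_finiteT.
pose m1 := isMeasure.Build _ _ _ (lebesgue_rV n) mu0 mu_ge0 mu_sadd.
pose mu' : {measure set 'rV[R]_n -> \bar R} := HB.pack (lebesgue_rV n) m1.
pose m2 := Measure_isSigmaFinite.Build _ _ _ mu' mu_sfin.
pose mu : {sigma_finite_measure set 'rV[R]_n -> \bar R} :=
  HB.pack (Measure.sort mu') m2.
pose m : {measure set (measurableTypeR R * 'rV[R]_n)%type -> \bar R} :=
  (@lebesgue_measure R \x mu)%E.
refine (pushforward_sfmeasure (m := m) _ (@measurable_rV_cons n)
  (@measurable_rV_uncons n) (@rV_consK n)).
have /sigma_finiteP[F [TF ndF Foo]] := sigma_finiteT (@lebesgue_measure R).
have /sigma_finiteP[G [TG ndG Goo]] := sigma_finiteT mu.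
exists (fun k => F k `*` G k).
 rewrite -setXTT TF TG predeqE => -[x y]; split.
    move=> [/= [i _ Fix] [k _ Gky]]; exists (maxn i k) => //; split.
    - by move: x Fix; exact/subsetPset/ndF/leq_maxl.
    - by move: y Gky; exact/subsetPset/ndG/leq_maxr.
  by move=> [i _ []/= ? ?]; split; exists i.
move=> k; have [mF Fk] := Foo k; have [mG Gk] := Goo k.
split; first exact: measurableX.
rewrite (_ : m _ = lebesgue_measure (F k) * mu (G k))%E.
  by rewrite lte_mul_pinfty// ge0_fin_numE.
exact: (product_measure1E _ mu).
Qed.

HB.instance Definition _ (n : nat) := isMeasure.Build _ _ _ (lebesgue_rV n)
  (let: And4 h _ _ _ := lebesgue_rV_sfmeasure n in h)
  (let: And4 _ h _ _ := lebesgue_rV_sfmeasure n in h)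
  (let: And4 _ _ h _ := lebesgue_rV_sfmeasure n in h).

HB.instance Definition _ (n : nat) :=
  Measure_isSigmaFinite.Build _ _ _ (lebesgue_rV n)
  (let: And4 _ _ _ h := lebesgue_rV_sfmeasure n in h).

End lebesgue_rV_measure.

(* A (semi)normed function space given by representatives: the elements are the
   x in the ambient vector space with [fmem x], and two of them are the same
   element of the normed space when [fnorm (x - y) = 0] (this is how functions
   equal almost everywhere are identified). *)
Record fspace (R : realType) := FSpace {
  fcarrier :> lmodType R ;
  fmem : set fcarrier ;
  fnorm : fcarrier -> R }.
Arguments fmem {R} _.
Arguments fnorm {R} _.

Section functionals.
Context {R : realType}.
Variable X : fspace R.

Definition dual : set (X -> R) := [set A |
  (forall (a : R) (x y : X), fmem X x -> fmem X y ->
     A (a *: x + y) = a * A x + A y) /\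
  exists C : R, forall x : X, fmem X x -> `|A x| <= C * fnorm X x].

Definition subdiff (F : X -> R) (w : X) : set (X -> R) := [set xi |
  dual xi /\ forall v : X, fmem X v -> F w + xi (v - w) <= F v].

Definition is_frechet_deriv (j : X -> R) (u : X) (A : X -> R) :=
  dual A /\
  forall e : R, 0 < e -> exists2 d : R, 0 < d &
    forall h : X, fmem X h -> fnorm X h < d ->
      `|j (u + h) - j u - A h| <= e * fnorm X h.

(* The last conjunct is the continuity of [u |-> dj u] for the operator norm
   on the dual. *)
Definition cont_frechet_diff (j : X -> R) := exists dj : X -> X -> R,
  (forall u, fmem X u -> is_frechet_deriv j u (dj u)) /\
  (forall u, fmem X u -> forall e : R, 0 < e -> exists2 d : R, 0 < d &
     forall w, fmem X w -> fnorm X (w - u) < d ->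
       forall h, fmem X h -> `|dj w h - dj u h| <= e * fnorm X h).

Definition bounded_below (j : X -> R) :=
  exists c : R, forall u, fmem X u -> c <= j u.

End functionals.
Arguments cont_frechet_diff {R} X j.
Arguments bounded_below {R} X j.

Definition compactly_supported {R : realType} {V : topologicalType}
    (D : set V) (phi : V -> R) :=
  compact (closure [set x | phi x != 0]) /\ closure [set x | phi x != 0] `<=` D.

Section domain.
Context {R : realType} {d : nat}.
Variable Omega : set 'rV[R]_d.

(* Near each boundary point, in suitable Cartesian coordinates [x *m Q],
   [Omega] is the set of points above the graph of a Lipschitz function of the
   d - 1 coordinates other than the k-th. *)
Definition lipschitz_boundary := forall p, (closure Omega `\` Omega) p ->
  exists (Q : 'M[R]_d) (k : 'I_d) (gamma : 'rV[R]_d.-1 -> R),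
    [/\ Q *m Q^T = 1%:M,
        [lipschitz gamma y | y in setT]
      & \forall x \near p,
          Omega x <-> gamma (col' k (x *m Q)) < (x *m Q) 0 k].

Definition bounded_lipschitz_domain :=
  [/\ open Omega, connected Omega, Omega !=set0, bounded_set Omega
    & lipschitz_boundary].

Definition partial (i : 'I_d) (f : 'rV[R]_d -> R) : 'rV[R]_d -> R :=
  fun x => 'D_(delta_mx 0 i) f x.

(* C_c^oo(Omega): differentiability of all iterated partial derivatives is
   smoothness. *)
Definition test_fun : set ('rV[R]_d -> R) := [set phi |
  (forall (s : seq 'I_d) x, differentiable (foldr partial phi s) x) /\
  compactly_supported Omega phi].

Definition L2 : fspace R := @FSpace R ('rV[R]_d -> R)
  [set f : 'rV[R]_d -> R | measurable_fun Omega f /\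
     (\int[lebesgue_rV d]_(x in Omega) (f x ^+ 2)%:E < +oo)%E]
  (fun f => Num.sqrt (\int[lebesgue_rV d]_(x in Omega) (f x ^+ 2))).

Definition is_weak_partial (i : 'I_d) (z g : 'rV[R]_d -> R) :=
  fmem L2 g /\ forall phi, test_fun phi ->
    \int[lebesgue_rV d]_(x in Omega) (z x * partial i phi x) =
    - \int[lebesgue_rV d]_(x in Omega) (g x * phi x).

(* A representative of the weak derivative, chosen arbitrarily among those that
   exist (0 when there is none). *)
Definition weak_partial (i : 'I_d) (z : 'rV[R]_d -> R) : 'rV[R]_d -> R :=
  xget 0 [set g | is_weak_partial i z g].

(* int_Omega grad z . grad w *)
Definition dirichlet (z w : 'rV[R]_d -> R) : R :=
  \int[lebesgue_rV d]_(x in Omega)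
    (\sum_(i < d) weak_partial i z x * weak_partial i w x).

Definition H1 : fspace R := @FSpace R ('rV[R]_d -> R)
  [set z | fmem L2 z /\ forall i, exists g, is_weak_partial i z g]
  (fun z => Num.sqrt (fnorm L2 z ^+ 2 + dirichlet z z)).

(* The closure of C_c^oo(Omega) in H^1, with the Dirichlet norm. *)
Definition H10 : fspace R := @FSpace R ('rV[R]_d -> R)
  [set z | fmem H1 z /\ exists phi : nat -> 'rV[R]_d -> R,
     (forall k, test_fun (phi k)) /\
     fnorm H1 (phi k - z) @[k --> \oo] --> 0]
  (fun z => Num.sqrt (dirichlet z z)).

(* Elements of H^{-1}(Omega), the dual of H10, are represented by functionals
   on functions; [laplacian z] is the distributional Laplacian and [L2_dual g]
   the image of g under the embedding of L^2 into H^{-1}. *)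
Definition laplacian (z : 'rV[R]_d -> R) : H10 -> R := fun v => - dirichlet z v.

Definition L2_dual (g : 'rV[R]_d -> R) : H10 -> R :=
  fun v => \int[lebesgue_rV d]_(x in Omega) (g x * v x).

Definition dissipation : H10 -> R :=
  fun v => \int[lebesgue_rV d]_(x in Omega) `|v x|.

End domain.

Section bochner.
Context {R : realType}.
Variable X : fspace R.

(* The simple function sum_i 1_{A_i} x_i of one real variable. *)
Record simple := Simple {
  simple_size : nat ;
  simple_set : 'I_simple_size -> set R ;
  simple_val : 'I_simple_size -> X }.

Definition simple_fun (s : simple) (t : R) : X :=
  \sum_i \1_(@simple_set s i) t *: @simple_val s i.

Definition simple_int (s : simple) : X :=
  \sum_i fine (lebesgue_measure (@simple_set s i)) *: @simple_val s i.

Definition simple_on (D : set R) (s : simple) := forall i,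
  [/\ measurable (@simple_set s i : set (measurableTypeR R)),
      @simple_set s i `<=` D & fmem X (@simple_val s i)].

(* As for the real-valued functions of the library, measurability is Borel
   measurability: the approximation is required at every point of [D]. Each
   class of functions equal almost everywhere that contains an a.e. limit of
   simple functions has such a representative. *)
Definition strongly_measurable (D : set R) (v : R -> X) :=
  (forall t, D t -> fmem X (v t)) /\
  exists s : nat -> simple, (forall k, simple_on D (s k)) /\
    forall t, D t -> fnorm X (simple_fun (s k) t - v t) @[k --> \oo] --> 0.

Definition is_bochner_int (D : set R) (v : R -> X) (y : X) :=
  [/\ strongly_measurable D v, fmem X y
    & exists s : nat -> simple, [/\ forall k, simple_on D (s k),
        (\int[lebesgue_measure]_(t in D)
           (fnorm X (simple_fun (s k) t - v t))%:E)%E @[k --> \oo] --> 0%E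
      & fnorm X (simple_int (s k) - y) @[k --> \oo] --> 0]].

Variable T : R.

Definition L2I : fspace R := @FSpace R (R -> X)
  [set v | strongly_measurable `]0, T[ v /\
     (\int[lebesgue_measure]_(t in `]0%R, T[) (fnorm X (v t) ^+ 2)%:E < +oo)%E]
  (fun v =>
     Num.sqrt (\int[lebesgue_measure]_(t in `]0%R, T[) (fnorm X (v t) ^+ 2))).

Definition test_funI : set (R -> R) := [set phi : R -> R |
  (forall n t, derivable (derive1n n phi) t 1) /\
  compactly_supported `]0, T[ phi].

(* int phi' v = - int phi dv as X-valued Bochner integrals; [y] is their common
   value up to sign. *)
Definition is_weak_derivI (v dv : R -> X) :=
  fmem L2I dv /\ forall phi, test_funI phi -> exists y : X,
    is_bochner_int `]0, T[ (fun t => derive1 phi t *: v t) y /\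
    is_bochner_int `]0, T[ (fun t => phi t *: dv t) (- y).

Definition weak_derivI (v : R -> X) : R -> X :=
  xget 0 [set dv | is_weak_derivI v dv].

Definition H1I : fspace R := @FSpace R (R -> X)
  [set v | fmem L2I v /\ exists dv, is_weak_derivI v dv]
  (fun v => Num.sqrt (fnorm L2I v ^+ 2 + fnorm L2I (weak_derivI v) ^+ 2)).

(* Continuity and equality are those of the normed space, as in [fspace].
   [x] is the value at t0 of the continuous representative of [v] on [0, T]. *)
Definition is_trace (v : R -> X) (t0 : R) (x : X) :=
  exists c : R -> X, [/\ forall t, t \in `[0, T] -> fmem X (c t),
    forall t, t \in `[0, T] ->
      fnorm X (c s - c t) @[s --> within [set` `[0, T]] (nbhs t)] --> 0,
    {ae lebesgue_measure, forall t, t \in `]0, T[ -> fnorm X (c t - v t) = 0}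
    & c t0 = x].

Definition trace (v : R -> X) (t0 : R) : X := xget 0 [set x | is_trace v t0 x].

Definition H1star : set (R -> X) := [set v | fmem H1I v /\ is_trace v 0 0].

End bochner.

Section control_problem.
Context {R : realType} {d : nat}.
Variables (Omega : set 'rV[R]_d) (T : R).

Definition state_equation (z : R -> H10 Omega) (G : R -> H10 Omega -> R) :=
  {ae lebesgue_measure, forall t, t \in `]0, T[ ->
     subdiff (@dissipation R d Omega) (weak_derivI T z t)
       (laplacian (z t) + G t)}.

Definition feasible (z : R -> H10 Omega) (g : R -> L2 Omega) :=
  [/\ H1star T z, fmem (H1I (L2 Omega) T) g,
      state_equation z (fun t => @L2_dual R d Omega (g t))
    & is_trace T g 0 0].

Definition objective (j1 : L2I (H10 Omega) T -> R) (j2 : H10 Omega -> R)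
    (z : R -> H10 Omega) (g : R -> L2 Omega) : R :=
  j1 z + j2 (trace T z T) + 2^-1 * fnorm (H1I (L2 Omega) T) g ^+ 2.

End control_problem.

(* Main.v *)
(* The direct method, for an abstract pairing [p] of the controls with the states
   in place of the L2 product. By homogeneity of the dissipation D, the inclusion
   splits into the stability p(g(t), v) - <z(t), v> <= D(v) for all v, and the
   energy inequality D(z') <= p(g, z') - <z, z'>. Stability at nearby times bounds
   |z'| by a multiple of |g'| almost everywhere, and testing two stable solutions
   against each other bounds sup |z1 - z2|^2 by the distance of g1 and g2 in
   C(I; H^-1). Along a minimizing sequence g is bounded in H^1(I; L2). As the unit
   ball of H_0^1 is totally bounded in L2 (Rellich, by slicing), a subsequence of g
   is Cauchy in C(I; H^-1), so z converges uniformly in H_0^1 and j1, j2 pass to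
   the limit. Convex combinations of the tails converge strongly (Mazur); this
   yields the limit control, the derivative of the limit state, both inequalities
   for the limit and the lower semicontinuity of the norm of g. *)
Require Import Defs.
From mathcomp Require Import all_boot all_order all_algebra.
From mathcomp Require Import all_classical all_reals all_analysis.
From mathcomp Require Import measurable_realfun ring lra.

Import Order.TTheory GRing.Theory Num.Theory.
Import numFieldNormedType.Exports.

Local Open Scope classical_set_scope.
Local Open Scope ring_scope.

Set Implicit Arguments.
Unset Strict Implicit.
Unset Printing Implicit Defensive.

(** * Semi-inner products and convex combinations *)

(** The obstacle is the energy inequality. Along a minimizing sequence only weak convergence is at
    hand for the derivatives z_k', and in <g_k, z_k'> - <z_k, z_k'> both factors depend on k. The
    uniform rates for g_k in H^-1 and z_k in H_0^1 allow the limits to replace g_k and z_k at the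
    price of an error (4^-k + r_k)|z_k'(t)|, with r_k a multiple of 2^-k. Geometric rates make these
    errors summable in k for almost every t, so they vanish uniformly over tails. What is left is
    affine in z_k' on one side and convex on the other, and convex combinations respect it. The rate
    imposed on the controls is 4^-k because the estimate for the states loses a square root. No weak
    compactness is invoked: near-minimizers of the norm over hulls of tails converge strongly by
    themselves, and an ultrafilter that contains the tails replaces repeated extraction of
    subsequences. All objects are representatives and all norms are seminorms. Identities between
    vectors are therefore stated through inner products, and differentiability of j1 and j2 is what
    makes them insensitive to changes of norm zero. *)

Section sequence_bounds.
Context {R : realType}.
Implicit Types (f : nat -> R) (a l : R).

Lemma cvg_ge f l a : f n @[n --> \oo] --> l -> (forall n, a <= f n) -> a <= l.
Proof.
move=> fl af; have <- := cvg_lim (@Rhausdorff R) fl.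
by apply: limr_ge; [apply/cvg_ex; exists l|exact: nearW].
Qed.

Lemma cvg0_eq0 f a : f n @[n --> \oo] --> 0 -> (forall n, `|a| <= f n) -> a = 0.
Proof.
by move=> f0 /(cvg_ge f0) a0; apply/eqP; rewrite -normr_eq0 eq_le normr_ge0 andbT.
Qed.

Lemma cvg0_squeeze (f g : nat -> R) : g n @[n --> \oo] --> 0 ->
  (forall n, 0 <= f n <= g n) -> f n @[n --> \oo] --> 0.
Proof.
move=> g0 fg; apply: (@squeeze_cvgr _ _ _ _ (fun _ => 0) g) => //.
  exact: nearW.
exact: cvg_cst.
Qed.

Lemma cvg0M (f : nat -> R) c : f n @[n --> \oo] --> 0 -> c * f n @[n --> \oo] --> 0.
Proof. by move=> f0; rewrite -(mulr0 c); apply: cvgM => //; exact: cvg_cst. Qed.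

Lemma cvg0D (f g : nat -> R) : f n @[n --> \oo] --> 0 -> g n @[n --> \oo] --> 0 ->
  f n + g n @[n --> \oo] --> 0.
Proof. by move=> f0 g0; rewrite -(addr0 0); exact: cvgD. Qed.

Lemma cvg_geometric0 : (2^-1 ^+ n : R) @[n --> \oo] --> 0.
Proof. by apply: cvg_expr; rewrite ger0_norm// invf_lt1// ltr1n. Qed.

End sequence_bounds.
Section semi_inner_product.
Context {R : realType} {V : lmodType R}.
Variables (P : set V) (B : V -> V -> R).

(** The laws hold only on the members [P], as in [fspace], and definiteness is not asked: functions
    equal almost everywhere are distinct vectors at distance 0. *)
Record semi_inner : Prop := SemiInner {
  smem0 : P 0;
  smemL : forall a x y, P x -> P y -> P (a *: x + y);
  sipC : forall x y, P x -> P y -> B x y = B y x;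
  sipl : forall a x y z, P x -> P y -> P z ->
    B (a *: x + y) z = a * B x z + B y z;
  sip_ge0 : forall x, P x -> 0 <= B x x }.

Hypothesis S : semi_inner.

Lemma smemZ a x : P x -> P (a *: x).
Proof. by move=> Px; rewrite -[_ *: _]addr0; apply: (smemL S) => //; exact: smem0. Qed.

Lemma smemD x y : P x -> P y -> P (x + y).
Proof. by move=> Px Py; rewrite -[x]scale1r; apply: (smemL S). Qed.

Lemma smemN x : P x -> P (- x).
Proof. by move=> Px; rewrite -scaleN1r; apply: smemZ. Qed.

Lemma smemB x y : P x -> P y -> P (x - y).
Proof. by move=> Px Py; apply: smemD => //; apply: smemN. Qed.

Lemma smem_sum (I : Type) (r : seq I) (Q : pred I) (F : I -> V) :
  (forall i, P (F i)) -> P (\sum_(i <- r | Q i) F i).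
Proof. by move=> PF; elim/big_ind : _ => //; [exact: smem0 S|exact: smemD]. Qed.

Lemma sipDl x y z : P x -> P y -> P z -> B (x + y) z = B x z + B y z.
Proof. by move=> Px Py Pz; rewrite -[x in LHS]scale1r (sipl S)// mul1r. Qed.

Lemma sip0l z : P z -> B 0 z = 0.
Proof.
move=> Pz; have P0 := smem0 S.
by have /eqP := sipDl P0 P0 Pz; rewrite addr0 -subr_eq0 opprD addrA subrr sub0r oppr_eq0 => /eqP.
Qed.

Lemma sipZl a x z : P x -> P z -> B (a *: x) z = a * B x z.
Proof.
move=> Px Pz; have P0 := smem0 S.
by rewrite -[_ *: _]addr0 (sipl S)// sip0l// addr0.
Qed.

Lemma sipNl x z : P x -> P z -> B (- x) z = - B x z.
Proof. by move=> Px Pz; rewrite -scaleN1r sipZl// mulN1r. Qed.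

Lemma sipBl x y z : P x -> P y -> P z -> B (x - y) z = B x z - B y z.
Proof. by move=> Px Py Pz; rewrite sipDl ?sipNl//; exact: smemN. Qed.

Lemma sip_suml (I : Type) (r : seq I) (Q : pred I) (F : I -> V) z :
  (forall i, P (F i)) -> P z ->
  B (\sum_(i <- r | Q i) F i) z = \sum_(i <- r | Q i) B (F i) z.
Proof.
move=> PF Pz; elim: r => [|i r IH]; first by rewrite !big_nil sip0l.
rewrite !big_cons; case: ifP => // _.
by rewrite sipDl// ?IH//; exact: smem_sum.
Qed.

Lemma sipDr x y z : P x -> P y -> P z -> B x (y + z) = B x y + B x z.
Proof.
move=> Px Py Pz; have Pyz := smemD Py Pz.
by rewrite (sipC S)// sipDl// (sipC S Py)// (sipC S Pz).
Qed.

Lemma sipZr a x z : P x -> P z -> B x (a *: z) = a * B x z.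
Proof.
move=> Px Pz; have Pa := smemZ a Pz.
by rewrite (sipC S)// sipZl// (sipC S Px).
Qed.

Lemma sip0r z : P z -> B z 0 = 0.
Proof. by move=> Pz; rewrite (sipC S)// ?sip0l//; exact: smem0 S. Qed.

Lemma sipNr x z : P x -> P z -> B x (- z) = - B x z.
Proof. by move=> Px Pz; rewrite -scaleN1r sipZr// mulN1r. Qed.

Lemma sipBr x y z : P x -> P y -> P z -> B x (y - z) = B x y - B x z.
Proof. by move=> Px Py Pz; rewrite sipDr ?sipNr//; exact: smemN. Qed.

Definition snorm x := Num.sqrt (B x x).

Lemma snorm_ge0 x : 0 <= snorm x. Proof. exact: sqrtr_ge0. Qed.

Lemma sqr_snorm x : P x -> snorm x ^+ 2 = B x x.
Proof. by move=> Px; rewrite sqr_sqrtr// (sip_ge0 S). Qed.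

Lemma snorm0 : snorm 0 = 0.
Proof. by rewrite /snorm sip0l ?sqrtr0//; exact: smem0 S. Qed.

Lemma snormZ a x : P x -> snorm (a *: x) = `|a| * snorm x.
Proof.
move=> Px; rewrite /snorm sipZl ?sipZr//; last exact: smemZ.
by rewrite mulrA -expr2 sqrtrM ?sqr_ge0// sqrtr_sqr.
Qed.

Lemma snormN x : P x -> snorm (- x) = snorm x.
Proof. by move=> Px; rewrite -scaleN1r snormZ// normrN1 mul1r. Qed.

Lemma snormBC x y : P x -> P y -> snorm (x - y) = snorm (y - x).
Proof. by move=> Px Py; rewrite -snormN ?opprB//; exact: smemB. Qed.

Lemma cauchy_schwarz x y : P x -> P y -> `|B x y| <= snorm x * snorm y.
Proof.
move=> Px Py.
have key a : 0 <= a ^+ 2 * B x x + 2 * a * B x y + B y y.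
  have Pa := smemZ a Px.
  have := sip_ge0 S (smemD Pa Py).
  rewrite sipDl ?sipDr//; try exact: smemD.
  rewrite sipZl ?sipZr// sipZl// (sipC S Py Px); lra.
have xx := sip_ge0 S Px; have yy := sip_ge0 S Py.
rewrite -sqrtrM// -sqrtr_sqr ler_wsqrtr//.
have [x0|x0] := eqVneq (B x x) 0.
  have /eqP : B x y = 0.
    apply: contrapT => /eqP xy0.
    (* If [B x x] vanishes, the quadratic in [a] is affine, and this value of [a] would make it
       equal to -1. *)
    have := key (- (B y y + 1) / (2 * B x y)); rewrite x0 mulr0 add0r.
    have -> : 2 * (- (B y y + 1) / (2 * B x y)) * B x y = - (B y y + 1) by field.
    lra.
  by rewrite x0 mul0r => /eqP ->; rewrite expr0n.
have := key (- B x y / B x x).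
have -> : (- B x y / B x x) ^+ 2 * B x x + 2 * (- B x y / B x x) * B x y + B y y
  = (B x x * B y y - B x y ^+ 2) / B x x by field.
have xx0 : 0 < B x x by rewrite lt_neqAle eq_sym x0.
by rewrite pmulr_lge0 ?invr_gt0// subr_ge0.
Qed.

Lemma snormD x y : P x -> P y -> snorm (x + y) <= snorm x + snorm y.
Proof.
move=> Px Py; rewrite -(@ler_pXn2r _ 2)// ?nnegrE ?addr_ge0 ?snorm_ge0//.
rewrite sqr_snorm; last exact: smemD.
rewrite sipDl ?sipDr//; try exact: smemD.
rewrite (sipC S Py Px) -!sqr_snorm// sqrrD.
have := cauchy_schwarz Px Py; rewrite ler_norml => /andP[_]; lra.
Qed.

Lemma snormB x y : P x -> P y -> snorm (x - y) <= snorm x + snorm y.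
Proof. by move=> Px Py; rewrite -(snormN Py); apply: snormD => //; exact: smemN. Qed.

Lemma snorm_dist x y : P x -> P y -> `|snorm x - snorm y| <= snorm (x - y).
Proof.
move=> Px Py; rewrite ler_norml; apply/andP; split.
  have := snormD (smemB Py Px) Px; rewrite subrK snormBC//; lra.
have := snormD (smemB Px Py) Py; rewrite subrK; lra.
Qed.

Lemma snorm_trans x y z : P x -> P y -> P z ->
  snorm (x - z) <= snorm (x - y) + snorm (y - z).
Proof.
move=> Px Py Pz; have -> : x - z = (x - y) + (y - z) by rewrite addrA subrK.
by apply: snormD; exact: smemB.
Qed.

Lemma snorm_sum (I : Type) (r : seq I) (Q : pred I) (F : I -> V) :
  (forall i, P (F i)) ->
  snorm (\sum_(i <- r | Q i) F i) <= \sum_(i <- r | Q i) snorm (F i).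
Proof.
move=> PF; elim: r => [|i r IH]; first by rewrite !big_nil snorm0.
rewrite !big_cons; case: ifP => // _.
apply: le_trans (snormD _ _) _ => //; first exact: smem_sum.
by rewrite lerD2l.
Qed.

Lemma sip_sqrD x y : P x -> P y ->
  B (x + y) (x + y) = B x x + 2 * B x y + B y y.
Proof.
move=> Px Py; have Pxy := smemD Px Py.
by rewrite sipDl// !sipDr// (sipC S Py Px); ring.
Qed.

Lemma sip_sqrB x y : P x -> P y ->
  B (x - y) (x - y) = B x x - 2 * B x y + B y y.
Proof.
move=> Px Py; have PNy := smemN Py.
by rewrite sip_sqrD// sipNr// sipNl// sipNr//; ring.
Qed.

Lemma parallelogram x y : P x -> P y ->
  B (x - y) (x - y) = 2 * B x x + 2 * B y y - 4 * B (2^-1 *: (x + y)) (2^-1 *: (x + y)).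
Proof.
move=> Px Py; have Pxy := smemD Px Py; have Ph := smemZ 2^-1 Pxy.
by rewrite sip_sqrB// sipZl// sipZr// sip_sqrD//; field.
Qed.

Lemma snorm_fast (u : nat -> V) n m : (forall k, P (u k)) ->
  (forall k, snorm (u k.+1 - u k) <= 2^-1 ^+ k) -> (n <= m)%N ->
  snorm (u n - u m) <= 2 * 2^-1 ^+ n.
Proof.
move=> Pu uP /subnK <-; move: (m - n)%N => k.
(* The partial sum of the geometric series is kept exactly, so that the induction closes. *)
suff : snorm (u n - u (k + n)%N) <= 2 * 2^-1 ^+ n - 2 * 2^-1 ^+ (k + n).
  by move=> /le_trans; apply; rewrite gerBl mulr_ge0// exprn_ge0.
elim: k => [|k IH]; first by rewrite subrr subrr snorm0.
apply: le_trans (snorm_trans (Pu _) (Pu (k + n)%N) (Pu _)) _.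
rewrite [snorm (u (k + n)%N - _)]snormBC// addSn.
have := uP (k + n)%N; rewrite exprS; lra.
Qed.

End semi_inner_product.


(** * Convex combinations of tails *)

Section mazur.
Context {R : realType} {V : lmodType R}.
Implicit Types (n N : nat) (l : nat -> R) (x : nat -> V).

Definition tail_weights n N l :=
  [/\ forall k, 0 <= l k, forall k, (k < n)%N || (N <= k)%N -> l k = 0
    & \sum_(k < N) l k = 1].

Definition cvx N l x : V := \sum_(k < N) l k *: x k.

Lemma tail_weights_le n m N l : (n <= m)%N -> tail_weights m N l ->
  tail_weights n N l.
Proof.
move=> nm [l0 ls l1]; split=> // k /orP[kn|Nk]; apply: ls.
  by rewrite (leq_trans kn nm).
by rewrite Nk orbT.
Qed.

Lemma tail_weightsW n N N' l : (N <= N')%N -> tail_weights n N l ->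
  tail_weights n N' l.
Proof.
move=> NN [l0 ls l1]; split=> //.
  by move=> k /orP[kn|Nk]; apply: ls; rewrite ?kn// (leq_trans NN Nk) orbT.
rewrite -l1 (big_ord_widen _ _ NN) [RHS]big_mkcond/=; apply: eq_bigr => i _.
by case: ifPn => //; rewrite -leqNgt => Ni; rewrite ls// Ni orbT.
Qed.

Lemma cvxW n N N' l x : (N <= N')%N -> tail_weights n N l ->
  cvx N' l x = cvx N l x.
Proof.
move=> NN [l0 ls l1]; rewrite /cvx (big_ord_widen _ (fun k => l k *: x k) NN).
rewrite [RHS]big_mkcond/=; apply: eq_bigr => i _.
by case: ifPn => //; rewrite -leqNgt => Ni; rewrite ls ?Ni ?orbT// scale0r.
Qed.

Lemma tail_weights_half n N l1 l2 : tail_weights n N l1 -> tail_weights n N l2 ->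
  tail_weights n N (fun k => 2^-1 * (l1 k + l2 k)).
Proof.
move=> [l10 l1s l11] [l20 l2s l21]; split.
- by move=> k; rewrite mulr_ge0// addr_ge0.
- by move=> k kn; rewrite l1s// l2s// addr0 mulr0.
- by rewrite -mulr_sumr big_split/= l11 l21; lra.
Qed.

Lemma tail_weights_dirac n : tail_weights n n.+1 (fun k => (k == n)%:R).
Proof.
split=> [k|k|]; first exact: ler0n.
  by case/orP => nk; [rewrite ltn_eqF|rewrite gtn_eqF].
rewrite big_ord_recr/= eqxx big1 ?add0r// => i _.
by rewrite ltn_eqF.
Qed.

Lemma ler_cvx n N l (a b : nat -> R) : tail_weights n N l ->
  (forall k, (n <= k)%N -> a k <= b k) ->
  \sum_(k < N) l k * a k <= \sum_(k < N) l k * b k.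
Proof.
move=> [l0 ls _] ab; apply: ler_sum => k _.
have [kn|nk] := ltnP k n; first by rewrite ls ?kn// !mul0r.
by rewrite ler_wpM2l// ab.
Qed.

Lemma cvx_cst n N l (c : R) : tail_weights n N l -> \sum_(k < N) l k * c = c.
Proof. by move=> [_ _ l1]; rewrite -mulr_suml l1 mul1r. Qed.

Lemma ler_cvx_cst n N l (a : nat -> R) c : tail_weights n N l ->
  (forall k, (n <= k)%N -> a k <= c) -> \sum_(k < N) l k * a k <= c.
Proof. by move=> lN ac; rewrite -[leRHS](cvx_cst c lN); exact: ler_cvx ac. Qed.

Variables (P : set V) (B : V -> V -> R).
Hypothesis S : semi_inner P B.

Lemma cvx_mem N l x : (forall k, P (x k)) -> P (cvx N l x).
Proof. by move=> Px; apply: (smem_sum S) => k; exact: (smemZ S). Qed.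

Lemma cvx_subl n N l x (v : V) : tail_weights n N l ->
  cvx N l x - v = cvx N l (fun k => x k - v).
Proof.
move=> [_ _ l1]; rewrite /cvx -[v in LHS]scale1r -l1 scaler_suml -sumrB.
by apply: eq_bigr => k _; rewrite scalerBr.
Qed.

Lemma snorm_cvx n N l x : tail_weights n N l -> (forall k, P (x k)) ->
  snorm B (cvx N l x) <= \sum_(k < N) l k * snorm B (x k).
Proof.
move=> [l0 _ _] Px; apply: le_trans (snorm_sum S _ _ _) _ => [k|].
  exact: (smemZ S).
by apply: ler_sum => k _; rewrite (snormZ S)// ger0_norm.
Qed.

(* Near-minimizers of the norm over the convex hulls of the tails are Cauchy by
   the parallelogram law, since their midpoints again lie in such a hull. *)
Lemma mazur (x : nat -> V) (M : R) :
  (forall k, P (x k)) -> (forall k, B (x k) (x k) <= M) ->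
  exists (N : nat -> nat) (l : nat -> nat -> R),
    (forall n, tail_weights n (N n) (l n)) /\
    forall n m, (n <= m)%N ->
      snorm B (cvx (N n) (l n) x - cvx (N m) (l m) x) <= 2^-1 ^+ n.
Proof.
move=> Px xM.
pose E n := [set B (cvx w.1 w.2 x) (cvx w.1 w.2 x) | w in
  [set w : nat * (nat -> R) | tail_weights n w.1 w.2]].
have Einf n : has_inf (E n).
  split; last first.
    by exists 0 => _ [w _ <-]; apply: (sip_ge0 S); exact: cvx_mem.
  by eexists; exists (n.+1, fun k => (k == n)%:R) => //=; exact: tail_weights_dirac.
pose d n := inf (E n).
have dM n : d n <= M.
  apply: le_trans (xM n); apply: (inf_lbound (Einf n).2).
  exists (n.+1, fun k => (k == n)%:R); first exact: tail_weights_dirac.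
  rewrite /= /cvx big_ord_recr/= eqxx scale1r big1 ?add0r// => i _.
  by rewrite ltn_eqF// scale0r.
have dsup : has_sup (range d).
  by split; [exists (d 0%N), 0%N|exists M => _ [n _ <-]; exact: dM].
pose e := sup (range d).
(* In the parallelogram law the two norms give 2([e] + [eps n]) + 2([e] + [eps m]) and the midpoint
   takes away 4([e] - [eps n]). The multiples of [e] cancel and at most 8 [eps n] is left, the
   square of 2^-n. *)
pose eps n : R := (2^-1 ^+ n) ^+ 2 / 8.
have eps0 n : 0 < eps n by rewrite divr_gt0// exprn_gt0// exprn_gt0.
have dmono n m : (n <= m)%N -> d n <= d m.
  move=> nm; apply: lb_le_inf; first exact: (Einf m).1.
  move=> _ [w mw <-]; apply: (inf_lbound (Einf n).2); exists w => //.
  exact: tail_weights_le mw.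
have ex n : exists w : nat * (nat * (nat -> R)), [/\ (n <= w.1)%N,
    e - eps n < d w.1, tail_weights w.1 w.2.1 w.2.2 &
    B (cvx w.2.1 w.2.2 x) (cvx w.2.1 w.2.2 x) < e + eps n].
  have [_ [p _ <-] ep] := sup_adherent (eps0 n) dsup.
  have [_ [w pw <-] wp] := inf_adherent (eps0 n) (Einf (maxn n p)).
  (* [p] is a tail whose infimum is already within [eps n] of the supremum [e]; starting no earlier
     keeps this, since [d] is nondecreasing. *)
  exists (maxn n p, w); split => //=; first exact: leq_maxl.
    by apply: lt_le_trans ep _; apply: dmono; exact: leq_maxr.
  apply: lt_le_trans wp _; rewrite lerD2r.
  by apply: (sup_upper_bound dsup); exists (maxn n p).
have [w wP] := choice ex.
exists (fun n => (w n).2.1), (fun n => (w n).2.2); split.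
  by move=> n; have [nw _ + _] := wP n; exact: tail_weights_le.
move=> n m nm; set v := cvx _ _ _; set u := cvx _ _ _.
have Pv : P v by exact: cvx_mem.
have Pu : P u by exact: cvx_mem.
have [nw dn twn Bn] := wP n; have [mw dm twm Bm] := wP m.
have enm : eps m <= eps n.
  rewrite /eps ler_pM2r ?invr_gt0// ler_pXn2r ?nnegrE ?exprn_ge0//.
  by rewrite ler_wiXn2l// invf_le1 ?ler1n.
rewrite -(@ler_pXn2r _ 2)// ?nnegrE ?snorm_ge0 ?exprn_ge0//.
rewrite (sqr_snorm S); last exact: (smemB S).
rewrite (parallelogram S Pv Pu).
suff : e - eps n <= B (2^-1 *: (v + u)) (2^-1 *: (v + u)).
  move: Bn Bm enm; rewrite -/v -/u.
  have -> : (2^-1 ^+ n) ^+ 2 = 8 * eps n by rewrite /eps mulrC divfK.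
  by lra.
(* The midpoint is a convex combination of the tail from [q] on, and [d q] is one of two infima that
   both exceed [e - eps n]. *)
pose q := minn (w n).1 (w m).1; pose K := maxn (w n).2.1 (w m).2.1.
have eq : e - eps n <= d q.
  rewrite /q; case: leqP => _; first exact: ltW.
  by apply: le_trans (ltW dm); rewrite lerD2l lerN2.
apply: le_trans eq _; apply: (inf_lbound (Einf q).2).
have tn : tail_weights q K (w n).2.2.
  by apply: tail_weightsW (leq_maxl _ _) _; apply: tail_weights_le twn; exact: geq_minl.
have tm : tail_weights q K (w m).2.2.
  by apply: tail_weightsW (leq_maxr _ _) _; apply: tail_weights_le twm; exact: geq_minr.
exists (K, fun k => 2^-1 * ((w n).2.2 k + (w m).2.2 k)).
  exact: tail_weights_half.
suff -> : cvx K (fun k => 2^-1 * ((w n).2.2 k + (w m).2.2 k)) x = 2^-1 *: (v + u) by [].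
rewrite /v /u -(cvxW x (leq_maxl (w n).2.1 (w m).2.1) twn).
rewrite -(cvxW x (leq_maxr (w n).2.1 (w m).2.1) twm) -/K /cvx -big_split/= scaler_sumr.
by apply: eq_bigr => k _; rewrite -scalerDl scalerA.
Qed.

End mazur.

(* Completeness is only asked for sequences with geometrically decreasing
   increments, the form in which Riesz-Fischer arguments deliver it. *)
Record hilbert {R : realType} (X : fspace R) (B : X -> X -> R) : Prop := Hilbert {
  hinner :> semi_inner (fmem X) B ;
  hnorm : forall x, fmem X x -> fnorm X x = snorm B x ;
  hfast : forall u : nat -> X, (forall n, fmem X (u n)) ->
    (forall n, snorm B (u n.+1 - u n) <= 2^-1 ^+ n) ->
    exists2 x, fmem X x & snorm B (u n - x) @[n --> \oo] --> 0 }.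

(** * Completeness for arbitrary Cauchy sequences *)

Section hilbert.
Context {R : realType} (X : fspace R) (B : X -> X -> R).
Hypothesis H : hilbert B.

(** A subsequence with geometric increments has a limit by [hfast], and the Cauchy bound [e n] is
    inherited by the distance of the whole sequence to it. *)
Lemma hcomplete (u : nat -> X) (e : nat -> R) : (forall n, fmem X (u n)) ->
  e @ \oo --> 0 ->
  (forall n m, (n <= m)%N -> snorm B (u n - u m) <= e n) ->
  exists2 x, fmem X x & forall n, snorm B (u n - x) <= e n.
Proof.
move=> um e0 ue.
have ex n : exists k, e k <= 2^-1 ^+ n.
  have : \forall k \near \oo, e k < 2^-1 ^+ n.
    by apply: (cvgr_lt 0) => //; rewrite exprn_gt0.
  by case=> k _ /(_ k (leqnn k)) /ltW; exists k.
have [s sP] := choice ex.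
pose t := fix t n := if n is m.+1 then maxn (t m).+1 (s m.+1) else s 0%N.
have st n : (s n <= t n)%N by case: n => //= n; exact: leq_maxr.
have tt n : (t n < t n.+1)%N by exact: leq_maxl.
have nt n : (n <= t n)%N by elim: n => // n /leq_ltn_trans; apply; exact: tt.
have key n k : (t n <= k)%N -> snorm B (u (t n) - u k) <= 2 * 2^-1 ^+ n.
  move=> tk; have sk := leq_trans (st n) tk.
  apply: le_trans (snorm_trans (hinner H) (um _) (um (s n)) (um _)) _.
  rewrite (snormBC (hinner H))//.
  have := ue _ _ (st n); have := ue _ _ sk; have := sP n; lra.
(* The shift by one index absorbs the factor 2 of [key]. *)
have := hfast H (u := fun n => u (t n.+1)); case.
- by move=> n; exact: um.
- move=> n; rewrite (snormBC (hinner H))//.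
  apply: le_trans (key _ _ (ltnW (tt _))) _.
  by rewrite exprS mulrA divff ?mul1r// lexx.
move=> x mx xl; exists x => // n; apply/ler_addgt0Pl => d d0.
have : \forall k \near \oo, snorm B (u (t k.+1) - x) < d by exact: (cvgr_lt 0).
case=> k _ /(_ (maxn k n) (leq_maxl _ _)) /ltW kd.
have nk : (n <= t (maxn k n).+1)%N.
  by apply: leq_trans (nt _); rewrite ltnW// ltnS leq_maxr.
apply: le_trans (snorm_trans (hinner H) (um _) (um (t (maxn k n).+1)) mx) _.
by rewrite addrC lerD// ue.
Qed.

End hilbert.

(** * Countable operations on almost-everywhere statements *)

Section almost_everywhere.
Context d {T : measurableType d} {R : realType} (mu : {measure set T -> \bar R}).
Implicit Types P Q : T -> Prop.

Lemma ae_imp P Q : (forall x, P x -> Q x) ->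
  {ae mu, forall x, P x} -> {ae mu, forall x, Q x}.
Proof.
move=> PQ [N [mN N0 PN]]; exists N; split=> // x nQ.
by apply: PN => /= Px; apply: nQ; exact: PQ.
Qed.

Lemma ae_and P Q : {ae mu, forall x, P x} -> {ae mu, forall x, Q x} ->
  {ae mu, forall x, P x /\ Q x}.
Proof.
move=> [N [mN N0 PN]] [M [mM M0 QM]]; exists (N `|` M); split.
- exact: measurableU.
- by rewrite null_set_setU.
move=> x nPQ; have [Px|nP] := pselect (P x); last by left; apply: PN.
by right; apply: QM => Qx; apply: nPQ.
Qed.

Lemma ae_forall (P : nat -> T -> Prop) : (forall n, {ae mu, forall x, P n x}) ->
  {ae mu, forall x n, P n x}.
Proof.
move=> aeP; have [N NP] := choice aeP.
exists (\bigcup_n N n); split.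
- by apply: bigcup_measurable => n _; have [] := NP n.
- apply/eqP; rewrite eq_le measure_ge0 andbT.
  apply: le_trans (generalized_Boole_inequality mu (A := N) _ _) _.
  + by move=> n; have [] := NP n.
  + by apply: bigcup_measurable => n _; have [] := NP n.
  by rewrite eseries0// => n _ _; have [] := NP n.
move=> x /existsNP[n nPn]; exists n => //; have [_ _] := NP n; exact.
Qed.

End almost_everywhere.

(** * Square-integrable functions *)

Section square_integrable.
Context d {T : measurableType d} {R : realType}.
Variables (mu : {measure set T -> \bar R}) (D : set T).
Hypotheses (mD : measurable D).
Implicit Types f g : T -> R.

Definition sqint (f : T -> R) := measurable_fun D f /\
  (\int[mu]_(x in D) (f x ^+ 2)%:E < +oo)%E.

Definition sqint_ip (f g : T -> R) := \int[mu]_(x in D) (f x * g x).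

Lemma measurable_fun_sqr (f : T -> R) : measurable_fun D f ->
  measurable_fun D (fun x => f x ^+ 2).
Proof. by move=> mf; exact: measurable_funX. Qed.

Lemma ge0_le_integrable (f g : T -> R) : measurable_fun D f ->
  (forall x, D x -> `|f x| <= g x) -> mu.-integrable D (EFin \o g) ->
  mu.-integrable D (EFin \o f).
Proof.
move=> mf fg ig; apply: le_integrable ig => //; first exact/measurable_EFinP.
move=> x Dx /=; rewrite lee_fin; apply: le_trans (fg x Dx) _; exact: ler_norm.
Qed.

Lemma integrable_EFinD f g : mu.-integrable D (EFin \o f) ->
  mu.-integrable D (EFin \o g) ->
  mu.-integrable D (EFin \o (fun x => f x + g x)).
Proof. by move=> fi gi; exact: (integrableD mD fi gi). Qed.

Lemma integrable_EFinZ a f : mu.-integrable D (EFin \o f) ->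
  mu.-integrable D (EFin \o (fun x => a * f x)).
Proof. by move=> fi; exact: (integrableZl mD a fi). Qed.

Lemma integrable_EFinB f g : mu.-integrable D (EFin \o f) ->
  mu.-integrable D (EFin \o g) ->
  mu.-integrable D (EFin \o (fun x => f x - g x)).
Proof. by move=> fi gi; exact: (integrableB mD fi gi). Qed.

Lemma sqint_integrable2 f : sqint f ->
  mu.-integrable D (EFin \o (fun x => f x ^+ 2)).
Proof.
move=> [mf foo]; apply/integrableP; split.
  exact/measurable_EFinP/measurable_fun_sqr.
by under eq_integral do rewrite /= ger0_norm ?sqr_ge0//.
Qed.

Lemma integrable2_sqint f : measurable_fun D f ->
  mu.-integrable D (EFin \o (fun x => f x ^+ 2)) -> sqint f.
Proof.
move=> mf /integrableP[_ foo]; split=> //.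
by move: foo; under eq_integral do rewrite /= ger0_norm ?sqr_ge0//.
Qed.

Lemma sqint_integrableM f g : sqint f -> sqint g ->
  mu.-integrable D (EFin \o (fun x => f x * g x)).
Proof.
move=> sf sg; have sf2 := sqint_integrable2 sf; have sg2 := sqint_integrable2 sg.
have [mf _] := sf; have [mg _] := sg.
apply: (@ge0_le_integrable _ (fun x => f x ^+ 2 + g x ^+ 2)).
- exact: measurable_funM.
- move=> x _; rewrite ler_norml.
  have := sqr_ge0 (f x - g x); have := sqr_ge0 (f x + g x).
  have := sqr_ge0 (f x); have := sqr_ge0 (g x).
  rewrite sqrrD sqrrB => *; apply/andP; split; lra.
- exact: integrable_EFinD.
Qed.

Lemma sqint_le (f g : T -> R) : measurable_fun D f ->
  (forall x, D x -> `|f x| <= `|g x|) -> sqint g -> sqint f.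
Proof.
move=> mf fg sg; apply: integrable2_sqint => //.
apply: (ge0_le_integrable (g := fun x => g x ^+ 2)) (sqint_integrable2 sg).
  exact: measurable_fun_sqr.
move=> x Dx; rewrite normrX -[g x ^+ 2]real_normK ?num_real//.
by rewrite ler_pXn2r ?nnegrE//; exact: fg.
Qed.

Lemma sqintL (a : R) (f g : T -> R) : sqint f -> sqint g ->
  sqint (fun x => a * f x + g x).
Proof.
move=> sf sg; have [mf _] := sf; have [mg _] := sg.
apply: integrable2_sqint.
  by apply: measurable_funD => //; apply: measurable_funM.
rewrite (_ : (fun x => _) = (fun x => a ^+ 2 * f x ^+ 2 +
    (2 * a * (f x * g x) + g x ^+ 2))); last by apply/funext => x; ring.
apply: integrable_EFinD; last apply: integrable_EFinD.
- by apply: integrable_EFinZ; exact: sqint_integrable2.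
- by apply: integrable_EFinZ; exact: sqint_integrableM.
- exact: sqint_integrable2.
Qed.

Lemma sqint0 : sqint (fun _ => 0).
Proof.
split; first exact: measurable_cst.
by under eq_integral do rewrite expr0n/=; rewrite integral0.
Qed.

Lemma sqintZ a f : sqint f -> sqint (fun x => a * f x).
Proof.
move=> sf; rewrite (_ : (fun _ => _) = (fun x => a * f x + 0)).
  by apply: sqintL => //; exact: sqint0.
by apply/funext => x; rewrite addr0.
Qed.

Lemma sqintB f g : sqint f -> sqint g -> sqint (fun x => f x - g x).
Proof.
move=> sf sg; rewrite (_ : (fun _ => _) = (fun x => -1 * g x + f x)).
  exact: sqintL.
by apply/funext => x; rewrite mulN1r addrC.
Qed.

Lemma sqint_abs f : sqint f -> sqint (fun x => `|f x|).
Proof.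
move=> sf; apply: sqint_le (sf).
  by apply: measurableT_comp => //; exact: sf.1.
by move=> x _; rewrite normr_id.
Qed.

Lemma sqint_semi_inner : semi_inner (V := T -> R) sqint sqint_ip.
Proof.
split.
- exact: sqint0.
- by move=> a f g; exact: sqintL.
- by move=> f g _ _; apply: eq_Rintegral => x _; rewrite mulrC.
- move=> a f g h sf sg sh; have ifh := sqint_integrableM sf sh.
  rewrite /sqint_ip -RintegralZl// -RintegralD//; last 2 first.
    exact: integrable_EFinZ.
    exact: sqint_integrableM.
  by apply: eq_Rintegral => x _; rewrite mulrDl mulrA.
- by move=> f _; apply: Rintegral_ge0 => x _; rewrite -expr2 sqr_ge0.
Qed.

Lemma sqint_ip_sqr f : sqint_ip f f = \int[mu]_(x in D) (f x ^+ 2).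
Proof. by []. Qed.

Lemma sqint_ereal f : sqint f ->
  (\int[mu]_(x in D) (f x ^+ 2)%:E = (snorm sqint_ip f ^+ 2)%:E)%E.
Proof.
move=> sf; rewrite (sqr_snorm sqint_semi_inner)//.
rewrite sqint_ip_sqr /Rintegral fineK// ge0_fin_numE; first exact: sf.2.
by apply: integral_ge0 => x _; rewrite lee_fin sqr_ge0.
Qed.

Lemma sqint_snorm_le f (c : R) : 0 <= c ->
  (\int[mu]_(x in D) (f x ^+ 2)%:E <= (c ^+ 2)%:E)%E ->
  snorm sqint_ip f <= c.
Proof.
move=> c0 fc; rewrite /snorm -[leRHS]ger0_norm// -sqrtr_sqr ler_wsqrtr//.
rewrite sqint_ip_sqr /Rintegral -lee_fin fineK//.
rewrite ge0_fin_numE; first exact: le_lt_trans fc (ltry _).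
by apply: integral_ge0 => x _; rewrite lee_fin sqr_ge0.
Qed.

Lemma sqint_CS f g : sqint f -> sqint g ->
  \int[mu]_(x in D) `|f x * g x| <= snorm sqint_ip f * snorm sqint_ip g.
Proof.
move=> sf sg; have := cauchy_schwarz sqint_semi_inner (sqint_abs sf) (sqint_abs sg).
have E h : snorm sqint_ip (fun x => `|h x|) = snorm sqint_ip h.
  congr Num.sqrt; apply: eq_Rintegral => x _; rewrite -normrM ger0_norm//.
  by rewrite -expr2 sqr_ge0.
rewrite !E; apply: le_trans; apply: le_trans (ler_norm _).
rewrite le_eqVlt; apply/orP; left; apply/eqP.
by apply: eq_Rintegral => x _; rewrite normrM.
Qed.

(** Fatou's lemma for squares. It converts convergence almost everywhere of a Cauchy sequence into a
    bound on its L2 distance to the limit. *)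
Lemma fatou_sqr (u_ : nat -> T -> R) (u : T -> R) (C : \bar R) :
  (forall n, measurable_fun D (u_ n)) -> measurable_fun D u ->
  {ae mu, forall x, D x -> u_ n x @[n --> \oo] --> u x} ->
  (forall n, (\int[mu]_(x in D) (u_ n x ^+ 2)%:E <= C)%E) ->
  (\int[mu]_(x in D) (u x ^+ 2)%:E <= C)%E.
Proof.
move=> mu_ mu' cu uC.
have mE n : measurable_fun D (fun x => (u_ n x ^+ 2)%:E).
  exact/measurable_EFinP/measurable_fun_sqr.
have := @fatou _ _ _ mu D mD (fun n x => (u_ n x ^+ 2)%:E) mE.
move=> /(_ (fun n x _ => sqr_ge0 (u_ n x))) fat.
rewrite (@ge0_ae_eq_integral _ _ _ mu D _
  (fun x => limn_einf (fun n => (u_ n x ^+ 2)%:E)))//.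
- apply: (le_trans fat); rewrite limn_einf_lim; apply: lime_le.
    exact: is_cvg_einfs.
  apply: nearW => n; apply: le_trans (uC n); apply: ereal_inf_lbound.
  by exists n => /=.
- exact/measurable_EFinP/measurable_fun_sqr.
- rewrite /limn_einf; apply: (measurableT_comp (f := -%E)) => //.
  apply: measurable_fun_limn_esup => n.
  exact: (measurableT_comp (f := -%E)).
- by move=> x _; rewrite lee_fin sqr_ge0.
- move=> x _; rewrite limn_einf_lim; apply: lime_ge; first exact: is_cvg_einfs.
  apply: nearW => n; apply: le_ereal_inf_tmp => _ [m _ <-].
  by rewrite lee_fin sqr_ge0.
- apply: filterS cu => x cu Dx.
  have cE : (u_ n x ^+ 2)%:E @[n --> \oo] --> (u x ^+ 2)%:E.
    apply: cvg_EFin; first exact: nearW.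
    by apply: (@cvg_comp _ _ _ (fun n => u_ n x) (fun y => y ^+ 2)) (cu Dx) _; exact: exprn_continuous.
  by have [-> _] := cvg_limn_einf_sup cE.
Qed.

Hypothesis finD : (mu D < +oo)%E.

Lemma integrable_cst c : mu.-integrable D (EFin \o (fun _ => c)).
Proof.
apply/integrableP; split; first exact: measurable_cst.
by rewrite /= integral_cst// lte_mul_pinfty.
Qed.

Lemma sqint_cst c : sqint (fun _ => c).
Proof.
by apply: integrable2_sqint; [exact: measurable_cst|exact: integrable_cst].
Qed.

Lemma sqint_integrable f : sqint f -> mu.-integrable D (EFin \o f).
Proof.
move=> sf; have := sqint_integrableM sf (sqint_cst 1).
by apply: eq_integrable => // x _ /=; rewrite mulr1.
Qed.

(* The sum over n of a n has finite integral, since 2 a n <= 2^n (a n)^2 + 2^-n. *)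
Lemma ae_summable_sqr (a : nat -> T -> R) (c : R) :
  (forall n, measurable_fun D (a n)) -> (forall n x, 0 <= a n x) ->
  (forall n, (\int[mu]_(x in D) (a n x ^+ 2)%:E <= (c * (2^-1 ^+ n) ^+ 2)%:E)%E) ->
  {ae mu, forall x, D x -> exists2 e : nat -> R, e @ \oo --> 0 &
    forall n m, (n <= m)%N -> \sum_(n <= k < m) a k x <= e n}.
Proof.
move=> ma a0 ac.
have maE n : measurable_fun D (fun x => (a n x)%:E) by exact/measurable_EFinP.
pose K := c + fine (mu D).
have mDE : mu D = (fine (mu D))%:E by rewrite fineK// ge0_fin_numE.
have an n : (\int[mu]_(x in D) (a n x)%:E <= (K * 2^-1 ^+ n)%:E)%E.
  have p0 : 0 < 2^-1 ^+ n :> R by rewrite exprn_gt0.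
  apply: (@le_trans _ _ (\int[mu]_(x in D)
      (((2^-1 ^+ n)^-1)%:E * (a n x ^+ 2)%:E + (2^-1 ^+ n)%:E))%E).
    apply: ge0_le_integral => //.
    - by move=> x _; rewrite lee_fin.
    - apply/measurable_EFinP; apply: measurable_funD => //.
      by apply: measurable_funM => //; exact: measurable_fun_sqr.
    - move=> x _; rewrite -EFinM -EFinD lee_fin.
      rewrite -(@ler_pM2l _ (2^-1 ^+ n))// mulrDr mulrA divff ?gt_eqF// mul1r.
      have := sqr_ge0 (a n x - 2^-1 ^+ n); rewrite sqrrB expr2 (expr2 (2^-1 ^+ n)).
      have := mulr_ge0 (a0 n x) (ltW p0); lra.
  rewrite ge0_integralD//; last 2 first.
    by move=> x _; rewrite -EFinM lee_fin mulr_ge0// ?invr_ge0 ?sqr_ge0// ltW.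
    apply/measurable_EFinP; apply: measurable_funM => //.
    exact: measurable_fun_sqr.
  rewrite ge0_integralZl//; do ?by [exact/measurable_EFinP/measurable_fun_sqr
    |move=> x _; rewrite lee_fin sqr_ge0|rewrite lee_fin invr_ge0 ltW].
  rewrite integral_cst// mDE -EFinM /K mulrDl EFinD leeD//; last by rewrite mulrC.
  apply: (@le_trans _ _ (((2^-1 ^+ n)^-1)%:E * (c * (2^-1 ^+ n) ^+ 2)%:E)%E).
    by rewrite lee_pmul2l// ?lte_fin ?invr_gt0.
  by rewrite -EFinM lee_fin mulrC -mulrA expr2 mulfK ?gt_eqF.
have K0 : 0 <= K.
  rewrite -lee_fin; have := an 0%N; rewrite expr0 mulr1; apply: le_trans.
  by apply: integral_ge0 => x _; rewrite lee_fin.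
have sumoo : (\int[mu]_(x in D) (\sum_(n <oo) (a n x)%:E) < +oo)%E.
  rewrite integral_nneseries//; last by move=> n x _; rewrite lee_fin.
  apply: (@le_lt_trans _ _ (2 * K)%:E); last exact: ltry.
  apply: lime_le.
    apply: is_cvg_nneseries => n _ _.
    by apply: integral_ge0 => x _; rewrite lee_fin.
  apply: nearW => n; apply: (@le_trans _ _ (\sum_(0 <= k < n) (K * 2^-1 ^+ k)%:E)%E).
    by apply: lee_sum.
  rewrite sumEFin lee_fin -mulr_sumr mulrC ler_wpM2r//.
  suff -> : \sum_(0 <= k < n) 2^-1 ^+ k = 2 - 2 * 2^-1 ^+ n :> R.
    by rewrite gerBl mulr_ge0// exprn_ge0.
  elim: n => [|n IH]; first by rewrite big_nil expr0; lra.
  by rewrite big_nat_recr//= IH exprS; lra.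
have : {ae mu, forall x, D x -> (\sum_(n <oo) (a n x)%:E)%E \is a fin_num}.
  apply: (integrable_ae (mu := mu)) => //; apply/integrableP; split.
    by apply: ge0_emeasurable_sum => // n x _ _; rewrite lee_fin.
  rewrite (eq_integral (fun x => \sum_(n <oo) (a n x)%:E)%E)// => x _.
  by rewrite gee0_abs// nneseries_ge0// => n _ _; rewrite lee_fin.
apply: filterS => x xfin Dx; have := xfin Dx => {xfin}.
set S := (\sum_(n <oo) _)%E => Sfin.
pose s n := \sum_(0 <= k < n) a k x.
have sS n : s n <= fine S.
  rewrite -lee_fin fineK// /s -sumEFin; apply: nneseries_lim_ge => k _ _.
  by rewrite lee_fin.
have snd : nondecreasing_seq s.
  apply/nondecreasing_seqP => n; rewrite /s big_nat_recr//= lerDl//.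
have /cvg_ex[L sL] : cvgn s.
  by apply: nondecreasing_is_cvgn => //; exists (fine S) => _ [n _ <-].
exists (fun n => L - s n).
  by rewrite -(subrr L); apply: cvgB => //; exact: cvg_cst.
move=> n m nm; rewrite lerBrDr addrC.
rewrite /s -big_cat_nat//= -/(s m) -(cvg_lim _ sL)//.
by apply: nondecreasing_cvgn_le => //; apply/cvg_ex; exists L.
Qed.

Lemma ae_cauchy_fast (u : nat -> T -> R) : (forall n, sqint (u n)) ->
  (forall n x, 0 <= u n x) -> (forall n, snorm sqint_ip (u n) <= 2^-1 ^+ n) ->
  {ae mu, forall x, D x -> exists2 e : nat -> R, e @ \oo --> 0 &
    forall n m, (n <= m)%N -> \sum_(n <= k < m) u k x <= e n}.
Proof.
move=> su u0 uP; apply: (@ae_summable_sqr u 1) => //.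
  by move=> n; exact: (su n).1.
move=> n; rewrite sqint_ereal// mul1r lee_fin ler_pXn2r ?nnegrE ?snorm_ge0//.
Qed.

(** Riesz-Fischer: the increments are summable almost everywhere by [ae_cauchy_fast], so the
    sequence converges off a null set, and [fatou_sqr] bounds the distance to that pointwise
    limit. *)
Lemma sqint_complete (u : nat -> T -> R) : (forall n, sqint (u n)) ->
  (forall n, snorm sqint_ip (u n.+1 - u n) <= 2^-1 ^+ n) ->
  exists2 v, sqint v & snorm sqint_ip (u n - v) @[n --> \oo] --> 0.
Proof.
move=> su uP; have Si := sqint_semi_inner.
pose a n x := `|u n.+1 x - u n x|.
have sa n : sqint (a n) by apply: sqint_abs; exact: sqintB.
have aP n : snorm sqint_ip (a n) <= 2^-1 ^+ n.
  apply: le_trans (uP n); rewrite le_eqVlt; apply/orP; left; apply/eqP.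
  congr Num.sqrt; apply: eq_Rintegral => x _; rewrite -normrM ger0_norm//.
  by rewrite -expr2 sqr_ge0.
have [N [mN N0 NP]] := ae_cauchy_fast sa (fun n x => normr_ge0 _) aP.
have Nc x : D x -> ~ N x -> cvgn (u^~ x).
  move=> Dx Nx; have [e e0 ea] : exists2 e : nat -> R, e @ \oo --> 0 &
      forall n m, (n <= m)%N -> \sum_(n <= k < m) a k x <= e n.
    by apply: contrapT => h; apply: Nx; apply: NP => /= /(_ Dx).
  have ue n m : (n <= m)%N -> `|u n x - u m x| <= e n.
    move=> nm; apply: le_trans (ea _ _ nm); rewrite distrC.
    rewrite -(telescope_sumr (fun k => u k x) nm).
    exact: ler_norm_sum.
  apply: cauchy_cvg; apply/cauchy_exP => eps eps0.
  have : \forall n \near \oo, e n < eps by exact: (cvgr_lt 0).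
  case=> n _ /(_ n (leqnn _)) en; exists (u n x); exists n => // m /= nm.
  by apply: le_lt_trans en; exact: ue.
(* Setting the functions to 0 on the null set makes them converge everywhere on [D], so that the
   limit is measurable. *)
pose w n := (u n) \_ (~` N).
pose v x := limn (w^~ x).
have wv x : D x -> w n x @[n --> \oo] --> v x.
  move=> Dx; rewrite /v /w /patch.
  have [xN|/negP xN] := boolP (x \in ~` N); last by exact: is_cvg_cst.
  by apply: Nc => //; exact: set_mem.
have mN' : measurable (~` N) by exact: measurableC.
have mw n : measurable_fun D (w n).
  apply/(measurable_restrict _ mN' mD).
  by apply: measurable_funS (su n).1 => //; exact: subIsetl.
have mv : measurable_fun D v by apply: (measurable_fun_cvg mw).
have aeuv : {ae mu, forall x, D x -> u n x @[n --> \oo] --> v x}.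
  exists N; split => // x /=; apply: contra_notP => Nx Dx.
  have := wv x Dx; rewrite (_ : (fun n => w n x) = u^~ x)//.
  by apply/funext => n; rewrite /w patchE mem_set.
have bd n : (\int[mu]_(x in D) ((u n x - v x) ^+ 2)%:E <= ((2 * 2^-1 ^+ n) ^+ 2)%:E)%E.
  apply: (@fatou_sqr (fun m x => u n x - u (m + n)%N x)).
  - by move=> m; apply: measurable_funB; [exact: (su _).1|exact: (su _).1].
  - by apply: measurable_funB => //; exact: (su _).1.
  - apply: filterS aeuv => x uv Dx; apply: cvgB; first exact: cvg_cst.
    by have := uv Dx; rewrite -(@cvg_shiftn n R^o (u^~ x)).
  - move=> m; rewrite (@sqint_ereal (fun x => u n x - u (m + n)%N x)); last exact: sqintB.
    rewrite lee_fin ler_pXn2r ?nnegrE ?snorm_ge0 ?mulr_ge0 ?exprn_ge0//.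
    by apply: (snorm_fast Si) => //; exact: leq_addl.
have suv n : sqint (fun x => u n x - v x).
  split; last by apply: le_lt_trans (bd n) _; exact: ltry.
  by apply: measurable_funB => //; exact: (su _).1.
exists v.
  have := sqintB (su 0%N) (suv 0%N).
  by rewrite (_ : (fun _ => _) = v)//; apply/funext => x; rewrite subKr.
apply: (@squeeze_cvgr _ _ _ _ (fun _ => 0) (fun n => 2 * 2^-1 ^+ n)).
- apply: nearW => n; rewrite snorm_ge0/=; apply: sqint_snorm_le (bd n).
  by rewrite mulr_ge0// exprn_ge0.
- exact: cvg_cst.
- rewrite -(mulr0 2); apply: cvgM; first exact: cvg_cst.
  by apply: cvg_expr; rewrite ger0_norm// invf_lt1// ltr1n.
Qed.

End square_integrable.

Lemma bounded_convergence d {T : measurableType d} {R : realType}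
    (mu : {measure set T -> \bar R}) (D : set T) (g_ : nat -> T -> R) (g h : T -> R) (M : R) :
  measurable D -> (forall n, measurable_fun D (g_ n)) ->
  (forall n t, D t -> `|g_ n t| <= M) ->
  (forall t, D t -> g_ n t @[n --> \oo] --> g t) ->
  mu.-integrable D (EFin \o h) ->
  \int[mu]_(t in D) (g_ n t * h t) @[n --> \oo] --> \int[mu]_(t in D) (g t * h t).
Proof.
move=> mD mg gM cg ih; have mh : measurable_fun D h.
  by apply/measurable_EFinP; exact: (measurable_int mu).
have mg' : measurable_fun D g by exact: (measurable_fun_cvg mg).
have m1 n : measurable_fun D (fun t => (g_ n t * h t)%:E).
  by apply/measurable_EFinP; exact: measurable_funM.
have m2 : measurable_fun D (fun t => (g t * h t)%:E).
  by apply/measurable_EFinP; exact: measurable_funM.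
have c1 : {ae mu, forall t, D t -> (g_ n t * h t)%:E @[n --> \oo] --> (g t * h t)%:E}.
  apply: aeW => t Dt; apply: cvg_EFin; first exact: nearW.
  by apply: cvgM; [exact: cg|exact: cvg_cst].
have iM : mu.-integrable D (fun t => (M * `|h t|)%:E).
  by apply: (integrable_EFinZ mD); exact: integrable_norm.
have b1 : {ae mu, forall t n, D t -> (`|(g_ n t * h t)%:E| <= (M * `|h t|)%:E)%E}.
  by apply: aeW => t n Dt; rewrite /= lee_fin normrM ler_wpM2r// gM.
have [i2 _ cv] := dominated_convergence mD m1 m2 c1 iM b1.
by apply: fine_cvg; rewrite fineK//; exact: (integrable_fin_num mD i2).
Qed.

(** * Bochner measurability and integration *)

Section strong_measurability.
Context {R : realType} (X : fspace R) (B : X -> X -> R).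
Hypothesis H : hilbert B.
Variable D : set (measurableTypeR R).
Hypothesis mD : measurable D.
Notation mu := (@lebesgue_measure R).
Notation S := (hinner H).
Notation N := (snorm B).
Implicit Types u v : R -> X.

Lemma simple_mem (s : simple X) t : simple_on D s -> fmem X (simple_fun s t).
Proof.
move=> sD; apply: (smem_sum S) => i; apply: (smemZ S).
by have [] := sD i.
Qed.

(** The pieces of a simple function may overlap. Splitting on membership in the last set moves its
    value into the subtracted vector and leaves a sum with one term less, for another [y]. *)
Lemma measurable_snorm_sum n (A : 'I_n -> set (measurableTypeR R))
    (x : 'I_n -> X) (y : X) :
  (forall i, measurable (A i)) -> (forall i, fmem X (x i)) -> fmem X y ->
  measurable_fun D (fun t : measurableTypeR R =>
    N (\sum_i \1_(A i) t *: x i - y)).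
Proof.
elim: n A x y => [|n IH] A x y mA mx my.
  under eq_fun do rewrite big_ord0; exact: measurable_cst.
pose f y t := N (\sum_(i < n) \1_(A (widen_ord (leqnSn n) i)) t *:
  x (widen_ord (leqnSn n) i) - y).
rewrite (_ : (fun t => _) = (fun t => \1_(A ord_max) t * f (y - x ord_max) t +
    (1 - \1_(A ord_max) t) * f y t)).
  have mf z : fmem X z -> measurable_fun D (f z) by move=> mz; exact: IH.
  have mi : measurable_fun D (\1_(A ord_max) : measurableTypeR R -> R).
    exact: measurable_indic.
  apply: measurable_funD; apply: measurable_funM => //.
  - by apply: mf; apply: (smemB S).
  - by apply: measurable_funB => //; exact: measurable_cst.
  - exact: mf.
apply/funext => t; rewrite big_ord_recr/= /f indicE.
case: (t \in A ord_max) => /=.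
  by rewrite scale1r mul1r subrr mul0r addr0 opprB addrA.
by rewrite scale0r addr0 mul0r add0r subr0 mul1r.
Qed.

Lemma measurable_snorm_simple (s : simple X) y : simple_on D s -> fmem X y ->
  measurable_fun D (fun t : measurableTypeR R => N (simple_fun s t - y)).
Proof.
by move=> sD my; apply: measurable_snorm_sum => // i; have [] := sD i.
Qed.

Lemma cvg_snormB (u : nat -> X) x y : (forall n, fmem X (u n)) -> fmem X x ->
  fmem X y -> N (u n - x) @[n --> \oo] --> 0 ->
  N (u n - y) @[n --> \oo] --> N (x - y).
Proof.
move=> mu_ mx my ux; apply/cvgrPdist_le => e e0.
have : \forall n \near \oo, N (u n - x) < e by exact: (cvgr_lt 0).
apply: filterS => n /ltW; apply: le_trans.
apply: le_trans (snorm_dist S _ _) _; do ?exact: (smemB S).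
by rewrite opprB addrA subrK (snormBC S) ?lexx.
Qed.

(** A metric form of the Pettis criterion: a sequence comes arbitrarily near to every value of [v],
    and the distances to it are measurable. For limits, scalar multiples and continuous curves this
    is easier to check than an approximation by simple functions. *)
Definition pettis (v : R -> X) := (forall t, D t -> fmem X (v t)) /\
  exists x : nat -> X, [/\ forall j, fmem X (x j),
    forall j, measurable_fun D (fun t : measurableTypeR R => N (v t - x j))
    & forall t, D t -> forall e, 0 < e -> exists j, N (v t - x j) < e].

Lemma simple_fnorm (s : nat -> simple X) (v : R -> X) t :
  (forall k, simple_on D (s k)) -> fmem X (v t) ->
  (fun k => fnorm X (simple_fun (s k) t - v t)) =
  (fun k => N (simple_fun (s k) t - v t)).
Proof.
move=> sD mv; apply/funext => k; rewrite (hnorm H)//.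
by apply: (smemB S) => //; exact: simple_mem.
Qed.

Lemma sm_measurable (v : R -> X) y : strongly_measurable D v -> fmem X y ->
  measurable_fun D (fun t : measurableTypeR R => N (v t - y)).
Proof.
move=> [mv [s [sD sv]]] my.
apply: (measurable_fun_cvg (h := fun k t => N (simple_fun (s k) t - y))).
  by move=> k; exact: measurable_snorm_simple.
move=> t Dt; apply: cvg_snormB => //; [|exact: mv|].
- by move=> k; exact: simple_mem.
- by have := sv t Dt; rewrite simple_fnorm//; exact: mv.
Qed.

Lemma sm_pettis (v : R -> X) : strongly_measurable D v -> pettis v.
Proof.
move=> smv; have [mv [s [sD sv]]] := smv; split => //.
(* As pieces may overlap, a value of [s k] is a sum over the subset of pieces that contain the time;
   pairs of [k] and a subset form a countable set. *)
pose I := {k : nat & {set 'I_(simple_size (s k))}}.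
pose val (w : I) := \sum_(i in tagged w) simple_val (s := s (tag w)) i.
have mval w : fmem X (val w).
  by apply: (smem_sum S) => i; have [] := sD (tag w) i.
pose x j := if unpickle j is Some w then val w else 0.
have mx j : fmem X (x j) by rewrite /x; case: unpickle => //; exact: smem0 S.
exists x; split => //; first by move=> j; exact: sm_measurable.
move=> t Dt e e0.
have := sv t Dt; rewrite simple_fnorm//; last exact: mv.
move=> /(cvgr_lt 0)/(_ e e0) [k _ /(_ k (leqnn k)) /=].
pose w : I := Tagged (fun k => {set 'I_(simple_size (s k))})
  [set i | t \in simple_set (s := s k) i]%SET.
exists (pickle w); rewrite /x pickleK (snormBC S)//; last exact: mv.
rewrite (_ : val w = simple_fun (s k) t)// /val /simple_fun big_mkcond/=.
apply: eq_bigr => i _; rewrite inE indicE.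
by case: (t \in _); rewrite ?scale1r ?scale0r.
Qed.

Section nearest.
Variables (v : R -> X) (x : nat -> X).
Hypothesis mv : forall t, D t -> fmem X (v t).
Hypothesis mx : forall j, fmem X (x j).
Hypothesis md : forall j,
  measurable_fun D (fun t : measurableTypeR R => N (v t - x j)).
Hypothesis dx : forall t, D t -> forall e, 0 < e -> exists j, N (v t - x j) < e.

Let d j (t : measurableTypeR R) := N (v t - x j).

(** The index of a point nearest to [v t] among [x 0], ..., [x k], ties going to the smaller index.
    The recursion makes its level sets measurable by induction on [k]. *)
Let idx := fix idx k (t : measurableTypeR R) : nat := if k is k'.+1 then
  (if d k t < d (idx k' t) t then k else idx k' t) else 0%N.

Let idx_le k t : (idx k t <= k)%N.
Proof. by elim: k => //= k IH; case: ifP => // _; exact: leqW. Qed.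

Let idx_min k j t : (j <= k)%N -> d (idx k t) t <= d j t.
Proof.
elim: k j => [|k IH] j; first by rewrite leqn0 => /eqP ->.
rewrite leq_eqVlt => /orP[/eqP ->|jk] /=.
  by case: ltP.
case: ltP => [dk|_]; last exact: IH.
by apply: le_trans (ltW dk) _; exact: IH.
Qed.

Let mmin k : measurable_fun D (fun t => d (idx k t) t).
Proof.
elim: k => [|k IH]; first exact: md.
rewrite (_ : (fun t => _) = (d k.+1 \min (fun t => d (idx k t) t))).
  by apply: measurable_minr => //; exact: md.
by apply/funext => t /=; rewrite /Order.min; case: ifP.
Qed.

Let piece k j := D `&` [set t | idx k t = j].

Let mpiece k j : measurable (piece k j).
Proof.
elim: k j => [|k IH] j.
  have [->|j0] := eqVneq j 0%N.
    by rewrite /piece (_ : [set _ | _] = setT) ?setIT// -subTset.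
  rewrite /piece (_ : [set _ | _] = set0) ?setI0//.
  by apply/seteqP; split => t //= /esym/eqP; rewrite (negbTE j0).
have mlt : measurable (D `&` [set t | d k.+1 t < d (idx k t) t]).
  exact: (measurable_fun_ltr (md k.+1) (mmin k) mD (Y := [set true])).
have -> : piece k.+1 j = (if j == k.+1 then D `&` [set t | d k.+1 t < d (idx k t) t] else set0)
    `|` (piece k j `\` (D `&` [set t | d k.+1 t < d (idx k t) t])).
  apply/seteqP; split => t /=.
    move=> [Dt]; rewrite /=; case: ifPn => [lt <-|/negP ge ij].
      by left; rewrite eqxx.
    by right; split => // -[].
  move=> [|[[Dt ij] ge]].
    by case: ifP => // /eqP -> [Dt lt]; split => //=; rewrite lt.
  split => //=; case: ifPn => // lt; exfalso; exact: ge.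
apply: measurableU; first by case: ifP.
by apply: measurableD => //; exact: IH.
Qed.

(** The k-th simple function takes the nearest of the first k + 1 points. As [x 0] always competes,
    the error is dominated by the distance to [x 0], which later feeds dominated convergence. *)
Lemma pettis_approx : exists s : nat -> simple X, [/\ forall k, simple_on D (s k),
  forall t, D t -> N (simple_fun (s k) t - v t) @[k --> \oo] --> 0
  & forall k t, D t -> N (simple_fun (s k) t - v t) <= N (v t - x 0%N)].
Proof.
pose s k := @Simple R X k.+1 (fun j => piece k j) (fun j => x j).
have sE k t : D t -> simple_fun (s k) t = x (idx k t).
  move=> Dt; rewrite /simple_fun /=.
  have ik : (idx k t < k.+1)%N by rewrite ltnS.
  rewrite (bigD1 (Ordinal ik))//= indicE mem_set//= scale1r big1 ?addr0// => i ii.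
  rewrite indicE memNset ?scale0r// => -[_ /= e].
  by case/eqP: ii; apply: val_inj; rewrite /= e.
have sd k t : D t -> N (simple_fun (s k) t - v t) = d (idx k t) t.
  by move=> Dt; rewrite sE// /d (snormBC S)//; exact: mv.
exists s; split.
- by move=> k i; split => //=; exact: subIsetl.
- move=> t Dt; apply/cvgr0Pnorm_lt => e e0.
  have [j jt] := dx Dt e0; exists j => // k /= jk.
  rewrite sd// ger0_norm ?snorm_ge0//.
  by apply: le_lt_trans jt; exact: idx_min.
- by move=> k t Dt; rewrite sd//; exact: idx_min.
Qed.

End nearest.

Lemma pettis_sm (v : R -> X) : pettis v -> strongly_measurable D v.
Proof.
move=> [mv [x [mx md dx]]]; split => //.
have [s [sD sv _]] := pettis_approx mv mx md dx; exists s; split=> // t Dt.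
by rewrite simple_fnorm//; [exact: sv|exact: mv].
Qed.

Lemma sm_approx (v : R -> X) : strongly_measurable D v ->
  exists s : nat -> simple X, [/\ forall k, simple_on D (s k),
  forall t, D t -> N (simple_fun (s k) t - v t) @[k --> \oo] --> 0
  & forall k t, D t -> N (simple_fun (s k) t - v t) <= N (v t)].
Proof.
move=> smv; have [mv [x [mx md dx]]] := sm_pettis smv.
(* With 0 put in front of the sequence, the error of the approximation is dominated by the norm of
   [v] itself. *)
pose y j := if j is i.+1 then x i else 0.
have my j : fmem X (y j) by case: j => //; exact: smem0 S.
have [] := @pettis_approx v y mv my.
- by move=> j; exact: sm_measurable.
- by move=> t Dt e e0; have [j je] := dx t Dt e e0; exists j.+1.
by move=> s [sD sv sb]; exists s; split=> // k t Dt; have := sb k t Dt; rewrite subr0.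
Qed.

Lemma sm_mem v t : strongly_measurable D v -> D t -> fmem X (v t).
Proof. by move=> [mv _]; exact: mv. Qed.

Lemma sm_measurable_norm v : strongly_measurable D v ->
  measurable_fun D (fun t : measurableTypeR R => N (v t)).
Proof.
move=> sv; rewrite (_ : (fun _ => _) = (fun t => N (v t - 0))).
  by apply: sm_measurable => //; exact: smem0 S.
by apply/funext => t; rewrite subr0.
Qed.

Lemma sm_lim (u : nat -> R -> X) v : (forall n, strongly_measurable D (u n)) ->
  (forall t, D t -> fmem X (v t)) ->
  (forall t, D t -> N (u n t - v t) @[n --> \oo] --> 0) ->
  strongly_measurable D v.
Proof.
move=> su mv uv; apply: pettis_sm; split => //.
have ex n : exists x : nat -> X, [/\ forall j, fmem X (x j),
    forall j, measurable_fun D (fun t : measurableTypeR R => N (u n t - x j))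
    & forall t, D t -> forall e, 0 < e -> exists j, N (u n t - x j) < e].
  by have [_ ] := sm_pettis (su n).
have [x xP] := choice ex.
pose y j := if @unpickle (nat * nat)%type j is Some w then x w.1 w.2 else 0.
have my j : fmem X (y j).
  rewrite /y; case: unpickle => [w|]; last exact: smem0 S.
  by have [] := xP w.1.
exists y; split=> //.
  move=> j; apply: (measurable_fun_cvg (h := fun n t => N (u n t - y j))).
    by move=> n; exact: sm_measurable.
  move=> t Dt; apply: cvg_snormB => //; [|exact: mv|exact: uv].
  by move=> n; exact: sm_mem.
move=> t Dt e e0; have e20 : 0 < e / 2 by rewrite divr_gt0.
have /(cvgr_lt 0)/(_ _ e20) [n _ /(_ n (leqnn n)) /= un] := uv t Dt.
have [mxn _ /(_ t Dt _ e20)[j jn]] := xP n.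
exists (pickle (n, j)); rewrite /y pickleK /=.
apply: le_lt_trans (snorm_trans S (mv t Dt) (sm_mem (su n) Dt) (mxn j)) _.
rewrite (snormBC S (mv t Dt) (sm_mem (su n) Dt)); lra.
Qed.

Lemma smL a u v : strongly_measurable D u -> strongly_measurable D v ->
  strongly_measurable D (fun t => a *: u t + v t).
Proof.
move=> smu smv; have [mu_ [s [sD su]]] := smu; have [mv [r [rD rv]]] := smv.
split; first by move=> t Dt; apply: (smemL S); [exact: mu_|exact: mv].
pose q (k : nat) : simple X := @Simple R X (simple_size (s k) + simple_size (r k))%N
  (fun i => match fintype.split i with inl j => @simple_set R X (s k) j
                             | inr j => @simple_set R X (r k) j end)
  (fun i => match fintype.split i with inl j => a *: @simple_val R X (s k) j
                             | inr j => @simple_val R X (r k) j end).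
have qE k t : simple_fun (q k) t = a *: simple_fun (s k) t + simple_fun (r k) t.
  rewrite /simple_fun /= big_split_ord/= scaler_sumr; congr (_ + _).
    by apply: eq_bigr => i _; rewrite (unsplitK (inl _)) !scalerA mulrC.
  by apply: eq_bigr => i _; rewrite (unsplitK (inr _)).
have qD k : simple_on D (q k).
  move=> i /=; case: fintype.split => j; last by have [] := rD k j.
  by have [mA AD mx] := sD k j; split => //; exact: (smemZ S).
exists q; split=> // t Dt.
rewrite (@simple_fnorm q (fun t => a *: u t + v t))//; last by apply: (smemL S); [exact: mu_|exact: mv].
have := su t Dt; rewrite simple_fnorm//; last exact: mu_.
have := rv t Dt; rewrite simple_fnorm//; last exact: mv.
move=> rvt sut; apply: (@squeeze_cvgr _ _ _ _ (fun _ => 0)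
  (fun k => `|a| * N (simple_fun (s k) t - u t) + N (simple_fun (r k) t - v t))).
- apply: nearW => k; rewrite snorm_ge0/= qE.
  have m1 : fmem X (simple_fun (s k) t - u t).
    by apply: (smemB S); [exact: simple_mem|exact: mu_].
  have m2 : fmem X (simple_fun (r k) t - v t).
    by apply: (smemB S); [exact: simple_mem|exact: mv].
  rewrite -(snormZ S)// opprD addrACA -scalerBr.
  by apply: (snormD S) => //; exact: (smemZ S).
- exact: cvg_cst.
- rewrite -(addr0 0) -{1}(mulr0 `|a|); apply: cvgD => //.
  by apply: cvgM => //; exact: cvg_cst.
Qed.

Lemma sm0 : strongly_measurable D (fun _ => 0 : X).
Proof.
apply: pettis_sm; split=> [t _|]; first exact: smem0 S.
exists (fun _ => 0); split=> [j|j|t _ e e0]; first exact: smem0 S.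
  exact: measurable_cst.
by exists 0%N; rewrite subr0 (snorm0 S).
Qed.

Lemma smD u v : strongly_measurable D u -> strongly_measurable D v ->
  strongly_measurable D (fun t => u t + v t).
Proof.
move=> su sv; rewrite (_ : (fun _ => _) = (fun t => 1 *: u t + v t)).
  exact: smL.
by apply/funext => t; rewrite scale1r.
Qed.

Lemma smB u v : strongly_measurable D u -> strongly_measurable D v ->
  strongly_measurable D (fun t => u t - v t).
Proof.
move=> su sv; rewrite (_ : (fun _ => _) = (fun t => -1 *: v t + u t)).
  exact: smL.
by apply/funext => t; rewrite scaleN1r addrC.
Qed.

Lemma sm_cst x : fmem X x -> strongly_measurable D (fun _ => x).
Proof.
move=> mx; apply: pettis_sm; split=> //.
exists (fun _ => x); split=> // t _ e e0.
by exists 0%N; rewrite subrr (snorm0 S).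
Qed.

(** Polarization expresses the inner product through norms, whose measurability is known. *)
Lemma sm_ip u v : strongly_measurable D u -> strongly_measurable D v ->
  measurable_fun D (fun t : measurableTypeR R => B (u t) (v t)).
Proof.
move=> su sv; apply: (@eq_measurable_fun _ _ _ _ _ (fun t : measurableTypeR R =>
    2^-1 * (N (u t + v t) ^+ 2 - N (u t) ^+ 2 - N (v t) ^+ 2))).
  move=> t /set_mem Dt; have mu_ := sm_mem su Dt; have mv := sm_mem sv Dt.
  rewrite !(sqr_snorm S)//; last exact: (smemD S).
  by rewrite (sip_sqrD S)//; field.
apply: measurable_funM => //; apply: measurable_funB; first apply: measurable_funB.
- by apply: measurable_funX; apply: sm_measurable_norm; exact: smD.
- by apply: measurable_funX; exact: sm_measurable_norm.
- by apply: measurable_funX; exact: sm_measurable_norm.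
Qed.

(** Rational multiples of a sequence that approximates [v] approximate [phi t *: v t]. The distance
    to a fixed vector is measurable because its square expands into products of measurable
    functions. *)
Lemma sm_scale (phi : R -> R) v : strongly_measurable D v ->
  measurable_fun D (phi : measurableTypeR R -> R) ->
  strongly_measurable D (fun t => phi t *: v t).
Proof.
move=> sv mphi; have [mv [x [mx md dx]]] := sm_pettis sv.
apply: pettis_sm; split; first by move=> t Dt; apply: (smemZ S); exact: mv.
pose y j := if @unpickle (rat * nat)%type j is Some w then ratr w.1 *: x w.2 else 0.
have my j : fmem X (y j).
  by rewrite /y; case: unpickle => [w|]; [exact: (smemZ S)|exact: smem0 S].
exists y; split=> //.
  move=> j; apply: (@eq_measurable_fun _ _ _ _ _ (fun t : measurableTypeR R =>
    Num.sqrt (phi t ^+ 2 * N (v t) ^+ 2 - 2 * (phi t * B (v t) (y j)) + B (y j) (y j)))).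
    move=> t /set_mem Dt; have mvt := mv t Dt; have mpv := smemZ S (phi t) mvt.
    rewrite -[RHS]ger0_norm ?snorm_ge0// -sqrtr_sqr.
    rewrite (sqr_snorm S (smemB S mpv (my j))).
    congr Num.sqrt; rewrite (sip_sqrB S)// -(sqr_snorm S mpv) (snormZ S)//.
    by rewrite exprMn real_normK ?num_real// (sipZl S).
  apply: (measurableT_comp (f := @Num.sqrt R)).
    by apply: continuous_measurable_fun; exact: sqrt_continuous.
  apply: measurable_funD; last exact: measurable_cst.
  apply: measurable_funB; first apply: measurable_funM.
  - exact: measurable_funX.
  - by apply: measurable_funX; exact: sm_measurable_norm.
  - apply: measurable_funM => //; apply: measurable_funM => //.
    by apply: sm_ip => //; exact: sm_cst.
move=> t Dt e e0.
have [j jt] : exists j, N (v t - x j) < e / 2 / (`|phi t| + 1).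
  by apply: dx => //; rewrite !divr_gt0// ltr_wpDl.
have [q qt] : exists q : rat, `|phi t - ratr q| < e / 2 / (N (x j) + 1).
  set del := _ / _; have del0 : 0 < del by rewrite !divr_gt0// ltr_wpDl// snorm_ge0.
  have : phi t - del < phi t + del by lra.
  move=> /rat_in_itvoo[q]; rewrite in_itv/= => /andP[q1 q2].
  by exists q; rewrite ltr_norml; apply/andP; split; lra.
exists (pickle (q, j)); rewrite /y pickleK /=.
have mvt := mv t Dt; have m1 := smemZ S (phi t) mvt.
have m2 := smemZ S (phi t) (mx j); have m3 := smemZ S (ratr q) (mx j).
apply: le_lt_trans (snorm_trans S m1 m2 m3) _.
rewrite -scalerBr -scalerBl !(snormZ S)//; last exact: (smemB S).
have h1 : `|phi t| * N (v t - x j) <= e / 2.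
  apply: (@le_trans _ _ (`|phi t| * (e / 2 / (`|phi t| + 1)))).
    by rewrite ler_wpM2l// ltW.
  rewrite mulrCA; apply: ler_piMr; first by rewrite ltW// divr_gt0.
  by rewrite ler_pdivrMr ?mul1r ?lerDl// ltr_wpDl.
have h2 : `|phi t - ratr q| * N (x j) < e / 2.
  apply: (@le_lt_trans _ _ (`|phi t - ratr q| * (N (x j) + 1))).
    by rewrite ler_wpM2l// lerDl.
  by rewrite -ltr_pdivlMr// ltr_wpDl// snorm_ge0.
lra.
Qed.

End strong_measurability.

(** * Square-integrable vector functions and Bochner integrals *)

Section bochner.
Context {R : realType} (X : fspace R) (B : X -> X -> R).
Hypothesis H : hilbert B.
Notation mu := (@lebesgue_measure R).
Notation S := (hinner H).
Notation N := (snorm B).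
Implicit Types (u v : R -> X).

Section on_domain.
Variable D : set (measurableTypeR R).
Hypotheses (mD : measurable D) (finD : (mu D < +oo)%E).

Definition sqsm v := strongly_measurable D v /\ sqint mu D (fun t => N (v t)).

Definition ipI u v : R := \int[mu]_(t in D) B (u t) (v t).

Lemma sqsm_integrable u v : sqsm u -> sqsm v ->
  mu.-integrable D (EFin \o (fun t => B (u t) (v t))).
Proof.
move=> [su qu] [sv qv].
apply: (ge0_le_integrable mD (g := fun t => N (u t) * N (v t))).
- exact: (sm_ip H).
- by move=> t Dt; apply: (cauchy_schwarz S); exact: sm_mem Dt.
- exact: sqint_integrableM.
Qed.

Lemma sqsm_norm_integrable v : sqsm v ->
  mu.-integrable D (EFin \o (fun t => N (v t))).
Proof. by move=> [_ qv]; exact: (sqint_integrable mD finD). Qed.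

Lemma ipI_norm v : strongly_measurable D v ->
  ipI v v = \int[mu]_(t in D) (N (v t) ^+ 2).
Proof.
move=> sv; apply: eq_Rintegral => t /set_mem Dt.
by rewrite (sqr_snorm S)//; exact: sm_mem Dt.
Qed.

Lemma ipI_snorm v : sqsm v -> snorm ipI v = snorm (sqint_ip mu D) (fun t => N (v t)).
Proof. by move=> [sv _]; rewrite /snorm ipI_norm. Qed.

Lemma sqsmL a u v : sqsm u -> sqsm v -> sqsm (fun t => a *: u t + v t).
Proof.
move=> [su qu] [sv qv]; split; first exact: (smL H).
apply: (sqint_le mD _ _ (sqintL mD `|a| qu qv)).
  by apply: (sm_measurable_norm H); exact: (smL H).
move=> t Dt; have mut := sm_mem su Dt; have mvt := sm_mem sv Dt.
rewrite ger0_norm ?snorm_ge0// [leRHS]ger0_norm ?addr_ge0 ?mulr_ge0 ?snorm_ge0//.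
by rewrite -(snormZ S)//; apply: (snormD S) => //; exact: (smemZ S).
Qed.

Lemma sqsm0 : sqsm (fun _ => 0).
Proof.
split; first exact: (sm0 H mD).
by rewrite (snorm0 S); exact: sqint0.
Qed.

Lemma sqsm_semi_inner : semi_inner (V := R -> X) sqsm ipI.
Proof.
split.
- exact: sqsm0.
- by move=> a u v; exact: sqsmL.
- move=> u v [su _] [sv _]; apply: eq_Rintegral => t /set_mem Dt.
  by apply: (sipC S); exact: sm_mem Dt.
- move=> a u v w qu qv qw; have iuw := sqsm_integrable qu qw.
  have ivw := sqsm_integrable qv qw.
  rewrite /ipI -RintegralZl// -RintegralD//; last exact: integrable_EFinZ.
  apply: eq_Rintegral => t /set_mem Dt.
  have [[su _] [[sv _] [sw _]]] := (qu, (qv, qw)).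
  by apply: (sipl S); exact: sm_mem Dt.
- move=> u [su _]; apply: Rintegral_ge0 => t Dt.
  by apply: (sip_ge0 S); exact: sm_mem Dt.
Qed.

Notation SI := sqsm_semi_inner.

(** The argument of [sqint_complete], with the pointwise limits supplied by completeness of [X].
    Convergence almost everywhere is recorded as well, since the energy inequality is later passed
    to the limit at fixed times. *)
Lemma sqsm_complete (u : nat -> R -> X) : (forall n, sqsm (u n)) ->
  (forall n, snorm ipI (u n.+1 - u n) <= 2^-1 ^+ n) ->
  exists v, [/\ sqsm v,
    forall n, snorm ipI (u n - v) <= 2 * 2^-1 ^+ n
    & {ae mu, forall t, D t -> N (u n t - v t) @[n --> \oo] --> 0}].
Proof.
move=> qu uP.
pose a n t := N (u n.+1 t - u n t).
have qd n m : sqsm (u n - u m) by exact: (smemB SI).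
have sa n : sqint mu D (a n) by have [] := qd n.+1 n.
have aP n : snorm (sqint_ip mu D) (a n) <= 2^-1 ^+ n.
  by rewrite -(ipI_snorm (qd n.+1 n)).
have [Z [mZ Z0 ZP]] := ae_cauchy_fast mD finD sa (fun n t => snorm_ge0 _ _) aP.
(* Membership is demanded on the null set too, because strong measurability concerns every point of
   [D]; the value 0 serves there. *)
have Zc t : exists x, (D t -> fmem X x) /\
    (D t -> ~ Z t -> N (u n t - x) @[n --> \oo] --> 0).
  have [[Dt Zt]|ndz] := pselect (D t /\ ~ Z t); last first.
    exists 0; split=> [_|Dt Zt]; first exact: smem0 S.
    by exfalso; exact: ndz.
  have [e e0 ea] : exists2 e : nat -> R, e @ \oo --> 0 &
      forall n m, (n <= m)%N -> \sum_(n <= k < m) a k t <= e n.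
    by apply: contrapT => h; apply: Zt; apply: ZP => /= /(_ Dt).
  have mut n : fmem X (u n t) by apply: sm_mem Dt; exact: (qu n).1.
  have [|x mx xe] := hcomplete H mut e0.
    move=> n m nm; apply: le_trans (ea _ _ nm); rewrite (snormBC S)//.
    rewrite -(telescope_sumr (fun k => u k t) nm).
    by apply: (snorm_sum S) => i; exact: (smemB S).
  exists x; split=> // _ _; apply: (@squeeze_cvgr _ _ _ _ (fun _ => 0) e) => //.
    by apply: nearW => n; rewrite snorm_ge0 xe.
  exact: cvg_cst.
have [v0 v0P] := choice Zc.
have mZ' : measurable (~` Z) by exact: measurableC.
pose w n t : X := \1_(~` Z) t *: u n t.
pose v t : X := \1_(~` Z) t *: v0 t.
have wv t : D t -> N (w n t - v t) @[n --> \oo] --> 0.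
  move=> Dt; rewrite /w /v indicE.
  have [|] := boolP (t \in ~` Z) => [/set_mem zt|_].
    under eq_fun do rewrite /= !scale1r.
    exact: (v0P t).2.
  under eq_fun do rewrite /= !scale0r subr0 (snorm0 S).
  exact: cvg_cst.
have mv t : D t -> fmem X (v t).
  by move=> Dt; apply: (smemZ S); exact: (v0P t).1.
have sw n : strongly_measurable D (w n).
  by apply: (sm_scale H mD); [exact: (qu n).1|exact: measurable_indic].
have sv : strongly_measurable D v by apply: (sm_lim H mD sw).
have aeuv : {ae mu, forall t, D t -> N (u n t - v t) @[n --> \oo] --> 0}.
  exists Z; split => // t /=; apply: contra_notP => Zt Dt.
  have := wv t Dt; rewrite (_ : (fun n => N (w n t - v t)) = (fun n => N (u n t - v t)))//.
  by apply/funext => n; rewrite /w indicE mem_set// scale1r.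
have bd n : (\int[mu]_(t in D) (N (u n t - v t) ^+ 2)%:E <= ((2 * 2^-1 ^+ n) ^+ 2)%:E)%E.
  apply: (@fatou_sqr _ _ _ mu _ mD (fun m t => N (u n t - u (m + n)%N t))).
  - by move=> m; have [_ []] := qd n (m + n)%N.
  - by apply: (sm_measurable_norm H); apply: (smB H) => //; exact: (qu n).1.
  - apply: filterS aeuv => t uv Dt.
    have mut k : fmem X (u k t) by apply: sm_mem Dt; exact: (qu k).1.
    have -> : (fun m => N (u n t - u (m + n)%N t)) = (fun m => N (u (m + n)%N t - u n t)).
      by apply/funext => m; rewrite (snormBC S).
    rewrite (snormBC S (mut n) (mv t Dt)).
    apply: (@cvg_snormB _ _ _ H (fun m => u (m + n)%N t) (v t)) => //; first exact: mv.
    by have := uv Dt; rewrite -(@cvg_shiftn n R^o (fun k => N (u k t - v t))).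
  - move=> m; have [_ qnm] := qd n (m + n)%N.
    rewrite (sqint_ereal mD qnm) lee_fin -(ipI_snorm (qd n (m + n)%N)).
    rewrite ler_pXn2r ?nnegrE ?snorm_ge0 ?mulr_ge0 ?exprn_ge0//.
    by apply: (snorm_fast SI) => //; exact: leq_addl.
have quv n : sqsm (u n - v).
  split; first by apply: (smB H) => //; exact: (qu n).1.
  split; last by apply: le_lt_trans (bd n) _; exact: ltry.
  by apply: (sm_measurable_norm H); apply: (smB H) => //; exact: (qu n).1.
exists v; split=> //.
  by have := smemB SI (qu 0%N) (quv 0%N); rewrite subKr.
move=> n; rewrite ipI_snorm//; apply: sqint_snorm_le (bd n).
by rewrite mulr_ge0// exprn_ge0.
Qed.

Lemma sm_simple (s : simple X) : simple_on D s ->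
  strongly_measurable D (simple_fun s).
Proof.
move=> sD; split=> [t _|]; first exact: (simple_mem H).
exists (fun _ => s); split=> // t Dt.
rewrite (_ : (fun _ => _) = fun _ => 0); first exact: cvg_cst.
by apply/funext => k; rewrite subrr (hnorm H) ?(snorm0 S)//; exact: smem0 S.
Qed.

Lemma simple_norm_integrable (s : simple X) : simple_on D s ->
  mu.-integrable D (EFin \o (fun t => N (simple_fun s t))).
Proof.
move=> sD; apply: (ge0_le_integrable mD (g := fun _ => \sum_i N (@simple_val R X s i))).
- by apply: (sm_measurable_norm H); exact: sm_simple.
- move=> t Dt; rewrite ger0_norm ?snorm_ge0//.
  have mx i : fmem X (@simple_val R X s i) by have [] := sD i.
  apply: le_trans (snorm_sum S _ _ _) _ => [i|]; first exact: (smemZ S).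
  apply: ler_sum => i _; rewrite (snormZ S)// indicE.
  by case: (_ \in _); rewrite ?normr1 ?mul1r// normr0 mul0r snorm_ge0.
- exact: integrable_cst.
Qed.

Lemma snorm_integrableB u v : strongly_measurable D u -> strongly_measurable D v ->
  mu.-integrable D (EFin \o (fun t => N (u t))) ->
  mu.-integrable D (EFin \o (fun t => N (v t))) ->
  mu.-integrable D (EFin \o (fun t => N (u t - v t))).
Proof.
move=> su sv iu iv.
apply: (ge0_le_integrable mD (g := fun t => N (u t) + N (v t))).
- by apply: (sm_measurable_norm H); exact: (smB H).
- move=> t Dt; rewrite ger0_norm ?snorm_ge0//.
  by apply: (snormB S); exact: sm_mem Dt.
- exact: integrable_EFinD.
Qed.

Lemma ip_integrable v x : strongly_measurable D v -> fmem X x ->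
  mu.-integrable D (EFin \o (fun t => N (v t))) ->
  mu.-integrable D (EFin \o (fun t => B (v t) x)).
Proof.
move=> sv mx iv; apply: (ge0_le_integrable mD (g := fun t => N x * N (v t))).
- by apply: (sm_ip H) => //; exact: (sm_cst H).
- by move=> t Dt; rewrite mulrC; apply: (cauchy_schwarz S) => //; exact: sm_mem Dt.
- exact: integrable_EFinZ.
Qed.

Lemma ip_Rintegral_le v x : strongly_measurable D v -> fmem X x ->
  mu.-integrable D (EFin \o (fun t => N (v t))) ->
  `|\int[mu]_(t in D) B (v t) x| <= N x * \int[mu]_(t in D) N (v t).
Proof.
move=> sv mx iv; have ix := ip_integrable sv mx iv.
apply: le_trans (le_normr_Rintegral mD ix) _; rewrite -RintegralZl//.
apply: le_Rintegral => //; last by move=> t Dt; rewrite mulrC;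
  apply: (cauchy_schwarz S) => //; exact: sm_mem Dt.
  exact: (integrable_norm ix).
exact: integrable_EFinZ.
Qed.

Lemma simple_int_mem (s : simple X) : simple_on D s -> fmem X (simple_int s).
Proof.
move=> sD; apply: (smem_sum S) => i; apply: (smemZ S).
by have [] := sD i.
Qed.

Lemma simple_intE (s : simple X) x : simple_on D s -> fmem X x ->
  B (simple_int s) x = \int[mu]_(t in D) B (simple_fun s t) x.
Proof.
move=> sD mx; have mv i : fmem X (@simple_val R X s i) by have [] := sD i.
have mA i : measurable (@simple_set R X s i : set (measurableTypeR R)).
  by have [] := sD i.
rewrite (sip_suml S)//; last by move=> i; exact: (smemZ S).
pose f i t := B (@simple_val R X s i) x * \1_(@simple_set R X s i) t.
have fi i : mu.-integrable D (EFin \o f i).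
  apply: (@integrable_EFinZ _ _ _ _ _ mD _ (\1_(@simple_set R X s i))).
  apply: (ge0_le_integrable mD (g := fun _ => 1)).
  - exact: measurable_indic.
  - by move=> t _; rewrite indicE; case: (_ \in _); rewrite ?normr1 ?normr0.
  - exact: integrable_cst.
have -> : \int[mu]_(t in D) B (simple_fun s t) x =
    \int[mu]_(t in D) (\sum_i f i t).
  apply: eq_Rintegral => t /set_mem Dt; rewrite (sip_suml S)//.
    by apply: eq_bigr => i _; rewrite (sipZl S)// /f mulrC.
  by move=> i; exact: (smemZ S).
have sumE (r : seq 'I_(simple_size s)) : mu.-integrable D (EFin \o (fun t => \sum_(i <- r) f i t)) /\
    \int[mu]_(t in D) (\sum_(i <- r) f i t) = \sum_(i <- r) \int[mu]_(t in D) f i t.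
  elim: r => [|i r [IHi IH]].
    split; last by rewrite big_nil; under eq_Rintegral do rewrite big_nil;
      rewrite Rintegral_cst// mul0r.
    by under eq_fun do rewrite big_nil; exact: integrable_cst.
  split; first by under eq_fun do rewrite big_cons; exact: integrable_EFinD.
  by under eq_Rintegral do rewrite big_cons; rewrite RintegralD// IH big_cons.
rewrite (sumE _).2; apply: eq_bigr => i _; rewrite (sipZl S)// mulrC /f.
rewrite RintegralZl//; last first.
  have [b0|b0] := eqVneq (B (simple_val i) x) 0.
    apply: (ge0_le_integrable mD (g := fun _ => 1)).
    - exact: measurable_indic.
    - by move=> t _; rewrite indicE; case: (_ \in _); rewrite ?normr1 ?normr0.
    - exact: integrable_cst.
  apply: (ge0_le_integrable mD (g := fun _ => 1)).
  - exact: measurable_indic.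
  - by move=> t _; rewrite indicE; case: (_ \in _); rewrite ?normr1 ?normr0.
  - exact: integrable_cst.
congr (_ * _); rewrite /Rintegral integral_indic//; congr fine.
by congr (_ _); apply/esym/setIidPl; have [] := sD i.
Qed.

Lemma Rintegral_EFin (f : R -> R) : mu.-integrable D (EFin \o f) ->
  (\int[mu]_(t in D) (f t)%:E)%E = (\int[mu]_(t in D) f t)%:E.
Proof.
by move=> fi; rewrite /Rintegral fineK//; exact: (integrable_fin_num mD fi).
Qed.

(** Dominated convergence: the approximations of [sm_approx] converge pointwise with error at most
    the norm of [v]. *)
Lemma sm_L1_approx v : strongly_measurable D v ->
  mu.-integrable D (EFin \o (fun t => N (v t))) ->
  exists s : nat -> simple X, (forall k, simple_on D (s k)) /\
    (\int[mu]_(t in D) N (simple_fun (s k) t - v t)) @[k --> \oo] --> 0.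
Proof.
move=> sv iv; have [s [sD sl sb]] := sm_approx H mD sv.
exists s; split=> //.
pose f k (t : measurableTypeR R) := (N (simple_fun (s k) t - v t))%:E.
have mf k : measurable_fun D (f k).
  apply/measurable_EFinP; apply: (sm_measurable_norm H).
  by apply: (smB H) => //; exact: sm_simple.
have fl : {ae mu, forall t, D t -> f ^~ t @ \oo --> 0%E}.
  by apply: aeW => t Dt; apply: cvg_EFin; [exact: nearW|exact: sl].
have fb : {ae mu, forall t k, D t -> (`|f k t| <= (N (v t))%:E)%E}.
  by apply: aeW => t k Dt; rewrite /f /= lee_fin ger0_norm ?snorm_ge0//; exact: sb.
have [_ _] := dominated_convergence mD mf (measurable_cst _) fl iv fb.
by rewrite integral0 => /fine_cvg.
Qed.

(** This reduces Bochner integrals to scalar ones. For the converse, the difference between the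
    integral of a simple function and [y] is tested against itself, and one factor of its norm is
    cancelled. *)
Lemma is_bochner_intP v y : mu.-integrable D (EFin \o (fun t => N (v t))) ->
  is_bochner_int D v y <-> [/\ strongly_measurable D v, fmem X y
    & forall x, fmem X x -> B y x = \int[mu]_(t in D) B (v t) x].
Proof.
move=> iv; have isv s : strongly_measurable D v -> simple_on D s ->
    mu.-integrable D (EFin \o (fun t => N (simple_fun s t - v t))).
  move=> sv sD; apply: snorm_integrableB => //; first exact: sm_simple.
  exact: simple_norm_integrable.
have Bsv s x : strongly_measurable D v -> simple_on D s -> fmem X x ->
    `|B (simple_int s) x - \int[mu]_(t in D) B (v t) x| <=
    N x * \int[mu]_(t in D) N (simple_fun s t - v t).
  move=> sv sD mx; have ss := sm_simple sD.
  rewrite simple_intE// -RintegralB//; last 2 first.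
  - by apply: ip_integrable => //; exact: simple_norm_integrable.
  - exact: ip_integrable.
  have -> : \int[mu]_(t in D) (B (simple_fun s t) x - B (v t) x) =
      \int[mu]_(t in D) B (simple_fun s t - v t) x.
    apply: eq_Rintegral => t /set_mem Dt.
    by rewrite (sipBl S)//; [exact: sm_mem Dt|exact: sm_mem Dt].
  by apply: (@ip_Rintegral_le (fun t => simple_fun s t - v t)) => //; [exact: (smB H)|exact: isv].
split.
  move=> [sv my [s [sD sv0 sy0]]]; split=> // x mx.
  have c1 : N x * \int[mu]_(t in D) N (simple_fun (s k) t - v t) @[k --> \oo] --> 0.
    rewrite -(mulr0 (N x)); apply: cvgM; first exact: cvg_cst.
    move/fine_cvg : sv0; rewrite /= (_ : _ \o _ = (fun k => \int[mu]_(t in D) N (simple_fun (s k) t - v t)))//.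
    apply/funext => k /=; congr fine; apply: eq_integral => t /set_mem Dt.
    rewrite (hnorm H)//; apply: (smemB S); [exact: (simple_mem H)|exact: sm_mem Dt].
  have c2 : N x * N (simple_int (s k) - y) @[k --> \oo] --> 0.
    rewrite -(mulr0 (N x)); apply: cvgM; first exact: cvg_cst.
    move: sy0; rewrite (_ : (fun k => fnorm X _) = (fun k => N (simple_int (s k) - y)))//.
    apply/funext => k; rewrite (hnorm H)//; apply: (smemB S) => //.
    exact: simple_int_mem.
  apply/eqP; rewrite -subr_eq0; apply/eqP; apply: (cvg0_eq0 (cvg0D c1 c2)) => k.
  have msk := simple_int_mem (sD k).
  have -> : B y x - \int[mu]_(t in D) B (v t) x =
    (B (simple_int (s k)) x - \int[mu]_(t in D) B (v t) x) -
      B (simple_int (s k) - y) x by rewrite (sipBl S)//; ring.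
  apply: le_trans (ler_normB _ _) _; apply: lerD; first exact: Bsv.
  by rewrite mulrC; apply: (cauchy_schwarz S) => //; exact: (smemB S).
move=> [sv my yE]; split=> //; have [s [sD s0]] := sm_L1_approx sv iv.
exists s; split=> //.
  rewrite (_ : (fun k => _) = (fun k => (\int[mu]_(t in D) N (simple_fun (s k) t - v t))%:E)).
    by apply: cvg_EFin => //; exact: nearW.
  apply/funext => k; rewrite -Rintegral_EFin; last exact: isv.
  apply: eq_integral => t /set_mem Dt.
  by rewrite (hnorm H)//; apply: (smemB S); [exact: (simple_mem H)|exact: sm_mem Dt].
apply: (@squeeze_cvgr _ _ _ _ (fun _ => 0) (fun k => \int[mu]_(t in D) N (simple_fun (s k) t - v t))) => //.
  apply: nearW => k; have msk := simple_int_mem (sD k).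
  have mx : fmem X (simple_int (s k) - y) by exact: (smemB S).
  rewrite (hnorm H)// snorm_ge0/=; set n := N _.
  have [n0|n0] := eqVneq n 0.
    by rewrite n0; apply: Rintegral_ge0 => t _; exact: snorm_ge0.
  have np : 0 < n by rewrite lt_neqAle eq_sym n0 snorm_ge0.
  rewrite -(ler_pM2l np) -expr2 /n (sqr_snorm S)//.
  apply: le_trans (Bsv _ _ sv (sD k) mx); rewrite -yE// -(sipBl S)//.
  exact: ler_norm.
exact: cvg_cst.
Qed.

Lemma bochner_exists v : strongly_measurable D v ->
  mu.-integrable D (EFin \o (fun t => N (v t))) ->
  exists2 y, fmem X y &
    forall x, fmem X x -> B y x = \int[mu]_(t in D) B (v t) x.
Proof.
move=> sv iv; have [s [sD s0]] := sm_L1_approx sv iv.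
set a := fun k => _ in s0.
have sn k : strongly_measurable D (simple_fun (s k)) by exact: sm_simple.
have isn k : mu.-integrable D (EFin \o (fun t => N (simple_fun (s k) t))).
  exact: simple_norm_integrable.
have msk k := simple_int_mem (sD k).
have ad n m : N (simple_int (s n) - simple_int (s m)) <= a n + a m.
  have mx : fmem X (simple_int (s n) - simple_int (s m)) by exact: (smemB S).
  set x := simple_int _ - _ in mx *.
  have [n0|n0] := eqVneq (N x) 0.
    by rewrite n0 addr_ge0//; apply: Rintegral_ge0 => t _; exact: snorm_ge0.
  have np : 0 < N x by rewrite lt_neqAle eq_sym n0 snorm_ge0.
  rewrite -(ler_pM2l np) -expr2 (sqr_snorm S)// {1}/x (sipBl S)//.
  rewrite !simple_intE// -RintegralB//; [|exact: ip_integrable..].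
  have -> : \int[mu]_(t in D) (B (simple_fun (s n) t) x - B (simple_fun (s m) t) x) =
      \int[mu]_(t in D) B (simple_fun (s n) t - simple_fun (s m) t) x.
    apply: eq_Rintegral => t /set_mem Dt.
    by rewrite (sipBl S)//; exact: (simple_mem H).
  have i1 : mu.-integrable D (EFin \o (fun t => N (simple_fun (s n) t - simple_fun (s m) t))).
    exact: snorm_integrableB.
  apply: le_trans (ler_norm _) _; apply: le_trans (ip_Rintegral_le _ mx i1) _.
    exact: (smB H).
  rewrite ler_wpM2l ?snorm_ge0// /a -RintegralD//; [|exact: snorm_integrableB..].
  apply: le_Rintegral => //.
    by apply: integrable_EFinD => //; exact: snorm_integrableB.
  move=> t Dt; have m1 := simple_mem H t (sD n); have m2 := simple_mem H t (sD m).
  have m3 := sm_mem sv Dt; rewrite (snormBC S m2 m3).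
  exact: (snorm_trans S).
(* The distance of two approximants is at most [a n + a m]; the supremum over the tail turns this
   into a bound that depends on [n] alone. *)
have [|n m nm|y my ye] := hcomplete H msk (e := fun n => sups a n *+ 2).
- by rewrite -(mul0rn _ 2); apply: cvgMn; exact: cvg_sups.
- have ub : forall i, has_ubound (sdrop a i).
    move=> i; have [M [_ aM]] := cvg_seq_bounded (cvgP _ s0).
    exists (M + 1) => _ [j _ <-]; apply: le_trans (ler_norm _) _.
    by apply: (aM (M + 1)) => //; rewrite ltrDl.
  apply: le_trans (ad n m) _; rewrite mulr2n; apply: lerD.
    by apply: (ub_le_sup (ub n)); exists n => //=.
  by apply: (ub_le_sup (ub n)); exists m => //=.
exists y => // x mx.
have c1 : N x * (a k + sups a k *+ 2) @[k --> \oo] --> 0.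
  rewrite -(mulr0 (N x)); apply: cvgM; first exact: cvg_cst.
  rewrite -(addr0 0); apply: cvgD => //.
  by rewrite -(mul0rn _ 2); apply: cvgMn; exact: cvg_sups.
apply/eqP; rewrite -subr_eq0; apply/eqP; apply: (cvg0_eq0 c1) => k.
have -> : B y x - \int[mu]_(t in D) B (v t) x =
    (B (simple_int (s k)) x - \int[mu]_(t in D) B (v t) x) -
      B (simple_int (s k) - y) x by rewrite (sipBl S)//; ring.
apply: le_trans (ler_normB _ _) _; rewrite mulrDr; apply: lerD; last first.
  rewrite mulrC; apply: le_trans (cauchy_schwarz S _ _) _ => //; first exact: (smemB S).
  by rewrite ler_wpM2r ?snorm_ge0.
rewrite simple_intE// -RintegralB//; [|exact: ip_integrable..].
have -> : \int[mu]_(t in D) (B (simple_fun (s k) t) x - B (v t) x) =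
      \int[mu]_(t in D) B (simple_fun (s k) t - v t) x.
  apply: eq_Rintegral => t /set_mem Dt.
  by rewrite (sipBl S)//; [exact: (simple_mem H)|exact: sm_mem Dt].
apply: (@ip_Rintegral_le (fun t => simple_fun (s k) t - v t)) => //; first exact: (smB H).
exact: snorm_integrableB.
Qed.

End on_domain.
End bochner.

(** * Smooth cutoffs *)

Section smooth_bump.
Context {R : realType}.
Implicit Types (p : {poly R}) (f g : R -> R) (x s t : R).

Definition flat_exp p x : R :=
  if 0 < x then p.[x^-1] * expR (- x^-1) else 0.

Lemma flat_exp_npos p x : x <= 0 -> flat_exp p x = 0.
Proof. by rewrite /flat_exp leNgt => /negbTE ->. Qed.

Lemma horner_growth p : exists2 A, 0 <= A &
  forall y, 1 <= y -> `|p.[y]| <= A * y ^+ (size p).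
Proof.
exists (\sum_(i < size p) `|p`_i|); first exact: sumr_ge0.
move=> y y1; have y0 : 0 <= y by exact: le_trans y1.
rewrite horner_coef mulr_suml; apply: le_trans (ler_norm_sum _ _ _) _.
apply: ler_sum => i _; rewrite normrM ler_wpM2l// ger0_norm ?exprn_ge0//.
by apply: ler_weXn2l => //; exact: ltnW.
Qed.

(** With y = 1/x, the exponential dominates y^(m+1)/(m+1)!, one power more than the growth of [p];
    the spare power is the factor x. *)
Lemma flat_exp_lipschitz0 p : exists2 C, 0 < C &
  forall x, `|x| <= 1 -> `|flat_exp p x| <= C * `|x|.
Proof.
have [A A0 pA] := horner_growth p.
pose m := size p; pose C := A * (m.+1)`!%:R + 1.
have C0 : 0 < C by rewrite ltr_wpDl// mulr_ge0.
exists C => // x x1; rewrite /flat_exp; case: ifPn => [x0|_]; last first.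
  by rewrite normr0 mulr_ge0// ltW.
rewrite (gtr0_norm x0) in x1 *.
set y := x^-1; have y0 : 0 < y by rewrite invr_gt0.
have y1 : 1 <= y by rewrite -[y]mul1r ler_pdivlMr// mul1r.
rewrite normrM (ger0_norm (expR_ge0 _)) expRN ler_pdivrMr ?expR_gt0//.
apply: le_trans (pA _ y1) _; rewrite -/m.
have ey : y ^+ m.+1 / (m.+1)`!%:R <= expR y.
  by apply: le_trans (expR_ge1Dxn m (ltW y0)); rewrite lerDr.
have f0 : (m.+1)`!%:R != 0 :> R by rewrite pnatr_eq0 -lt0n fact_gt0.
have -> : A * y ^+ m = A * (m.+1)`!%:R * (x * (y ^+ m.+1 / (m.+1)`!%:R)).
  rewrite exprS /y; field.
  by rewrite f0 gt_eqF.
rewrite -[leRHS]mulrA; apply: ler_pM.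
- by rewrite mulr_ge0.
- by rewrite mulr_ge0 ?divr_ge0 ?exprn_ge0// ltW.
- by rewrite /C lerDl.
- by rewrite ler_wpM2l// ltW.
Qed.

(** With y = 1/x one has y' = -y^2, so p(y) exp(-y) has derivative y^2 (p - p')(y) exp(-y): the
    family is closed under derivation, also at the origin. *)
Lemma is_derive_flat_exp p x :
  is_derive x 1 (flat_exp p) (flat_exp ('X^2 * (p - p^`())) x).
Proof.
have [x0|x0|->] := ltgtP x 0.
- rewrite [flat_exp _ x]flat_exp_npos ?ltW//.
  have d0 : is_derive x 1 (cst (0 : R)) (0 : R) by exact: is_derive_cst.
  apply: near_eq_is_derive d0; near=> y; rewrite flat_exp_npos//= ltW//.
  by near: y; exact: lt_nbhsl.
- rewrite {2}/flat_exp x0.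
  have x0' : x != 0 by rewrite gt_eqF.
  have dV : is_derive x 1 (fun y => y^-1) (- x ^- 2).
    by apply: is_derive_eq; [exact: (@is_deriveV R id)|rewrite /= [_ *: _]mulr1].
  have dp : is_derive x 1 (fun y => p.[y^-1]) (p^`().[x^-1] * (- x ^- 2)).
    exact: (@is_derive1_comp R (horner p) (fun y => y^-1)).
  have de : is_derive x 1 (fun y => expR (- y^-1)) (expR (- x^-1) * (- - x ^- 2)).
    exact: (@is_derive1_comp R expR (fun y => - y^-1)).
  have dm := @is_deriveM R R (fun y : R => p.[y^-1]) (fun y : R => expR (- y^-1)) x 1 _ _ dp de.
  have dm' := near_eq_is_derive _ dm.
  apply: is_derive_eq; first apply: dm'.
    near=> y; rewrite /flat_exp ifT//.
    by near: y; exact: lt_nbhsr.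
  rewrite !hornerE /GRing.scale/=; field.
  exact: x0'.
(* At 0 the difference quotient is again of the family, with [p * 'X] for [p], and it tends to 0 by
   the Lipschitz bound. *)
- rewrite [flat_exp _ 0]flat_exp_npos//; apply/is_derive1_caratheodory.
  exists (flat_exp (p * 'X)); split.
  + move=> z; rewrite [flat_exp p 0]flat_exp_npos// !subr0 /flat_exp.
    case: ifPn => z0; last by rewrite mul0r.
    by rewrite hornerM hornerX; field; rewrite gt_eqF.
  + have [C C0 CP] := flat_exp_lipschitz0 (p * 'X).
    suff : flat_exp (p * 'X) z @[z --> (0:R)] --> (0:R).
      by rewrite -[X in _ --> X](flat_exp_npos (p * 'X) (lexx 0)).
    apply/cvgr0Pnorm_lt => e e0; apply/nbhs_ballP.
    exists (Num.min 1 (C^-1 * e)).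
      by rewrite /= lt_min ltr01/= mulr_gt0 ?invr_gt0.
    move=> z; rewrite /ball/= sub0r normrN lt_min => /andP[/ltW z1 zC].
    by apply: le_lt_trans (CP _ z1) _; rewrite -ltr_pdivlMl.
  + by rewrite flat_exp_npos.
Unshelve. all: by end_near. Qed.

(* The algebra generated by the functions x |-> p(1/y) exp(-1/y), y = a x + b,
   and by inversion, is closed under derivation. *)
Inductive flat_alg : (R -> R) -> Prop :=
| flat_alg_exp p (a b : R) : flat_alg (fun x => flat_exp p (a * x + b))
| flat_alg_cst (a : R) : flat_alg (fun _ => a)
| flat_algD f g : flat_alg f -> flat_alg g -> flat_alg (fun x => f x + g x)
| flat_algM f g : flat_alg f -> flat_alg g -> flat_alg (fun x => f x * g x)
| flat_algV f : flat_alg f -> (forall x, f x != 0) -> flat_alg (fun x => (f x)^-1).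

Lemma flat_alg_derive f : flat_alg f ->
  exists2 g, flat_alg g & forall x, is_derive x 1 f (g x).
Proof.
elim=> {f} [p a b|a|f g _ [f' sf' ff'] _ [g' sg' gg']|f g sf [f' sf' ff'] sg [g' sg' gg']|f sf [f' sf' ff'] f0].
- exists (fun x => flat_exp ('X^2 * (p - p^`())) (a * x + b) * a).
    by apply: flat_algM; [exact: flat_alg_exp|exact: flat_alg_cst].
  move=> x; apply: (@is_derive1_comp R (flat_exp p) (fun x => a * x + b)).
    exact: is_derive_flat_exp.
  apply: (@is_derive_eq R R R (fun x => a * x + b)).
  by rewrite addr0 [_ *: _]mulr1.
- by exists (fun _ => 0); [exact: flat_alg_cst|move=> x; exact: is_derive_cst].
- exists (fun x => f' x + g' x); first exact: flat_algD.
  by move=> x; exact: (@is_deriveD R R R f g).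
- exists (fun x => f x * g' x + g x * f' x).
    by apply: flat_algD; apply: flat_algM.
  by move=> x; exact: (@is_deriveM R R f g).
- exists (fun x => -1 * ((f x)^-1 * (f x)^-1) * f' x).
    apply: flat_algM => //; apply: flat_algM; first exact: flat_alg_cst.
    by apply: flat_algM; exact: flat_algV.
  move=> x; have := is_deriveV (f0 x) (ff' x).
  by rewrite [_ *: _]mulNr -mulrA mulN1r expr2 invfM.
Qed.

Lemma flat_alg_derive1 f : flat_alg f -> flat_alg (derive1 f).
Proof.
move=> /flat_alg_derive[g sg fg]; rewrite (_ : derive1 f = g)//.
by apply/funext => x; rewrite derive1E; have [_ ->] := fg x.
Qed.

Lemma flat_alg_derivable f x : flat_alg f -> derivable f x 1.
Proof. by move=> /flat_alg_derive[g sg /(_ x)[]]. Qed.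

Lemma flat_alg_continuous f : flat_alg f -> continuous f.
Proof.
move=> sf x; apply: differentiable_continuous.
by apply/derivable1_diffP; exact: flat_alg_derivable.
Qed.

Lemma flat_alg_smooth f n x : flat_alg f -> derivable (derive1n n f) x 1.
Proof.
move=> sf; apply: flat_alg_derivable; elim: n => //= n IH.
exact: flat_alg_derive1.
Qed.

(* exp(-1/(k(x-s))) exp(-1/(k(t-x))) on (s,t): it increases to the indicator
   function of (s,t) as k grows. *)
Definition bump s t (k : R) x : R :=
  flat_exp 1 (k * x + - (k * s)) * flat_exp 1 (- k * x + k * t).

Lemma bump_flat_alg s t k : flat_alg (bump s t k).
Proof. by apply: flat_algM; exact: flat_alg_exp. Qed.

Lemma flat_exp1_ge0 x : 0 <= flat_exp 1 x.
Proof. by rewrite /flat_exp; case: ifP => // _; rewrite hornerC mul1r expR_ge0. Qed.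

Lemma flat_exp1_le1 x : flat_exp 1 x <= 1.
Proof.
rewrite /flat_exp; case: ifPn => // x0.
by rewrite hornerC mul1r expR_le1 oppr_le0 invr_ge0 ltW.
Qed.

Lemma bump_ge0 s t k x : 0 <= bump s t k x.
Proof. by rewrite mulr_ge0 ?flat_exp1_ge0. Qed.

Lemma bump_le1 s t k x : bump s t k x <= 1.
Proof. by rewrite mulr_ile1 ?flat_exp1_ge0 ?flat_exp1_le1. Qed.

Lemma bump_out s t k x : 0 < k -> ~~ (s < x < t) -> bump s t k x = 0.
Proof.
move=> k0; rewrite negb_and -!leNgt /bump => /orP[xs|tx].
  by rewrite [flat_exp _ _]flat_exp_npos ?mul0r// subr_le0 ler_pM2l.
rewrite [X in _ * X]flat_exp_npos ?mulr0// mulNr addrC subr_le0 ler_pM2l//.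
Qed.

Lemma cvg_flat_exp1 x : 0 < x -> flat_exp 1 (n.+1%:R * x) @[n --> \oo] --> (1 : R).
Proof.
move=> x0; rewrite (_ : (fun n : nat => _) = (fun n : nat => expR (- (x^-1 * harmonic n)))).
  have c0 : - (x^-1 * harmonic n) @[n --> \oo] --> (0 : R).
    by rewrite -oppr0; apply: cvgN; apply: cvg0M; exact: cvg_harmonic.
  by rewrite -expR0; apply: continuous_cvg => //; exact: continuous_expR.
apply/funext => n; rewrite /flat_exp hornerC mul1r mulr_gt0//.
by rewrite invfM mulrC /harmonic.
Qed.

Lemma cvg_bump s t x : bump s t n.+1%:R x @[n --> \oo] --> ((s < x < t)%R%:R : R).
Proof.
have [sxt|sxt] := boolP (s < x < t); last first.
  under eq_fun do rewrite bump_out//; exact: cvg_cst.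
have /andP[sx xt] := sxt.
rewrite /bump; have -> : (true%:R : R) = 1 * 1 by rewrite mulr1.
apply: cvgM.
  under eq_fun do rewrite -mulrBr.
  by apply: cvg_flat_exp1; rewrite subr_gt0.
under eq_fun do rewrite mulNr addrC -mulrBr.
by apply: cvg_flat_exp1; rewrite subr_gt0.
Qed.

Lemma sub_compactly_supported (D : set R) f s t : `[s, t] `<=` D ->
  (forall x, ~~ (s <= x <= t) -> f x = 0) -> compactly_supported D f.
Proof.
move=> stD f0; have cl : closed [set` `[s, t]] by exact: itv_closed.
have sub : closure [set x | f x != 0] `<=` `[s, t].
  rewrite [X in _ `<=` X](closure_id _).1//; apply: closure_subset => x /=.
  by rewrite in_itv/=; apply: contra_neqT => sxt; rewrite f0.
split; last exact: subset_trans sub stD.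
by apply: subclosed_compact sub; [exact: closed_closure|exact: segment_compact].
Qed.

(* E1 / (E1 + E2), with E1 and E2 vanishing exactly for x <= s - w and x >= s. *)
Lemma smooth_step s w : 0 < w -> exists F rho : R -> R,
  [/\ flat_alg F, flat_alg rho /\ (forall x, is_derive x 1 F (rho x)),
    (forall x, 0 <= rho x) /\ (forall x, ~~ (s - w < x < s) -> rho x = 0),
    (forall x, x <= s - w -> F x = 0) /\ (forall x, s <= x -> F x = 1)
    & forall x, 0 <= F x <= 1].
Proof.
move=> w0; pose q : {poly R} := 'X^2 * (1 - 1^`()).
have q0 y : 0 <= flat_exp q y.
  rewrite /flat_exp; case: ifP => // _; rewrite /q derivC subr0 mulr1 hornerXn.
  by rewrite mulr_ge0 ?sqr_ge0 ?expR_ge0.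
pose E1 x := flat_exp 1 (1 * x + - (s - w)); pose E2 x := flat_exp 1 (-1 * x + s).
pose d1 x := flat_exp q (1 * x + - (s - w)); pose d2 x := flat_exp q (-1 * x + s).
have a1 : flat_alg E1 by exact: flat_alg_exp.
have a2 : flat_alg E2 by exact: flat_alg_exp.
have E1_ge0 x : 0 <= E1 x by exact: flat_exp1_ge0.
have E2_ge0 x : 0 <= E2 x by exact: flat_exp1_ge0.
have E10 x : x <= s - w -> E1 x = 0 by move=> xs; apply: flat_exp_npos; lra.
have E20 x : s <= x -> E2 x = 0 by move=> xs; apply: flat_exp_npos; lra.
have d10 x : x <= s - w -> d1 x = 0 by move=> xs; apply: flat_exp_npos; lra.
have d20 x : s <= x -> d2 x = 0 by move=> xs; apply: flat_exp_npos; lra.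
have Epos x : 0 < E1 x + E2 x.
  have pos y : 0 < y -> 0 < flat_exp 1 y :> R.
    by move=> y0; rewrite /flat_exp y0 hornerC mul1r expR_gt0.
  have [xs|sx] := ltP x s.
    by rewrite ltr_wpDl//; apply: pos; lra.
  by rewrite ltr_pwDl//; apply: pos; lra.
have E0 x : E1 x + E2 x != 0 by rewrite gt_eqF.
have lin (a b x : R) : is_derive x 1 (fun x : R => a * x + b) a.
  by apply: (@is_derive_eq R R R (fun x => a * x + b)); rewrite addr0 [_ *: _]mulr1.
have D1 x : is_derive x 1 E1 (d1 x * 1).
  by apply: (@is_derive1_comp R (flat_exp 1) (fun x => 1 * x + - (s - w)));
    exact: is_derive_flat_exp.
have D2 x : is_derive x 1 E2 (d2 x * -1).
  by apply: (@is_derive1_comp R (flat_exp 1) (fun x => -1 * x + s));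
    exact: is_derive_flat_exp.
(* The quotient rule. [E2] has derivative [- d2], so both terms of the numerator are nonnegative. *)
pose rho x := (d1 x * E2 x + E1 x * d2 x) * ((E1 x + E2 x)^-1 * (E1 x + E2 x)^-1).
have aV : flat_alg (fun x => (E1 x + E2 x)^-1).
  by apply: flat_algV => //; exact: flat_algD.
exists (fun x => E1 x * (E1 x + E2 x)^-1), rho; split.
- exact: flat_algM.
- split.
    apply: flat_algM; last exact: flat_algM.
    by apply: flat_algD; apply: flat_algM => //; exact: flat_alg_exp.
  move=> x; have DE : is_derive x 1 (fun x : R => E1 x + E2 x) (d1 x * 1 + d2 x * -1).
    exact: (@is_deriveD R R R E1 E2).
  have DV := @is_deriveV R (fun x => E1 x + E2 x) x _ 1 (E0 x) DE.
  have DM := @is_deriveM R R E1 (fun x => (E1 x + E2 x)^-1) x 1 _ _ (D1 x) DV.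
  apply: (is_derive_eq DM); rewrite /GRing.scale/= /rho; field.
  exact: E0.
- split=> x; first by rewrite mulr_ge0// ?addr_ge0 ?mulr_ge0 ?invr_ge0 ?addr_ge0 ?q0.
  rewrite negb_and -!leNgt => /orP[xs|sx].
    by rewrite /rho d10// E10// !mul0r addr0 mul0r.
  by rewrite /rho d20// E20// !mulr0 addr0 mul0r.
- split=> x xs; first by rewrite E10// mul0r.
  by have := E0 x; rewrite E20// addr0 => ?; rewrite divff.
- move=> x; rewrite divr_ge0 ?addr_ge0//=.
  by rewrite ler_pdivrMr// mul1r lerDl.
Qed.

End smooth_bump.

(** * Curves with square-integrable derivative *)

Section weak_derivative_scalar.
Context {R : realType}.
Notation mu := (@lebesgue_measure R).
Implicit Types (f h rho : R -> R) (s t w x : R).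

Lemma continuous_measurable (D : set (measurableTypeR R)) f : measurable D ->
  {in D, continuous f} -> measurable_fun D (f : measurableTypeR R -> R).
Proof.
move=> mD cf; apply: subspace_continuous_measurable_fun => //.
by apply: continuous_in_subspaceT => x xD; exact: cf.
Qed.

Lemma continuous_measurableT (D : set (measurableTypeR R)) f :
  continuous f -> measurable_fun D (f : measurableTypeR R -> R).
Proof.
move=> cf; apply: (@measurable_funTS _ _ _ _ D).
by apply: continuous_measurable => // x _; exact: cf.
Qed.

Lemma flat_alg_FTC2 (F rho : R -> R) (a b : R) : a < b -> flat_alg rho ->
  (forall x, is_derive x 1 F (rho x)) ->
  (\int[mu]_(x in `[a, b]) (rho x)%:E = (F b - F a)%:E)%E.
Proof.
move=> ab srho dF; have cF : continuous F.
  move=> x; apply: differentiable_continuous; apply/derivable1_diffP.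
  by have [] := dF x.
rewrite (@continuous_FTC2 _ rho F a b ab)//.
- by apply: continuous_subspaceT => x; exact: flat_alg_continuous.
- split.
  + by move=> x _; have [] := dF x.
  + by apply: cvg_at_right_filter; exact: cF.
  + by apply: cvg_at_left_filter; exact: cF.
- by move=> x _; rewrite derive1E; have [_ ->] := dF x.
Qed.

Lemma Rintegral_eq0 (D : set (measurableTypeR R)) f :
  (forall x, D x -> f x = 0) -> \int[mu]_(x in D) f x = 0.
Proof.
move=> f0; rewrite /Rintegral (_ : (\int[mu]_(x in D) _ = 0)%E)//.
by apply: integral0_eq => x Dx; rewrite f0.
Qed.

Variable T : R.
Notation I := (`]0, T[%classic : set (measurableTypeR R)).

Lemma mI : measurable I. Proof. exact: measurable_itv. Qed.
Hint Resolve mI : core.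

Lemma finI : (mu I < +oo)%E.
Proof. by rewrite /= lebesgue_measure_itv; case: ifP => // _; rewrite ltry. Qed.

Lemma bounded_integrableM f h (M : R) : measurable_fun I f ->
  (forall t, I t -> `|f t| <= M) -> mu.-integrable I (EFin \o h) ->
  mu.-integrable I (EFin \o (fun t => f t * h t)).
Proof.
move=> mf fM ih; have mh : measurable_fun I h.
  by apply/measurable_EFinP; exact: (measurable_int mu).
apply: (ge0_le_integrable mI (g := fun t => M * `|h t|)).
- exact: measurable_funM.
- by move=> t It; rewrite normrM ler_wpM2r// fM.
- by apply: integrable_EFinZ => //; exact: integrable_norm.
Qed.

(** As a weight under an integral over the fixed interval it stands for integration up to [t].
    Differences [cut t - cut s] are integrals from s to t with the correct sign also when t < s. *)
Definition cut t x : R := (x < t)%R%:R.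

Lemma cut_measurable t : measurable_fun I (cut t : measurableTypeR R -> R).
Proof.
rewrite (_ : cut t = \1_(`]-oo, t[%classic)); last first.
  apply/funext => x; rewrite indicE /cut; congr (_%:R).
  by rewrite mem_setE in_itv.
by apply: measurable_indic; exact: measurable_itv.
Qed.

Lemma cutB_le1 t s x : `|cut t x - cut s x| <= 1.
Proof. by rewrite /cut; case: (x < t)%R; case: (x < s)%R; rewrite ?subrr ?subr0 ?sub0r ?normrN ?normr1 ?normr0. Qed.

(** A smooth step equals 1 up to the right end and is not a test function; the difference of two
    steps is one. *)
Lemma step_test_funI (F1 F2 : R -> R) (a s t : R) : 0 < a -> s < T -> t < T ->
  flat_alg F1 -> flat_alg F2 -> (forall x, x <= a -> F1 x = 0) ->
  (forall x, x <= a -> F2 x = 0) -> (forall x, s <= x -> F1 x = 1) ->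
  (forall x, t <= x -> F2 x = 1) ->
  test_funI T (fun x => F1 x - F2 x).
Proof.
move=> a0 sT tT sF1 sF2 F10 F20 F11 F21.
have e : (fun x => F1 x - F2 x) = (fun x => F1 x + -1 * F2 x).
  by apply/funext => x; rewrite mulN1r.
split.
  move=> n x; apply: flat_alg_smooth; rewrite e; apply: flat_algD => //.
  by apply: flat_algM => //; exact: flat_alg_cst.
apply: (@sub_compactly_supported _ _ _ a (Num.max s t)).
  move=> x /=; rewrite !in_itv/= => /andP[ax xs]; rewrite (lt_le_trans a0 ax)/=.
  by apply: le_lt_trans xs _; rewrite gt_max sT.
move=> x; rewrite negb_and -!ltNge => /orP[/ltW xa|].
  by rewrite F10// F20// subrr.
by rewrite gt_max => /andP[/ltW sx /ltW tx]; rewrite F11// F21// subrr.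
Qed.

Variables (f h : R -> R).
Hypotheses (cf : {in I, continuous f}) (ih : mu.-integrable I (EFin \o h)).
Hypothesis bf : exists M, forall t, I t -> `|f t| <= M.
Hypothesis fh : forall phi, test_funI T phi ->
  \int[mu]_(t in I) (derive1 phi t * f t) = - \int[mu]_(t in I) (phi t * h t).

(** The derivative of a step of width [w] ending at [s] is an averaging kernel on the left of [s]:
    its mass is F(s) - F(s - w) = 1. *)
Lemma mollify_cvg (s e : R) : 0 < s < T -> 0 < e -> exists2 d : R, 0 < d &
  forall w F rho, 0 < w < d -> flat_alg rho -> (forall x, is_derive x 1 F (rho x)) ->
    (forall x, 0 <= rho x) -> (forall x, ~~ (s - w < x < s) -> rho x = 0) ->
    (forall x, x <= s - w -> F x = 0) -> (forall x, s <= x -> F x = 1) ->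
    mu.-integrable I (EFin \o (fun t => rho t * f t)) /\
    `|\int[mu]_(t in I) (rho t * f t) - f s| <= e.
Proof.
move=> /andP[s0 sT] e0.
have sI : s \in I by apply/mem_set; rewrite /= in_itv/= s0.
have /nbhs_ballP[d /= d0 dP] : \forall x \near s, `|f s - f x| < e.
  by move: (cf sI) => /cvgrPdist_lt/(_ e e0).
exists (Num.min s d); first by rewrite lt_min s0.
move=> w F rho /andP[w0]; rewrite lt_min => /andP[ws wd] srho dF rho0 rhoout F0 F1.
have mrho : measurable_fun I (rho : measurableTypeR R -> R).
  by apply: continuous_measurableT => x; exact: flat_alg_continuous.
have ab : s - w < s by rewrite gtrBl.
have int1 : (\int[mu]_(x in I) (rho x)%:E = 1%:E)%E.
  have := flat_alg_FTC2 ab srho dF; rewrite (F0 _ (lexx _)) (F1 _ (lexx _)) subr0 => <-.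
  rewrite [LHS]integral_mkcond [RHS]integral_mkcond; apply: eq_integral => x _.
  rewrite !patchE; case: ifPn => xI; case: ifPn => xJ //.
    rewrite rhoout//; apply: contra xJ => /andP[sx xs].
    by apply/mem_set; rewrite /= in_itv/= !ltW.
  rewrite rhoout//; apply: contra xI => /andP[sx xs].
  by apply/mem_set; rewrite /= in_itv/= (lt_trans xs sT) andbT (lt_trans _ sx)// subr_gt0.
have irho : mu.-integrable I (EFin \o rho).
  apply/integrableP; split; first exact/measurable_EFinP.
  under eq_integral do rewrite /= ger0_norm//.
  by rewrite int1 ltry.
have irf : mu.-integrable I (EFin \o (fun t => rho t * f t)).
  have [M fM] := bf.
  rewrite (_ : (fun t => _) = (fun t => f t * rho t)); last first.
    by apply/funext => x; rewrite mulrC.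
  apply: (@bounded_integrableM f rho M) => //.
  exact: (continuous_measurable mI).
split=> //.
have rint : \int[mu]_(t in I) rho t = 1 by rewrite /Rintegral int1.
have -> : \int[mu]_(t in I) (rho t * f t) - f s = \int[mu]_(t in I) (rho t * f t - f s * rho t).
  rewrite RintegralB//; last exact: integrable_EFinZ.
  by rewrite RintegralZl// rint mulr1.
have i2 : mu.-integrable I (EFin \o (fun t => rho t * f t - f s * rho t)).
  by apply: integrable_EFinB => //; exact: integrable_EFinZ.
apply: le_trans (le_normr_Rintegral mI i2) _.
rewrite -[e]mulr1 -rint -RintegralZl//; apply: le_Rintegral => //.
- exact: (integrable_norm i2).
- exact: integrable_EFinZ.
move=> x _; have [xs|xs] := boolP (s - w < x < s); last first.
  by rewrite rhoout// mul0r !mulr0 subrr normr0.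
rewrite [f s * _]mulrC -mulrBr normrM (ger0_norm (rho0 x)) mulrC ler_wpM2r//.
rewrite distrC; apply/ltW/dP => /=; move: xs => /andP[sx xs].
by rewrite /ball/= ger0_norm; lra.
Qed.

(** Test with the difference of smooth steps at [t] and [s] whose widths shrink to 0. Their
    derivatives average [f] near the two points, and the steps themselves converge boundedly to
    indicator functions. Each of the three errors is at most e/3. *)
Lemma weak_FTC s t : 0 < s < T -> 0 < t < T ->
  f t - f s = \int[mu]_(x in I) ((cut t x - cut s x) * h x).
Proof.
move=> hs ht; have [s0 sT] := andP hs; have [t0 tT] := andP ht.
apply/eqP; rewrite -subr_eq0 -normr_le0; apply/ler_addgt0Pl => e e0.
have e30 : 0 < e / 3 by rewrite divr_gt0.
have [ds ds0 dsP] := mollify_cvg hs e30; have [dt dt0 dtP] := mollify_cvg ht e30.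
(* Half the minimum satisfies the width bounds at both points and keeps the supports inside (0,
   T). *)
pose w0 := Num.min (Num.min ds dt) (Num.min s t) / 2.
have w00 : 0 < w0 by rewrite divr_gt0// !lt_min ds0 dt0 s0.
have [ws0 wd0 wS wT] : [/\ w0 < ds, w0 < dt, w0 < s & w0 < t].
  have := ds0; have := dt0; rewrite /w0.
  have : Num.min (Num.min ds dt) (Num.min s t) <= ds by rewrite !ge_min lexx.
  have : Num.min (Num.min ds dt) (Num.min s t) <= dt by rewrite !ge_min lexx orbT.
  have : Num.min (Num.min ds dt) (Num.min s t) <= s by rewrite !ge_min lexx !orbT.
  have : Num.min (Num.min ds dt) (Num.min s t) <= t by rewrite !ge_min lexx !orbT.
  by move=> *; split; lra.
pose w n := w0 / n.+1%:R.
have wP n : 0 < w n <= w0.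
  by rewrite divr_gt0//= ler_pdivrMr// ler_peMr ?ler1n// ltW.
have Fs n := smooth_step s (andP (wP n)).1.
have Ft n := smooth_step t (andP (wP n)).1.
have [P PP] := choice Fs; have [Q QP] := choice Ft.
pose phi n x := Q n x - P n x.
have tphi n : test_funI T (phi n).
  have [rP [aP _ _ [P0 P1] _]] := PP n; have [rQ [aQ _ _ [Q0 Q1] _]] := QP n.
  have /andP[wn0 wn1] := wP n.
  apply: (@step_test_funI _ _ (Num.min (s - w n) (t - w n)) t s) => //.
  - by rewrite lt_min; apply/andP; split; lra.
  - by move=> x; rewrite le_min => /andP[_]; exact: Q0.
  - by move=> x; rewrite le_min => /andP[+ _]; exact: P0.
have mF n x : flat_alg (P n) /\ flat_alg (Q n).
  by have [rP []] := PP n; have [rQ []] := QP n.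
have c1 : \int[mu]_(x in I) (phi n x * h x) @[n --> \oo] -->
    \int[mu]_(x in I) ((cut s x - cut t x) * h x).
  apply: (bounded_convergence (M := 1) mI) => //.
  - move=> n; apply: measurable_funB; apply: continuous_measurableT => x;
      apply: flat_alg_continuous; by have [] := mF n 0.
  - move=> n x _; have [rP [_ _ _ _ /(_ x)]] := PP n; have [rQ [_ _ _ _ /(_ x)]] := QP n.
    by rewrite ler_norml /phi => /andP[? ?] /andP[? ?]; apply/andP; split; lra.
  - have key (r : R) (G : nat -> R -> R) x : (forall n, exists rho : R -> R,
        [/\ flat_alg (G n), flat_alg rho /\ (forall x, is_derive x 1 (G n) (rho x)),
        (forall x, 0 <= rho x) /\ (forall x, ~~ (r - w n < x < r) -> rho x = 0),
        (forall x, x <= r - w n -> G n x = 0) /\ (forall x, r <= x -> G n x = 1)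
        & forall x, 0 <= G n x <= 1]) -> G n x @[n --> \oo] --> 1 - cut r x.
      move=> GP; rewrite /cut; have [xr|rx] := ltP x r; last first.
        rewrite subr0 (_ : (fun n => _) = fun _ => 1); first exact: cvg_cst.
        by apply/funext => n; have [rho [_ _ _ [_ ->]]] := GP n.
      rewrite subrr; apply/cvgrPdist_lt => d d0.
      have c0 : w n @[n --> \oo] --> 0 by apply: cvg0M; exact: cvg_harmonic.
      have rx0 : 0 < r - x by rewrite subr_gt0.
      have : \forall n \near \oo, w n < r - x by exact: (cvgr_lt 0).
      apply: filterS => n wn; have [rho [_ _ _ [G0 _] _]] := GP n.
      by rewrite G0 ?subrr ?normr0//; lra.
    move=> x _; rewrite (_ : cut s x - cut t x = (1 - cut t x) - (1 - cut s x)); last by ring.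
    by apply: cvgB; apply: key.
have : \forall n \near \oo,
    `|\int[mu]_(x in I) ((cut s x - cut t x) * h x) - \int[mu]_(x in I) (phi n x * h x)| < e / 3.
  by move: c1 => /cvgrPdist_lt; apply.
case=> n _ /(_ n (leqnn n)) /= hn.
have [rP [aP [arP dP] [rP0 rPo] [P0 P1] _]] := PP n.
have [rQ [aQ [arQ dQ] [rQ0 rQo] [Q0 Q1] _]] := QP n.
have /andP[wn0 wn1] := wP n.
have [is_ hs1] := dsP (w n) (P n) rP (introT andP (conj wn0 (le_lt_trans wn1 ws0))) arP dP rP0 rPo P0 P1.
have [it_ ht1] := dtP (w n) (Q n) rQ (introT andP (conj wn0 (le_lt_trans wn1 wd0))) arQ dQ rQ0 rQo Q0 Q1.
have := fh (tphi n).
have -> : \int[mu]_(x in I) (derive1 (phi n) x * f x) =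
    \int[mu]_(x in I) (rQ x * f x) - \int[mu]_(x in I) (rP x * f x).
  rewrite -RintegralB//; apply: eq_Rintegral => x _; rewrite -mulrBl; congr (_ * _).
  have dphi := @is_deriveB R R R (Q n) (P n) x 1 _ _ (dQ x) (dP x).
  by rewrite derive1E; have [_ ->] := dphi.
have -> : \int[mu]_(x in I) ((cut t x - cut s x) * h x) =
    - \int[mu]_(x in I) ((cut s x - cut t x) * h x).
  rewrite -mulN1r -RintegralZl//; first by apply: eq_Rintegral => x _; ring.
  apply: (@bounded_integrableM _ _ 1) => //.
    by apply: measurable_funB; exact: cut_measurable.
  by move=> x _; exact: cutB_le1.
move: hs1 ht1; rewrite addr0 !ler_norml.
set i1 := \int[mu]_(t in I) (rP t * f t); set i2 := \int[mu]_(t in I) (rQ t * f t).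
set i3 := \int[mu]_(t in I) (phi n t * h t) in hn *.
set i4 := \int[mu]_(x in I) ((cut s x - cut t x) * h x) in hn *.
move=> /andP[? ?] /andP[? ?] ?; move: hn; rewrite ltr_norml => /andP[? ?].
clearbody i1 i2 i3 i4; clear c1.
by apply/andP; split; lra.
Qed.

End weak_derivative_scalar.

(** * Integrals up to a moving time and integration by parts *)

Section scalar_time.
Context {R : realType}.
Variable T : R.
Notation mu := (@lebesgue_measure R).
Notation I := (`]0, T[%classic : set (measurableTypeR R)).
Implicit Types (f h : R -> R) (s t x : R).

Let mI : measurable I := mI T.
Hint Resolve mI : core.

Lemma cut_ge0 t x : 0 <= cut t x :> R.
Proof. by rewrite /cut; case: (_ < _). Qed.

Lemma cut_le1 t x : `|cut t x| <= 1 :> R.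
Proof. by rewrite /cut; case: (_ < _); rewrite ?normr1 ?normr0. Qed.

Lemma cut_integrable h t : mu.-integrable I (EFin \o h) ->
  mu.-integrable I (EFin \o (fun x => cut t x * h x)).
Proof.
move=> ih; apply: (@bounded_integrableM _ _ _ _ 1) => //.
  exact: cut_measurable.
by move=> x _; exact: cut_le1.
Qed.

Lemma cutB_integrable h s t : mu.-integrable I (EFin \o h) ->
  mu.-integrable I (EFin \o (fun x => (cut t x - cut s x) * h x)).
Proof.
move=> ih; apply: (@bounded_integrableM _ _ _ _ 1) => //.
  by apply: measurable_funB; exact: cut_measurable.
by move=> x _; exact: cutB_le1.
Qed.

Lemma RintegralB_cut h s t : mu.-integrable I (EFin \o h) ->
  \int[mu]_(x in I) ((cut t x - cut s x) * h x) =
  \int[mu]_(x in I) (cut t x * h x) - \int[mu]_(x in I) (cut s x * h x).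
Proof.
move=> ih; rewrite -RintegralB//; [|exact: cut_integrable..].
by apply: eq_Rintegral => x _; rewrite mulrBl.
Qed.

Lemma cutT x : I x -> cut T x = 1.
Proof. by rewrite /= in_itv/= /cut => /andP[_ ->]. Qed.

Lemma cut0 x : I x -> cut 0 x = 0 :> R.
Proof. by rewrite /= in_itv/= /cut => /andP[x0 _]; rewrite ltNge ltW. Qed.

Lemma cutBE s t x : s <= t -> cut t x - cut s x = (s <= x < t)%R%:R :> R.
Proof.
move=> st; rewrite /cut; have [xs|sx] := ltP x s; last by rewrite subr0.
by rewrite (lt_le_trans xs st) subrr.
Qed.

Lemma Rintegral_cutB_sqr s t : 0 <= s -> s <= t -> t <= T ->
  \int[mu]_(x in I) ((cut t x - cut s x) ^+ 2) <= t - s.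
Proof.
move=> s0 st tT; have -> : \int[mu]_(x in I) ((cut t x - cut s x) ^+ 2) =
    \int[mu]_(x in I) (\1_(`[s, t[%classic) x).
  apply: eq_Rintegral => x _; rewrite cutBE// indicE mem_setE in_itv/=.
  by case: (_ && _); rewrite ?expr1n// expr0n.
have mst : measurable (`[s, t[%classic : set (measurableTypeR R)) by exact: measurable_itv.
have mstI : (mu (`[s, t[%classic `&` I) <= mu `[s, t[%classic)%E.
  by apply: le_measure; rewrite ?inE//; exact: measurableI.
have muE : mu `[s, t[%classic = (t - s)%:E.
  rewrite /= lebesgue_measure_itv/= lte_fin; case: ltP => // ts.
  by rewrite (_ : s = t) ?subrr//; apply/eqP; rewrite eq_le st.
rewrite /Rintegral integral_indic// -lee_fin -muE fineK//.
rewrite ge0_fin_numE//; apply: le_lt_trans mstI _.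
by rewrite muE ltry.
Qed.

Lemma integral_restrictZ (f : R -> R) (c : R) : mu.-integrable I (EFin \o f) ->
  (\int[mu]_x (c * (f \_ I) x)%:E = (c * \int[mu]_(x in I) f x)%:E)%E.
Proof.
move=> fi; have fi' : mu.-integrable setT (EFin \o (f \_ I)).
  by rewrite -restrict_EFin; apply/(integrable_mkcond _ mI).
under eq_integral do rewrite EFinM.
rewrite (integralZl measurableT fi') EFinM; congr (_ * _)%E.
rewrite -Rintegral_EFin//.
by rewrite [RHS]integral_mkcond restrict_EFin.
Qed.

(* Integration by parts, by Fubini on the triangle x < t. *)
Lemma Rintegral_derive_primitive (phi h : R -> R) : test_funI T phi ->
  mu.-integrable I (EFin \o h) ->
  \int[mu]_(t in I) (derive1 phi t * \int[mu]_(x in I) (cut t x * h x)) =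
  - \int[mu]_(t in I) (phi t * h t).
Proof.
move=> [sphi [_ cphi]] ih.
have dphi x : derivable phi x 1 by exact: (sphi 0%N).
have ddphi x : derivable (derive1 phi) x 1 by exact: (sphi 1%N).
have cont (f : R -> R) : (forall x, derivable f x 1) -> continuous f.
  by move=> df x; apply: differentiable_continuous; apply/derivable1_diffP.
have c0 := cont _ dphi; have c1 := cont _ ddphi.
have phi0 x : ~ I x -> phi x = 0.
  apply: contra_notP => /eqP px; apply: cphi; exact: subset_closure.
have bnd (f : R -> R) : continuous f -> exists M, forall x, I x -> `|f x| <= M.
  move=> cf; have /compact_bounded[N [_ NP]] : compact (f @` `[0, T]).
    by apply: continuous_compact; [exact: continuous_subspaceT|exact: segment_compact].
  exists (N + 1) => x Ix; apply: (NP (N + 1)); first by rewrite ltrDl.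
  by exists x => //; move: Ix; exact: subset_itv_oo_cc.
have [M MP] := bnd _ c1; have [M2 M2P] := bnd _ c0.
pose g (z : measurableTypeR R * measurableTypeR R) : \bar R :=
  ((derive1 phi \_ I) z.1 * (cut z.1 z.2 * (h \_ I) z.2))%:E.
have mh : measurable_fun I h by apply/measurable_EFinP; exact: (measurable_int mu).
have mg : measurable_fun setT g.
  apply/measurable_EFinP; apply: measurable_funM.
    apply: (measurableT_comp (f := derive1 phi \_ I)) => //.
    by apply/(measurable_restrictT _ mI); exact: continuous_measurableT.
  apply: measurable_funM; last first.
    apply: (measurableT_comp (f := h \_ I)) => //.
    exact/(measurable_restrictT _ mI).
  rewrite (_ : (fun z => _) = \1_[set z : measurableTypeR R * measurableTypeR R | z.2 < z.1]).
    apply: measurable_indic; rewrite -[X in measurable X]setTI.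
    exact: (measurable_fun_ltr measurable_snd measurable_fst measurableT (Y := [set true])).
  apply/funext => z; rewrite indicE /cut; congr (_%:R).
  by have [zz|zz] := boolP (z.2 < z.1); [rewrite mem_set|rewrite memNset//; apply/negP].
have ih1 : mu.-integrable setT (EFin \o (fun x => `|(h \_ I) x|)).
  apply: integrable_norm; rewrite -restrict_EFin.
  by apply/(integrable_mkcond _ mI).
have iphi : mu.-integrable I (EFin \o derive1 phi).
  apply: (ge0_le_integrable mI (g := fun _ => M)) => //.
    exact: continuous_measurableT.
  by apply: integrable_cst => //; exact: finI.
pose K := (\int[mu]_x `|(h \_ I) x|%:E)%E.
have K0 : (0 <= K)%E by apply: integral_ge0 => x _; rewrite lee_fin.
have Kfin : (K < +oo)%E.
  by have /integrableP[_] := ih1; under eq_integral do rewrite /= normr_id.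
pose m : {sigma_finite_measure set (measurableTypeR R) -> \bar R} := @lebesgue_measure R.
have ig : (m \x m)%E.-integrable setT g.
  refine (proj2 (@integrable12ltyP _ _ _ _ R m m g mg) _).
  apply: (@le_lt_trans _ _ (\int[mu]_(t in I) (`|M| * fine K)%:E)%E); last first.
    by rewrite integral_cst// lte_mul_pinfty// ?finI// lee_fin mulr_ge0// fine_ge0.
  rewrite [leRHS]integral_mkcond; apply: ge0_le_integral => //.
  - by move=> t _; apply: integral_ge0.
  - apply: (measurable_fun_fubini_tonelli_F (abse \o g)) => //=.
    exact: measurableT_comp.
  - by apply/(measurable_restrictT _ mI); exact: measurable_cst.
  move=> t _; rewrite patchE; case: ifPn => tI; last first.
    rewrite le_eqVlt integral0_eq ?eqxx// => x _.
    by rewrite /g /= patchE (negbTE tI) mul0r normr0.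
  rewrite EFinM fineK ?ge0_fin_numE// -ge0_integralZl//; last first.
    by have /integrableP[] := ih1.
  apply: ge0_le_integral => //.
  - by apply: measurableT_comp => //; exact: (measurableT_comp mg (measurable_pair1 t)).
  - apply/measurable_EFinP; apply: measurable_funM => //.
    by apply/measurable_EFinP; have /integrableP[] := ih1.
  move=> x _; rewrite /g /= lee_fin patchE tI !normrM ler_pM// ?mulr_ge0//.
    by apply: le_trans (ler_norm _); apply: MP; exact: set_mem.
  by rewrite ler_piMl// cut_le1.
have Fub := @Fubini _ _ _ _ R m m g ig.
have F1 : (\int[mu]_t \int[mu]_x g (t, x) =
    (\int[mu]_(t in I) (derive1 phi t * \int[mu]_(x in I) (cut t x * h x))%:E))%E.
  rewrite [RHS]integral_mkcond; apply: eq_integral => t _.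
  rewrite patchE -integral_restrictZ; last exact: cut_integrable.
  have [tI|tI] := boolP (t \in I); last first.
    by apply: integral0_eq => x _; rewrite /g /= patchE (negbTE tI) mul0r.
  apply: eq_integral => x _; rewrite /g /= !patchE tI.
  by case: ifP; rewrite ?mulr0.
have F2 : (\int[mu]_x \int[mu]_t g (t, x) =
    (\int[mu]_(x in I) (- (phi x * h x))%:E))%E.
  rewrite [RHS]integral_mkcond; apply: eq_integral => x _.
  have icut : mu.-integrable I (EFin \o (fun t => cut t x * derive1 phi t)).
    apply: (@bounded_integrableM _ _ (fun t => cut t x) _ 1) => //; last by move=> ? _; exact: cut_le1.
    rewrite (_ : (fun t => _) = \1_(`]x, +oo[%classic)).
      by apply: measurable_indic; exact: measurable_itv.
    by apply/funext => t; rewrite indicE /cut; congr (_%:R); rewrite mem_setE in_itv/= andbT.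
  transitivity (\int[mu]_t ((h \_ I) x * ((fun t => cut t x * derive1 phi t) \_ I) t)%:E)%E.
    apply: eq_integral => t _; rewrite /g /= !patchE.
    by case: ifP; rewrite ?mul0r ?mulr0// => _; congr EFin; ring.
  rewrite integral_restrictZ// !patchE; case: ifPn => xI; last by rewrite mul0r.
  have /andP[x0 xT] : 0 < x < T by move/set_mem: xI; rewrite /= in_itv.
  congr EFin; rewrite -mulNr mulrC; congr (_ * _).
  rewrite -[LHS]/(fine _) (_ : (\int[mu]_(t in I) _ = (- phi x)%:E)%E)//.
  (* After the exchange the inner integral runs over (x, T); it equals [- phi x], as [phi] vanishes
     at T. *)
  have := @continuous_FTC2 R (derive1 phi) phi x T xT.
  rewrite phi0 ?sub0e -?EFinN; last by rewrite /= in_itv/= ltxx andbF.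
  move=> <- //; last first.
    split; first by move=> y _.
    - by apply: cvg_at_right_filter; exact: c0.
    - by apply: cvg_at_left_filter; exact: c0.
    by apply: continuous_subspaceT.
  have mphi D : measurable_fun D (fun x : measurableTypeR R => (derive1 phi x)%:E).
    by apply/measurable_EFinP; exact: continuous_measurableT.
  rewrite -(integral_itv_obnd_cbnd (mphi _)) -(integral_itv_bndo_bndc (mphi _)).
  rewrite [LHS]integral_mkcond [RHS]integral_mkcond; apply: eq_integral => t _.
  rewrite !patchE /cut !mem_setE !in_itv/=.
  have [xt|tx] := ltP x t; first by rewrite (lt_trans x0 xt)/= mul1r.
  by rewrite /= mul0r; case: ifP.
rewrite /Rintegral; move: Fub; rewrite F1 F2 => ->.
rewrite -[RHS]mulN1r -RintegralZl//; last first.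
  apply: (@ge0_le_integrable _ _ _ mu I mI _ (fun t => M2 * `|h t|)).
  - by apply: measurable_funM => //; exact: continuous_measurableT.
  - by move=> t It; rewrite normrM ler_wpM2r// M2P.
  - by apply: integrable_EFinZ => //; exact: integrable_norm.
by congr fine; apply: eq_integral => t _; rewrite mulN1r.
Qed.

End scalar_time.

(** * Continuity on the closed interval and Lebesgue differentiation *)

Section scalar_time2.
Context {R : realType}.
Variable T : R.
Hypothesis T0 : 0 < T.
Notation mu := (@lebesgue_measure R).
Notation I := (`]0, T[%classic : set (measurableTypeR R)).

Lemma eps_delta_within (g : R -> R) :
  (forall t, 0 <= t <= T -> forall e, 0 < e -> exists2 d, 0 < d &
     forall s, 0 <= s <= T -> `|s - t| < d -> `|g s - g t| < e) ->
  [/\ {in I, continuous g}, measurable_fun I (g : measurableTypeR R -> R)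
    & exists M, forall t, 0 <= t <= T -> `|g t| <= M].
Proof.
move=> gP; have cg : {in I, continuous g}.
  move=> t /set_mem /=; rewrite in_itv/= => /andP[t0 tT].
  apply/cvgrPdist_lt => e e0.
  have [|d d0 dP] := gP t _ e e0; first by rewrite !ltW.
  apply/nbhs_ballP; exists (Num.min d (Num.min t (T - t))) => /=.
    by rewrite !lt_min d0 t0 subr_gt0.
  move=> s; rewrite /ball/= !lt_min => /and3P[sd st sT].
  rewrite distrC; apply: dP; last by rewrite distrC.
  by move: st sT; rewrite !ltr_norml => /andP[? ?] /andP[? ?]; apply/andP; split; lra.
split=> //; first exact: (continuous_measurable (mI T)).
have cw : {within `[0, T], continuous g}.
  apply/subspace_continuousP => t; rewrite /= in_itv/= => t0T.
  apply/cvgrPdist_lt => e e0; have [d d0 dP] := gP t t0T e e0.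
  rewrite near_withinE; apply/nbhs_ballP; exists d => //= s; rewrite /ball/= => sd.
  by rewrite in_itv/= => s0T; rewrite distrC dP// distrC.
have /compact_bounded[M [_ MP]] : compact (g @` `[0, T]).
  by apply: continuous_compact => //; exact: segment_compact.
exists (M + 1) => t t0T; apply: (MP (M + 1)); first by rewrite ltrDl.
by exists t => //; rewrite /= in_itv.
Qed.

(** The distance is abstract because the lemma serves both curves in a seminormed space and scalar
    primitives. *)
Lemma holder_eps_delta (dist : R -> R -> R) (K : R) : 0 <= K ->
  (forall s t, dist s t = dist t s) ->
  (forall s t, 0 <= s -> s <= t -> t <= T -> dist t s <= Num.sqrt (t - s) * K) ->
  forall t, 0 <= t <= T -> forall e, 0 < e -> exists2 d, 0 < d &
     forall s, 0 <= s <= T -> `|s - t| < d -> dist s t < e.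
Proof.
move=> K0 distC dK t tT e e0; have K1 : 0 < K + 1 by rewrite ltr_wpDl.
exists ((e / (K + 1)) ^+ 2); first by rewrite exprn_gt0// divr_gt0.
have key a b : 0 <= a -> a <= b -> b <= T -> `|b - a| < (e / (K + 1)) ^+ 2 -> dist b a < e.
  move=> a0 ab bT abe; apply: le_lt_trans (dK a b a0 ab bT) _.
  apply: (@le_lt_trans _ _ (Num.sqrt (b - a) * (K + 1))).
    by rewrite ler_wpM2l ?sqrtr_ge0// lerDl.
  have q0 : 0 < e / (K + 1) by rewrite divr_gt0.
  rewrite -ltr_pdivlMr// -[ltRHS]gtr0_norm// -sqrtr_sqr ltr_sqrt ?exprn_gt0//.
  by move: abe; rewrite ger0_norm ?subr_ge0.
move=> s sT sd; have /andP[s0 sT'] := sT; have /andP[t0 tT'] := tT.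
have [st|/ltW ts] := leP s t; last exact: key.
by rewrite distC; apply: key => //; rewrite distrC.
Qed.

Lemma primitive_ae (h : R -> R) : mu.-integrable I (EFin \o h) ->
  {ae mu, forall t, I t ->
    is_derive t 1 (fun y : R => \int[mu]_(x in I) (cut y x * h x)) (h t)}.
Proof.
move=> ih; pose f := h \_ I.
have fi : mu.-integrable setT (EFin \o f).
  by rewrite -restrict_EFin; apply/(integrable_mkcond _ (mI T)).
have lf : locally_integrable setT f.
  by apply: open_integrable_locally => //; exact: openT.
have fiy (y : R) : mu.-integrable `]-oo, y] (EFin \o f).
  by apply: integrableS fi => //; exact: measurable_itv.
have fE : (fun y => \int[mu]_(t in `]-oo, y]) f t) =
    (fun y => \int[mu]_(x in I) (cut y x * h x)).
  apply/funext => y; rewrite -Rintegral_itv_bndo_bndc; last first.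
    by apply: integrableS fi => //; exact: measurable_itv.
  rewrite [LHS]Rintegral_mkcond [RHS]Rintegral_mkcond; apply: eq_Rintegral => x _.
  rewrite !patchE /cut mem_setE in_itv/=.
  by rewrite /f patchE; case: (x < y); case: ifP => _ //; rewrite ?mul1r ?mul0r.
apply: (ae_imp (mu := mu)) (FTC1Ny fiy lf) => t /=; rewrite fE => -[d1 d2] It.
apply: DeriveDef => //; rewrite -derive1E d2 /f patchE mem_set//.
Qed.

(** The primitive is constant on (0, T), while its derivative is [h] at almost every time. *)
Lemma cutB_eq0_ae (h : R -> R) : mu.-integrable I (EFin \o h) ->
  (forall s t, 0 < s < T -> 0 < t < T ->
    \int[mu]_(x in I) ((cut t x - cut s x) * h x) = 0) ->
  {ae mu, forall t, I t -> h t = 0}.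
Proof.
move=> ih h0; apply: (ae_imp (mu := mu)) (primitive_ae ih) => t dt It.
have [t0 tT] : 0 < t /\ t < T by apply/andP; move: It; rewrite /= in_itv.
have c0 : is_derive t 1 (cst (\int[mu]_(x in I) (cut t x * h x))) (0 : R).
  exact: is_derive_cst.
have dt' : is_derive t 1 (fun y : R => \int[mu]_(x in I) (cut y x * h x)) 0.
  apply: near_eq_is_derive c0.
  near=> y; have yI : 0 < y < T.
    apply/andP; split; near: y; [exact: lt_nbhsr|exact: lt_nbhsl].
  have tI : 0 < t < T by rewrite t0.
  by apply/eqP; rewrite /= -subr_eq0 -RintegralB_cut// h0.
by have [_ e1] := dt It; have [_ e2] := dt'; rewrite -e1 e2.
Unshelve. all: by end_near. Qed.

End scalar_time2.

(** * Absolutely continuous curves in a Hilbert space *)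

Section AC.
Context {R : realType} (X : fspace R) (B : X -> X -> R).
Hypothesis H : hilbert B.
Variable T : R.
Hypothesis T0 : 0 < T.
Notation mu := (@lebesgue_measure R).
Notation S := (hinner H).
Notation N := (snorm B).
Notation I := (`]0, T[%classic : set (measurableTypeR R)).
Implicit Types (u v c dc : R -> X).

Let mI : measurable I := mI T.
Let finI : (mu I < +oo)%E := finI T.
Hint Resolve mI finI : core.

Let I_le t : I t -> 0 <= t <= T.
Proof. by rewrite /= in_itv/= => /andP[? ?]; rewrite !ltW. Qed.

Lemma L2I_fnormE v (D : set (measurableTypeR R)) : strongly_measurable D v ->
  forall t, D t -> fnorm X (v t) = N (v t).
Proof. by move=> sv t Dt; rewrite (hnorm H)//; exact: sm_mem Dt. Qed.

Lemma L2I_memP v : fmem (L2I X T) v <-> sqsm B I v.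
Proof.
split=> [[sv voo]|[sv [_ voo]]]; split=> //.
  split; first exact: (sm_measurable_norm H).
  move: voo; congr (_ < _)%E; apply: eq_integral => t /set_mem It.
  by rewrite (L2I_fnormE sv).
move: voo; congr (_ < _)%E; apply: eq_integral => t /set_mem It.
by rewrite (L2I_fnormE sv).
Qed.

Lemma L2I_normE v : sqsm B I v -> fnorm (L2I X T) v = snorm (ipI B I) v.
Proof.
move=> [sv qv]; rewrite ipI_snorm//; congr Num.sqrt.
by apply: eq_Rintegral => t /set_mem It; rewrite (L2I_fnormE sv).
Qed.

Lemma snorm_dual y (K : R) : fmem X y -> B y y <= K * N y -> 0 <= K -> N y <= K.
Proof.
move=> my yK K0; have [->//|n0] := eqVneq (N y) 0.
have np : 0 < N y by rewrite lt_neqAle eq_sym n0 snorm_ge0.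
by rewrite -(ler_pM2r np) -expr2 (sqr_snorm S).
Qed.

Definition ccont c := (forall t, 0 <= t <= T -> fmem X (c t)) /\
  forall t, 0 <= t <= T -> forall e, 0 < e -> exists2 d, 0 < d &
    forall s, 0 <= s <= T -> `|s - t| < d -> N (c s - c t) < e.

Lemma ccont_ip c x : ccont c -> fmem X x ->
  forall t, 0 <= t <= T -> forall e, 0 < e -> exists2 d, 0 < d &
    forall s, 0 <= s <= T -> `|s - t| < d -> `|B (c s) x - B (c t) x| < e.
Proof.
move=> [mc cc] mx t tT e e0.
have e'0 : 0 < e / (N x + 1) by rewrite divr_gt0// ltr_wpDl// snorm_ge0.
have [d d0 dP] := cc t tT _ e'0; exists d => // s sT sd.
rewrite -(sipBl S)//; [|exact: mc..].
apply: le_lt_trans (cauchy_schwarz S _ mx) _; first by apply: (smemB S); exact: mc.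
apply: (@le_lt_trans _ _ (N (c s - c t) * (N x + 1))).
  by rewrite ler_wpM2l ?snorm_ge0// lerDl.
by rewrite -ltr_pdivlMr; [exact: dP|rewrite ltr_wpDl// snorm_ge0].
Qed.

Lemma ccont_norm c y : ccont c -> fmem X y ->
  forall t, 0 <= t <= T -> forall e, 0 < e -> exists2 d, 0 < d &
    forall s, 0 <= s <= T -> `|s - t| < d -> `|N (c s - y) - N (c t - y)| < e.
Proof.
move=> [mc cc] my t tT e e0; have [d d0 dP] := cc t tT e e0; exists d => // s sT sd.
apply: le_lt_trans (dP s sT sd); have mcs := mc s sT; have mct := mc t tT.
apply: le_trans (snorm_dist S _ _) _; do ?exact: (smemB S).
by rewrite opprB addrA subrK.
Qed.

(** By continuity the values at rational times come near to all values; codes that give no rational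
    in [0, T] are sent to 0. *)
Lemma ccont_sm c : ccont c -> strongly_measurable I c.
Proof.
move=> cc; have [mc ccc] := cc; apply: (pettis_sm H mI); split.
  by move=> t /I_le; exact: mc.
pose x j := if @unpickle rat j is Some q then
  (if 0 <= (ratr q : R) <= T then c (ratr q : R) else 0) else 0.
have mx j : fmem X (x j).
  rewrite /x; case: unpickle => [q|]; last exact: smem0 S.
  by case: ifP => [/mc//|_]; exact: smem0 S.
exists x; split=> //.
  by move=> j; have [] := eps_delta_within (ccont_norm cc (mx j)).
move=> t It e e0; have [d d0 dP] := ccc t (I_le It) e e0.
have /andP[t0 tT] : 0 < t < T by move: It; rewrite /= in_itv.
have : Num.max 0 (t - d) < t by rewrite gt_max t0 gtrBl.
move=> /rat_in_itvoo[q]; rewrite in_itv/= gt_max => /andP[/andP[q0 qd] qt].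
have qT : 0 <= (ratr q : R) <= T by rewrite ltW// (le_trans (ltW qt) (ltW tT)).
exists (pickle q); rewrite /x pickleK qT (snormBC S); [|exact: mc (I_le It)|exact: mc].
by apply: dP => //; rewrite ltr_norml; apply/andP; split; lra.
Qed.

Lemma ccont_bounded c : ccont c -> exists M, forall t, 0 <= t <= T -> N (c t) <= M.
Proof.
move=> cc; have [_ _ [M MP]] := eps_delta_within (ccont_norm cc (smem0 S)).
by exists M => t /MP; rewrite subr0 ger0_norm// snorm_ge0.
Qed.

Lemma ccont_sqsm c : ccont c -> sqsm B I c.
Proof.
move=> cc; split; first exact: ccont_sm.
have [M MP] := ccont_bounded cc.
apply: (sqint_le mI _ _ (sqint_cst mI finI M)).
  by apply: (sm_measurable_norm H); exact: ccont_sm.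
move=> t /I_le /MP tM; rewrite ger0_norm ?snorm_ge0//.
exact: le_trans (ler_norm _).
Qed.

(** [c] is the primitive of [dc] that starts at 0, stated against each fixed vector so that only
    scalar integrals occur. The equation [c 0 = 0] is one of representatives, in the form that
    [H1star] requires of the trace; the integral identity would only give norm 0. *)
Definition AC c dc := [/\ forall t, 0 <= t <= T -> fmem X (c t), c 0 = 0,
  sqsm B I dc & forall t x, 0 <= t <= T -> fmem X x ->
    B (c t) x = \int[mu]_(r in I) (cut t r * B (dc r) x)].

Lemma sqsm_ip_integrable dc x : sqsm B I dc -> fmem X x ->
  mu.-integrable I (EFin \o (fun r => B (dc r) x)).
Proof.
move=> qd mx; apply: (ip_integrable H mI qd.1 mx).
exact: (sqsm_norm_integrable mI finI).
Qed.

(** Test the increment against itself and cancel one factor of its norm. *)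
Lemma AC_le c dc s t : AC c dc -> 0 <= s -> s <= t -> t <= T ->
  N (c t - c s) <= \int[mu]_(r in I) ((cut t r - cut s r) * N (dc r)).
Proof.
move=> [mc c0 qd cE] s0 st tT.
have tT' : 0 <= t <= T by rewrite (le_trans s0 st).
have sT' : 0 <= s <= T by rewrite s0 (le_trans st tT).
have mx : fmem X (c t - c s) by apply: (smemB S); exact: mc.
have cu r : 0 <= cut t r - cut s r :> R by rewrite cutBE.
have iN := sqsm_norm_integrable mI finI qd.
apply: snorm_dual => //; last first.
  by apply: Rintegral_ge0 => r _; rewrite mulr_ge0// snorm_ge0.
rewrite {1}(sipBl S)//; [|exact: mc..].
rewrite !cE// -RintegralB_cut; last exact: sqsm_ip_integrable.
rewrite -RintegralZr//; last exact: cutB_integrable.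
apply: le_Rintegral => //.
- by apply: cutB_integrable; exact: sqsm_ip_integrable.
- rewrite (_ : (fun r => _) = (fun r => N (c t - c s) * ((cut t r - cut s r) * N (dc r)))).
    by apply: integrable_EFinZ => //; exact: cutB_integrable.
  by apply/funext => r; rewrite mulrC.
move=> r Ir; rewrite -mulrA ler_wpM2l//.
apply: le_trans (ler_norm _) _; apply: (cauchy_schwarz S) => //.
exact: sm_mem qd.1 Ir.
Qed.

Lemma cutB_norm_le dc s t : sqsm B I dc -> 0 <= s -> s <= t -> t <= T ->
  \int[mu]_(r in I) ((cut t r - cut s r) * N (dc r)) <=
  Num.sqrt (t - s) * snorm (ipI B I) dc.
Proof.
move=> qd s0 st tT; have iN := sqsm_norm_integrable mI finI qd.
have qc : sqint mu I (fun r => cut t r - cut s r).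
  apply: (sqint_le mI _ _ (sqint_cst mI finI 1)).
    by apply: measurable_funB; exact: cut_measurable.
  by move=> r _; rewrite normr1; exact: cutB_le1.
apply: (@le_trans _ _ (snorm (sqint_ip mu I) (fun r => cut t r - cut s r) *
    snorm (sqint_ip mu I) (fun r => N (dc r)))).
  apply: le_trans (sqint_CS mI qc qd.2).
  apply: le_Rintegral => //; first exact: cutB_integrable.
    by apply: integrable_norm; exact: cutB_integrable.
  by move=> r _; exact: ler_norm.
rewrite -(ipI_snorm H qd) ler_wpM2r ?snorm_ge0// ler_wsqrtr//.
exact: Rintegral_cutB_sqr.
Qed.

Lemma AC_holder c dc s t : AC c dc -> 0 <= s -> s <= t -> t <= T ->
  N (c t - c s) <= Num.sqrt (t - s) * snorm (ipI B I) dc.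
Proof.
move=> ac s0 st tT; apply: le_trans (AC_le ac s0 st tT) _.
by have [_ _ qd _] := ac; exact: cutB_norm_le.
Qed.

Lemma AC_bound c dc t : AC c dc -> 0 <= t <= T ->
  N (c t) <= Num.sqrt T * snorm (ipI B I) dc.
Proof.
move=> ac /andP[t0 tT]; have [_ c0 _ _] := ac.
have := AC_holder ac (lexx 0) t0 tT; rewrite c0 !subr0 => /le_trans; apply.
by rewrite ler_wpM2r ?snorm_ge0// ler_wsqrtr.
Qed.

Lemma AC_ccont c dc : AC c dc -> ccont c.
Proof.
move=> ac; have [mc _ _ _] := ac; split=> // t tT e e0.
(* The distance is extended by 0, because it must be symmetric for all reals while [c] has its
   values in the space only on [0, T]. *)
pose dist s t := if (0 <= s <= T) && (0 <= t <= T) then N (c s - c t) else 0.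
have [u v|u v u0 uv vT|d d0 dP] := @holder_eps_delta _ T dist _ (snorm_ge0 (ipI B I) dc) _ _ t tT e e0.
- by rewrite /dist andbC; case: ifP => // /andP[/mc ? /mc ?]; rewrite (snormBC S).
- rewrite /dist; case: ifP => _; last by rewrite mulr_ge0 ?sqrtr_ge0 ?snorm_ge0.
  exact: AC_holder.
by exists d => // s sT sd; have := dP s sT sd; rewrite /dist sT tT.
Qed.

Lemma test_funI_bounded phi : test_funI T phi -> [/\ measurable_fun I (phi : measurableTypeR R -> R),
  measurable_fun I (derive1 phi : measurableTypeR R -> R) &
  exists M, forall t, I t -> `|phi t| <= M /\ `|derive1 phi t| <= M].
Proof.
move=> [sphi _].
have cont (f : R -> R) : (forall x, derivable f x 1) -> continuous f.
  by move=> df x; apply: differentiable_continuous; apply/derivable1_diffP.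
have c0 : continuous phi by apply: cont; exact: (sphi 0%N).
have c1 : continuous (derive1 phi) by apply: cont; exact: (sphi 1%N).
split; [exact: continuous_measurableT|exact: continuous_measurableT|].
have bnd (f : R -> R) : continuous f -> exists M, forall x, I x -> `|f x| <= M.
  move=> cf; have /compact_bounded[M [_ MP]] : compact (f @` `[0, T]).
    by apply: continuous_compact; [exact: continuous_subspaceT|exact: segment_compact].
  exists (M + 1) => x Ix; apply: (MP (M + 1)); first by rewrite ltrDl.
  by exists x => //; move: Ix; exact: subset_itv_oo_cc.
have [M1 M1P] := bnd _ c0; have [M2 M2P] := bnd _ c1.
exists (Num.max M1 M2) => t It; rewrite !le_max M1P// M2P// orbT.
by [].
Qed.

Lemma scale_sqsm (psi : R -> R) (M : R) v : sqsm B I v ->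
  measurable_fun I (psi : measurableTypeR R -> R) ->
  (forall t, I t -> `|psi t| <= M) -> sqsm B I (fun t => psi t *: v t).
Proof.
move=> [sv qv] mpsi psiM; have sp := sm_scale H mI sv mpsi; split=> //.
apply: (sqint_le mI _ _ (sqintZ mI M qv)); first exact: (sm_measurable_norm H).
move=> t It; rewrite (snormZ S); last exact: sm_mem It.
rewrite !normrM normr_id ler_wpM2r//.
by apply: le_trans (psiM t It) _; exact: ler_norm.
Qed.

(** Both Bochner integrals exist for square-integrable functions and are determined by their inner
    products, so the weak derivative can be handled one scalar function at a time. *)
Lemma weak_derivI_ip v dv : sqsm B I v -> is_weak_derivI T v dv <-> sqsm B I dv /\
  forall phi x, test_funI T phi -> fmem X x ->
    \int[mu]_(t in I) (derive1 phi t * B (v t) x) = - \int[mu]_(t in I) (phi t * B (dv t) x).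
Proof.
move=> qv; have Zip (psi : R -> R) u x : strongly_measurable I u -> fmem X x ->
    \int[mu]_(t in I) B (psi t *: u t) x = \int[mu]_(t in I) (psi t * B (u t) x).
  move=> su mx; apply: eq_Rintegral => t /set_mem It.
  by rewrite (sipZl S)//; exact: sm_mem It.
split=> [[/L2I_memP qdv dvP]|[qdv dvP]].
  split=> // phi x tphi mx; have [m0 m1 [M MP]] := test_funI_bounded tphi.
  have q1 := scale_sqsm qv m1 (fun t It => (MP t It).2).
  have q0 := scale_sqsm qdv m0 (fun t It => (MP t It).1).
  have [y [y1 y2]] := dvP phi tphi.
  move/(is_bochner_intP H mI finI _ (sqsm_norm_integrable mI finI q1)): y1 => [_ my yE].
  move/(is_bochner_intP H mI finI _ (sqsm_norm_integrable mI finI q0)): y2 => [_ _ y'E].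
  rewrite -(Zip _ _ _ qv.1 mx) -(Zip _ _ _ qdv.1 mx).
  by rewrite -yE// -y'E// (sipNl S)// opprK.
split; first exact/L2I_memP.
move=> phi tphi; have [m0 m1 [M MP]] := test_funI_bounded tphi.
have q1 := scale_sqsm qv m1 (fun t It => (MP t It).2).
have q0 := scale_sqsm qdv m0 (fun t It => (MP t It).1).
have [y my yE] := bochner_exists H mI finI q1.1 (sqsm_norm_integrable mI finI q1).
exists y; split.
  apply/(is_bochner_intP H mI finI _ (sqsm_norm_integrable mI finI q1)).
  by split=> //; exact: q1.1.
apply/(is_bochner_intP H mI finI _ (sqsm_norm_integrable mI finI q0)); split.
- exact: q0.1.
- exact: (smemN S).
move=> x mx; rewrite (sipNl S)// yE// (Zip _ _ _ qv.1 mx) (Zip _ _ _ qdv.1 mx).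
by rewrite dvP// opprK.
Qed.

Lemma AC_weak c dc : AC c dc -> is_weak_derivI T c dc.
Proof.
move=> ac; have [mc c0 qd cE] := ac; have cc := AC_ccont ac.
apply/weak_derivI_ip; first exact: ccont_sqsm.
split=> // phi x tphi mx.
rewrite -Rintegral_derive_primitive//; last exact: sqsm_ip_integrable.
by apply: eq_Rintegral => t /set_mem It; rewrite cE//; exact: I_le.
Qed.

(** The exceptional null set depends on [x]; a sequence that comes near to the values of [v] yields
    a common one. *)
Lemma sm_eq0_ae v : strongly_measurable I v ->
  (forall x, fmem X x -> {ae mu, forall t, I t -> B (v t) x = 0}) ->
  {ae mu, forall t, I t -> N (v t) = 0}.
Proof.
move=> sv v0; have [mv [x [mx _ xd]]] := sm_pettis H sv.
apply: (ae_imp (mu := mu)) (ae_forall (fun j => v0 _ (mx j))) => t vt It.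
have mvt := mv t It; apply/eqP; rewrite eq_le snorm_ge0 andbT.
apply/ler_addgt0Pl => e e0; rewrite addr0; have [j je] := xd t It e e0.
apply: snorm_dual => //; last exact: ltW.
rewrite -[leLHS]subr0 -(vt j It) -(sipBr S)//.
apply: le_trans (ler_norm _) _; apply: le_trans (cauchy_schwarz S _ _) _ => //.
  exact: (smemB S).
by rewrite mulrC ler_wpM2r ?snorm_ge0// ltW.
Qed.

(** Needed because [weak_derivI] is an arbitrary choice. The difference is a weak derivative of the
    zero function, so by [weak_FTC] its integrals over all intervals vanish. *)
Lemma weak_derivI_unique v d1 d2 : sqsm B I v -> is_weak_derivI T v d1 ->
  is_weak_derivI T v d2 -> {ae mu, forall t, I t -> N (d1 t - d2 t) = 0}.
Proof.
move=> qv /(weak_derivI_ip _ qv)[q1 d1P] /(weak_derivI_ip _ qv)[q2 d2P].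
apply: (@sm_eq0_ae (fun t => d1 t - d2 t)); first exact: (smB H q1.1 q2.1).
move=> x mx.
have i1 := sqsm_ip_integrable q1 mx; have i2 := sqsm_ip_integrable q2 mx.
have i12 : mu.-integrable I (EFin \o (fun t => B (d1 t - d2 t) x)).
  have := integrable_EFinB mI i1 i2; apply: eq_integrable => // t /set_mem It /=.
  by rewrite (sipBl S)//; [exact: sm_mem q1.1 It|exact: sm_mem q2.1 It].
apply: (cutB_eq0_ae i12) => s t sT tT.
rewrite -(@weak_FTC _ _ (fun _ => 0) _ _ i12 _ _ s t)// ?subrr//.
- by move=> r _; exact: cvg_cst.
- by exists 0 => r _; rewrite normr0.
move=> phi tphi; have [m0 m1 [M MP]] := test_funI_bounded tphi.
rewrite Rintegral_eq0; last by move=> r _; rewrite mulr0.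
have ip1 := @bounded_integrableM _ _ _ _ M m0 (fun r Ir => (MP r Ir).1) i1.
have ip2 := @bounded_integrableM _ _ _ _ M m0 (fun r Ir => (MP r Ir).1) i2.
have -> : \int[mu]_(r in I) (phi r * B (d1 r - d2 r) x) =
    \int[mu]_(r in I) (phi r * B (d1 r) x) - \int[mu]_(r in I) (phi r * B (d2 r) x).
  rewrite -RintegralB//; apply: eq_Rintegral => r /set_mem Ir.
  by rewrite -mulrBr (sipBl S)//; [exact: sm_mem q1.1 Ir|exact: sm_mem q2.1 Ir].
have := d1P phi x tphi mx; rewrite d2P// => /eqP; rewrite eqr_opp => /eqP ->.
by rewrite subrr oppr0.
Qed.

Lemma weak_derivI_val v dv : is_weak_derivI T v dv -> is_weak_derivI T v (weak_derivI T v).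
Proof. by move=> h; apply: (@xgetPex _ 0 [set dv | is_weak_derivI T v dv]); exists dv. Qed.

Lemma is_traceP v t0 x : 0 <= t0 <= T -> is_trace T v t0 x <-> exists c, [/\ ccont c,
  {ae mu, forall t, I t -> fnorm X (c t - v t) = 0} & c t0 = x].
Proof.
move=> t0T; split=> -[c].
  move=> [mc cc aecv ct0]; exists c; split=> //.
  split=> [t tT|t tT e e0]; first by apply: mc; rewrite in_itv.
  have tT' : t \in `[0, T] by rewrite in_itv.
  have /cvgr0Pnorm_lt/(_ e e0) := cc t tT'.
  rewrite near_withinE => /nbhs_ballP[d /= d0 dP]; exists d => // s sT sd.
  have := dP s; rewrite /ball/= distrC => /(_ sd); rewrite in_itv/= => /(_ sT).
  have ms : fmem X (c s) by apply: mc; rewrite in_itv.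
  have mt := mc _ tT'; rewrite (hnorm H); last exact: (smemB S).
  by rewrite ger0_norm// snorm_ge0.
move=> [[mc cc] aecv ct0]; exists c; split=> //.
move=> t; rewrite in_itv/= => tT; apply/cvgr0Pnorm_lt => e e0.
  have [d d0 dP] := cc t tT e e0.
  rewrite near_withinE; apply/nbhs_ballP; exists d => //= s; rewrite /ball/= => sd.
  rewrite in_itv/= => sT; rewrite (hnorm H); last by apply: (smemB S); exact: mc.
by rewrite ger0_norm ?snorm_ge0//; apply: dP => //; rewrite distrC.
Qed.

(** A null set contains no interval of positive length. With this, properties valid almost
    everywhere extend to all times by continuity. *)
Lemma ae_dense (P : R -> Prop) : {ae mu, forall t, I t -> P t} ->
  forall t d, 0 <= t <= T -> 0 < d -> exists s, [/\ I s, P s & `|s - t| < d].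
Proof.
move=> [Z [mZ Z0 ZP]] t d /andP[t0 tT] d0; apply: contrapT => h.
pose a := Num.max 0 (t - d); pose b := Num.min T (t + d).
have ab : a < b by rewrite /a /b lt_min !gt_max T0 /=; lra.
have sub : `]a, b[%classic `<=` Z.
  move=> s /=; rewrite in_itv/= gt_max lt_min => /andP[/andP[s0 sd] /andP[sT sd']].
  apply: ZP => /= Ps; apply: h; exists s; split.
  - by rewrite /= in_itv/= s0.
  - by apply: Ps; rewrite in_itv/= s0.
  - by rewrite ltr_norml; apply/andP; split; lra.
have : (mu `]a, b[%classic <= mu Z)%E.
  by apply: le_measure; rewrite ?inE//; exact: measurable_itv.
by rewrite Z0 /= lebesgue_measure_itv/= lte_fin ab -EFinB lee_fin subr_le0 leNgt ab.
Qed.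

Lemma ccont_ae_eq c1 c2 : ccont c1 -> ccont c2 ->
  {ae mu, forall t, I t -> N (c1 t - c2 t) = 0} ->
  forall t, 0 <= t <= T -> N (c1 t - c2 t) = 0.
Proof.
move=> [m1 cc1] [m2 cc2] ae12 t tT.
apply/eqP; rewrite eq_le snorm_ge0 andbT; apply/ler_addgt0Pl => e e0; rewrite addr0.
have e20 : 0 < e / 2 by rewrite divr_gt0.
have [d1 d10 dP1] := cc1 t tT _ e20; have [d2 d20 dP2] := cc2 t tT _ e20.
have d0 : 0 < Num.min d1 d2 by rewrite lt_min d10.
have [s [Is s12]] := ae_dense ae12 tT d0; rewrite lt_min => /andP[sd1 sd2].
have sT := I_le Is; have h1 := dP1 s sT sd1; have h2 := dP2 s sT sd2.
apply: le_trans (snorm_trans S (m1 t tT) (m1 s sT) (m2 t tT)) _.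
have := snorm_trans S (m1 s sT) (m2 s sT) (m2 t tT); rewrite s12 add0r.
by rewrite (snormBC S (m1 t tT) (m1 s sT)); lra.
Qed.

Lemma fnorm_ae v w : strongly_measurable I v -> strongly_measurable I w ->
  {ae mu, forall t, I t -> fnorm X (v t - w t) = 0} <->
  {ae mu, forall t, I t -> N (v t - w t) = 0}.
Proof.
move=> sv sw; have e t : I t -> fnorm X (v t - w t) = N (v t - w t).
  by move=> It; rewrite (hnorm H)//; apply: (smemB S); [exact: sm_mem sv It|exact: sm_mem sw It].
by split; apply: (ae_imp (mu := mu)) => t vw It; have := vw It; rewrite e.
Qed.

Lemma trace_unique v t x y : strongly_measurable I v -> 0 <= t <= T ->
  is_trace T v t x -> is_trace T v t y -> [/\ fmem X x, fmem X y & N (x - y) = 0].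
Proof.
move=> sv tT /(is_traceP _ _ tT)[c1 [cc1 ae1 <-]] /(is_traceP _ _ tT)[c2 [cc2 ae2 <-]].
have sc1 := ccont_sm cc1; have sc2 := ccont_sm cc2.
split; [exact: cc1.1|exact: cc2.1|].
apply: ccont_ae_eq => //.
move/(fnorm_ae sc1 sv): ae1 => ae1; move/(fnorm_ae sc2 sv): ae2 => ae2.
apply: (ae_imp (mu := mu)) (ae_and ae1 ae2) => s [h1 h2] Is.
have m1 := sm_mem sc1 Is; have m2 := sm_mem sc2 Is; have mv := sm_mem sv Is.
apply/eqP; rewrite eq_le snorm_ge0 andbT.
by apply: le_trans (snorm_trans S m1 mv m2) _; rewrite h1// (snormBC S mv m2) h2// addr0.
Qed.

(** The continuous representative behind the trace is the primitive of the weak derivative. From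
    here on, elements of [H1star] are treated as pairs of a curve and its derivative. *)
Lemma H1star_AC v : H1star T v -> exists c, [/\ AC c (weak_derivI T v),
  is_weak_derivI T v (weak_derivI T v),
  {ae mu, forall t, I t -> N (c t - v t) = 0}
  & forall t, 0 <= t <= T -> is_trace T v t (c t)].
Proof.
move=> [[/L2I_memP qv [dv0 /weak_derivI_val wdv]] tr0].
have T0T : 0 <= (0:R) <= T by rewrite lexx ltW.
move/(is_traceP _ _ T0T): tr0 => [c [cc aecv c0]].
exists c; split=> //; last first.
- by move=> t tT; apply/(is_traceP _ _ tT); exists c.
- by apply/(fnorm_ae (ccont_sm cc) qv.1).
have [mc ccc] := cc.
move/(fnorm_ae (ccont_sm cc) qv.1): aecv => aecv.
have /(weak_derivI_ip _ qv)[qd dP] := wdv; set dv := weak_derivI T v in qd dP *.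
split=> // t x tT mx.
have ix := sqsm_ip_integrable qd mx.
have [cf mf [M MP]] := eps_delta_within (ccont_ip cc mx).
have key s t' : 0 < s < T -> 0 < t' < T -> B (c t') x - B (c s) x =
    \int[mu]_(r in I) ((cut t' r - cut s r) * B (dv r) x).
  move=> sT t'T; apply: (@weak_FTC _ T (fun r => B (c r) x)) => //.
    by exists M => r /I_le; exact: MP.
  move=> phi tphi; rewrite -dP//; have [m0 m1 [M' MP']] := test_funI_bounded tphi.
  congr fine; apply: ae_eq_integral => //.
  - apply/measurable_EFinP; apply: measurable_funM => //.
  - apply/measurable_EFinP; apply: measurable_funM => //.
    by apply: (sm_ip H qv.1); exact: (sm_cst H).
  apply: (ae_imp (mu := mu)) aecv => r cv Ir; congr (_ * _)%:E.
  have mvr := sm_mem qv.1 Ir; have mcr := mc r (I_le Ir).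
  apply/eqP; rewrite -subr_eq0 -(sipBl S)// -normr_le0.
  by apply: le_trans (cauchy_schwarz S (smemB S mcr mvr) mx) _; rewrite cv// mul0r.
(* [G] is constant on (0, T) by [weak_FTC], continuous on [0, T], and 0 at time 0. *)
pose G t := B (c t) x - \int[mu]_(r in I) (cut t r * B (dv r) x).
have Gcst s t' : I s -> I t' -> G s = G t'.
  rewrite /= !in_itv/= => sT t'T; have := key s t' sT t'T.
  rewrite RintegralB_cut// => E.
  by rewrite /G -[B (c t') x](subrK (B (c s) x)) E; ring.
have bnd (s t' : R) : 0 <= s -> s <= t' -> t' <= T ->
    `|\int[mu]_(r in I) (cut t' r * B (dv r) x) - \int[mu]_(r in I) (cut s r * B (dv r) x)| <=
    Num.sqrt (t' - s) * (snorm (ipI B I) dv * N x).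
  move=> s0 st tT'; have iN := sqsm_norm_integrable mI finI qd.
  have cu r : 0 <= cut t' r - cut s r :> R by rewrite cutBE.
  rewrite -RintegralB_cut//.
  apply: (@le_trans _ _ (\int[mu]_(r in I) ((cut t' r - cut s r) * N (dv r)) * N x)).
    apply: le_trans (le_normr_Rintegral mI (cutB_integrable _ _ ix)) _.
    rewrite -RintegralZr//; last exact: cutB_integrable.
    apply: le_Rintegral => //.
    - exact: integrable_norm (cutB_integrable _ _ ix).
    - rewrite (_ : (fun r => _) = (fun r => N x * ((cut t' r - cut s r) * N (dv r)))).
        by apply: integrable_EFinZ => //; exact: cutB_integrable.
      by apply/funext => r; rewrite mulrC.
    move=> r Ir; rewrite normrM (ger0_norm (cu r)) -mulrA ler_wpM2l//.
    by apply: (cauchy_schwarz S) => //; exact: sm_mem qd.1 Ir.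
  by rewrite mulrA ler_wpM2r ?snorm_ge0//; exact: cutB_norm_le.
have Gcont r : 0 <= r <= T -> forall e, 0 < e -> exists2 d, 0 < d &
    forall s, 0 <= s <= T -> `|s - r| < d -> `|G s - G r| < e.
  move=> rT e e0; have e20 : 0 < e / 2 by rewrite divr_gt0.
  have [d1 d10 dP1] := ccont_ip cc mx rT e20.
  have K0 : 0 <= snorm (ipI B I) dv * N x by rewrite mulr_ge0 ?snorm_ge0.
  have [|d2 d20 dP2] := @holder_eps_delta _ T (fun s t => `|\int[mu]_(r in I) (cut s r * B (dv r) x) -
    \int[mu]_(r in I) (cut t r * B (dv r) x)|) _ K0 _ bnd r rT _ e20.
    by move=> ? ?; rewrite distrC.
  exists (Num.min d1 d2); first by rewrite lt_min d10.
  move=> s sT; rewrite lt_min => /andP[sd1 sd2].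
  have := dP1 s sT sd1; have := dP2 s sT sd2.
  by rewrite /G !ltr_norml => /andP[? ?] /andP[? ?]; apply/andP; split; lra.
have G0 : G 0 = 0.
  rewrite /G c0 (sip0l S)// Rintegral_eq0 ?subrr// => r Ir.
  by rewrite (@cut0 _ T r Ir) mul0r.
suff : G t = 0 by rewrite /G => /eqP; rewrite subr_eq0 => /eqP.
apply/eqP; rewrite -normr_le0; apply/ler_addgt0Pl => e e0; rewrite addr0.
have e20 : 0 < e / 2 by rewrite divr_gt0.
have [d1 d10 dP1] := Gcont _ T0T _ e20; have [d2 d20 dP2] := Gcont _ tT _ e20.
have aeT : {ae mu, forall t, I t -> True} by apply: aeW.
have [s [Is _ sd]] := ae_dense aeT T0T d10.
have [s' [Is' _ sd']] := ae_dense aeT tT d20.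
have := dP1 s (I_le Is) sd; have := dP2 s' (I_le Is') sd'; rewrite G0 (Gcst _ _ Is Is').
by rewrite !ltr_norml ler_norml => /andP[? ?] /andP[? ?]; apply/andP; split; lra.
Qed.

Lemma AC_H1star c dc : AC c dc -> H1star T c /\
  forall t, 0 <= t <= T -> is_trace T c t (c t).
Proof.
move=> ac; have cc := AC_ccont ac; have [_ c0 _ _] := ac.
have tr t : 0 <= t <= T -> is_trace T c t (c t).
  move=> tT; apply/(is_traceP _ _ tT); exists c; split=> //.
  apply/(fnorm_ae (ccont_sm cc) (ccont_sm cc)).
  by apply: aeW => r _; rewrite subrr (snorm0 S).
split=> //; split; first split.
- by apply/L2I_memP; exact: ccont_sqsm.
- by exists dc; exact: AC_weak.
- by have := tr 0; rewrite c0; apply; rewrite lexx ltW.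
Qed.

Lemma AC_weak_derivI c dc : AC c dc ->
  {ae mu, forall t, I t -> fmem X (weak_derivI T c t) /\ N (weak_derivI T c t - dc t) = 0}.
Proof.
move=> ac; have qc := ccont_sqsm (AC_ccont ac); have wc := AC_weak ac.
have wv := weak_derivI_val wc; have [qv _] := (weak_derivI_ip _ qc).1 wv.
apply: (ae_imp (mu := mu)) (weak_derivI_unique qc wv wc) => t vt It.
by split; [exact: sm_mem qv.1 It|exact: vt].
Qed.

End AC.

(** * Norms, linear operations and existence of primitives *)

Section AC_more.
Context {R : realType} (X : fspace R) (B : X -> X -> R).
Hypothesis H : hilbert B.
Variable T : R.
Hypothesis T0 : 0 < T.
Notation mu := (@lebesgue_measure R).
Notation S := (hinner H).
Notation N := (snorm B).
Notation I := (`]0, T[%classic : set (measurableTypeR R)).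
Implicit Types (u v c dc : R -> X).

Let mI : measurable I := mI T.
Let finI : (mu I < +oo)%E := finI T.
Hint Resolve mI finI : core.

Let I_le t : I t -> 0 <= t <= T.
Proof. by rewrite /= in_itv/= => /andP[? ?]; rewrite !ltW. Qed.

Notation AC := (AC B T).

Lemma sqsm_ae0 u : sqsm B I u -> {ae mu, forall t, I t -> N (u t) = 0} ->
  snorm (ipI B I) u = 0.
Proof.
move=> qu u0; rewrite (ipI_snorm H)// /snorm /sqint_ip /Rintegral.
rewrite (_ : (\int[mu]_(t in I) _ = 0)%E) ?sqrtr0//.
rewrite -(@integral0_eq _ _ _ mu I (fun _ => 0%E))//; apply: ae_eq_integral => //.
  apply/measurable_EFinP; apply: measurable_funM; exact: (sm_measurable_norm H qu.1).
by apply: (ae_imp (mu := mu)) u0 => t ut It; rewrite -/(snorm B _) ut// mul0r.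
Qed.

Lemma sqsm_ae_eq u v : sqsm B I u -> sqsm B I v ->
  {ae mu, forall t, I t -> N (u t - v t) = 0} -> snorm (ipI B I) u = snorm (ipI B I) v.
Proof.
move=> qu qv uv; have SI := sqsm_semi_inner H mI.
have /sqsm_ae0/(_ uv) uv0 := smemB SI qu qv.
have := snorm_dist SI qu qv; rewrite uv0 normr_le0 subr_eq0 => /eqP.
exact.
Qed.

Lemma AC_H1I_norm c dc : AC c dc -> fnorm (H1I X T) c ^+ 2 =
  ipI B I c c + ipI B I dc dc.
Proof.
move=> ac; have qc := ccont_sqsm H (AC_ccont H ac); have wc := AC_weak H ac.
have wv := weak_derivI_val wc; have [qv _] := (weak_derivI_ip H _ qc).1 wv.
have [_ _ qd _] := ac; have SI := sqsm_semi_inner H mI.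
rewrite (_ : fnorm (H1I X T) c = Num.sqrt (fnorm (L2I X T) c ^+ 2 +
    fnorm (L2I X T) (weak_derivI T c) ^+ 2))//.
rewrite !(L2I_normE H)// sqr_sqrtr; last by rewrite addr_ge0// sqr_ge0.
rewrite (sqr_snorm SI)//; congr (_ + _).
rewrite (sqsm_ae_eq qv qd) ?(sqr_snorm SI)//.
exact: (weak_derivI_unique H qc wv wc).
Qed.


Lemma AC_cvx (c dc : nat -> R -> X) (M : nat) (l : nat -> R) :
  (forall k, AC (c k) (dc k)) -> AC (cvx M l c) (cvx M l dc).
Proof.
move=> ac; have SI := sqsm_semi_inner H mI.
have qd k : sqsm B I (dc k) by have [] := ac k.
have cvxE (u : nat -> R -> X) t : cvx M l u t = cvx M l (fun k => u k t).
  by rewrite /cvx; elim/big_ind2 : _ => // ? ? ? ? <- <-.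
split.
- move=> t tT; rewrite cvxE; apply: (smem_sum S) => k; apply: (smemZ S).
  by have [mc _ _ _] := ac k; exact: mc.
- rewrite cvxE /cvx big1// => k _; have [_ -> _ _] := ac k.
  by rewrite scaler0.
- exact: (cvx_mem SI).
move=> t x tT mx; rewrite cvxE (sip_suml S)//; last first.
  by move=> k; apply: (smemZ S); have [mc _ _ _] := ac k; exact: mc.
have sumI (r : seq 'I_M) : mu.-integrable I (EFin \o (fun s =>
      \sum_(k <- r) cut t s * B (l k *: dc k s) x)) /\
    \sum_(k <- r) B (l k *: c k t) x = \int[mu]_(s in I) \sum_(k <- r) cut t s * B (l k *: dc k s) x.
  have i1 k : mu.-integrable I (EFin \o (fun s => cut t s * B (l k *: dc k s) x)).
    apply: cut_integrable; exact: (sqsm_ip_integrable H (smemZ SI (l k) (qd k)) mx).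
  elim: r => [|k r [IHi IH]].
    rewrite big_nil; split; last by rewrite Rintegral_eq0// => s _; rewrite big_nil.
    rewrite (_ : (fun s => _) = cst 0); first exact: integrable_cst.
    by apply/funext => s; rewrite big_nil.
  split.
    rewrite (_ : (fun s => _) = (fun s => cut t s * B (l k *: dc k s) x +
      \sum_(k <- r) cut t s * B (l k *: dc k s) x)); first exact: integrable_EFinD.
    by apply/funext => s; rewrite big_cons.
  under eq_Rintegral do rewrite big_cons.
  rewrite RintegralD// big_cons IH; congr (_ + _).
  have [mc _ _ cE] := ac k; have mct := mc t tT.
  rewrite (sipZl S)// cE//.
  rewrite -RintegralZl//; last by apply: cut_integrable; exact: (sqsm_ip_integrable H).
  apply: eq_Rintegral => s /set_mem Is; rewrite (sipZl S)//; last exact: sm_mem (qd k).1 Is.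
  by ring.
rewrite (sumI _).2; apply: eq_Rintegral => s /set_mem Is; rewrite cvxE (sip_suml S)//.
  by rewrite mulr_sumr.
by move=> k; apply: (smemZ S); exact: sm_mem (qd k).1 Is.
Qed.

Lemma AC_sub c1 d1 c2 d2 : AC c1 d1 -> AC c2 d2 ->
  AC (fun t => c1 t - c2 t) (fun t => d1 t - d2 t).
Proof.
move=> [m1 z1 q1 E1] [m2 z2 q2 E2]; have SI := sqsm_semi_inner H mI.
split.
- by move=> t tT; apply: (smemB S); [exact: m1|exact: m2].
- by rewrite z1 z2 subrr.
- exact: (smemB SI).
move=> t x tT mx; have m1t := m1 t tT; have m2t := m2 t tT.
rewrite (sipBl S)// E1// E2//.
rewrite -RintegralB//; [|by apply: cut_integrable; exact: (sqsm_ip_integrable H)..].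
apply: eq_Rintegral => s /set_mem Is.
by rewrite (sipBl S)// ?mulrBr//; [exact: sm_mem q1.1 Is|exact: sm_mem q2.1 Is].
Qed.

Lemma AC_primitive dc : sqsm B I dc -> exists c, AC c dc.
Proof.
move=> qd.
have cutP t : measurable_fun I (cut t : measurableTypeR R -> R) by exact: cut_measurable.
have ex t : exists y, fmem X y /\ (t = 0 -> y = 0) /\
    forall x, fmem X x -> B y x = \int[mu]_(r in I) (cut t r * B (dc r) x).
  (* A Bochner integral is determined only up to norm 0; at time 0 the vector 0 itself is chosen, as
     [AC] demands. *)
  have [->|t0] := eqVneq t 0.
    exists 0; split; [exact: smem0 S|split=> // x mx].
    by rewrite (sip0l S)// Rintegral_eq0// => r Ir; rewrite (@cut0 _ T r Ir) mul0r.
  have q := scale_sqsm H qd (cutP t) (fun r _ => cut_le1 t r).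
  have [y my yE] := bochner_exists H mI finI q.1 (sqsm_norm_integrable mI finI q).
  exists y; split=> //; split=> [/eqP|x mx]; first by rewrite (negbTE t0).
  rewrite yE//; apply: eq_Rintegral => r /set_mem Ir.
  by rewrite (sipZl S)//; exact: sm_mem qd.1 Ir.
have [c cP] := choice ex; exists c; split=> //.
- by move=> t _; have [] := cP t.
- by have [_ [c0 _]] := cP 0; exact: c0.
- by move=> t x _ mx; have [_ [_ cE]] := cP t; exact: cE.
Qed.

Lemma AC_sub_bound c1 d1 c2 d2 t : AC c1 d1 -> AC c2 d2 -> 0 <= t <= T ->
  N (c1 t - c2 t) <= Num.sqrt T * snorm (ipI B I) (d1 - d2).
Proof. by move=> a1 a2 tT; have := AC_bound H (AC_sub a1 a2) tT. Qed.

End AC_more.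

(** * Test functions in several variables *)

Section smooth_product.
Context {R : realType} {n : nat}.
Implicit Types (phi : 'rV[R]_n -> R) (x : 'rV[R]_n).

(** A class of differentiable functions stable under partial derivatives, so that the condition of
    [test_fun] on all iterated partials follows by induction. *)
Inductive smooth_alg : ('rV[R]_n -> R) -> Prop :=
| smooth_alg_coord (i : 'I_n) (f : R -> R) : flat_alg f -> smooth_alg (fun x => f (x 0 i))
| smooth_alg_cst (a : R) : smooth_alg (fun _ => a)
| smooth_algD phi psi : smooth_alg phi -> smooth_alg psi ->
    smooth_alg (fun x => phi x + psi x)
| smooth_algM phi psi : smooth_alg phi -> smooth_alg psi ->
    smooth_alg (fun x => phi x * psi x).

Lemma coord_differentiable i x : differentiable (fun y : 'rV[R]_n => y 0 i : R) x.
Proof. exact: differentiable_coord. Qed.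

Lemma smooth_alg_differentiable phi x : smooth_alg phi -> differentiable phi x.
Proof.
elim=> {phi} [i f sf|a|phi psi _ dphi _ dpsi|phi psi _ dphi _ dpsi].
- apply: (@differentiable_comp _ _ _ _ (fun y : 'rV[R]_n => y 0 i : R) f).
    exact: coord_differentiable.
  by apply/derivable1_diffP; exact: flat_alg_derivable.
- exact: differentiable_cst.
- exact: differentiableD.
- exact: differentiableM.
Qed.

Lemma smooth_alg_partial phi i : smooth_alg phi -> smooth_alg (partial i phi).
Proof.
move=> sphi; elim: sphi => {phi} [j f sf|a|phi psi sphi dphi spsi dpsi|phi psi sphi dphi spsi dpsi].
- have [g sg fg] := flat_alg_derive sf.
  rewrite (_ : partial i _ = fun x => g (x 0 j) * (i == j)%:R).
    by apply: smooth_algM; [exact: smooth_alg_coord|exact: smooth_alg_cst].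
  apply/funext => x; rewrite /partial.
  have dc := coord_differentiable j x.
  have dl : 'D_(delta_mx 0 i) (fun y : 'rV[R]_n => y 0 j : R) x = (i == j)%:R.
    rewrite /derive; apply/cvg_lim; first exact: Rhausdorff.
    have h1 : (fun _ : R => (i == j)%:R : R) h @[h --> (0 : R)^'] --> ((i == j)%:R : R).
      exact: cvg_cst.
    apply: cvg_trans h1; apply: near_eq_cvg.
    near=> h => /=; rewrite !mxE eqxx/= addrK [_ *: _]mulrA mulVf.
      by rewrite mul1r eq_sym.
    by near: h; exact: nbhs_dnbhs_neq.
  have df : differentiable f (x 0 j).
    by apply/derivable1_diffP; exact: flat_alg_derivable.
  have dfj : differentiable (f \o (fun y : 'rV[R]_n => y 0 j : R)) x.
    exact: differentiable_comp.
  rewrite (deriveE _ dfj) (diff_comp dc df) /= -(deriveE _ dc) dl diff1E//.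
  by rewrite derive1E; have [_ ->] := fg (x 0 j); rewrite [_ *: _]mulrC.
- rewrite (_ : partial i _ = fun _ => 0); first exact: smooth_alg_cst.
  by apply/funext => x; rewrite /partial derive_cst.
- rewrite (_ : partial i _ = fun x => partial i phi x + partial i psi x); first exact: smooth_algD.
  apply/funext => x; rewrite /partial deriveD//;
    apply: diff_derivable; exact: smooth_alg_differentiable.
- rewrite (_ : partial i _ = fun x => phi x * partial i psi x + psi x * partial i phi x).
    by apply: smooth_algD; exact: smooth_algM.
  apply/funext => x; rewrite /partial deriveM//;
    apply: diff_derivable; exact: smooth_alg_differentiable.
Unshelve. all: by end_near. Qed.

Lemma smooth_alg_test (Omega : set 'rV[R]_n) phi : smooth_alg phi ->
  compactly_supported Omega phi -> test_fun Omega phi.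
Proof.
move=> sphi cphi; split=> // s x; apply: smooth_alg_differentiable.
by elim: s => //= i s IH; exact: smooth_alg_partial.
Qed.

Definition obox (a b : 'rV[R]_n) : set 'rV[R]_n := [set x | forall i, a 0 i < x 0 i < b 0 i].
Definition cbox (a b : 'rV[R]_n) : set 'rV[R]_n := [set x | forall i, a 0 i <= x 0 i <= b 0 i].

Definition box_bump (a b : 'rV[R]_n) (k : R) x : R :=
  \prod_(i < n) bump (a 0 i) (b 0 i) k (x 0 i).

Lemma box_bump_smooth a b k : smooth_alg (box_bump a b k).
Proof.
rewrite /box_bump; elim: (index_enum _) => [|i r IH].
  by rewrite (_ : (fun x => _) = fun _ => 1); [exact: smooth_alg_cst|apply/funext => x; rewrite big_nil].
rewrite (_ : (fun x => _) = fun x => bump (a 0 i) (b 0 i) k (x 0 i) *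
    \prod_(j <- r) bump (a 0 j) (b 0 j) k (x 0 j)).
  by apply: smooth_algM => //; apply: smooth_alg_coord; exact: bump_flat_alg.
by apply/funext => x; rewrite big_cons.
Qed.

Lemma box_bump_ge0 a b k x : 0 <= box_bump a b k x.
Proof. by apply: prodr_ge0 => i _; exact: bump_ge0. Qed.

Lemma box_bump_le1 a b k x : box_bump a b k x <= 1.
Proof.
suff /andP[] : 0 <= box_bump a b k x <= 1 by [].
rewrite /box_bump; apply: (big_ind (fun y : R => 0 <= y <= 1)) => //.
- by rewrite ler01 lexx.
- by move=> y z /andP[y0 y1] /andP[z0 z1]; rewrite mulr_ge0// mulr_ile1.
- by move=> i _; rewrite bump_ge0 bump_le1.
Qed.

Lemma box_bump_out a b k x : 0 < k -> ~ obox a b x -> box_bump a b k x = 0.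
Proof.
move=> k0 /existsNP[i /negP xi]; rewrite /box_bump (bigD1 i)//= bump_out ?mul0r//.
Qed.

Lemma cvg_box_bump a b x : box_bump a b m.+1%:R x @[m --> \oo] --> (\1_(obox a b) x : R).
Proof.
have [xab|xab] := pselect (obox a b x); last first.
  rewrite indicE memNset// (_ : (fun m => _) = fun _ => 0); first exact: cvg_cst.
  by apply/funext => m; rewrite box_bump_out.
rewrite indicE mem_set//.
rewrite /box_bump; elim: (index_enum _) => [|i r IH].
  by under eq_fun do rewrite big_nil; exact: cvg_cst.
under eq_fun do rewrite big_cons.
rewrite (_ : (true%:R : R) = (a 0 i < x 0 i < b 0 i)%R%:R * true%:R); last first.
  by rewrite xab mulr1.
by apply: cvgM => //; exact: cvg_bump.
Qed.

End smooth_product.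

(** * Rational boxes and Borel sets *)

Section borel_rV.
Context {R : realType} {n : nat}.

Lemma measurable_obox (a b : 'rV[R]_n) : measurable (obox a b).
Proof.
rewrite (_ : obox a b = \bigcap_(i in [set: 'I_n]) (rV_coord i @^-1` `]a 0 i, b 0 i[)).
  apply: fin_bigcap_measurable => // i _; rewrite -[X in measurable X]setTI.
  by apply: measurable_rV_coord => //; exact: measurable_itv.
apply/seteqP; split=> x xab i; first by move=> _ /=; rewrite in_itv/=; exact: xab.
by have := xab i Logic.I; rewrite /= in_itv.
Qed.

Lemma measurable_cbox (a b : 'rV[R]_n) : measurable (cbox a b).
Proof.
rewrite (_ : cbox a b = \bigcap_(i in [set: 'I_n]) (rV_coord i @^-1` `[a 0 i, b 0 i])).
  apply: fin_bigcap_measurable => // i _; rewrite -[X in measurable X]setTI.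
  by apply: measurable_rV_coord => //; exact: measurable_itv.
apply/seteqP; split=> x xab i; first by move=> _ /=; rewrite in_itv/=; exact: xab.
by have := xab i Logic.I; rewrite /= in_itv.
Qed.

Definition rat_row (q : {ffun 'I_n -> rat}) : 'rV[R]_n := \row_i ratr (q i).

Lemma open_rat_box (U : set 'rV[R]_n) x : open U -> U x ->
  exists q : {ffun 'I_n -> rat} * {ffun 'I_n -> rat},
    obox (rat_row q.1) (rat_row q.2) x /\ cbox (rat_row q.1) (rat_row q.2) `<=` U.
Proof.
move=> oU Ux; have /nbhs_ballP[e /= e0 eU] : nbhs x U by exact: open_nbhs_nbhs.
have ex i : exists q : rat * rat, x 0 i - e < ratr q.1 < x 0 i /\ x 0 i < ratr q.2 < x 0 i + e.
  have /rat_in_itvoo[q1] : x 0 i - e < x 0 i by rewrite gtrBl.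
  have /rat_in_itvoo[q2] : x 0 i < x 0 i + e by rewrite ltrDl.
  by rewrite !in_itv/= => h2 h1; exists (q1, q2).
have [q qP] := choice ex.
exists ([ffun i => (q i).1], [ffun i => (q i).2]); split=> /= [i|y yq].
  by rewrite !mxE !ffunE; have [/andP[_ ->] /andP[-> _]] := qP i.
apply: eU; split=> // i j; rewrite ord1; have := yq j; rewrite !mxE !ffunE.
have [/andP[? ?] /andP[? ?]] := qP j => /andP[? ?].
by rewrite /ball/= ltr_norml; apply/andP; split; lra.
Qed.

(** Rational boxes whose closure lies in [U]: a bump on such an open box is compactly supported in
    [U]. *)
Definition rat_boxes (U : set 'rV[R]_n) (k : nat) : option (('rV[R]_n) * 'rV[R]_n) :=
  if @unpickle ({ffun 'I_n -> rat} * {ffun 'I_n -> rat})%type k is Some q then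
    if `[< cbox (rat_row q.1) (rat_row q.2) `<=` U >] then Some (rat_row q.1, rat_row q.2)
    else None else None.

Lemma open_bigcup_boxes (U : set 'rV[R]_n) : open U ->
  U = \bigcup_k (if rat_boxes U k is Some ab then obox ab.1 ab.2 else set0).
Proof.
move=> oU; apply/seteqP; split=> x.
  move=> /(open_rat_box oU)[q [xq qU]]; exists (pickle q) => //.
  by rewrite /rat_boxes pickleK asboolT.
move=> [k _]; rewrite /rat_boxes; case: unpickle => // q; case: ifP => // /asboolP qU xq.
by apply: qU => i; have /andP[? ?] := xq i; rewrite !ltW.
Qed.

Lemma open_measurable_rV (U : set 'rV[R]_n) : open U -> measurable U.
Proof.
move=> oU; rewrite (open_bigcup_boxes oU); apply: bigcup_measurable => k _.
by case: rat_boxes => // ab; exact: measurable_obox.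
Qed.

Lemma continuous_measurable_rV (f : 'rV[R]_n -> R) (D : set 'rV[R]_n) :
  continuous f -> measurable_fun D f.
Proof.
move=> cf; apply: (@measurable_funTS _ _ _ _ D).
apply: (measurability _ (RGenOpens.measurableE R)) => _ [_ [a [b ->] <-]].
rewrite setTI; apply: open_measurable_rV; apply: open_comp => // x _; exact: cf.
Qed.

End borel_rV.

(** * The fundamental lemma of the calculus of variations *)

Section fundamental_lemma.
Context {R : realType} {n : nat}.
Notation mu := (@lebesgue_rV R n).
Implicit Types (h : 'rV[R]_n -> R) (Omega : set 'rV[R]_n).

Let boxes : set (set 'rV[R]_n) := [set S | exists a b, S = obox a b].

Lemma oboxI (a b a' b' : 'rV[R]_n) : obox a b `&` obox a' b' =
  obox (\row_i Num.max (a 0 i) (a' 0 i)) (\row_i Num.min (b 0 i) (b' 0 i)).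
Proof.
apply/seteqP; split=> x.
  move=> [h1 h2] i; have /andP[? ?] := h1 i; have /andP[? ?] := h2 i.
  by rewrite !mxE gt_max lt_min; apply/andP; split; apply/andP.
move=> hx; split=> i; have := hx i; rewrite !mxE gt_max lt_min.
  by move=> /andP[/andP[-> _] /andP[-> _]].
by move=> /andP[/andP[_ ->] /andP[_ ->]].
Qed.

Lemma measurable_boxes : (@measurable _ 'rV[R]_n) = <<s boxes >>.
Proof.
apply/seteqP; split; last first.
  apply: smallest_sub; last by move=> _ [a [b ->]]; exact: measurable_obox.
  by split; [exact: measurable0|move=> A mA; rewrite setTD; exact: measurableC
    |move=> A mA; exact: bigcup_measurable].
apply: smallest_sub; first exact: smallest_sigma_algebra.
move=> A; rewrite /= -bigcup_seq => -[i _ [B mB <-]].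
suff mi : measurable_fun setT (rV_coord i : g_sigma_algebraType boxes -> measurableTypeR R).
  exact: (mi measurableT B mB).
apply: (measurability _ (RGenOpens.measurableE R)) => _ [_ [a [b ->] <-]].
rewrite setTI (@open_bigcup_boxes _ n (rV_coord i @^-1` `]a, b[)).
  apply: bigcup_measurable => k _; case: rat_boxes => [ab|]; last exact: measurable0.
  by apply: sub_sigma_algebra; exists ab.1, ab.2.
by apply: open_comp; [move=> x _; exact: coord_continuous|exact: interval_open].
Qed.

Lemma cbox_compact (a b : 'rV[R]_n) : compact (cbox a b).
Proof.
rewrite (_ : cbox a b = [set x : 'rV[R]_n | forall i, [set` `[a 0 i, b 0 i]] (x 0 i)]).
  by apply: (@rV_compact _ _ (fun i => [set` `[a 0 i, b 0 i]])) => i; exact: segment_compact.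
by apply/seteqP; split=> x xab i; have := xab i; rewrite /= in_itv.
Qed.

Lemma cbox_closed (a b : 'rV[R]_n) : closed (cbox a b).
Proof.
rewrite (_ : cbox a b = \bigcap_(i in [set: 'I_n]) ((fun x : 'rV[R]_n => x 0 i) @^-1` `[a 0 i, b 0 i])).
  apply: closed_bigI => i _; apply: preimage_closed; last exact: itv_closed.
  by move=> x _; exact: coord_continuous.
apply/seteqP; split=> x xab i; first by move=> _ /=; rewrite in_itv/=; exact: xab.
by have := xab i Logic.I; rewrite /= in_itv.
Qed.

Lemma box_bump_supported Omega a b k : 0 < k -> cbox a b `<=` Omega ->
  compactly_supported Omega (box_bump a b k).
Proof.
move=> k0 abO; have sub : closure [set x | box_bump a b k x != 0] `<=` cbox a b.
  rewrite [X in _ `<=` X]((closure_id _).1 (@cbox_closed a b)).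
  apply: closure_subset => x /= /eqP xn; apply: contrapT => xab; apply: xn.
  apply: box_bump_out => // xab'; apply: xab => i; have /andP[? ?] := xab' i.
  by rewrite !ltW.
split; last exact: subset_trans abO.
by apply: (subclosed_compact _ (@cbox_compact a b) sub); exact: closed_closure.
Qed.

Section vanishing.
Variables (Omega : set 'rV[R]_n) (h : 'rV[R]_n -> R).
Hypotheses (oO : open Omega) (ih : mu.-integrable Omega (EFin \o h)).
Hypothesis h0 : forall phi, test_fun Omega phi -> \int[mu]_(x in Omega) (h x * phi x) = 0.

Let mO : measurable Omega := open_measurable_rV oO.

Let ihS A : A `<=` Omega -> measurable A -> mu.-integrable A (EFin \o h).
Proof. by move=> AO mA; exact: integrableS ih. Qed.

(** Bumps are test functions that converge boundedly to the indicator function of the open box. *)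
Lemma obox_integral0 a b : cbox a b `<=` Omega ->
  (\int[mu]_(x in obox a b) (h x)%:E = 0)%E.
Proof.
move=> abO; have ooO : obox a b `<=` Omega.
  by move=> x xab; apply: abO => i; have /andP[? ?] := xab i; rewrite !ltW.
have mb := measurable_obox a b.
have : \int[mu]_(x in Omega) (box_bump a b m.+1%:R x * h x) @[m --> \oo] -->
    \int[mu]_(x in Omega) (\1_(obox a b) x * h x).
  apply: (bounded_convergence (M := 1) mO) => // [m|m x _|x _].
  - apply: continuous_measurable_rV => x.
    by apply: differentiable_continuous; exact/smooth_alg_differentiable/box_bump_smooth.
  - by rewrite ger0_norm ?box_bump_ge0// box_bump_le1.
  - exact: cvg_box_bump.
rewrite (_ : (fun m => _) = fun _ => 0); last first.
  apply/funext => m; have t := smooth_alg_test (box_bump_smooth a b m.+1%:R)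
    (box_bump_supported (ltr0Sn _ _) abO).
  by rewrite -[RHS](h0 t); apply: eq_Rintegral => x _; rewrite mulrC.
move=> /cvg_lim -/(_ (@Rhausdorff R)); rewrite lim_cst; last exact: Rhausdorff.
rewrite (_ : \int[mu]_(x in Omega) _ = \int[mu]_(x in obox a b) h x).
  move=> e; rewrite -[LHS]fineK; last exact: (integrable_fin_num mb (ihS ooO mb)).
  by rewrite -/(Rintegral _ _ _) -e.
rewrite -{2}(setIidr ooO) Rintegral_mkcondr; apply: eq_Rintegral => x _.
by rewrite patchE indicE; case: ifP => _; rewrite ?mul1r ?mul0r.
Qed.

(** The sets [A] for which [h] has integral 0 over the box intersected with [A] form a Dynkin system
    that contains all boxes, a generator stable under intersection. So [h] integrates to 0 over
    every Borel subset of the box. *)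
Lemma obox_ae0 a b : cbox a b `<=` Omega -> {ae mu, forall x, obox a b x -> h x = 0}.
Proof.
move=> abO; have ooO : obox a b `<=` Omega.
  by move=> x xab; apply: abO => i; have /andP[? ?] := xab i; rewrite !ltW.
have mb := measurable_obox a b.
have ib A : measurable A -> mu.-integrable (obox a b `&` A) (EFin \o h).
  move=> mA; apply: ihS; last exact: measurableI.
  by move=> x [/ooO].
have key A : measurable A -> (\int[mu]_(x in obox a b `&` A) (h x)%:E = 0)%E.
  rewrite measurable_boxes => mA.
  apply: (dynkin_induction (G := boxes) (P := fun A =>
    (\int[mu]_(x in obox a b `&` A) (h x)%:E = 0)%E) _ _ _ _ _ _ mA).
  - exact: measurable_boxes.
  - by move=> _ _ [a1 [b1 ->]] [a2 [b2 ->]]; rewrite oboxI; eexists; eexists.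
  - by rewrite setIT; exact: obox_integral0.
  - move=> _ [a1 [b1 ->]]; rewrite oboxI; apply: obox_integral0 => x xab.
    apply: abO => i; have := xab i; rewrite !mxE ge_max le_min.
    by move=> /andP[/andP[-> _] /andP[-> _]].
  - move=> A' mA' A'0; have := obox_integral0 abO.
    rewrite -[X in (\int[mu]_(x in X) _)%E = _](setIT (obox a b)) -(setUCr A') setIUr.
    rewrite integral_setU//; [|exact: measurableI|by apply: measurableI => //; exact: measurableC| |].
    + by rewrite A'0 add0e.
    + by rewrite -setIUr setUCr setIT; apply: (measurable_int mu); exact: ihS.
    + by rewrite disj_set2E; apply/eqP; rewrite setIACA setICr setI0.
  - move=> F mF tF F0; rewrite setI_bigcupr integral_bigcup.
    + by rewrite eseries0// => i _ _; exact: F0.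
    + by apply: trivIset_setIl.
    + by move=> k; exact: measurableI.
    + by rewrite -setI_bigcupr; apply: ib; exact: bigcup_measurable.
have := @integral_ae_eq _ _ _ mu _ mb (cst 0%E) (EFin \o h) (ihS ooO mb).
move=> /(_ (measurable_cst _)).
have h2 : forall E, E `<=` obox a b -> measurable E ->
    (\int[mu]_(x in E) (EFin \o h) x = \int[mu]_(x in E) cst 0 x)%E.
  by move=> E Eo mE; rewrite integral0 -(setIidr Eo); exact: key.
move=> /(_ h2); apply: (ae_imp (mu := mu)) => x hx xab.
by have := hx xab; rewrite /= => -[].
Qed.

Lemma test_fun_ae0 : {ae mu, forall x, Omega x -> h x = 0}.
Proof.
have : {ae mu, forall x k, (if rat_boxes Omega k is Some ab then obox ab.1 ab.2 else set0) x -> h x = 0}.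
  apply: (ae_forall (mu := mu)) => k; rewrite /rat_boxes.
  case: unpickle => [q|]; last by apply: aeW.
  by case: ifP => [/asboolP|_]; [exact: obox_ae0|apply: aeW].
apply: (ae_imp (mu := mu)) => x hx; rewrite {1}(open_bigcup_boxes oO) => -[k _].
exact: hx.
Qed.

End vanishing.
End fundamental_lemma.

(** * Rellich and Poincare inequalities *)

Section bounded_support.
Context d {T : measurableType d} {R : realType}.

(** Over a set of finite measure this class is integrable and closed under products, sections and
    partial integration. It discharges the integrability conditions of the slicing arguments. *)
Definition bms (Q : set T) (f : T -> R) := [/\ measurable_fun setT f,
  exists K, forall x, `|f x| <= K & forall x, ~ Q x -> f x = 0].

Variables (mu : {measure set T -> \bar R}) (Q : set T).
Hypotheses (mQ : measurable Q) (Qoo : (mu Q < +oo)%E).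
Implicit Types f g : T -> R.

Lemma bmsMr f g : bms Q f -> measurable_fun setT g -> (exists K, forall x, `|g x| <= K) ->
  bms Q (fun x => f x * g x).
Proof.
move=> [mf [K fK] f0] mg [L gL]; split; first exact: measurable_funM.
- by exists (K * L) => x; rewrite normrM ler_pM.
- by move=> x xQ; rewrite f0 ?mul0r.
Qed.

Lemma bmsM f g : bms Q f -> bms Q g -> bms Q (fun x => f x * g x).
Proof. by move=> bf [mg gL _]; exact: bmsMr. Qed.

Lemma bms_sqr f : bms Q f -> bms Q (fun x => f x ^+ 2).
Proof. by move=> bf; exact: bmsM. Qed.

Lemma bmsD f g : bms Q f -> bms Q g -> bms Q (fun x => f x + g x).
Proof.
move=> [mf [K fK] f0] [mg [L gL] g0]; split; first exact: measurable_funD.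
- by exists (K + L) => x; apply: le_trans (ler_normD _ _) _; exact: lerD.
- by move=> x xQ; rewrite f0 ?g0 ?addr0.
Qed.

Lemma bmsZ a f : bms Q f -> bms Q (fun x => a * f x).
Proof.
move=> bf; rewrite (_ : (fun x => _) = fun x => f x * a); last first.
  by apply/funext => x; rewrite mulrC.
by apply: bmsMr => //; exists `|a|.
Qed.

Lemma bms_abs f : bms Q f -> bms Q (fun x => `|f x|).
Proof.
move=> [mf [K fK] f0]; split; first exact: measurableT_comp.
- by exists K => x; rewrite normr_id.
- by move=> x /f0 ->; rewrite normr0.
Qed.

Lemma bms_sum (J : Type) (r : seq J) (F : J -> T -> R) : (forall j, bms Q (F j)) ->
  bms Q (fun x => \sum_(j <- r) F j x).
Proof.
move=> bF; elim: r => [|j r IH].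
  rewrite (_ : (fun x => _) = cst 0); last by apply/funext => x; rewrite big_nil.
  by split=> //; exists 0 => x; rewrite normr0.
rewrite (_ : (fun x => _) = fun x => F j x + \sum_(j <- r) F j x); first exact: bmsD.
by apply/funext => x; rewrite big_cons.
Qed.

Lemma bms_indic A f : measurable A -> bms Q f -> bms Q (fun x => \1_A x * f x).
Proof.
move=> mA bf; rewrite (_ : (fun x => _) = fun x => f x * \1_A x); last first.
  by apply/funext => x; rewrite mulrC.
apply: bmsMr => //; exists 1 => x; rewrite indicE; case: (_ \in _); rewrite ?normr1//.
by rewrite normr0.
Qed.

Lemma bms_1 : bms Q (\1_Q).
Proof.
split; first exact: measurable_indic.
  exists 1 => x; rewrite indicE; case: (_ \in _); rewrite ?normr1//.
  by rewrite normr0.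
by move=> x xs; rewrite indicE memNset.
Qed.

Lemma bms_integrable f : bms Q f -> mu.-integrable setT (EFin \o f).
Proof.
move=> [mf [K fK] f0].
have -> : EFin \o f = (EFin \o f) \_ Q.
  apply/funext => x; rewrite patchE; case: ifPn => // /negP xQ.
  by rewrite /= f0// => Qx; apply: xQ; rewrite inE.
apply/(integrable_mkcond _ mQ); apply: (@ge0_le_integrable _ _ _ _ _ mQ f (cst K)).
- exact: measurable_funTS.
- by move=> x _; exact: fK.
- exact: integrable_cst.
Qed.

Lemma bms_sqint f : bms Q f -> sqint mu setT f.
Proof.
move=> bf; apply: integrable2_sqint; first by have [] := bf.
exact/bms_integrable/bms_sqr.
Qed.

Lemma bms_Rintegral_bound f K : 0 <= K -> (forall x, `|f x| <= K) -> bms Q f ->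
  `|\int[mu]_x f x| <= K * fine (mu Q).
Proof.
move=> K0 fK bf; have [_ _ f0] := bf.
apply: le_trans (le_normr_Rintegral measurableT (bms_integrable bf)) _.
rewrite -(Rintegral_cst mu mQ K) [leRHS]Rintegral_mkcond; apply: le_Rintegral => //.
- exact: bms_integrable (bms_abs bf).
- by rewrite -restrict_EFin; apply/(integrable_mkcond _ mQ); exact: integrable_cst.
move=> x _; rewrite patchE; case: ifPn => // /negP xQ.
by rewrite f0 ?normr0// => Qx; apply: xQ; rewrite inE.
Qed.

Lemma bms_CS f g : bms Q f -> bms Q g ->
  (\int[mu]_x (f x * g x)) ^+ 2 <= (\int[mu]_x (f x ^+ 2)) * (\int[mu]_x (g x ^+ 2)).
Proof.
move=> bf bg; have S := sqint_semi_inner mu (@measurableT _ T).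
have sf := bms_sqint bf; have sg := bms_sqint bg.
rewrite -[leLHS]/(sqint_ip mu setT f g ^+ 2) -[X in X * _]/(sqint_ip mu setT f f).
rewrite -[X in _ * X]/(sqint_ip mu setT g g) -!(sqr_snorm S)// -exprMn.
by rewrite -[leLHS]real_normK ?num_real// ler_sqr ?nnegrE ?mulr_ge0 ?snorm_ge0// (cauchy_schwarz S).
Qed.

Lemma bms_Rintegral_sqr_ge0 f : 0 <= \int[mu]_x (f x ^+ 2).
Proof. by apply: Rintegral_ge0 => x _; exact: sqr_ge0. Qed.

Lemma bms_le f g : bms Q f -> bms Q g -> (forall x, f x <= g x) ->
  \int[mu]_x f x <= \int[mu]_x g x.
Proof. by move=> bf bg fg; apply: le_Rintegral => //; exact: bms_integrable. Qed.

Lemma bms_RintegralD f g : bms Q f -> bms Q g ->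
  \int[mu]_x (f x + g x) = \int[mu]_x f x + \int[mu]_x g x.
Proof. by move=> bf bg; rewrite RintegralD//; exact: bms_integrable. Qed.

Lemma bms_RintegralZ a f : bms Q f -> \int[mu]_x (a * f x) = a * \int[mu]_x f x.
Proof. by move=> bf; rewrite RintegralZl//; exact: bms_integrable. Qed.

Lemma bms_Rintegral_sum (J : Type) (r : seq J) (F : J -> T -> R) :
  (forall j, bms Q (F j)) ->
  \int[mu]_x \sum_(j <- r) F j x = \sum_(j <- r) \int[mu]_x F j x.
Proof.
move=> bF; elim: r => [|j r IH].
  by under eq_Rintegral do rewrite big_nil; rewrite big_nil Rintegral_cst// mul0r.
under eq_Rintegral do rewrite big_cons.
by rewrite bms_RintegralD ?big_cons ?IH//; exact: bms_sum.
Qed.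

End bounded_support.

Section bounded_support_fubini.
Context d1 d2 {T1 : measurableType d1} {T2 : measurableType d2} {R : realType}.
Variables (m1 : {sigma_finite_measure set T1 -> \bar R}).
Variables (m2 : {sigma_finite_measure set T2 -> \bar R}).
Variables (Q1 : set T1) (Q2 : set T2).
Hypotheses (mQ1 : measurable Q1) (mQ2 : measurable Q2).
Hypotheses (Q1oo : (m1 Q1 < +oo)%E) (Q2oo : (m2 Q2 < +oo)%E).
Implicit Types f : T1 * T2 -> R.

Lemma bms_sec1 f x : bms (Q1 `*` Q2) f -> bms Q2 (fun y => f (x, y)).
Proof.
move=> [mf [K fK] f0]; split; first exact: measurableT_comp.
- by exists K.
- by move=> y yQ; apply: f0 => -[].
Qed.

Lemma bms_sec2 f y : bms (Q1 `*` Q2) f -> bms Q1 (fun x => f (x, y)).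
Proof.
move=> [mf [K fK] f0]; split; first exact: measurableT_comp.
- by exists K.
- by move=> x xQ; apply: f0 => -[].
Qed.

Lemma prod_lty : ((m1 \x m2)%E (Q1 `*` Q2) < +oo)%E.
Proof.
rewrite (_ : (m1 \x m2)%E _ = (m1 Q1 * m2 Q2)%E); last exact: product_measure1E.
by rewrite lte_mul_pinfty// ge0_fin_numE.
Qed.

Let imf f : bms (Q1 `*` Q2) f -> (m1 \x m2)%E.-integrable setT (EFin \o f).
Proof.
move=> bf; exact: (@bms_integrable _ _ _ (m1 \x m2)%E _ (measurableX mQ1 mQ2) prod_lty f bf).
Qed.

Let F1E f x : bms (Q1 `*` Q2) f ->
  (\int[m2]_y f (x, y))%:E = (\int[m2]_y (f (x, y))%:E)%E.
Proof.
move=> bf; rewrite fineK//; apply: (integrable_fin_num (mu := m2)) => //.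
exact: (bms_integrable mQ2 Q2oo (bms_sec1 x bf)).
Qed.

Let F2E f y : bms (Q1 `*` Q2) f ->
  (\int[m1]_x f (x, y))%:E = (\int[m1]_x (f (x, y))%:E)%E.
Proof.
move=> bf; rewrite fineK//; apply: (integrable_fin_num (mu := m1)) => //.
exact: (bms_integrable mQ1 Q1oo (bms_sec2 y bf)).
Qed.

Lemma bms_int1 f : bms (Q1 `*` Q2) f -> bms Q1 (fun x => \int[m2]_y f (x, y)).
Proof.
move=> bf; have [_ [K fK] f0] := bf; split.
- apply/measurable_EFinP; rewrite (_ : _ \o _ = fun x => \int[m2]_y (EFin \o f) (x, y))%E.
    exact: (measurable_fubini_F (imf bf)).
  by apply/funext => x; exact: F1E.
- exists (`|K| * fine (m2 Q2)) => x; apply: bms_Rintegral_bound (bms_sec1 x bf) => //.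
  by move=> y; apply: le_trans (fK _) (ler_norm _).
- move=> x xQ; rewrite (_ : (fun y => _) = cst 0) ?Rintegral_cst ?mul0r//.
  by apply/funext => y; apply: f0 => -[].
Qed.

Lemma bms_int2 f : bms (Q1 `*` Q2) f -> bms Q2 (fun y => \int[m1]_x f (x, y)).
Proof.
move=> bf; have [_ [K fK] f0] := bf; split.
- apply/measurable_EFinP; rewrite (_ : _ \o _ = fun y => \int[m1]_x (EFin \o f) (x, y))%E.
    exact: (measurable_fubini_G (imf bf)).
  by apply/funext => y; exact: F2E.
- exists (`|K| * fine (m1 Q1)) => y; apply: bms_Rintegral_bound (bms_sec2 y bf) => //.
  by move=> x; apply: le_trans (fK _) (ler_norm _).
- move=> y yQ; rewrite (_ : (fun x => _) = cst 0) ?Rintegral_cst ?mul0r//.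
  by apply/funext => x; apply: f0 => -[].
Qed.

Lemma bms_fubini f : bms (Q1 `*` Q2) f ->
  \int[m1]_x \int[m2]_y f (x, y) = \int[m2]_y \int[m1]_x f (x, y).
Proof.
move=> bf; congr fine; under eq_integral do rewrite F1E//.
under [RHS]eq_integral do rewrite F2E//.
exact: (Fubini (imf bf)).
Qed.

Lemma bms_prod_integral f : bms (Q1 `*` Q2) f ->
  \int[(m1 \x m2)%E]_z f z = \int[m1]_x \int[m2]_y f (x, y).
Proof.
move=> bf; congr fine; under [RHS]eq_integral do rewrite F1E//.
by rewrite -(integral12_prod_meas1 (imf bf)).
Qed.

End bounded_support_fubini.

(** * Slicing Lebesgue measure by the first coordinate *)

Section cube.
Context {R : realType}.
Variable M : R.
Notation leb := (@lebesgue_measure R).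
Notation mu n := (@lebesgue_rV R n).

Definition seg : set (measurableTypeR R) := `[- M, M].
Definition cube n : set 'rV[R]_n := cbox (const_mx (- M)) (const_mx M).
Arguments cube n _ : clear implicits.

Lemma measurable_seg : measurable seg.
Proof. exact: measurable_itv. Qed.

Lemma seg_lty : (leb seg < +oo)%E.
Proof. by rewrite /seg lebesgue_measure_itv/=; case: ifP => // _; rewrite -EFinB ltry. Qed.

Lemma measurable_cube n : measurable (cube n).
Proof. exact: measurable_cbox. Qed.
#[local] Arguments measurable_cube n : clear implicits.

Lemma rV_cons0 n x (y : 'rV[R]_n) : rV_cons (x, y) 0 0 = x.
Proof. by have := rV_consK (x, y) => -[]. Qed.

Lemma rV_consS n x (y : 'rV[R]_n) i : rV_cons (x, y) 0 (lift ord0 i) = y 0 i.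
Proof.
have := rV_consK (x, y) => -[_ /rowP/(_ i)]; rewrite mxE => <-.
by congr (rV_cons _ _ _); exact/val_inj.
Qed.

Lemma cube_cons n x (y : 'rV[R]_n) : cube n.+1 (rV_cons (x, y)) <-> seg x /\ cube n y.
Proof.
split=> [h|[hx hy]].
  split; first by have := h 0; rewrite rV_cons0 !mxE /seg/= in_itv.
  by move=> i; have := h (lift ord0 i); rewrite rV_consS !mxE.
move=> i; case: (unliftP ord0 i) => [j ->|->]; first by have := hy j; rewrite rV_consS !mxE.
by move: hx; rewrite rV_cons0 !mxE /seg/= in_itv.
Qed.

Lemma cube_lty n : (mu n (cube n) < +oo)%E.
Proof.
elim: n => [|n IH].
  by rewrite /= diracE ltry.
rewrite /= /pushforward (_ : _ @^-1` _ = seg `*` cube n); last first.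
  by apply/seteqP; split=> -[x y] /cube_cons.
exact: (prod_lty measurable_seg (measurable_cube n) seg_lty IH).
Qed.

Lemma bms_cons n (f : 'rV[R]_n.+1 -> R) : bms (cube n.+1) f ->
  bms (seg `*` cube n) (f \o @rV_cons R n).
Proof.
move=> [mf fK f0]; split.
- by apply: measurableT_comp => //; exact: measurable_rV_cons.
- by have [K KP] := fK; exists K => x; exact: KP.
- by move=> [x y] xy; apply: f0 => /cube_cons.
Qed.

(** [lebesgue_rV] is an iterated product pushed forward along [rV_cons], so Fubini peels off one
    coordinate. The inductions on the dimension rest on this. *)
Lemma rV_integral n (f : 'rV[R]_n.+1 -> R) : bms (cube n.+1) f ->
  \int[mu n.+1]_z f z = \int[leb]_x \int[mu n]_y f (rV_cons (x, y)).
Proof.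
move=> bf; have bc := bms_cons bf; have [mf _ _] := bf.
have ms := measurable_seg; have mc := measurable_cube n.
rewrite -(bms_prod_integral ms mc seg_lty (cube_lty n) bc); congr fine.
have mcons : @measurable_fun _ _ (measurableTypeR R * 'rV[R]_n)%type 'rV[R]_n.+1 setT
  (@rV_cons R n) := @measurable_rV_cons R n.
have := @integral_pushforward _ _ _ _ R _ mcons (leb \x mu n)%E setT (EFin \o f); rewrite preimage_setT; apply=> //; first exact/measurable_EFinP.
exact: (@bms_integrable _ _ _ (leb \x mu n)%E _ (measurableX ms mc)
  (prod_lty ms mc seg_lty (cube_lty n)) _ bc).
Qed.

Lemma rV_integralC n (f : 'rV[R]_n.+1 -> R) : bms (cube n.+1) f ->
  \int[mu n.+1]_z f z = \int[mu n]_y \int[leb]_x f (rV_cons (x, y)).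
Proof.
move=> bf; rewrite rV_integral//.
exact: (bms_fubini measurable_seg (measurable_cube n) seg_lty (cube_lty n) (bms_cons bf)).
Qed.

End cube.
Arguments cube {R} M n _.
Arguments measurable_cube {R} M n.

Lemma cauchy_schwarz_sqr (R : realType) (V : lmodType R) (P : set V) (B : V -> V -> R) :
  semi_inner P B -> forall x y, P x -> P y -> B x y ^+ 2 <= B x x * B y y.
Proof.
move=> S x y Px Py; rewrite -!(sqr_snorm S)// -exprMn.
by rewrite -[leLHS]real_normK ?num_real// ler_sqr ?nnegrE ?mulr_ge0 ?snorm_ge0// (cauchy_schwarz S).
Qed.

(** * Inequalities on the line *)

Section one_dim.
Context {R : realType}.
Variable M : R.
Notation leb := (@lebesgue_measure R).
Notation seg := (seg M).
Notation itv a b := (`[a, b[%classic : set (measurableTypeR R)).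
Implicit Types (f g : measurableTypeR R -> R) (a b x y : R).

Definition prim f g := forall a b, a <= b -> f b - f a = \int[leb]_(x in `[a, b[) g x.

Let iI f a b : bms seg f -> leb.-integrable (itv a b) (EFin \o f).
Proof.
move=> bf; apply: integrableS (bms_integrable (measurable_seg M) (seg_lty M) bf) => //.
Qed.

Let mI a b : measurable (itv a b). Proof. exact: measurable_itv. Qed.

Let lebI a b : a <= b -> fine (leb (itv a b)) = b - a.
Proof.
move=> ab; rewrite /= lebesgue_measure_itv/= lte_fin.
by case: ltP => [_|ba] //=; rewrite (le_anti (introT andP (conj ab ba))) subrr.
Qed.

Let lebIoo a b : (leb (itv a b) < +oo)%E.
Proof. by rewrite lebesgue_measure_itv/=; case: ifP => // _; rewrite -EFinB ltry. Qed.

Lemma prim_osc f g a b : bms seg g -> prim f g -> forall x y, a <= x <= b -> a <= y <= b ->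
  `|f x - f y| <= \int[leb]_(t in itv a b) `|g t|.
Proof.
move=> bg fg; have key x y : a <= x -> x <= y -> y <= b ->
    `|f y - f x| <= \int[leb]_(t in itv a b) `|g t|.
  move=> ax xy yb; rewrite fg//.
  apply: le_trans (le_normr_Rintegral (mI x y) (iI _ _ bg)) _.
  have bga := bms_abs bg.
  rewrite [leLHS]Rintegral_mkcond [leRHS]Rintegral_mkcond; apply: le_Rintegral => //.
  - by rewrite -restrict_EFin; apply/(integrable_mkcond _ (mI x y)); exact: iI.
  - by rewrite -restrict_EFin; apply/(integrable_mkcond _ (mI a b)); exact: iI.
  move=> t _; rewrite !patchE; case: ifPn => [|_]; last by case: ifP => _ //; exact: normr_ge0.
  rewrite inE/= in_itv/= => /andP[xt ty]; rewrite ifT// inE/= in_itv/=.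
  by rewrite (le_trans ax xt) (lt_le_trans ty yb).
move=> x y /andP[ax xb] /andP[ay yb]; have [xy|/ltW yx] := leP x y; last exact: key.
by rewrite distrC; exact: key.
Qed.

Lemma itv_CS g a b : a <= b -> bms seg g ->
  (\int[leb]_(t in itv a b) `|g t|) ^+ 2 <= (b - a) * \int[leb]_(t in itv a b) (g t ^+ 2).
Proof.
move=> ab bg; have S := sqint_semi_inner leb (mI a b).
have sg : sqint leb (itv a b) (fun t => `|g t|).
  apply: integrable2_sqint.
    by have [mg _ _] := bms_abs bg; exact: measurable_funTS.
  by have := iI a b (bms_sqr (bms_abs bg)).
have s1 : sqint leb (itv a b) (fun=> 1) by exact: sqint_cst (mI a b) (lebIoo a b) 1.
have := cauchy_schwarz_sqr S s1 sg; rewrite /sqint_ip.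
under eq_Rintegral do rewrite mul1r.
under [X in _ <= X * _ -> _]eq_Rintegral do rewrite mulr1.
rewrite Rintegral_cst// mul1r lebI//.
by under [X in _ <= _ * X -> _]eq_Rintegral do rewrite -expr2 real_normK ?num_real//.
Qed.

(** On a cell of length h, [f] differs from its mean A/h by at most the integral G of |g|, and G^2
    is at most h times the integral of g^2. Hence f^2 is at most 2(A/h)^2 + 2G^2, which is
    integrated over the cell. *)
Lemma prim_cell f g a h : 0 < h -> bms seg f -> bms seg g -> prim f g ->
  \int[leb]_(t in itv a (a + h)) (f t ^+ 2) <=
  2 / h * (\int[leb]_(t in itv a (a + h)) f t) ^+ 2 +
  2 * h ^+ 2 * \int[leb]_(t in itv a (a + h)) (g t ^+ 2).
Proof.
move=> h0 bf bg fg; set A := \int[leb]_(t in _) f t.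
pose G := \int[leb]_(t in itv a (a + h)) `|g t|.
have ah : a <= a + h by rewrite lerDl ltW.
have hE : fine (leb (itv a (a + h))) = h by rewrite lebI// addrAC subrr add0r.
have icst (r : R) : leb.-integrable (itv a (a + h)) (EFin \o cst r).
  exact: (integrable_cst (mI _ _) (lebIoo _ _)).
have fA t : itv a (a + h) t -> `|h * f t - A| <= h * G.
  rewrite /= in_itv/= => /andP[at_ ta]; have tI : a <= t <= a + h by rewrite at_ ltW.
  have osc s : itv a (a + h) s -> `|f t - f s| <= G.
    rewrite /= in_itv/= => /andP[as_ sa]; apply: (prim_osc bg fg) => //.
    by rewrite as_ ltW.
  have h1 : A <= h * (f t + G).
    rewrite -[X in X * _]hE mulrC -Rintegral_cst//; apply: (le_Rintegral (mI _ _)); [exact: iI|exact: icst|].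
    by move=> s /osc; rewrite /= ler_norml => /andP[]; lra.
  have h2 : h * (f t - G) <= A.
    rewrite -[X in X * _]hE mulrC -Rintegral_cst//; apply: (le_Rintegral (mI _ _)); [exact: icst|exact: iI|].
    by move=> s /osc; rewrite /= ler_norml => /andP[]; lra.
  by move: h1 h2; rewrite mulrDr mulrBr ler_norml => ? ?; apply/andP; split; lra.
have G2 : G ^+ 2 <= h * \int[leb]_(t in itv a (a + h)) (g t ^+ 2).
  by have := itv_CS ah bg; rewrite addrAC subrr add0r.
have fb t : itv a (a + h) t -> f t ^+ 2 <= 2 / h ^+ 2 * A ^+ 2 + 2 * G ^+ 2.
  move=> /fA fAt; have h20 : 0 < h ^+ 2 by rewrite exprn_gt0.
  rewrite -(ler_pM2l h20).
  have -> : h ^+ 2 * (2 / h ^+ 2 * A ^+ 2 + 2 * G ^+ 2) = 2 * A ^+ 2 + 2 * (h * G) ^+ 2.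
    by field; rewrite gt_eqF.
  have : (h * f t - A) ^+ 2 <= (h * G) ^+ 2.
    by rewrite -[leLHS]real_normK ?num_real// lerXn2r ?nnegrE// (le_trans (normr_ge0 _) fAt).
  (* The square of hf - 2A is the difference between 2A^2 + 2(hf - A)^2 and (hf)^2. *)
  have := sqr_ge0 (h * f t - 2 * A); rewrite -subr_ge0 => p1; rewrite -subr_ge0 => p2.
  rewrite -subr_ge0; apply: le_trans (addr_ge0 p1 (mulr_ge0 (ler0n R 2) p2)) _.
  by rewrite le_eqVlt; apply/orP; left; apply/eqP; ring.
apply: (@le_trans _ _ (h * (2 / h ^+ 2 * A ^+ 2 + 2 * G ^+ 2))).
  rewrite -[X in X * _]hE mulrC -Rintegral_cst//.
  by apply: (le_Rintegral (mI _ _)); [exact: iI (bms_sqr bf)|exact: icst|].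
rewrite mulrDr; apply: lerD.
  by rewrite le_eqVlt; apply/orP; left; apply/eqP; field; rewrite gt_eqF.
rewrite mulrCA -[2 * h ^+ 2 * _]mulrA ler_pM2l// expr2 -mulrA ler_pM2l//.
Qed.

Lemma prim_cells f g a h N : 0 < h -> bms seg f -> bms seg g -> prim f g ->
  \int[leb]_(t in itv a (a + h *+ N)) (f t ^+ 2) <=
  2 / h * \sum_(m < N) (\int[leb]_(t in itv (a + h *+ m) (a + h *+ m + h)) f t) ^+ 2 +
  2 * h ^+ 2 * \int[leb]_(t in itv a (a + h *+ N)) (g t ^+ 2).
Proof.
move=> h0 bf bg fg; elim: N => [|N IH].
  by rewrite mulr0n addr0 big_ord0 set_itvco0 !Rintegral_set0 !mulr0 addr0.
have dec u : bms seg u -> \int[leb]_(t in itv a (a + h *+ N.+1)) u t =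
    \int[leb]_(t in itv a (a + h *+ N)) u t +
    \int[leb]_(t in itv (a + h *+ N) (a + h *+ N + h)) u t.
  move=> bu; rewrite mulrSr addrA -Rintegral_setU//.
  - congr (Rintegral _ _ _); apply/seteqP; split=> t /=; rewrite !in_itv/=.
      by move=> /andP[at_ ->]; rewrite at_ andbT; case: ltP; [left|right].
    have hN : 0 <= h *+ N by rewrite mulrn_wge0 ?ltW.
    by move=> [] /andP[? ?]; apply/andP; split; lra.
  - apply: integrableS (bms_integrable (measurable_seg M) (seg_lty M) bu) => //.
    by apply: measurableU; exact: mI.
  - rewrite disj_set2E; apply/eqP/seteqP; split=> // t /= [].
    by rewrite !in_itv/= => /andP[_ tl] /andP[tr _]; move: (lt_le_trans tl tr); rewrite ltxx.
rewrite (dec _ (bms_sqr bf)) (dec _ (bms_sqr bg)) big_ord_recr/=.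
apply: le_trans (lerD IH (prim_cell _ h0 bf bg fg)) _.
by rewrite le_eqVlt; apply/orP; left; apply/eqP; ring.
Qed.

Lemma bms_seg_itv f a b : bms seg f -> a <= - M -> M < b ->
  \int[leb]_t f t = \int[leb]_(t in itv a b) f t.
Proof.
move=> [_ _ f0] aM Mb; rewrite [RHS]Rintegral_mkcond; apply: eq_Rintegral => t _.
rewrite patchE; case: ifPn => // /negP tab; apply: f0; rewrite /seg/= in_itv/= => /andP[h1 h2].
by apply: tab; rewrite inE/= in_itv/= (le_trans aM h1) (le_lt_trans h2 Mb).
Qed.

(** The constant is the squared length of [-M - 1, M + 1), enlarged so that [f] vanishes at its left
    end: one factor comes from Cauchy-Schwarz for f(t), the other from integrating over t. *)
Lemma prim_poincare f g : 0 <= M -> bms seg f -> bms seg g -> prim f g ->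
  \int[leb]_t (f t ^+ 2) <= (M *+ 2 + 2) ^+ 2 * \int[leb]_t (g t ^+ 2).
Proof.
move=> M0 bf bg fg; have [_ _ f0] := bf.
have h1 : - M - 1 <= - M by rewrite gerBl.
have h2 : M < M + 1 by rewrite ltrDl.
have hab : - M - 1 <= M + 1 by lra.
rewrite (bms_seg_itv (bms_sqr bf) h1 h2) (bms_seg_itv (bms_sqr bg) h1 h2).
set G := \int[leb]_(t in _) (g t ^+ 2).
have dE : M + 1 - (- M - 1) = M *+ 2 + 2 by rewrite mulr2n; ring.
have fz : f (- M - 1) = 0.
  by apply: f0; rewrite /seg/= in_itv/= => /andP[? _]; lra.
have fb t : itv (- M - 1) (M + 1) t -> f t ^+ 2 <= (M *+ 2 + 2) * G.
  rewrite /= in_itv/= => /andP[at_ ta].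
  have ftG : `|f t| <= \int[leb]_(t in itv (- M - 1) (M + 1)) `|g t|.
    rewrite -[f t]subr0 -[X in _ - X]fz; apply: (prim_osc bg fg); first by rewrite at_ ltW.
    by rewrite lexx.
  rewrite -dE; apply: le_trans (itv_CS hab bg).
  by rewrite -[leLHS]real_normK ?num_real// lerXn2r ?nnegrE// (le_trans (normr_ge0 _) ftG).
apply: (@le_trans _ _ (\int[leb]_(t in itv (- M - 1) (M + 1)) cst ((M *+ 2 + 2) * G) t)).
  apply: (le_Rintegral (mI _ _)) => //; first exact: iI (bms_sqr bf).
  exact: (integrable_cst (mI _ _) (lebIoo _ _)).
rewrite Rintegral_cst// lebI// dE.
by rewrite le_eqVlt; apply/orP; left; apply/eqP; ring.
Qed.

Lemma prim_int0 f g : 0 <= M -> bms seg f -> bms seg g -> prim f g -> \int[leb]_t g t = 0.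
Proof.
move=> M0 [_ _ f0] bg fg; have h1 : - M - 1 <= - M by rewrite gerBl.
have h2 : M < M + 1 by rewrite ltrDl.
rewrite (bms_seg_itv bg h1 h2) -fg; last lra.
by rewrite !f0 ?subrr// /seg/= in_itv/= => /andP[? ?]; lra.
Qed.

End one_dim.

(** * Induction on the dimension *)

Section wclass.
Context {R : realType}.
Variable M : R.
Hypothesis M0 : 0 <= M.
Notation leb := (@lebesgue_measure R).
Notation mu n := (@lebesgue_rV R n).
Notation seg := (seg M).
Notation cube n := (cube M n).
Notation itv a b := (`[a, b[%classic : set (measurableTypeR R)).

(** Test functions with their partial derivatives belong to this class. Unlike smoothness, its
    conditions pass to slices immediately: [g i] is a derivative along every line parallel to the
    i-th axis. *)
Definition wclass n (f : 'rV[R]_n -> R) (g : 'I_n -> 'rV[R]_n -> R) :=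
  [/\ bms (cube n) f, forall i, bms (cube n) (g i)
    & forall i x, prim (fun t => f (x + t *: delta_mx 0 i)) (fun t => g i (x + t *: delta_mx 0 i))].

Lemma line_coord n (u : 'rV[R]_n) t i j :
  (u + t *: delta_mx 0 i) 0 j = u 0 j + t * (j == i)%:R.
Proof. by rewrite !mxE. Qed.

Lemma rV_cons_line0 n t (y : 'rV[R]_n) :
  rV_cons (t, y) = rV_cons (0, y) + t *: delta_mx 0 ord0.
Proof.
apply/rowP => i; rewrite line_coord; case: (unliftP ord0 i) => [j ->|->].
  by rewrite !rV_consS /= mulr0 addr0.
by rewrite !rV_cons0 eqxx mulr1 add0r.
Qed.

Lemma rV_cons_lineS n x (y : 'rV[R]_n) t i :
  rV_cons (x, y + t *: delta_mx 0 i) = rV_cons (x, y) + t *: delta_mx 0 (lift ord0 i).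
Proof.
apply/rowP => j; rewrite line_coord; case: (unliftP ord0 j) => [k ->|->].
  by rewrite !rV_consS line_coord (inj_eq (@lift_inj _ ord0)).
by rewrite !rV_cons0 /= mulr0 addr0.
Qed.

Lemma bms_slice n (f : 'rV[R]_n.+1 -> R) x : bms (cube n.+1) f ->
  bms (cube n) (fun y => f (rV_cons (x, y))).
Proof. by move=> bf; exact: (bms_sec1 x (bms_cons bf)). Qed.

Lemma bms_slice0 n (f : 'rV[R]_n.+1 -> R) y : bms (cube n.+1) f ->
  bms seg (fun x => f (rV_cons (x, y))).
Proof. by move=> bf; exact: (bms_sec2 y (bms_cons bf)). Qed.

Lemma bms_slice_int n (f : 'rV[R]_n.+1 -> R) : bms (cube n.+1) f ->
  bms seg (fun x => \int[mu n]_y f (rV_cons (x, y))).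
Proof.
move=> bf; exact: (bms_int1 (measurable_seg M) (measurable_cube M n)
  (seg_lty M) (cube_lty M n) (bms_cons bf)).
Qed.

Lemma bms_slice0_int n (f : 'rV[R]_n.+1 -> R) : bms (cube n.+1) f ->
  bms (cube n) (fun y => \int[leb]_x f (rV_cons (x, y))).
Proof.
move=> bf; exact: (bms_int2 (measurable_seg M) (measurable_cube M n)
  (seg_lty M) (cube_lty M n) (bms_cons bf)).
Qed.

Lemma wclass_slice n (f : 'rV[R]_n.+1 -> R) g x : wclass f g ->
  wclass (fun y => f (rV_cons (x, y))) (fun i y => g (lift ord0 i) (rV_cons (x, y))).
Proof.
move=> [bf bg fg]; split=> [|i|i y].
- exact: bms_slice.
- exact: bms_slice.
- move=> a b ab; rewrite !rV_cons_lineS fg//.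
  by apply: eq_Rintegral => t _; rewrite rV_cons_lineS.
Qed.

Lemma wclass_prim0 n (f : 'rV[R]_n.+1 -> R) g y : wclass f g ->
  prim (fun x => f (rV_cons (x, y))) (fun x => g ord0 (rV_cons (x, y))).
Proof.
move=> [_ _ fg] a b ab; rewrite (rV_cons_line0 a) (rV_cons_line0 b) fg//.
by apply: eq_Rintegral => t _; rewrite -rV_cons_line0.
Qed.

Lemma bms_tensor n (u : measurableTypeR R -> R) (v : 'rV[R]_n -> R) : bms seg u ->
  bms (cube n) v -> bms (cube n.+1) (fun z => u (rV_uncons z).1 * v (rV_uncons z).2).
Proof.
move=> [mu_ [K uK] u0] [mv [L vL] v0]; split.
- apply: measurable_funM.
    have h : measurable_fun setT (u \o fst : measurableTypeR R * 'rV[R]_n -> R).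
      by apply: measurableT_comp => //; exact: measurable_fst.
    exact: (measurableT_comp h (@measurable_rV_uncons R n)).
  have h : measurable_fun setT (v \o snd : measurableTypeR R * 'rV[R]_n -> R).
    by apply: measurableT_comp => //; exact: measurable_snd.
  exact: (measurableT_comp h (@measurable_rV_uncons R n)).
- by exists (K * L) => z; rewrite normrM ler_pM.
- move=> z; rewrite -{1}(rV_unconsK z); case: (rV_uncons z) => x y /= h.
  have [xs|xs] := pselect (seg x); last by rewrite u0 ?mul0r.
  by rewrite [v y]v0 ?mulr0// => cy; apply: h; apply/cube_cons.
Qed.

Lemma wclass_int0 n (f : 'rV[R]_n -> R) g i : wclass f g -> \int[mu n]_x g i x = 0.
Proof.
elim: n f g i => [|n IH] f g i fg; first by case: i.
have [bf bg _] := fg; have [j ->|->] := unliftP ord0 i.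
  rewrite (rV_integral (bg _)); under eq_Rintegral do rewrite (IH _ _ _ (wclass_slice _ fg)).
  by rewrite Rintegral_cst// mul0r.
rewrite (rV_integralC (bg _)).
under eq_Rintegral do rewrite (prim_int0 M0 (bms_slice0 _ bf) (bms_slice0 _ (bg _)) (wclass_prim0 _ fg)).
by rewrite Rintegral_cst// mul0r.
Qed.

Lemma wclass_poincare n (f : 'rV[R]_n.+1 -> R) g : wclass f g ->
  \int[mu n.+1]_x (f x ^+ 2) <= (M *+ 2 + 2) ^+ 2 * \int[mu n.+1]_x (g ord0 x ^+ 2).
Proof.
move=> fg; have [bf bg _] := fg.
have b1 := bms_slice0_int (bms_sqr bf); have b2 := bms_slice0_int (bms_sqr (bg ord0)).
rewrite (rV_integralC (bms_sqr bf)) (rV_integralC (bms_sqr (bg ord0))).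
rewrite -(bms_RintegralZ (measurable_cube M n) (cube_lty M n))//.
apply: (bms_le (measurable_cube M n) (cube_lty M n) b1 (bmsZ _ b2)) => y.
exact: (prim_poincare M0 (bms_slice0 _ bf) (bms_slice0 _ (bg _)) (wclass_prim0 _ fg)).
Qed.

Section ehrling_step.
Variables (n : nat) (f : 'rV[R]_n.+1 -> R) (g : 'I_n.+1 -> 'rV[R]_n.+1 -> R).
Hypothesis fg : wclass f g.
Variable w : 'rV[R]_n -> R.
Hypothesis bw : bms (cube n) w.

Let F x := \int[mu n]_y (w y * f (rV_cons (x, y))).
Let G x := \int[mu n]_y (w y * g ord0 (rV_cons (x, y))).

Let bF u : bms (cube n.+1) u ->
  bms (seg `*` cube n) (fun p => w p.2 * u (rV_cons p)).
Proof.
move=> /bms_cons bu; rewrite (_ : (fun p => _) = fun p => u (rV_cons p) * w p.2); last first.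
  by apply/funext => p; rewrite mulrC.
have [mw [K wK] _] := bw; apply: bmsMr => //.
  by apply: measurableT_comp => //; exact: measurable_snd.
by exists K.
Qed.

Lemma bms_slice_mul u : bms (cube n.+1) u ->
  bms seg (fun x => \int[mu n]_y (w y * u (rV_cons (x, y)))).
Proof.
move=> /bF bu; exact: (bms_int1 (measurable_seg M) (measurable_cube M n)
  (seg_lty M) (cube_lty M n) bu).
Qed.

(** A weighted integral over slices, as a function of the first coordinate, again has a derivative;
    by Fubini it is the weighted integral of the first partial derivative. So the one-dimensional
    inequality applies to it. *)
Lemma prim_slice_mul : prim F G.
Proof.
have [bf bg _] := fg; have mc := measurable_cube M n; have cl := cube_lty M n.
move=> a b ab; rewrite /F -RintegralB//; last 2 first.
- exact: (bms_integrable mc cl (bms_sec1 b (bF bf))).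
- exact: (bms_integrable mc cl (bms_sec1 a (bF bf))).
have bu : bms (seg `*` cube n) (fun p => \1_(itv a b `*` setT) p * (w p.2 * g ord0 (rV_cons p))).
  by apply: bms_indic (bF (bg _)); apply: measurableX => //; exact: measurable_itv.
transitivity (\int[mu n]_y \int[leb]_x (\1_(itv a b `*` setT) (x, y) * (w y * g ord0 (rV_cons (x, y))))).
  apply: eq_Rintegral => y _; rewrite -mulrBr (wclass_prim0 y fg ab).
  rewrite -RintegralZl//; last first.
    apply: integrableS (bms_integrable (measurable_seg M) (seg_lty M) (bms_slice0 y (bg _))) => //.
  rewrite Rintegral_mkcond; apply: eq_Rintegral => x _.
  rewrite patchE indicE; have -> : ((x, y) \in itv a b `*` setT) = (x \in itv a b).
    by apply/idP/idP; rewrite !inE /=; [case|].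
  by case: ifP => _; rewrite ?mul1r ?mul0r.
rewrite -(bms_fubini (measurable_seg M) mc (seg_lty M) cl bu) [RHS]Rintegral_mkcond.
apply: eq_Rintegral => x _; rewrite patchE; case: ifPn => xab.
  rewrite /G; apply: eq_Rintegral => y _; rewrite indicE mem_set ?mul1r//.
  by split=> //; exact: set_mem xab.
rewrite (_ : (fun y => _) = cst 0) ?Rintegral_cst ?mul0r//.
apply/funext => y; rewrite indicE memNset ?mul0r// => -[/= xab' _].
by move/negP: xab; apply; rewrite inE.
Qed.

Lemma slice_mul_sqr : \int[leb]_x (G x ^+ 2) <=
  (\int[mu n]_y (w y ^+ 2)) * \int[mu n.+1]_z (g ord0 z ^+ 2).
Proof.
have [_ bg _] := fg; have b0 := bg ord0.
have mc := measurable_cube M n; have cl := cube_lty M n.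
have ms := measurable_seg M; have sl := seg_lty M.
rewrite (rV_integral (bms_sqr b0)) -(bms_RintegralZ ms sl); last exact: bms_slice_int (bms_sqr b0).
apply: (bms_le ms sl (bms_sqr (bms_slice_mul b0)) (bmsZ _ (bms_slice_int (bms_sqr b0)))) => x.
exact: (bms_CS mc cl bw (bms_slice x b0)).
Qed.

(** A cell integral of a slice functional is one linear functional of [f] in the higher dimension.
    The factor [\1_seg] keeps its weight supported in the cube. *)
Lemma slice_mul_cell a h : 0 <= h -> \int[leb]_(x in itv a (a + h)) F x =
  \int[mu n.+1]_z ((\1_(itv a (a + h)) (rV_uncons z).1 * \1_seg (rV_uncons z).1) *
     w (rV_uncons z).2 * f z).
Proof.
move=> h0; have [bf _ _] := fg.
have b1 : bms seg (fun x => \1_(itv a (a + h)) x * \1_seg x : R).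
  apply: bms_indic; first exact: measurable_itv.
  exact: bms_1 (measurable_seg M).
rewrite (rV_integral (bmsM (bms_tensor b1 bw) bf)).
rewrite Rintegral_mkcond; apply: eq_Rintegral => x _; rewrite patchE.
under [RHS]eq_Rintegral do rewrite rV_consK /= -mulrA.
rewrite RintegralZl//; last first.
  exact: (bms_integrable (measurable_cube M n) (cube_lty M n) (bmsM bw (bms_slice x bf))).
rewrite !indicE -/(F x); rewrite -!mulrA; case: ifP => _; rewrite ?mul0r// mul1r.
have [xs|xs] := boolP (x \in seg); first by rewrite mul1r.
have [_ _ F0] := bms_slice_mul bf; rewrite mul0r.
by apply: F0 => xs1; move/negP: xs; apply; rewrite inE.
Qed.

End ehrling_step.

(* An inequality of Ehrling type: the Rellich embedding in quantitative form. *)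
Lemma ehrling n (e : R) : 0 < e -> exists (K : finType) (w : K -> 'rV[R]_n -> R),
  (forall k, bms (cube n) (w k)) /\ forall f g, wclass f g ->
  \int[mu n]_x (f x ^+ 2) <=
    e * \sum_i \int[mu n]_x (g i x ^+ 2) + \sum_k (\int[mu n]_x (w k x * f x)) ^+ 2.
Proof.
elim: n => [|n IH] e0.
  (* In dimension 0 the measure is a Dirac mass, and a single functional recovers [f]. *)
  exists unit, (fun _ => \1_(cube 0)); split=> [_|f g [bf _ _]].
    exact: bms_1 (measurable_cube M 0).
  rewrite big_ord0 mulr0 add0r (bigD1 tt)//= big1 ?addr0; last by case.
  have [mf _ _] := bf.
  have E (u : 'rV[R]_0 -> R) : measurable_fun setT u -> \int[mu 0]_x u x = u 0.
    move=> mu_; rewrite /Rintegral /= integral_dirac//; first by rewrite diracT mul1e.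
    exact/measurable_EFinP.
  rewrite !E//.
    by rewrite indicE mem_set ?mul1r// => i; case: i.
  by apply: measurable_funM => //; exact: measurable_indic (measurable_cube M 0).
  exact: measurable_funX.
have [K [w [bw wP]]] := IH e0.
pose S := \sum_k \int[mu n]_y (w k y ^+ 2).
have S0 : 0 <= S by apply: sumr_ge0 => k _; exact: bms_Rintegral_sqr_ge0.
(* The cell size makes 2 h^2 S at most [e], so the oscillation terms of all slice functionals
   together cost at most [e] times the first partial derivative. *)
pose h := Num.min 1 (e / (2 * S + 1)).
have S1 : 0 < 2 * S + 1 by rewrite ltr_wpDl// mulr_ge0.
have h0 : 0 < h by rewrite lt_min ltr01 divr_gt0.
have hS : 2 * h ^+ 2 * S <= e.
  have h1 : h <= 1 by rewrite ge_min lexx.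
  have h2 : h * (2 * S + 1) <= e by rewrite -ler_pdivlMr// ge_min lexx orbT.
  apply: le_trans h2; rewrite mulrDr mulr1.
  apply: (@le_trans _ _ (h * (2 * S))); last by rewrite lerDl ltW.
  rewrite (_ : 2 * h ^+ 2 * S = h * (h * (2 * S))); last by ring.
  by apply: (ler_wpM2l (ltW h0)); rewrite ler_piMl// mulr_ge0.
pose N := Num.bound (M *+ 2 / h).
have hN : M < - M + h *+ N.
  have : M *+ 2 / h < N%:R.
    by apply: le_lt_trans (archi_boundP _); rewrite ?ler_norm// divr_ge0// ?mulrn_wge0// ltW.
  by rewrite ltr_pdivrMr// mulr_natl mulr2n; lra.
pose I (m : 'I_N) := itv (- M + h *+ m) (- M + h *+ m + h).
pose c := Num.sqrt (2 / h).
have cE : c ^+ 2 = 2 / h by rewrite sqr_sqrtr// divr_ge0// ltW.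
(* One new weight for each old weight and each cell. The factor [c] squares to the coefficient 2/h
   in [prim_cells]. *)
pose w' (km : K * 'I_N) (z : 'rV[R]_n.+1) :=
  c * ((\1_(I km.2) (rV_uncons z).1 * \1_seg (rV_uncons z).1) * w km.1 (rV_uncons z).2).
have bw' km : bms (cube n.+1) (w' km).
  apply: bmsZ; apply: (@bms_tensor _ (fun x => \1_(I km.2) x * \1_seg x)) => //.
  apply: bms_indic; first exact: measurable_itv.
  exact: bms_1 (measurable_seg M).
exists (K * 'I_N)%type, w'; split=> // f g fg; have [bf bg _] := fg.
have ms := measurable_seg M; have sl := seg_lty M.
have mc := measurable_cube M n; have cl := cube_lty M n.
pose F k x := \int[mu n]_y (w k y * f (rV_cons (x, y))).
have bF k : bms seg (F k) := bms_slice_mul (bw k) bf.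
have bG i : bms seg (fun x => \int[mu n]_y (g (lift ord0 i) (rV_cons (x, y)) ^+ 2)).
  exact: bms_slice_int (bms_sqr (bg _)).
(* The induction hypothesis is applied to every slice and integrated over the first coordinate. This
   gives all partial derivatives but the first; the functionals have become functions [F k] of that
   coordinate. *)
apply: (@le_trans _ _ (e * (\sum_i \int[mu n.+1]_z (g (lift ord0 i) z ^+ 2)) +
    \sum_k \int[leb]_x (F k x ^+ 2))).
  rewrite (rV_integral (bms_sqr bf)).
  under [X in _ <= e * X + _]eq_bigr do rewrite (rV_integral (bms_sqr (bg _))).
  rewrite -(bms_Rintegral_sum ms sl _ bG) -(bms_RintegralZ ms sl); last exact: bms_sum.
  rewrite -(bms_Rintegral_sum ms sl _ (fun k => bms_sqr (bF k))) -(bms_RintegralD ms sl); last 2 first.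
  - exact/bmsZ/bms_sum.
  - by apply: bms_sum => k; exact: bms_sqr.
  apply: (bms_le ms sl (bms_slice_int (bms_sqr bf))).
    by apply: bmsD; [exact/bmsZ/bms_sum|apply: bms_sum => k; exact: bms_sqr].
  by move=> x; exact: wP (wclass_slice x fg).
rewrite [X in _ <= e * X + _]big_ord_recl mulrDr [X in _ <= X + _]addrC -addrA lerD2l.
have step k : \int[leb]_x (F k x ^+ 2) <=
    2 * h ^+ 2 * ((\int[mu n]_y (w k y ^+ 2)) * \int[mu n.+1]_z (g ord0 z ^+ 2)) +
    \sum_(m < N) (\int[mu n.+1]_z (w' (k, m) z * f z)) ^+ 2.
  rewrite (bms_seg_itv (bms_sqr (bF k)) (lexx _) hN).
  have pF := prim_slice_mul fg (bw k).
  have bGk := bms_slice_mul (bw k) (bg ord0).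
  apply: le_trans (prim_cells _ _ h0 (bF k) bGk pF) _.
  rewrite addrC -(bms_seg_itv (bms_sqr bGk) (lexx _) hN); apply: lerD.
    have h20 : 0 <= 2 * h ^+ 2 by rewrite mulr_ge0// sqr_ge0.
    exact: (ler_wpM2l h20 (slice_mul_sqr fg (bw k))).
  rewrite mulr_sumr; apply: ler_sum => m _; rewrite (slice_mul_cell fg (bw k) _ (ltW h0)).
  rewrite -cE -exprMn -(bms_RintegralZ (measurable_cube M n.+1) (cube_lty M n.+1)); last first.
    apply: bmsM bf; apply: (@bms_tensor _ (fun x => \1_(I m) x * \1_seg x)) => //.
    apply: bms_indic; first exact: measurable_itv.
    exact: bms_1 (measurable_seg M).
  rewrite le_eqVlt; apply/orP; left; apply/eqP; congr (_ ^+ 2).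
  by apply: eq_Rintegral => z _; rewrite /w' !mulrA.
apply: le_trans (ler_sum _ (fun k _ => step k)) _.
rewrite big_split/= -mulr_sumr -mulr_suml mulrA; apply: lerD.
  by rewrite ler_wpM2r// bms_Rintegral_sqr_ge0.
by rewrite pair_bigA /=; apply: ler_sum => -[k m].
Qed.

End wclass.

Lemma cvg_dist_squeeze (R : realType) (f g : nat -> R) (l : R) : g n @[n --> \oo] --> 0 ->
  (forall n, `|f n - l| <= g n) -> f n @[n --> \oo] --> l.
Proof.
move=> g0 fg; apply/cvgrPdist_le => e e0.
have : \forall n \near \oo, g n < e by exact: (cvgr_lt 0).
by apply: filterS => n /ltW; apply: le_trans; rewrite distrC.
Qed.

Section semi_inner_limits.
Context {R : realType} {V : lmodType R} {P : set V} {B : V -> V -> R}.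
Hypothesis S : semi_inner P B.

Lemma cvg_snorm (u : nat -> V) x : (forall n, P (u n)) -> P x ->
  snorm B (u n - x) @[n --> \oo] --> 0 -> snorm B (u n) @[n --> \oo] --> snorm B x.
Proof.
by move=> Pu Px ux; apply: (cvg_dist_squeeze ux) => n; exact: (snorm_dist S).
Qed.

Lemma cvg_sip (u : nat -> V) x y : (forall n, P (u n)) -> P x -> P y ->
  snorm B (u n - x) @[n --> \oo] --> 0 -> B (u n) y @[n --> \oo] --> B x y.
Proof.
move=> Pu Px Py ux; apply: (@cvg_dist_squeeze _ _ (fun n => snorm B y * snorm B (u n - x))).
  exact: cvg0M.
move=> n; rewrite -(sipBl S)// mulrC; apply: (cauchy_schwarz S) => //.
exact: (smemB S).
Qed.

Lemma snorm0_sip x y : P x -> P y -> snorm B x = 0 -> B x y = 0.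
Proof.
move=> Px Py x0; apply/eqP; rewrite -normr_le0.
by apply: le_trans (cauchy_schwarz S Px Py) _; rewrite x0 mul0r.
Qed.
End semi_inner_limits.

(** * Smooth functions of compact support along lines *)

Section smooth_compact.
Context {R : realType} {n : nat}.
Variable M : R.
Notation cube := (cube M n).
Implicit Types f : 'rV[R]_n -> R.

Lemma is_derive_line f x v (t : R) : differentiable f (x + t *: v) ->
  is_derive t 1 (fun s : R => f (x + s *: v)) ('D_v f (x + t *: v)).
Proof.
move=> df; have E : (fun h : R => h^-1 *: (((fun s : R => f (x + s *: v)) \o shift t) (h *: (1 : R))
      - f (x + t *: v))) =
    (fun h : R => h^-1 *: ((f \o shift (x + t *: v)) (h *: v) - f (x + t *: v))).
  apply/funext => h /=; congr (_ *: (f _ - _)).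
  by rewrite scalerDl [h *: (1 : R)]mulr1 addrCA.
apply: DeriveDef; first by rewrite /derivable E; exact: diff_derivable.
by rewrite /derive E.
Qed.

Lemma partial_out f i x : ~ closure [set y | f y != 0] x -> partial i f x = 0.
Proof.
move=> xf; rewrite /partial.
have nf : {near x, f =1 cst 0}.
  have : open (~` closure [set y | f y != 0]) by apply: closed_openC; exact: closed_closure.
  move=> oC; have : nbhs x (~` closure [set y | f y != 0]) by exact: open_nbhs_nbhs.
  apply: filterS => y yf.
  by apply/eqP/negPn/negP => y0; apply: yf; exact: subset_closure.
by rewrite (near_eq_derive _ nf) derive_cst.
Qed.

Lemma continuous_bms f : continuous f -> (forall x, ~ cube x -> f x = 0) -> bms cube f.
Proof.
move=> cf f0; split=> //; first exact: continuous_measurable_rV.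
have /compact_bounded[K [_ KP]] : compact (f @` cube).
  by apply: continuous_compact; [exact: continuous_subspaceT|exact: cbox_compact].
exists (`|K| + 1) => x; have [xc|xc] := pselect (cube x); last by rewrite f0 ?normr0// addr_ge0.
by apply: KP; [rewrite (le_lt_trans (ler_norm _))// ltrDl|exists x].
Qed.

Lemma C1_wclass f : (forall x, differentiable f x) -> (forall i, continuous (partial i f)) ->
  closure [set y | f y != 0] `<=` cube -> wclass M f (fun i => partial i f).
Proof.
move=> df cpf sf; have cf : continuous f by move=> x; exact: differentiable_continuous.
split=> [|i|i x a b].
- apply: continuous_bms => // x xc; apply/eqP/negPn/negP => fx; apply: xc; apply: sf.
  exact: subset_closure.
- by apply: continuous_bms => // x xc; apply: partial_out => /sf.
rewrite le_eqVlt => /predU1P[->|ab]; first by rewrite subrr set_itvco0 Rintegral_set0.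
have dF (t : R) : is_derive t 1 (fun s : R => f (x + s *: delta_mx 0 i))
    (partial i f (x + t *: delta_mx 0 i)) by exact: is_derive_line.
have cl : continuous (fun t : R => x + t *: delta_mx 0 i : 'rV[R]_n).
  by move=> t; apply: cvgD; [exact: cvg_cst|apply: cvgZ; [exact: cvg_id|exact: cvg_cst]].
have cF : continuous (fun s : R => f (x + s *: delta_mx 0 i)).
  by move=> t; apply: (@continuous_comp _ _ _ (fun t : R => x + t *: delta_mx 0 i) f); [exact: cl|exact: cf].
have cg : continuous (fun s : R => partial i f (x + s *: delta_mx 0 i)).
  by move=> t; apply: (@continuous_comp _ _ _ (fun t : R => x + t *: delta_mx 0 i) (partial i f)); [exact: cl|exact: cpf].
have ftc := @continuous_FTC2 _ (fun s : R => partial i f (x + s *: delta_mx 0 i))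
  (fun s : R => f (x + s *: delta_mx 0 i)) a b ab.
rewrite /Rintegral integral_itv_bndo_bndc; last first.
  by apply/measurable_EFinP; exact: continuous_measurableT.
rewrite ftc//.
- by apply: continuous_subspaceT.
- split.
  + by move=> t _; have [] := dF t.
  + by apply: cvg_at_right_filter; exact: cF.
  + by apply: cvg_at_left_filter; exact: cF.
- by move=> t _; rewrite derive1E; have [_ ->] := dF t.
Qed.

End smooth_compact.

(** * Integration by parts for test functions *)

Section test_functions.
Context {R : realType} {n : nat}.
Variables (Omega : set 'rV[R]_n) (M : R).
Hypotheses (M0 : 0 <= M) (OM : Omega `<=` cube M n) (oO : open Omega).
Notation mu := (@lebesgue_rV R n).
Notation ip := (sqint_ip mu Omega).
Notation L2mem := (sqint mu Omega).
Implicit Types (phi psi z w g h : 'rV[R]_n -> R).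

Let mO : measurable Omega := open_measurable_rV oO.

Lemma Omega_lty : (mu Omega < +oo)%E.
Proof.
apply: le_lt_trans (cube_lty M n); apply: le_measure => //; rewrite inE//.
exact: measurable_cube.
Qed.

Lemma Rintegral_Omega f : (forall x, ~ Omega x -> f x = 0) ->
  \int[mu]_(x in Omega) f x = \int[mu]_x f x.
Proof.
move=> f0; rewrite Rintegral_mkcond; apply: eq_Rintegral => x _; rewrite patchE.
by case: ifPn => // /negP xO; rewrite f0// => Ox; apply: xO; rewrite inE.
Qed.

Lemma bms_L2 f : bms (cube M n) f -> L2mem f.
Proof.
move=> bf; have [mf _ _] := bf; apply: integrable2_sqint; first exact: measurable_funTS.
apply: integrableS (bms_integrable (measurable_cube M n) (cube_lty M n) (bms_sqr bf)) => //.
Qed.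

Section one_test.
Variable phi : 'rV[R]_n -> R.
Hypothesis tphi : test_fun Omega phi.

Lemma test_diff x : differentiable phi x.
Proof. exact: (tphi.1 [::] x). Qed.

Lemma test_partial_diff i x : differentiable (partial i phi) x.
Proof. exact: (tphi.1 [:: i] x). Qed.

Lemma test_supp : closure [set y | phi y != 0] `<=` Omega.
Proof. by have [_ []] := tphi. Qed.

Lemma test_out x : ~ Omega x -> phi x = 0.
Proof.
by move=> xO; apply/eqP/negPn/negP => px; apply: xO; apply: test_supp; exact: subset_closure.
Qed.

Lemma test_partial_out i x : ~ Omega x -> partial i phi x = 0.
Proof. by move=> xO; apply: partial_out => /test_supp. Qed.

Lemma test_wclass : wclass M phi (fun i => partial i phi).
Proof.
apply: C1_wclass; [exact: test_diff|by move=> i x; exact/differentiable_continuous/test_partial_diff|].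
exact: subset_trans test_supp OM.
Qed.

Lemma test_L2 : L2mem phi.
Proof. by have [bf _ _] := test_wclass; exact: bms_L2. Qed.

Lemma test_partial_L2 i : L2mem (partial i phi).
Proof. by have [_ bg _] := test_wclass; exact: bms_L2. Qed.

End one_test.

(** The product is of class C^1 with support in the cube, so the integral of its partial derivative
    is 0 by [wclass_int0]. *)
Lemma test_by_parts phi psi i : test_fun Omega phi -> test_fun Omega psi ->
  ip phi (partial i psi) = - ip (partial i phi) psi.
Proof.
move=> tphi tpsi.
have pE j x : partial j (fun y => phi y * psi y) x = phi x * partial j psi x + psi x * partial j phi x.
  by rewrite /partial deriveM//; apply: diff_derivable; exact: test_diff.
have dprod x : differentiable (fun y => phi y * psi y) x.
  by apply: differentiableM; exact: test_diff.
have sprod : closure [set y | phi y * psi y != 0] `<=` cube M n.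
  apply: subset_trans (subset_trans (test_supp tphi) OM); apply: closure_subset => y /=.
  by rewrite mulf_eq0 negb_or => /andP[].
have cprod j : continuous (partial j (fun y => phi y * psi y)).
  rewrite (_ : partial j _ = fun x => phi x * partial j psi x + psi x * partial j phi x); last first.
    by apply/funext => x; exact: pE.
  move=> x; apply: differentiable_continuous.
  by apply: differentiableD; apply: differentiableM; (exact: test_diff || exact: test_partial_diff).
have := wclass_int0 M0 i (C1_wclass dprod cprod sprod).
under eq_Rintegral do rewrite pE.
have [bp bpp _] := test_wclass tphi; have [bs bss _] := test_wclass tpsi.
rewrite (bms_RintegralD (measurable_cube M n) (cube_lty M n)); [|exact: bmsM..].
move=> /eqP; rewrite addr_eq0 => /eqP e; rewrite /sqint_ip !Rintegral_Omega//.
- by rewrite e; congr (- _); apply: eq_Rintegral => x _; rewrite mulrC.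
- by move=> x xO; rewrite (test_out tpsi) ?mulr0.
- by move=> x xO; rewrite (test_out tphi) ?mul0r.
Qed.

Lemma test_weak_partial phi i : test_fun Omega phi ->
  is_weak_partial Omega i phi (partial i phi).
Proof.
move=> tphi; split; first exact: test_partial_L2.
by move=> psi tpsi; exact: test_by_parts.
Qed.

Lemma test_funL (a : R) phi psi : test_fun Omega phi -> test_fun Omega psi ->
  test_fun Omega (a *: phi + psi).
Proof.
move=> tphi tpsi.
have E s : foldr partial (a *: phi + psi) s = a *: foldr partial phi s + foldr partial psi s.
  elim: s => //= i s ->; apply/funext => x; rewrite /partial.
  have d1 : derivable (foldr partial phi s) x (delta_mx 0 i).
    exact: (diff_derivable (tphi.1 s x)).
  have d2 : derivable (foldr partial psi s) x (delta_mx 0 i).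
    exact: (diff_derivable (tpsi.1 s x)).
  by have := deriveD (derivableZ (k := a) d1) d2; rewrite (deriveZ a d1).
split=> [s x|].
  by rewrite E; exact: (differentiableD (differentiableZ a (tphi.1 s x)) (tpsi.1 s x)).
have sub : closure [set y | (a *: phi + psi) y != 0] `<=`
    closure [set y | phi y != 0] `|` closure [set y | psi y != 0].
  rewrite -closureU; apply: closure_subset => y /=; apply: contraNP => /not_orP[/negP/negPn/eqP p0].
  by move=> /negP/negPn/eqP s0; rewrite !fctE /= p0 s0 scaler0 addr0.
split; last first.
  by apply: subset_trans sub _ => x [/(test_supp tphi)|/(test_supp tpsi)].
apply: (subclosed_compact _ _ sub); first exact: closed_closure.
by apply: compactU; [have [_ []] := tphi|have [_ []] := tpsi].
Qed.

Lemma test_fun0 : test_fun Omega (0 : 'rV[R]_n -> R).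
Proof.
have E s : foldr partial (0 : 'rV[R]_n -> R) s = 0.
  by elim: s => //= i s ->; apply/funext => x; rewrite /partial derive_cst.
split=> [s x|]; first by rewrite E; exact: differentiable_cst.
rewrite /compactly_supported (_ : [set x | _] = set0); last first.
  by apply/seteqP; split=> y //=; rewrite eqxx.
by rewrite closure0; split=> //; exact: compact0.
Qed.

End test_functions.

Section semi_inner_constructions.
Context {R : realType} {V : lmodType R}.

Lemma semi_inner_sub (P Q : set V) (B : V -> V -> R) : semi_inner P B -> Q `<=` P ->
  Q 0 -> (forall a x y, Q x -> Q y -> Q (a *: x + y)) -> semi_inner Q B.
Proof.
move=> S QP Q0 QL; split=> //.
- by move=> x y /QP ? /QP ?; exact: (sipC S).
- by move=> a x y z /QP ? /QP ? /QP ?; exact: (sipl S).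
- by move=> x /QP; exact: (sip_ge0 S).
Qed.

Lemma semi_innerD (P : set V) (B B' : V -> V -> R) : semi_inner P B -> semi_inner P B' ->
  semi_inner P (fun x y => B x y + B' x y).
Proof.
move=> S S'; split; [exact: (smem0 S)|exact: (smemL S)|..].
- by move=> x y Px Py; rewrite (sipC S)// (sipC S').
- by move=> a x y z Px Py Pz; rewrite (sipl S)// (sipl S')//; ring.
- by move=> x Px; rewrite addr_ge0 ?(sip_ge0 S) ?(sip_ge0 S').
Qed.

Lemma snorm_le_sqr (B B' : V -> V -> R) (C : R) x : 0 <= C -> B x x <= C ^+ 2 * B' x x ->
  snorm B x <= C * snorm B' x.
Proof.
move=> C0 h; rewrite /snorm -[C]ger0_norm// -sqrtr_sqr -sqrtrM ?sqr_ge0//.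
exact: ler_wsqrtr.
Qed.

End semi_inner_constructions.

Lemma Rintegral_sum d (T : measurableType d) (R : realType) (mu : {measure set T -> \bar R})
    (D : set T) (J : Type) (r : seq J) (F : J -> T -> R) : measurable D ->
  (forall j, mu.-integrable D (EFin \o F j)) ->
  \int[mu]_(x in D) \sum_(j <- r) F j x = \sum_(j <- r) \int[mu]_(x in D) F j x.
Proof.
move=> mD iF.
suff [] : mu.-integrable D (EFin \o (fun x => \sum_(j <- r) F j x)) /\
  \int[mu]_(x in D) \sum_(j <- r) F j x = \sum_(j <- r) \int[mu]_(x in D) F j x by [].
elim: r => [|j r [IHi IH]].
  rewrite (_ : (fun x => _) = cst 0); last by apply/funext => x; rewrite big_nil.
  by rewrite big_nil Rintegral_cst// mul0r; split=> //; exact: integrable0.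
rewrite (_ : (fun x => _) = fun x => F j x + \sum_(j <- r) F j x); last first.
  by apply/funext => x; rewrite big_cons.
split; first exact: integrable_EFinD.
by rewrite RintegralD// big_cons IH.
Qed.

Lemma sqint_ae0 d (T : measurableType d) (R : realType) (mu : {measure set T -> \bar R})
    (D : set T) (u : T -> R) : measurable D -> sqint mu D u ->
  {ae mu, forall x, D x -> u x = 0} -> snorm (sqint_ip mu D) u = 0.
Proof.
move=> mD [mu_ _] u0; rewrite /snorm /sqint_ip /Rintegral.
rewrite (_ : (\int[mu]_(t in D) _ = 0)%E) ?sqrtr0//.
rewrite -(@integral0_eq _ _ _ mu D (fun _ => 0%E))//; apply: ae_eq_integral => //.
  by apply/measurable_EFinP; exact: measurable_funM.
by apply: (ae_imp (mu := mu)) u0 => x ux Dx; rewrite ux// mul0r.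
Qed.

(** * Weak derivatives and the Dirichlet form *)

Section sobolev.
Context {R : realType} {n : nat}.
Variables (Omega : set 'rV[R]_n) (M : R).
Hypotheses (M0 : 0 <= M) (OM : Omega `<=` cube M n) (oO : open Omega).
Notation mu := (@lebesgue_rV R n).
Notation ip := (sqint_ip mu Omega).
Notation L2mem := (sqint mu Omega).
Notation wp := (weak_partial Omega).
Notation iwp := (is_weak_partial Omega).
Notation dir := (dirichlet Omega).
Notation H1mem := (fmem (H1 Omega)).
Notation H10mem := (fmem (H10 Omega)).
Implicit Types (phi psi z w g h : 'rV[R]_n -> R).

Let mO : measurable Omega := open_measurable_rV oO.
Let Olty : (mu Omega < +oo)%E := Omega_lty OM oO.
Let S : semi_inner L2mem ip := sqint_semi_inner mu mO.

Lemma weak_partial_uniq i z g h : iwp i z g -> iwp i z h -> snorm ip (g - h) = 0.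
Proof.
move=> [qg gP] [qh hP]; have qgh := smemB S qg qh.
apply: sqint_ae0 => //; apply: test_fun_ae0 => //.
  exact: sqint_integrable.
move=> phi tphi; have tL := test_L2 OM oO tphi.
rewrite -[LHS]/(ip (g - h) phi) (sipBl S)//.
by apply/eqP; rewrite subr_eq0 -eqr_opp; apply/eqP; rewrite -[LHS]gP// -[RHS]hP.
Qed.

Lemma weak_partial_val i z : (exists g, iwp i z g) -> iwp i z (wp i z).
Proof. by move=> [g zg]; exact: (xgetPex 0 (ex_intro _ g zg)). Qed.

Lemma weak_partialL i (a : R) z w g h : L2mem z -> L2mem w -> iwp i z g -> iwp i w h ->
  iwp i (a *: z + w) (a *: g + h).
Proof.
move=> qz qw [qg gP] [qh hP]; split; first exact: (smemL S a qg qh).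
move=> phi tphi; have tL := test_L2 OM oO tphi; have tP := test_partial_L2 OM oO tphi i.
rewrite -[LHS]/(ip (a *: z + w) (partial i phi)) -[X in - X]/(ip (a *: g + h) phi).
rewrite !(sipl S)// -[ip z _]/(Rintegral _ _ _) gP// -[ip w _]/(Rintegral _ _ _) hP//.
by rewrite /sqint_ip; ring.
Qed.

(** Weak partial derivatives are unique up to norm 0, so the form can be computed from any of them
    and not only from the chosen ones. Bilinearity follows. *)
Lemma dirichletE z w (g h : 'I_n -> 'rV[R]_n -> R) : (forall i, iwp i z (g i)) ->
  (forall i, iwp i w (h i)) -> dir z w = \sum_i ip (g i) (h i).
Proof.
move=> zg wh; have zv i : iwp i z (wp i z) by apply: weak_partial_val; exists (g i).
have wv i : iwp i w (wp i w) by apply: weak_partial_val; exists (h i).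
rewrite /dirichlet Rintegral_sum//; last first.
  by move=> i; apply: sqint_integrableM => //; [have [] := zv i|have [] := wv i].
apply: eq_bigr => i _; rewrite -[LHS]/(ip (wp i z) (wp i w)).
have [[q1 _] [q2 _]] := (zv i, wv i); have [[q3 _] [q4 _]] := (zg i, wh i).
have e1 := weak_partial_uniq (zv i) (zg i); have e2 := weak_partial_uniq (wv i) (wh i).
have d1 := snorm0_sip S (smemB S q1 q3) q2 e1; have d2 := snorm0_sip S (smemB S q2 q4) q3 e2.
have /eqP := sipBl S q1 q3 q2; rewrite d1 eq_sym subr_eq0 => /eqP ->.
have /eqP := sipBl S q2 q4 q3; rewrite d2 eq_sym subr_eq0 => /eqP e.
by rewrite (sipC S q3 q2) e (sipC S q4 q3).
Qed.

Lemma dirichlet_semi_inner : semi_inner H1mem dir.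
Proof.
have v z : H1mem z -> forall i, iwp i z (wp i z).
  by move=> [_ zg] i; exact: weak_partial_val (zg i).
split.
- split=> [|i]; first exact: (smem0 S).
  exists 0; split; first exact: (smem0 S).
  move=> phi tphi; rewrite -[LHS]/(ip 0 (partial i phi)) -[X in - X]/(ip 0 phi).
  have tL := test_L2 OM oO tphi; have tP := test_partial_L2 OM oO tphi i.
  by rewrite (sip0l S tL) (sip0l S tP) oppr0.
- move=> a z w mz mw; have [[qz _] [qw _]] := (mz, mw).
  split=> [|i]; first exact: (smemL S a qz qw).
  by exists (a *: wp i z + wp i w); exact: weak_partialL (v _ mz i) (v _ mw i).
- move=> z w mz mw; rewrite (dirichletE (v _ mz) (v _ mw)) (dirichletE (v _ mw) (v _ mz)).
  by apply: eq_bigr => i _; apply: (sipC S); [have [] := v _ mz i|have [] := v _ mw i].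
- move=> a z w y mz mw my; have [[qz _] [qw _]] := (mz, mw).
  have vL i := weak_partialL a qz qw (v _ mz i) (v _ mw i).
  rewrite (dirichletE vL (v _ my)) (dirichletE (v _ mz) (v _ my)) (dirichletE (v _ mw) (v _ my)).
  rewrite mulr_sumr -big_split; apply: eq_bigr => i _.
  by apply: (sipl S); [have [] := v _ mz i|have [] := v _ mw i|have [] := v _ my i].
- move=> z mz; rewrite (dirichletE (v _ mz) (v _ mz)).
  by apply: sumr_ge0 => i _; apply: (sip_ge0 S); have [] := v _ mz i.
Qed.

Definition h1ip z w := ip z w + dir z w.

Lemma L2_sub_semi_inner : semi_inner H1mem ip.
Proof.
by apply: (semi_inner_sub S) => [z []//||]; [exact: smem0 dirichlet_semi_inner|exact: smemL dirichlet_semi_inner].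
Qed.

Lemma H1_semi_inner : semi_inner H1mem h1ip.
Proof. exact: semi_innerD L2_sub_semi_inner dirichlet_semi_inner. Qed.

Notation SD := dirichlet_semi_inner.
Notation S1 := H1_semi_inner.

Lemma H1_normE z : H1mem z -> fnorm (H1 Omega) z = snorm h1ip z.
Proof.
move=> mz; rewrite /= -[Num.sqrt (Rintegral _ _ _)]/(snorm ip z) (sqr_snorm L2_sub_semi_inner)//.
Qed.

Lemma snorm_ip_h1 z : H1mem z -> snorm ip z <= snorm h1ip z.
Proof. by move=> mz; apply: ler_wsqrtr; rewrite lerDl (sip_ge0 SD). Qed.

Lemma snorm_dir_h1 z : H1mem z -> snorm dir z <= snorm h1ip z.
Proof. by move=> mz; apply: ler_wsqrtr; rewrite lerDr (sip_ge0 L2_sub_semi_inner). Qed.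

Lemma test_H1 phi : test_fun Omega phi -> H1mem phi.
Proof.
move=> tphi; have tL := test_L2 OM oO tphi; split=> [|i]; first exact: tL.
by exists (partial i phi); exact: (test_weak_partial M0 OM oO i tphi).
Qed.

Lemma H10P z : H10mem z <-> H1mem z /\ exists phi : nat -> 'rV[R]_n -> R,
  (forall k, test_fun Omega (phi k)) /\ snorm h1ip (phi k - z) @[k --> \oo] --> 0.
Proof.
have E (phi : nat -> 'rV[R]_n -> R) : H1mem z -> (forall k, test_fun Omega (phi k)) ->
    (fun k => fnorm (H1 Omega) (phi k - z)) = (fun k => snorm h1ip (phi k - z)).
  move=> mz tphi; apply/funext => k; rewrite H1_normE//.
  exact: (smemB S1 (test_H1 (tphi k)) mz).
by split=> -[mz [phi [tphi cphi]]]; (split=> //; exists phi; split=> //); move: cphi; rewrite E.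
Qed.

Lemma H10_semi_inner : semi_inner H10mem dir.
Proof.
apply: (semi_inner_sub SD); first by move=> z [].
  apply/H10P; split; first exact: (smem0 S1).
  exists (fun _ => 0); split; first by move=> _; exact: test_fun0.
  by rewrite subrr (snorm0 S1); exact: cvg_cst.
move=> a z w /H10P[mz [phi [tphi cphi]]] /H10P[mw [psi [tpsi cpsi]]].
apply/H10P; split; first exact: (smemL S1 a mz mw).
exists (fun k => a *: phi k + psi k); split.
  by move=> k; exact: test_funL.
apply: (cvg0_squeeze (cvg0D (cvg0M `|a| cphi) cpsi)) => k; rewrite snorm_ge0/=.
rewrite (_ : _ - _ = a *: (phi k - z) + (psi k - w)); last first.
  by rewrite scalerBr opprD addrACA.
have m1 := smemB S1 (test_H1 (tphi k)) mz; have m2 := smemB S1 (test_H1 (tpsi k)) mw.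
by apply: le_trans (snormD S1 (smemZ S1 a m1) m2) _; rewrite (snormZ S1).
Qed.
End sobolev.

Lemma cvg_sqr (R : realType) (f : nat -> R) (l : R) :
  f n @[n --> \oo] --> l -> f n ^+ 2 @[n --> \oo] --> l ^+ 2.
Proof. by move=> fl; exact: (cvgM fl fl). Qed.

(** * Completeness and compactness for H_0^1 *)

Section h10_space.
Context {R : realType} {n : nat}.
Variables (Omega : set 'rV[R]_n) (M : R).
Hypotheses (M0 : 0 <= M) (OM : Omega `<=` cube M n) (oO : open Omega) (n0 : (0 < n)%N).
Notation mu := (@lebesgue_rV R n).
Notation ip := (sqint_ip mu Omega).
Notation L2mem := (sqint mu Omega).
Notation wp := (weak_partial Omega).
Notation iwp := (is_weak_partial Omega).
Notation dir := (dirichlet Omega).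
Notation H1mem := (fmem (H1 Omega)).
Notation H10mem := (fmem (H10 Omega)).
Notation h1ip := (h1ip Omega).
Implicit Types (phi psi z w g h : 'rV[R]_n -> R).

Let mO : measurable Omega := open_measurable_rV oO.
Let Olty : (mu Omega < +oo)%E := Omega_lty OM oO.
Let S : semi_inner L2mem ip := sqint_semi_inner mu mO.
Let SD : semi_inner H1mem dir := dirichlet_semi_inner OM oO.
Let S1 : semi_inner H1mem h1ip := H1_semi_inner OM oO.
Let S10 : semi_inner H10mem dir := H10_semi_inner M0 OM oO.

Lemma test_dirichlet phi : test_fun Omega phi ->
  dir phi phi = \sum_i ip (partial i phi) (partial i phi).
Proof. by move=> tphi; apply: (dirichletE OM oO) => i; exact: (test_weak_partial M0 OM oO i tphi). Qed.

Lemma test_ip phi psi : test_fun Omega phi -> ip psi phi = \int[mu]_x (psi x * phi x).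
Proof.
by move=> tphi; apply: Rintegral_Omega => x xO; rewrite (test_out tphi) ?mulr0.
Qed.

Lemma H10_approx z : H10mem z -> exists phi : nat -> 'rV[R]_n -> R,
  [/\ forall k, test_fun Omega (phi k), snorm h1ip (phi k - z) @[k --> \oo] --> 0,
    snorm ip (phi k - z) @[k --> \oo] --> 0 & snorm dir (phi k - z) @[k --> \oo] --> 0].
Proof.
move=> /(H10P M0 OM oO)[mz [phi [tphi cphi]]]; exists phi.
have m k : H1mem (phi k - z) := smemB S1 (test_H1 M0 OM oO (tphi k)) mz.
split=> //; apply: (cvg0_squeeze cphi) => k; rewrite snorm_ge0/=.
  exact: (snorm_ip_h1 OM oO (m k)).
exact: (snorm_dir_h1 OM oO (m k)).
Qed.

Let C := M *+ 2 + 2.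
Let C0 : 0 <= C. Proof. by rewrite addr_ge0// mulrn_wge0. Qed.

Lemma test_poincare phi : test_fun Omega phi -> snorm ip phi <= C * snorm dir phi.
Proof.
(* Positivity of the dimension supplies a first coordinate, whose partial derivative alone controls
   [phi]. *)
move=> tphi; apply: snorm_le_sqr => //; have wphi := test_wclass OM tphi.
rewrite test_dirichlet// test_ip//; case: n n0 Omega M0 OM oO phi tphi wphi => // m _ O M0' OM' oO' phi tphi wphi.
apply: le_trans (wclass_poincare M0' wphi) _; apply: ler_wpM2l; first exact: sqr_ge0.
rewrite (bigD1 ord0)//= -[leLHS]addr0; apply: lerD.
  rewrite le_eqVlt; apply/orP; left; apply/eqP; symmetry; apply: Rintegral_Omega => x xO.
  by rewrite (test_partial_out tphi) ?mul0r.
by apply: sumr_ge0 => i _; apply: Rintegral_ge0 => x _; rewrite -expr2 sqr_ge0.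
Qed.

Lemma H10_poincare z : H10mem z -> snorm ip z <= C * snorm dir z.
Proof.
move=> hz; have [phi [tphi _ c1 c2]] := H10_approx hz; have [mz _] := hz.
have tH k := test_H1 M0 OM oO (tphi k).
have l1 := cvg_snorm S (fun k => (tH k).1) mz.1 c1.
have l2 := cvg_snorm SD tH mz c2.
have l : C * snorm dir (phi k) - snorm ip (phi k) @[k --> \oo] --> C * snorm dir z - snorm ip z.
  by apply: cvgB => //; apply: cvgM => //; exact: cvg_cst.
by rewrite -subr_ge0; apply: (cvg_ge l) => k; rewrite subr_ge0 test_poincare.
Qed.

(** The functions and their weak derivatives converge in L2, and the defining identity passes to the
    limit because both its sides are inner products with fixed functions. The factor [K] leaves room
    for the constant that compares the H^1 and Dirichlet norms. *)
Lemma H1_complete (u : nat -> 'rV[R]_n -> R) (K : R) : 0 < K -> (forall k, H1mem (u k)) ->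
  (forall k, snorm h1ip (u k.+1 - u k) <= K * 2^-1 ^+ k) ->
  exists2 z, H1mem z & snorm h1ip (u k - z) @[k --> \oo] --> 0.
Proof.
move=> K0 mu_ uP.
have cplt (v : nat -> 'rV[R]_n -> R) : (forall k, L2mem (v k)) ->
    (forall k, snorm ip (v k.+1 - v k) <= K * 2^-1 ^+ k) ->
    exists2 y, L2mem y & snorm ip (v k - y) @[k --> \oo] --> 0.
  move=> qv vP; have [|k|y qy cy] := @sqint_complete _ _ R mu Omega mO Olty (fun k => K^-1 *: v k).
  - by move=> k; exact: (smemZ S).
  - rewrite -scalerBr (snormZ S); last exact: (smemB S).
    rewrite gtr0_norm ?invr_gt0// ler_pdivrMl//; exact: vP.
  exists (K *: y); first exact: (smemZ S).
  rewrite (_ : (fun k => _) = fun k => K * snorm ip (K^-1 *: v k - y)); first exact: cvg0M.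
  apply/funext => k; rewrite -[X in X * _]gtr0_norm// -(snormZ S); last first.
    by apply: (smemB S) => //; exact: (smemZ S).
  by rewrite scalerBr scalerA divff ?gt_eqF// scale1r.
have v k i : iwp i (u k) (wp i (u k)) by apply: weak_partial_val; exact: (mu_ k).2.
have mB k : H1mem (u k.+1 - u k) by exact: (smemB S1).
have vB k l i : iwp i (u k - u l) (wp i (u k) - wp i (u l)).
  have := weak_partialL OM oO (-1) (mu_ l).1 (mu_ k).1 (v l i) (v k i).
  by rewrite !scaleN1r ![- _ + _]addrC.
have [z qz cz] : exists2 y, L2mem y & snorm ip (u k - y) @[k --> \oo] --> 0.
  apply: cplt => [k|k]; first exact: (mu_ k).1.
  by apply: le_trans (uP k); exact: (snorm_ip_h1 OM oO (mB k)).
have ex i : exists y, L2mem y /\ snorm ip (wp i (u k) - y) @[k --> \oo] --> 0.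
  have [|k|y qy cy] := cplt (fun k => wp i (u k)); last by exists y.
    by move=> k; have [] := v k i.
  apply: le_trans (uP k); apply: le_trans (snorm_dir_h1 OM oO (mB k)); apply: ler_wsqrtr.
  rewrite (dirichletE OM oO (vB k.+1 k) (vB k.+1 k)) (bigD1 i)//= lerDl.
  by apply: sumr_ge0 => j _; apply: (sip_ge0 S); have [] := vB k.+1 k j.
have [g gP] := choice ex.
have wz i : iwp i z (g i).
  have [qg cg] := gP i; split=> // phi tphi.
  have tL := test_L2 OM oO tphi; have tP := test_partial_L2 OM oO tphi i.
  have l1 := cvg_sip S (fun k => (mu_ k).1) qz tP cz.
  have l2 := cvg_sip S (fun k => (v k i).1) qg tL cg.
  have e : (fun k => ip (u k) (partial i phi)) = fun k => - ip (wp i (u k)) phi.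
    by apply/funext => k; have [_] := v k i; apply.
  have l3 : - ip (wp i (u k)) phi @[k --> \oo] --> - ip (g i) phi by exact: cvgN.
  by rewrite e in l1; exact: (cvg_unique _ l1 l3).
have mz : H1mem z by split=> // i; exists (g i).
exists z => //.
have vz k i : iwp i (u k - z) (wp i (u k) - g i).
  have := weak_partialL OM oO (-1) qz (mu_ k).1 (wz i) (v k i).
  by rewrite !scaleN1r ![- _ + _]addrC.
have E k : snorm h1ip (u k - z) = Num.sqrt (snorm ip (u k - z) ^+ 2 +
    \sum_i snorm ip (wp i (u k) - g i) ^+ 2).
  rewrite -[LHS]/(Num.sqrt (ip (u k - z) (u k - z) + dir (u k - z) (u k - z))).
  rewrite (sqr_snorm S (smemB S (mu_ k).1 qz)); congr (Num.sqrt (_ + _)).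
  rewrite (dirichletE OM oO (vz k) (vz k)); apply: eq_bigr => i _.
  by rewrite (sqr_snorm S)//; have [] := vz k i.
rewrite (_ : (fun k => _) = fun k => Num.sqrt (snorm ip (u k - z) ^+ 2 +
    \sum_i snorm ip (wp i (u k) - g i) ^+ 2)); last by apply/funext.
have sq0 (a : nat -> R) : a k @[k --> \oo] --> 0 -> a k ^+ 2 @[k --> \oo] --> 0.
  by move=> /cvg_sqr; rewrite expr0n.
suff l : snorm ip (u k - z) ^+ 2 + \sum_i snorm ip (wp i (u k) - g i) ^+ 2 @[k --> \oo] --> 0.
  have := continuous_cvg _ (@sqrt_continuous R 0) l; rewrite sqrtr0; exact.
apply: cvg0D; first exact: sq0.
elim: (index_enum _) => [|i r IH].
  by rewrite (_ : (fun k => _) = fun=> 0); [exact: cvg_cst|apply/funext => k; rewrite big_nil].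
rewrite (_ : (fun k => _) = fun k => snorm ip (wp i (u k) - g i) ^+ 2 +
    \sum_(i <- r) snorm ip (wp i (u k) - g i) ^+ 2); last by apply/funext => k; rewrite big_cons.
by apply: cvg0D => //; apply: sq0; have [] := gP i.
Qed.

Lemma H10_snorm_h1 z : H10mem z -> snorm h1ip z <= (C + 1) * snorm dir z.
Proof.
move=> hz; have [mz _] := hz; have := H10_poincare hz.
have p := snorm_ge0 ip z; have q := snorm_ge0 dir z.
rewrite -(ler_sqr (_ : _ \in Num.nneg)) ?nnegrE ?mulr_ge0// ?addr_ge0// => h.
rewrite -ler_sqr ?nnegrE ?mulr_ge0 ?addr_ge0 ?snorm_ge0// (sqr_snorm S1)// /h1ip.
rewrite -(sqr_snorm S mz.1) -(sqr_snorm SD mz).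
apply: le_trans (lerD h (lexx _)) _; rewrite !exprMn -[X in _ + X <= _]mul1r -mulrDl.
apply: ler_wpM2r; first exact: sqr_ge0.
rewrite (_ : (C + 1) ^+ 2 = C ^+ 2 + 1 + C *+ 2); last by rewrite mulr2n; ring.
by rewrite lerDl mulrn_wge0.
Qed.

(** By the Poincare inequality, geometric increments in the Dirichlet norm are geometric in H^1 up
    to a constant. The limit is approximated by test functions, the k-th being 2^-k close to
    [u k]. *)
Lemma H10_hilbert : hilbert (X := H10 Omega) dir.
Proof.
apply: Hilbert; [exact: S10|by []|].
move=> u hu uP; have mu_ k : H1mem (u k) by have [] := hu k.
have C1 : 0 < C + 1 by rewrite ltr_wpDl.
have [|z mz cz] := H1_complete C1 mu_.
  move=> k; apply: le_trans (H10_snorm_h1 (smemB S10 (hu _) (hu _))) _.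
  by rewrite ler_pM2l.
exists z; last first.
  apply: (cvg0_squeeze cz) => k; rewrite snorm_ge0/=.
  exact: (snorm_dir_h1 OM oO (smemB S1 (mu_ k) mz)).
apply/(H10P M0 OM oO); split=> //.
have ex k : exists phi, test_fun Omega phi /\ snorm h1ip (phi - u k) <= 2^-1 ^+ k.
  have [phi [tphi cphi _ _]] := H10_approx (hu k).
  have : \forall j \near \oo, snorm h1ip (phi j - u k) < 2^-1 ^+ k.
    by apply: (cvgr_lt 0) => //; rewrite exprn_gt0.
  by case=> j _ /(_ j (leqnn j)) /ltW hj; exists (phi j).
have [phi phiP] := choice ex; exists phi; split; first by move=> k; have [] := phiP k.
apply: (cvg0_squeeze (cvg0D (@cvg_geometric0 R) cz)) => k; rewrite snorm_ge0/=.
have [tphi phiu] := phiP k; have tH := test_H1 M0 OM oO tphi.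
apply: le_trans (snorm_trans S1 tH (mu_ k) mz) _.
by rewrite lerD2r.
Qed.

Lemma L2_hilbert : hilbert (X := L2 Omega) ip.
Proof.
apply: Hilbert; [exact: S|by []|].
by move=> u qu uP; exact: (sqint_complete mO Olty).
Qed.

(** All terms are continuous in H^1 and the functionals are finitely many, so the inequality extends
    from test functions by density. *)
Lemma H10_ehrling (e : R) : 0 < e -> exists (K : finType) (w : K -> 'rV[R]_n -> R),
  (forall k, L2mem (w k)) /\ forall z, H10mem z ->
  ip z z <= e * dir z z + \sum_k ip (w k) z ^+ 2.
Proof.
move=> e0; have [K [w [bw wP]]] := ehrling M0 n e0.
have qw k : L2mem (w k) by exact: (bms_L2 oO (bw k)).
exists K, w; split=> // z hz; have [mz _] := hz; have qz := mz.1.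
have [phi [tphi _ c1 c2]] := H10_approx hz.
have tH k := test_H1 M0 OM oO (tphi k).
have l1 := cvg_snorm S (fun k => (tH k).1) qz c1.
have l2 := cvg_snorm SD tH mz c2.
have l3 k := cvg_sip S (fun j => (tH j).1) qz (qw k) c1.
rewrite -(sqr_snorm S)// -(sqr_snorm SD)//.
have l : e * snorm dir (phi j) ^+ 2 + \sum_k ip (w k) (phi j) ^+ 2 - snorm ip (phi j) ^+ 2
   @[j --> \oo] --> e * snorm dir z ^+ 2 + \sum_k ip (w k) z ^+ 2 - snorm ip z ^+ 2.
  apply: cvgB; last by exact: cvg_sqr.
  apply: cvgD; first by apply: cvgM; [exact: cvg_cst|exact: cvg_sqr].
  elim: (index_enum _) => [|k r IH].
    rewrite big_nil (_ : (fun j => _) = fun=> 0); first exact: cvg_cst.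
    by apply/funext => j; rewrite big_nil.
  rewrite big_cons (_ : (fun j => _) = fun j => ip (phi j) (w k) ^+ 2 + \sum_(k <- r) ip (w k) (phi j) ^+ 2).
    apply: cvgD IH; rewrite (sipC S)//; exact: cvg_sqr.
  by apply/funext => j; rewrite big_cons (sipC S)//; exact: (tH j).1.
rewrite -subr_ge0; apply: (cvg_ge l) => j; rewrite subr_ge0.
rewrite (sqr_snorm S) ?(sqr_snorm SD)//; last exact: (tH j).1.
have wphi := test_wclass OM (tphi j).
rewrite test_dirichlet// test_ip//; apply: le_trans (wP _ _ wphi) _.
rewrite le_eqVlt; apply/orP; left; apply/eqP; congr (e * _ + _).
  apply: eq_bigr => i _; symmetry; apply: Rintegral_Omega => x xO.
  by rewrite (test_partial_out (tphi j)) ?mul0r.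
by apply: eq_bigr => k _; rewrite test_ip.
Qed.

(** Rellich's theorem as total boundedness. Sort the unit ball by the values of the finitely many
    functionals of [H10_ehrling], rounded to multiples of [d]. Two elements of one class differ by
    at most 2 in the Dirichlet norm, so their squared L2 distance is at most 4 e^2/8 + #|K| d^2. *)
Lemma H10_net (e : R) : 0 < e -> exists (K : finType) (v : K -> 'rV[R]_n -> R),
  (forall k, H10mem (v k)) /\
  forall z, H10mem z -> snorm dir z <= 1 -> exists k, snorm ip (z - v k) <= e.
Proof.
move=> e0; have e8 : 0 < e ^+ 2 / 8 by rewrite divr_gt0// exprn_gt0.
have [K [w [qw wP]]] := H10_ehrling e8.
(* This makes #|K| d^2 at most e^2/4; the successor keeps the denominator positive. *)
pose d := e / (2 * #|K|.+1%:R); have d0 : 0 < d by rewrite divr_gt0// mulr_gt0.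
pose b := (\sum_k snorm ip (w k)) * C.
have bnd z k : H10mem z -> snorm dir z <= 1 -> `|ip (w k) z| <= b.
  move=> hz z1; apply: le_trans (cauchy_schwarz S (qw k) hz.1.1) _; apply: ler_pM.
  - exact: snorm_ge0.
  - exact: snorm_ge0.
  - by rewrite (bigD1 k)//= lerDl sumr_ge0// => *; exact: snorm_ge0.
  - by apply: le_trans (H10_poincare hz) _; rewrite ler_piMr.
pose N := (Num.truncn (2 * b / d)).+1.
pose cell z : {ffun K -> 'I_N} := [ffun k => inord (Num.truncn ((ip (w k) z + b) / d))].
have cellP z z' : H10mem z -> snorm dir z <= 1 -> H10mem z' -> snorm dir z' <= 1 ->
    cell z = cell z' -> forall k, `|ip (w k) z - ip (w k) z'| <= d.
  move=> hz z1 hz' z1' /ffunP cc k; have := cc k; rewrite !ffunE => /(congr1 (@nat_of_ord _)).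
  have b1 := bnd _ k hz z1; have b2 := bnd _ k hz' z1'.
  have ge y : `|y| <= b -> 0 <= (y + b) / d.
    by rewrite ler_norml => /andP[yb _]; rewrite divr_ge0 ?(ltW d0)// -lerBlDr sub0r.
  have lt y : `|y| <= b -> (Num.truncn ((y + b) / d) < N)%N.
    move=> yb; have /andP[t1 _] := truncn_itv (ge _ yb).
    have yb2 : (y + b) / d <= 2 * b / d.
      rewrite ler_pM2r ?invr_gt0// mulr_natl mulr2n lerD2r.
      exact: le_trans (ler_norm _) yb.
    have /andP[_ t2] := truncn_itv (le_trans (ge _ yb) yb2).
    by rewrite -(ltr_nat R); apply: le_lt_trans t1 _; exact: le_lt_trans yb2 t2.
  rewrite !inordK ?lt// => tt.
  have /andP[p1 p2] := truncn_itv (ge _ b1); have /andP[p3 p4] := truncn_itv (ge _ b2).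
  move: p1 p2; rewrite tt => p1 p2.
  rewrite -(ler_pM2r (_ : 0 < d^-1)) ?invr_gt0// divff ?gt_eqF//.
  rewrite -[X in _ * X]gtr0_norm ?invr_gt0// -normrM mulrBl ler_norml.
  move: p1 p2 p3 p4; rewrite !mulrDl -natr1; clear.
  move: (ip (w k) z / d) (ip (w k) z' / d) (b / d) (_%:R : R) => x1 x2 x3 x4 *.
  by apply/andP; split; lra.
(* Each inhabited class contributes one of its elements as a centre; the empty ones contribute 0. *)
have ex (c : {ffun K -> 'I_N}) : exists y : 'rV[R]_n -> R, H10mem y /\ snorm dir y <= 1 /\
    ((exists z, [/\ H10mem z, snorm dir z <= 1 & cell z = c]) -> cell y = c).
  have [[z [hz z1 zc]]|nc] := pselect (exists z, [/\ H10mem z, snorm dir z <= 1 & cell z = c]).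
    by exists z.
  by exists 0; split; [exact: (smem0 S10)|rewrite (snorm0 S10)].
have [v vP] := choice ex.
exists {ffun K -> 'I_N}, v; split=> [c|z hz z1]; first by have [] := vP c.
exists (cell z); have [hv [v1 /(_ _)vc]] := vP (cell z).
have {}vc : cell (v (cell z)) = cell z by apply: vc; exists z.
set y := v (cell z) in hv v1 vc *.
have hzy := smemB S10 hz hv.
have dzy : dir (z - y) (z - y) <= 4.
  rewrite -(sqr_snorm S10 hzy) (_ : 4 = 2 ^+ 2); last by rewrite -natrX.
  rewrite ler_sqr ?nnegrE ?snorm_ge0//; apply: le_trans (snorm_trans S10 hz (smem0 S10) hv) _.
  rewrite subr0 sub0r (snormN S10 hv); apply: le_trans (lerD z1 v1) _.
  by rewrite -(natrD R 1 1).
have sq : snorm ip (z - y) ^+ 2 <= e ^+ 2.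
  rewrite (sqr_snorm S hzy.1.1); apply: le_trans (wP _ hzy) _.
  apply: (@le_trans _ _ (e ^+ 2 / 8 * 4 + #|K|%:R * d ^+ 2)).
    apply: lerD; first by rewrite ler_wpM2l// ltW.
    rewrite mulr_natl -sumr_const; apply: ler_sum => k _.
    rewrite (sipC S (qw k) hzy.1.1) (sipBl S hz.1.1 hv.1.1 (qw k)) -[leLHS]real_normK ?num_real//.
    rewrite ler_sqr ?nnegrE ?(ltW d0)//.
    rewrite (sipC S hz.1.1 (qw k)) (sipC S hv.1.1 (qw k)).
    by apply: cellP.
  have k1 : (1 : R) <= #|K|.+1%:R by rewrite ler1n.
  have kK : #|K|%:R <= #|K|.+1%:R :> R by rewrite ler_nat.
  have : #|K|%:R * d ^+ 2 <= e ^+ 2 / 4.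
    rewrite /d exprMn exprVn mulrCA ler_pM2l ?exprn_gt0// exprMn invfM.
    rewrite mulrCA (_ : 4 = 2 ^+ 2); last by rewrite -natrX.
    rewrite -[leRHS]mulr1 ler_pM2l ?invr_gt0 ?exprn_gt0//.
    rewrite ler_pdivrMr ?exprn_gt0// mul1r (le_trans kK)// expr2 ler_peMl//.
  move=> h; apply: le_trans (lerD (lexx _) h) _; rewrite -subr_ge0.
  rewrite (_ : _ - _ = e ^+ 2 / 4); last by field.
  by rewrite divr_ge0// sqr_ge0.
by move: sq; rewrite ler_sqr ?nnegrE ?snorm_ge0 ?(ltW e0).
Qed.

End h10_space.

(** * Frictional evolution in Hilbert spaces *)

Lemma le_Rintegral_ae d (T : measurableType d) (R : realType) (mu : {measure set T -> \bar R})
    (D : set T) (f g : T -> R) : measurable D -> mu.-integrable D (EFin \o f) ->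
  mu.-integrable D (EFin \o g) -> {ae mu, forall x, D x -> f x <= g x} ->
  \int[mu]_(x in D) f x <= \int[mu]_(x in D) g x.
Proof.
move=> mD fi gi fg; rewrite -subr_ge0 -RintegralB//.
have ih : mu.-integrable D (EFin \o (fun x => g x - f x)) by exact: integrable_EFinB.
have mh : measurable_fun D (fun x => g x - f x) by apply/measurable_EFinP; exact: measurable_int ih.
suff -> : \int[mu]_(x in D) (g x - f x) = \int[mu]_(x in D) `|g x - f x|.
  by apply: Rintegral_ge0 => x _; exact: normr_ge0.
congr fine; apply: ae_eq_integral => //.
- exact/measurable_EFinP.
- by apply/measurable_EFinP; exact: measurableT_comp.
by apply: (ae_imp (mu := mu)) fg => x fgx Dx; rewrite ger0_norm// subr_ge0 fgx.
Qed.

Lemma is_derive_bound (R : realType) (P : R -> R) (t l e : R) : is_derive t 1 P l -> 0 < e ->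
  exists2 d : R, 0 < d & forall s, `|s - t| < d -> `|P s - P t - (s - t) * l| <= e * `|s - t|.
Proof.
move=> dP e0; have [dv vE] := dP; move: dv; rewrite /derivable => /cvg_ex[l' cl].
have ll' : l' = l by rewrite -vE /derive; symmetry; exact: (cvg_lim (@Rhausdorff R) cl).
move: cl => /cvgrPdist_le/(_ e e0); rewrite ll' => /nbhs_ballP[d /= d0 dB].
exists d => // s sd; have [->|st] := eqVneq s t.
  by rewrite !subrr mul0r subr0 normr0 mulr0.
have h0 : s - t != 0 by rewrite subr_eq0.
have := dB (s - t); rewrite /ball/= sub0r normrN => /(_ sd h0).
rewrite [(s - t) *: (1 : R)]mulr1 subrK -normrN opprB => h.
rewrite -ler_pdivrMr ?normr_gt0// -normf_div; move: h; congr (`|_| <= _).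
by rewrite /GRing.scale/=; field.
Qed.

(** * Products of semi-inner product spaces *)

Section semi_inner_pair.
Context {R : realType} {V W : lmodType R} {P : set V} {Q : set W}.
Context {B : V -> V -> R} {B' : W -> W -> R}.
Hypotheses (S : semi_inner P B) (S' : semi_inner Q B').

(** [mazur] applied in a product yields the same weights for both components, such as the
    derivatives of state and control. It also expresses the H^1 norm of a control as the norm of a
    pair. *)
Definition pair_ip (x y : V * W) := B x.1 y.1 + B' x.2 y.2.

Lemma pair_semi_inner : semi_inner (P `*` Q) pair_ip.
Proof.
split.
- by split; [exact: smem0 S|exact: smem0 S'].
- by move=> a x y [? ?] [? ?]; split; [exact: (smemL S)|exact: (smemL S')].
- by move=> x y [? ?] [? ?]; rewrite /pair_ip (sipC S)// (sipC S').
- by move=> a x y z [? ?] [? ?] [? ?]; rewrite /pair_ip/= (sipl S)// (sipl S')//; ring.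
- by move=> x [? ?]; rewrite addr_ge0 ?(sip_ge0 S) ?(sip_ge0 S').
Qed.

Lemma snorm_fst x : P x.1 -> Q x.2 -> snorm B x.1 <= snorm pair_ip x.
Proof. by move=> _ q; apply: ler_wsqrtr; rewrite lerDl (sip_ge0 S'). Qed.

Lemma snorm_snd x : P x.1 -> Q x.2 -> snorm B' x.2 <= snorm pair_ip x.
Proof. by move=> p _; apply: ler_wsqrtr; rewrite lerDr (sip_ge0 S). Qed.

Lemma snorm_pair_le x : P x.1 -> Q x.2 -> snorm pair_ip x <= snorm B x.1 + snorm B' x.2.
Proof.
move=> p q; rewrite -ler_sqr ?nnegrE ?addr_ge0 ?snorm_ge0//.
rewrite (sqr_snorm pair_semi_inner)// sqrrD (sqr_snorm S)// (sqr_snorm S')// /pair_ip.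
by rewrite addrAC lerDl mulrn_wge0// mulr_ge0 ?snorm_ge0.
Qed.

Lemma cvx_pair N l (x : nat -> V) (y : nat -> W) :
  cvx N l (fun k => (x k, y k)) = (cvx N l x, cvx N l y).
Proof.
rewrite /cvx; elim: (index_enum _) => [|k r IH]; first by rewrite !big_nil.
by rewrite !big_cons IH.
Qed.
End semi_inner_pair.

(** A bounded sequence converges along an ultrafilter. Handling many sequences with one ultrafilter
    only takes intersections of its members, where subsequences would have to be nested. *)
Lemma ultra_bounded (R : realType) (U : set_system nat) (x : nat -> R) (C d : R) :
  UltraFilter U -> (forall k, `|x k| <= C) -> 0 < d ->
  exists2 A, U A & forall k l, A k -> A l -> `|x k - x l| <= d.
Proof.
move=> uU xC d0; have pU := @ultra_proper _ _ uU.
have cpt : compact `[(- C), C]%classic by exact: segment_compact.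
have xU : U [set k | `[(- C), C]%classic (x k)].
  by apply: filterE => k /=; rewrite in_itv/= -ler_norml; exact: xC.
have [p [_ clp]] := cpt (x @ U) _ xU.
have d2 : 0 < d / 2 by rewrite divr_gt0.
exists [set k | `|x k - p| <= d / 2]; last first.
  move=> k l /= kp lp; rewrite (_ : x k - x l = (x k - p) - (x l - p)); last by ring.
  apply: le_trans (ler_normB _ _) _; rewrite (_ : d = d / 2 + d / 2); last by field.
  exact: lerD.
have [//|nU] := in_ultra_setVsetC [set k | `|x k - p| <= d / 2] uU.
have c1 : (x @ U) [set y | d / 2 < `|y - p|].
  apply: (@filterS _ U _ _ _ _ nU) => k /= /negP.
  by rewrite -real_ltNge ?num_real.
have [y [/= y1]] := clp _ _ c1 (nbhsx_ballx p _ d2).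
by rewrite /ball/= distrC => y2; have := lt_trans y1 y2; rewrite ltxx.
Qed.

(** * Differentiability of curves almost everywhere *)

Section AC_differentiable.
Context {R : realType} (X : fspace R) (B : X -> X -> R).
Hypothesis H : hilbert B.
Variable T : R.
Hypothesis T0 : 0 < T.
Notation mu := (@lebesgue_measure R).
Notation S := (hinner H).
Notation N := (snorm B).
Notation I := (`]0, T[%classic : set (measurableTypeR R)).
Notation AC := (AC B T).

Let mI : measurable I := mI T.
Let finI : (mu I < +oo)%E := finI T.

Lemma Rintegral_cut (k t : R) : 0 <= t <= T -> \int[mu]_(r in I) (cut t r * k) = t * k.
Proof.
move=> /andP[t0 tT].
transitivity (\int[mu]_(r in (`]0, t[%classic : set (measurableTypeR R))) cst k r).
  rewrite [LHS]Rintegral_mkcond [RHS]Rintegral_mkcond; apply: eq_Rintegral => r _.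
  rewrite !patchE /cut !mem_setE !in_itv/=; case: (ltP r t) => rt; rewrite ?andbT ?andbF.
    by rewrite (lt_le_trans rt tT) andbT; case: ifP => //; rewrite mul1r.
  by case: ifP => //; rewrite mul0r.
rewrite Rintegral_cst//.
rewrite mulrC /= lebesgue_measure_itv/= lte_fin.
by case: ltP => [_|t0'] /=; rewrite ?subr0// (le_anti (introT andP (conj t0' t0))).
Qed.

Lemma AC_affine x : fmem X x -> AC (fun t => t *: x) (fun=> x).
Proof.
move=> mx; split.
- by move=> t _; exact: (smemZ S).
- by rewrite scale0r.
- split; first exact: (sm_cst H mI mx).
  exact: (sqint_cst mI finI).
by move=> t y tT my; rewrite (sipZl S)// Rintegral_cut.
Qed.

(** Scalar Lebesgue differentiation is applied to the norms of [dc - x j], for a sequence [x] near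
    all values of [dc]. With [x j] within e/3 of [dc t], the integral of that norm over (s, t) is at
    most 2e/3 times t - s, and replacing [x j] by [dc t] costs another e/3. *)
Lemma AC_diff c dc : AC c dc -> {ae mu, forall t, I t -> forall e, 0 < e ->
  exists2 d, 0 < d & forall s, 0 <= s -> t - d < s -> s < t ->
    N (c t - c s - (t - s) *: dc t) <= e * (t - s)}.
Proof.
move=> ac; have [mc _ qd _] := ac; have [_ [x [mx _ dx]]] := sm_pettis H qd.1.
have aj j : AC (fun t => c t - t *: x j) (fun t => dc t - x j).
  exact: (AC_sub H ac (AC_affine (mx j))).
have ih j : mu.-integrable I (EFin \o (fun r => N (dc r - x j))).
  by have [_ _ q _] := aj j; exact: (sqsm_norm_integrable mI finI q).
apply: (ae_imp (mu := mu)) (ae_forall (mu := mu) (fun j => primitive_ae (ih j))).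
move=> t dt It e e0; have [t0 tT] : 0 < t /\ t < T by apply/andP; move: It; rewrite /= in_itv.
have e3 : 0 < e / 3 by rewrite divr_gt0.
have [j hj] := dx t It _ e3.
have [d d0 dP] := is_derive_bound (dt j It) e3; exists d => // s s0 sd st.
have ts : 0 < t - s by rewrite subr_gt0.
have tT' : 0 <= t <= T by rewrite !ltW.
have sT' : 0 <= s <= T by rewrite s0 (le_trans (ltW st) (ltW tT)).
have mdt := sm_mem qd.1 It; have m1 := smemB S (mc t tT') (mc s sT').
have m2 := smemZ S (t - s) (mx j); have m3 := smemZ S (t - s) mdt.
apply: le_trans (snorm_trans S m1 m2 m3) _.
have -> : N ((t - s) *: x j - (t - s) *: dc t) = (t - s) * N (dc t - x j).
  rewrite -scalerBr (snormZ S); last exact: (smemB S).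
  by rewrite gtr0_norm// (snormBC S).
have h1 := AC_le H (aj j) s0 (ltW st) (ltW tT).
rewrite (_ : c t - t *: x j - (c s - s *: x j) = c t - c s - (t - s) *: x j) in h1; last first.
  by rewrite scalerBl !opprD !opprK addrACA.
apply: le_trans (lerD h1 (lexx _)) _; rewrite RintegralB_cut//.
have sdt : `|s - t| < d by rewrite distrC gtr0_norm// ltrBlDr -ltrBlDl.
have := dP s sdt; rewrite [`|s - t|]distrC (gtr0_norm ts) ler_norml => /andP[h2 _].
have h3 : (t - s) * N (dc t - x j) <= (t - s) * (e / 3) by rewrite ler_pM2l// ltW.
move: h2 h3; set p := \int[mu]_(_ in I) _; set q := \int[mu]_(_ in I) _.
by set z := N _; clearbody p q z => h2 h3; lra.
Qed.

End AC_differentiable.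

(** * An energy estimate without a chain rule *)

Section AC_energy.
Context {R : realType} (X : fspace R) (B : X -> X -> R).
Hypothesis H : hilbert B.
Variable T : R.
Hypothesis T0 : 0 < T.
Notation mu := (@lebesgue_measure R).
Notation S := (hinner H).
Notation N := (snorm B).
Notation I := (`]0, T[%classic : set (measurableTypeR R)).
Notation AC := (AC B T).

Let mI : measurable I := mI T.
Let finI : (mu I < +oo)%E := finI T.

Lemma Rintegral_norm_le u : sqsm B I u -> \int[mu]_(r in I) N (u r) <= Num.sqrt T * snorm (ipI B I) u.
Proof.
move=> qu; have := cutB_norm_le H qu (lexx 0) (ltW T0) (lexx T); rewrite subr0; apply: le_trans.
rewrite le_eqVlt; apply/orP; left; apply/eqP; apply: eq_Rintegral => r /set_mem Ir.
by rewrite (cutT Ir) (cut0 Ir) subr0 mul1r.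
Qed.

Lemma snorm_ipI_sup u (C : R) : sqsm B I u -> (forall t, I t -> N (u t) <= C) -> 0 <= C ->
  snorm (ipI B I) u <= Num.sqrt T * C.
Proof.
move=> qu uC C0; rewrite (ipI_snorm H qu) -[leLHS]/(Num.sqrt (\int[mu]_(t in I) (N (u t) * N (u t)))).
rewrite -[C]ger0_norm// -sqrtr_sqr -(sqrtrM _ (ltW T0)); have TT : 0 <= T <= T by rewrite lexx ltW.
apply: ler_wsqrtr; rewrite -(Rintegral_cut (C ^+ 2) TT).
apply: le_Rintegral => //.
- exact: (sqint_integrableM mI qu.2 qu.2).
- by apply: cut_integrable; exact: (integrable_cst mI finI).
by move=> t It; rewrite (cutT It) mul1r; apply: ler_pM; rewrite ?snorm_ge0//; exact: uC.
Qed.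

Lemma half_sqr_le u v : fmem X u -> fmem X v -> 2^-1 * N u ^+ 2 - 2^-1 * N v ^+ 2 <= B (u - v) u.
Proof.
move=> mu_ mv; have := sip_ge0 S (smemB S mu_ mv).
rewrite (sip_sqrB S)// (sipBl S)// !(sqr_snorm S)// (sipC S mv mu_); lra.
Qed.

(* Summation over a fine partition, where [1/2 |u|^2 - 1/2 |v|^2 <= <u - v, u>]
   replaces the chain rule. *)
Lemma energy_le w dw (d : R) : AC w dw -> 0 <= d ->
  {ae mu, forall r, I r -> B (w r) (dw r) <= d * N (dw r)} ->
  forall t, 0 <= t <= T -> N (w t) ^+ 2 <= 2 * (d * \int[mu]_(r in I) N (dw r)).
Proof.
move=> aw d0 aeE t /andP[t0 tT]; have [mw w0 qw wE] := aw.
have iN := sqsm_norm_integrable mI finI qw.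
set L := \int[mu]_(r in I) N (dw r).
have L0 : 0 <= L by apply: Rintegral_ge0 => r _; exact: snorm_ge0.
suff key e : 0 < e -> 2^-1 * N (w t) ^+ 2 <= (d + e) * L.
  have : 2^-1 * N (w t) ^+ 2 <= d * L.
    apply/ler_addgt0Pr => e e0; have e1 : 0 < e / (L + 1) by rewrite divr_gt0// ltr_wpDl.
    apply: le_trans (key _ e1) _; rewrite mulrDl lerD2l mulrAC ler_pdivrMr ?ltr_wpDl//.
    by rewrite ler_pM2l// lerDl.
  move: (N (w t) ^+ 2) (d * L) => x y; lra.
move=> e0; set q := snorm (ipI B I) dw.
have q0 : 0 <= q by exact: snorm_ge0.
(* By the Hoelder bound of [AC_holder], [w] varies by at most [e] over times no longer than this. *)
pose h1 := (e / (q + 1)) ^+ 2.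
have q1 : 0 < q + 1 by rewrite ltr_wpDl.
have h10 : 0 < h1 by rewrite exprn_gt0// divr_gt0.
pose n := (Num.bound (t / h1)).+1.
pose h := t / n%:R.
have n0 : 0 < n%:R :> R by rewrite ltr0n.
have h0 : 0 <= h by rewrite divr_ge0.
have hh1 : h <= h1.
  rewrite /h ler_pdivrMr// mulrC -ler_pdivrMr//.
  have th : 0 <= t / h1 := divr_ge0 t0 (ltW h10).
  by apply: le_trans (ltW (archi_boundP th)) _; rewrite ler_nat.
have osc a b : 0 <= a -> a <= b -> b <= T -> b - a <= h -> N (w b - w a) <= e.
  move=> a0 ab bT bah; apply: le_trans (AC_holder H aw a0 ab bT) _.
  apply: (@le_trans _ _ (e / (q + 1) * q)).
    apply: ler_wpM2r => //; rewrite -[leRHS](ger0_norm (divr_ge0 (ltW e0) (ltW q1))) -sqrtr_sqr.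
    by apply: ler_wsqrtr; exact: le_trans bah hh1.
  by rewrite mulrAC ler_pdivrMr// ler_pM2l// lerDl.
have iG s : mu.-integrable I (EFin \o (fun r => cut s r * ((d + e) * N (dw r)))).
  by apply: cut_integrable; exact: integrable_EFinZ.
have step i : (i <= n)%N ->
    2^-1 * N (w (h * i%:R)) ^+ 2 <= \int[mu]_(r in I) (cut (h * i%:R) r * ((d + e) * N (dw r))).
  elim: i => [|i IH] lin.
    rewrite mulr0 w0 (snorm0 S) expr0n/= mulr0; apply: Rintegral_ge0 => r _.
    by rewrite mulr_ge0 ?cut_ge0// mulr_ge0 ?snorm_ge0// addr_ge0// ltW.
  have {}IH := IH (ltnW lin); set a := h * i%:R in IH *; set b := h * i.+1%:R.
  have ba : b - a = h by rewrite /a /b -natr1 mulrDr mulr1 addrAC subrr add0r.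
  have a0 : 0 <= a by rewrite mulr_ge0.
  have ab : a <= b by rewrite -subr_ge0 ba.
  have bT : b <= T.
    apply: le_trans tT; rewrite /b /h mulrAC ler_pdivrMr//.
    by apply: ler_wpM2l => //; rewrite ler_nat.
  have aT : 0 <= a <= T by rewrite a0 (le_trans ab bT).
  have bT' : 0 <= b <= T by rewrite bT (le_trans a0 ab).
  have ma := mw a aT; have mb := mw b bT'.
  suff hb : B (w b - w a) (w b) <= \int[mu]_(r in I) (cut b r * ((d + e) * N (dw r))) -
      \int[mu]_(r in I) (cut a r * ((d + e) * N (dw r))).
    have := le_trans (half_sqr_le mb ma) hb; rewrite lerBlDr => /le_trans; apply.
    by apply: le_trans (lerD (lexx _) IH) _; rewrite subrK.
  rewrite -RintegralB_cut; last exact: integrable_EFinZ.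
  have iB := sqsm_ip_integrable H qw mb.
  rewrite (sipBl S)// !wE// -RintegralB_cut//; apply: le_Rintegral_ae => //.
  - exact: cutB_integrable.
  - by apply: cutB_integrable; exact: integrable_EFinZ.
  apply: (ae_imp (mu := mu)) aeE => r wr Ir; have {}wr := wr Ir.
  have [r0 rT] : 0 < r /\ r < T by apply/andP; move: Ir; rewrite /= in_itv.
  rewrite (cutBE r ab); case: (boolP (a <= r < b)) => [/andP[ar rb]|_]; last by rewrite !mul0r.
  rewrite !mul1r.
  have mr : fmem X (w r) by apply: mw; rewrite !ltW.
  have mdr := sm_mem qw.1 Ir.
  (* The right end of the cell is exchanged for the current time, where the hypothesis applies; the
     error is at most [e] times the norm of [dw r]. *)
  have -> : B (dw r) (w b) = B (w r) (dw r) + B (dw r) (w b - w r).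
    by rewrite (sipBr S)// (sipC S mr mdr) addrC subrK.
  rewrite mulrDl; apply: lerD => //; apply: le_trans (ler_norm _) _.
  apply: le_trans (cauchy_schwarz S mdr (smemB S mb mr)) _; rewrite mulrC.
  apply: ler_wpM2r; first exact: snorm_ge0.
  apply: osc => //; [exact: ltW|exact: ltW|].
  by rewrite -ba; apply: lerB.
have := step n (leqnn n); rewrite /h divfK ?gt_eqF// => /le_trans; apply.
rewrite /L -RintegralZl//; apply: le_Rintegral => //; first exact: integrable_EFinZ.
move=> r _; rewrite -[leRHS]mul1r; apply: ler_wpM2r; last exact: le_trans (ler_norm _) (cut_le1 _ _).
by rewrite mulr_ge0 ?snorm_ge0// addr_ge0// ltW.
Qed.

End AC_energy.

(** * A priori estimates for solutions *)

Section friction.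
Context {R : realType} (X Y : fspace R) (BX : X -> X -> R) (BY : Y -> Y -> R).
Hypotheses (HX : hilbert BX) (HY : hilbert BY).
Variable T : R.
Hypothesis T0 : 0 < T.
Notation mu := (@lebesgue_measure R).
Notation SX := (hinner HX).
Notation SY := (hinner HY).
Notation NX := (snorm BX).
Notation NY := (snorm BY).
Notation I := (`]0, T[%classic : set (measurableTypeR R)).

Let mI : measurable I := mI T.
Let finI : (mu I < +oo)%E := finI T.

(* [p] plays the role of the L2 pairing, [D] that of the dissipation; the last
   field expresses the compactness of the embedding of [X] in the dual of [Y]. *)
Record friction (p : Y -> X -> R) (D : X -> R) (K C : R) : Prop := Friction {
  fr_K : 0 <= K ;
  fr_pl : forall a y z v, fmem Y y -> fmem Y z -> fmem X v -> p (a *: y + z) v = a * p y v + p z v ;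
  fr_pr : forall a y v w, fmem Y y -> fmem X v -> fmem X w -> p y (a *: v + w) = a * p y v + p y w ;
  fr_pB : forall y v, fmem Y y -> fmem X v -> `|p y v| <= K * NY y * NX v ;
  fr_D0 : forall v, fmem X v -> 0 <= D v ;
  fr_DZ : forall a v, fmem X v -> D (a *: v) = `|a| * D v ;
  fr_DD : forall v w, fmem X v -> fmem X w -> D (v + w) <= D v + D w ;
  fr_DB : forall v, fmem X v -> D v <= C * NX v ;
  fr_net : forall e, 0 < e -> exists (J : finType) (z : J -> X), (forall j, fmem X (z j)) /\
    forall v, fmem X v -> NX v <= 1 -> exists j, forall y, fmem Y y -> `|p y (v - z j)| <= e * NY y }.

Variables (p : Y -> X -> R) (D : X -> R) (K C : R).
Hypothesis F : friction p D K C.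

Lemma fr_pl0 v : fmem X v -> p 0 v = 0.
Proof.
move=> mv; have := fr_pl F 1 (smem0 SY) (smem0 SY) mv.
by rewrite scale1r addr0 mul1r => /eqP; rewrite -subr_eq0 opprD addrA subrr sub0r oppr_eq0 => /eqP.
Qed.

Lemma fr_plZ a y v : fmem Y y -> fmem X v -> p (a *: y) v = a * p y v.
Proof.
by move=> my mv; have := fr_pl F a my (smem0 SY) mv; rewrite addr0 fr_pl0// addr0.
Qed.

Lemma fr_plD y z v : fmem Y y -> fmem Y z -> fmem X v -> p (y + z) v = p y v + p z v.
Proof. by move=> my mz mv; have := fr_pl F 1 my mz mv; rewrite scale1r mul1r. Qed.

Lemma fr_plB y z v : fmem Y y -> fmem Y z -> fmem X v -> p (y - z) v = p y v - p z v.
Proof.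
move=> my mz mv; rewrite fr_plD//; last exact: (smemN SY).
by rewrite -scaleN1r fr_plZ// mulN1r.
Qed.

Lemma fr_pr0 y : fmem Y y -> p y 0 = 0.
Proof.
move=> my; have := fr_pr F 1 my (smem0 SX) (smem0 SX).
by rewrite scale1r addr0 mul1r => /eqP; rewrite -subr_eq0 opprD addrA subrr sub0r oppr_eq0 => /eqP.
Qed.

Lemma fr_prZ a y v : fmem Y y -> fmem X v -> p y (a *: v) = a * p y v.
Proof.
by move=> my mv; have := fr_pr F a my mv (smem0 SX); rewrite addr0 fr_pr0// addr0.
Qed.

Lemma fr_prD y v w : fmem Y y -> fmem X v -> fmem X w -> p y (v + w) = p y v + p y w.
Proof. by move=> my mv mw; have := fr_pr F 1 my mv mw; rewrite scale1r mul1r. Qed.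

Lemma fr_prB y v w : fmem Y y -> fmem X v -> fmem X w -> p y (v - w) = p y v - p y w.
Proof.
move=> my mv mw; rewrite fr_prD//; last exact: (smemN SX).
by rewrite -scaleN1r fr_prZ// mulN1r.
Qed.

Definition stable y x := forall v, fmem X v -> p y v - BX x v <= D v.

Definition solution (c dc : R -> X) (b db : R -> Y) := [/\ AC BX T c dc, AC BY T b db
  & {ae mu, forall t, I t -> stable (b t) (c t) /\
       D (dc t) <= p (b t) (dc t) - BX (c t) (dc t)}].

(** Stability is a closed condition and both curves are continuous. Having it at every time lets the
    next lemma use it at arbitrary times before [t]. *)
Lemma solution_stable c dc b db : solution c dc b db ->
  forall t, 0 <= t <= T -> stable (b t) (c t).
Proof.
move=> [ac ab ae] t tT v mv; apply/ler_addgt0Pr => e e0.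
have cb := AC_ccont HY ab; have cc := AC_ccont HX ac.
have e2 : 0 < e / 2 by rewrite divr_gt0.
have k1 : 0 < K * NX v + 1 by rewrite ltr_wpDl// mulr_ge0 ?snorm_ge0// (fr_K F).
have e3 : 0 < e / 2 / (K * NX v + 1) by rewrite divr_gt0.
have [d1 d10 dP1] := ccont_ip HX cc mv tT e2.
have [d2 d20 dP2] := cb.2 t tT _ e3.
have d0 : 0 < Num.min d1 d2 by rewrite lt_min d10.
have [s [Is [st _] s12]] := ae_dense T0 ae tT d0; move: s12; rewrite lt_min => /andP[sd1 sd2].
have sT : 0 <= s <= T by move: Is; rewrite /= in_itv/= => /andP[? ?]; rewrite !ltW.
have h1 := dP1 s sT sd1; have h2 := dP2 s sT sd2.
have mbs := cb.1 s sT; have mbt := cb.1 t tT.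
have h3 : `|p (b s) v - p (b t) v| <= e / 2.
  rewrite -fr_plB//; apply: le_trans (fr_pB F (smemB SY mbs mbt) mv) _.
  apply: (@le_trans _ _ (e / 2 / (K * NX v + 1) * (K * NX v))).
    rewrite mulrAC mulrC; apply: ler_wpM2r; last exact: ltW.
    by rewrite mulr_ge0 ?snorm_ge0// (fr_K F).
  by rewrite mulrAC ler_pdivrMr// ler_pM2l// lerDl.
have := st v mv; move: h1 h3; rewrite ltr_norml ler_norml => /andP[? ?] /andP[? ?] ?; lra.
Qed.

(** Stability at an earlier s tested with v = [dc t], together with the energy inequality at [t],
    gives <c(t) - c(s), v> at most p(b(t) - b(s), v). Division by t - s and differentiability at [t]
    leave |v|^2 at most K |b'(t)| |v|. *)
Lemma solution_rate_ae c dc b db : solution c dc b db ->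
  {ae mu, forall t, I t -> NX (dc t) <= K * NY (db t)}.
Proof.
move=> sol; have st := solution_stable sol; have [ac ab ae] := sol.
have [mc _ qdc _] := ac; have [mb _ qdb _] := ab.
apply: (ae_imp (mu := mu)) (ae_and ae (ae_and (AC_diff HX ac) (AC_diff HY ab))).
move=> t [ht [hc hb]] It; have [_ en] := ht It.
have [t0 tT] : 0 < t /\ t < T by apply/andP; move: It; rewrite /= in_itv.
have tT' : 0 <= t <= T by rewrite !ltW.
have mdc := sm_mem qdc.1 It; have mdb := sm_mem qdb.1 It.
set n := NX (dc t); set m := NY (db t).
have n0 : 0 <= n by exact: snorm_ge0.
have m0 : 0 <= m by exact: snorm_ge0.
have K0 := fr_K F.
(* The remainder of the state contributes [e], that of the control [K * e]. *)
suff key e : 0 < e -> n * n <= (K * m + (K + 1) * e) * n.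
  have [->|nz] := eqVneq n 0; first by rewrite mulr_ge0.
  have np : 0 < n by rewrite lt_neqAle eq_sym nz.
  apply/ler_addgt0Pr => e e0; have e1 : 0 < e / (K + 1) by rewrite divr_gt0// ltr_wpDl.
  have := key _ e1; rewrite ler_pM2r// mulrCA divff ?mulr1//.
  by rewrite gt_eqF// ltr_wpDl.
move=> e0; have [d1 d10 dP1] := hc It e e0; have [d2 d20 dP2] := hb It e e0.
have [s [s0 sd1 sd2 st']] : exists s, [/\ 0 <= s, t - d1 < s, t - d2 < s & s < t].
  have : Num.max 0 (Num.max (t - d1) (t - d2)) < t by rewrite !gt_max t0 !gtrBl d10 d20.
  move=> /midf_lt[]; set s := _ / _ => h1 h2; exists s; move: h1; rewrite !gt_max => /and3P[? ? ?].
  by split=> //; exact: ltW.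
have ts : 0 < t - s by rewrite subr_gt0.
have sT : 0 <= s <= T by rewrite s0 (le_trans (ltW st') (ltW tT)).
have h1 := dP1 s s0 sd1 st'; have h2 := dP2 s s0 sd2 st'.
have mct := mc t tT'; have mcs := mc s sT; have mbt := mb t tT'; have mbs := mb s sT.
have mcB := smemB SX mct mcs; have mbB := smemB SY mbt mbs.
have mcR := smemB SX mcB (smemZ SX (t - s) mdc); have mbR := smemB SY mbB (smemZ SY (t - s) mdb).
have h3 := st s sT _ mdc.
have h4 : BX (c t - c s) (dc t) <= p (b t - b s) (dc t).
  by rewrite (sipBl SX)// fr_plB//; move: en h3; lra.
have h5 : (t - s) * (n * n) - e * (t - s) * n <= BX (c t - c s) (dc t).
  have -> : BX (c t - c s) (dc t) = BX (c t - c s - (t - s) *: dc t) (dc t) + (t - s) * (n * n).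
    rewrite (sipBl SX mcB (smemZ SX (t - s) mdc) mdc) (sipZl SX (t - s) mdc mdc).
    by rewrite -expr2 (sqr_snorm SX mdc) subrK.
  rewrite addrC lerD2r lerNl; apply: le_trans (ler_norm _) _; rewrite normrN.
  by apply: le_trans (cauchy_schwarz SX mcR mdc) _; apply: ler_wpM2r.
have h6 : p (b t - b s) (dc t) <= (t - s) * (K * m * n) + K * (e * (t - s)) * n.
  have -> : p (b t - b s) (dc t) = (t - s) * p (db t) (dc t) + p (b t - b s - (t - s) *: db t) (dc t).
    by rewrite (fr_plB mbB (smemZ SY (t - s) mdb) mdc) (fr_plZ (t - s) mdb mdc) [RHS]addrC subrK.
  apply: lerD.
    by rewrite ler_pM2l//; apply: le_trans (ler_norm _) (fr_pB F mdb mdc).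
  apply: le_trans (ler_norm _) _; apply: le_trans (fr_pB F mbR mdc) _.
  by apply: ler_wpM2r => //; apply: ler_wpM2l.
rewrite -(ler_pM2l ts).
have := le_trans h5 (le_trans h4 h6); rewrite lerBlDr => /le_trans; apply.
by rewrite le_eqVlt; apply/orP; left; apply/eqP; ring.
Qed.

Lemma solution_rate c dc b db : solution c dc b db ->
  snorm (ipI BX I) dc <= K * snorm (ipI BY I) db.
Proof.
move=> sol; have [[_ _ qc _] [_ _ qb _] _] := sol; have K0 := fr_K F.
rewrite (ipI_snorm HX qc) (ipI_snorm HY qb).
rewrite -[leLHS]/(Num.sqrt (\int[mu]_(t in I) (NX (dc t) * NX (dc t)))).
rewrite -[X in _ * X]/(Num.sqrt (\int[mu]_(t in I) (NY (db t) * NY (db t)))).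
rewrite -[K]ger0_norm// -sqrtr_sqr -(sqrtrM _ (sqr_ge0 K)).
apply: ler_wsqrtr; rewrite -RintegralZl//; last exact: sqint_integrableM qb.2 qb.2.
apply: le_Rintegral_ae => //.
- exact: sqint_integrableM qc.2 qc.2.
- by apply: integrable_EFinZ => //; exact: sqint_integrableM qb.2 qb.2.
apply: (ae_imp (mu := mu)) (solution_rate_ae sol) => t h It.
by rewrite -!expr2 -exprMn lerXn2r ?nnegrE ?mulr_ge0 ?snorm_ge0// h.
Qed.

(** The stability of each solution tested with the derivative of the other, added to the two energy
    inequalities, cancels every dissipation term. What remains is the hypothesis of [energy_le] for
    the difference of the states. *)
Lemma solution_dist c1 dc1 b1 db1 c2 dc2 b2 db2 (d : R) : 0 <= d ->
  solution c1 dc1 b1 db1 -> solution c2 dc2 b2 db2 ->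
  (forall t v, 0 <= t <= T -> fmem X v -> `|p (b1 t - b2 t) v| <= d * NX v) ->
  forall t, 0 <= t <= T ->
    NX (c1 t - c2 t) ^+ 2 <= 2 * (d * \int[mu]_(r in I) NX (dc1 r - dc2 r)).
Proof.
move=> d0 [ac1 ab1 ae1] [ac2 ab2 ae2] bd; apply: (energy_le HX (AC_sub HX ac1 ac2) d0).
apply: (ae_imp (mu := mu)) (ae_and ae1 ae2) => r [h1 h2] Ir.
have [s1 e1] := h1 Ir; have [s2 e2] := h2 Ir.
have rT : 0 <= r <= T by move: Ir; rewrite /= in_itv/= => /andP[? ?]; rewrite !ltW.
have [[mc1 _ q1 _] [mc2 _ q2 _]] := (ac1, ac2); have [[mb1 _ _ _] [mb2 _ _ _]] := (ab1, ab2).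
have m1 := sm_mem q1.1 Ir; have m2 := sm_mem q2.1 Ir.
have := le_trans (ler_norm _) (bd r _ rT (smemB SX m1 m2)).
have k1 := mc1 r rT; have k2 := mc2 r rT; have k3 := mb1 r rT; have k4 := mb2 r rT.
have mB := smemB SX m1 m2.
apply: le_trans; rewrite (fr_plB k3 k4 mB) (fr_prB k3 m1 m2) (fr_prB k4 m1 m2).
rewrite (sipBl SX k1 k2 mB) (sipBr SX k1 m1 m2) (sipBr SX k2 m1 m2).
have := s1 _ m2; have := s2 _ m1; lra.
Qed.
End friction.

Lemma le_cvg0 (R : realType) (g : nat -> R) (a b : R) k : g n @[n --> \oo] --> 0 ->
  (forall n, (k <= n)%N -> a <= b + g n) -> a <= b.
Proof.
move=> g0 h; apply/ler_addgt0Pr => e e0.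
have : \forall n \near \oo, g n < e by exact: (cvgr_lt 0).
case=> n _ /(_ (maxn k n) (leq_maxr _ _)) /= ge.
by apply: le_trans (h _ (leq_maxl k n)) _; rewrite lerD2l ltW.
Qed.

Lemma cvx_app (R : realType) (V : lmodType R) (M : nat) (l : nat -> R) (u : nat -> R -> V) t :
  cvx M l u t = cvx M l (fun k => u k t).
Proof. by rewrite /cvx; elim/big_ind2 : _ => // ? ? ? ? <- <-. Qed.

(** * Compactness of the controls in the dual space *)

Section friction_limits.
Context {R : realType} (X Y : fspace R) (BX : X -> X -> R) (BY : Y -> Y -> R).
Hypotheses (HX : hilbert BX) (HY : hilbert BY).
Variable T : R.
Hypothesis T0 : 0 < T.
Notation mu := (@lebesgue_measure R).
Notation SX := (hinner HX).
Notation SY := (hinner HY).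
Notation NX := (snorm BX).
Notation NY := (snorm BY).
Notation I := (`]0, T[%classic : set (measurableTypeR R)).
Variables (p : Y -> X -> R) (D : X -> R) (K C : R).
Hypothesis F : friction BX BY p D K C.

Let mI : measurable I := mI T.
Let finI : (mu I < +oo)%E := finI T.

Lemma fr_pl_cvx N l (y : nat -> Y) v : (forall k, fmem Y (y k)) -> fmem X v ->
  p (cvx N l y) v = \sum_(k < N) l k * p (y k) v.
Proof.
move=> my mv; rewrite /cvx.
suff [] : fmem Y (\sum_(k < N) l k *: y k) /\
  p (\sum_(k < N) l k *: y k) v = \sum_(k < N) l k * p (y k) v by [].
elim/big_ind2 : _ => [|a a' b b' [ma <-] [mb <-]|k _].
- by rewrite (fr_pl0 HY F mv); split=> //; exact: (smem0 SY).
- by split; [exact: (smemD SY)|rewrite (fr_plD F)].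
- by split; [exact: (smemZ SY)|rewrite (fr_plZ HY F)].
Qed.

Lemma fr_pr_cvx N l y (v : nat -> X) : (forall k, fmem X (v k)) -> fmem Y y ->
  p y (cvx N l v) = \sum_(k < N) l k * p y (v k).
Proof.
move=> mv my; rewrite /cvx.
suff [] : fmem X (\sum_(k < N) l k *: v k) /\
  p y (\sum_(k < N) l k *: v k) = \sum_(k < N) l k * p y (v k) by [].
elim/big_ind2 : _ => [|a a' b b' [ma <-] [mb <-]|k _].
- by rewrite (fr_pr0 HX F my); split=> //; exact: (smem0 SX).
- by split; [exact: (smemD SX)|rewrite (fr_prD F)].
- by split; [exact: (smemZ SX)|rewrite (fr_prZ HX F)].
Qed.

Lemma fr_D_cvx n N l (v : nat -> X) : tail_weights n N l -> (forall k, fmem X (v k)) ->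
  D (cvx N l v) <= \sum_(k < N) l k * D (v k).
Proof.
move=> [l0 _ _] mv; rewrite /cvx.
suff [] : fmem X (\sum_(k < N) l k *: v k) /\
  D (\sum_(k < N) l k *: v k) <= \sum_(k < N) l k * D (v k) by [].
elim/big_ind2 : _ => [|a a' b b' [ma ha] [mb hb]|k _].
- split; first exact: (smem0 SX).
  by have := fr_DZ F 0 (smem0 SX); rewrite scale0r normr0 mul0r => ->.
- split; first exact: (smemD SX).
  by apply: le_trans (fr_DD F ma mb) _; exact: lerD.
- by split; [exact: (smemZ SX)|rewrite (fr_DZ F)// ger0_norm].
Qed.

(** An Arzela-Ascoli argument. The pairings at finitely many grid times with finitely many net
    points are nearly constant on a member of the ultrafilter. On the unit ball the net costs e/2,
    moving two controls to a grid time costs e/8 each, and the grid values differ by at most e/4. *)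
Lemma dual_cauchy (b db : nat -> R -> Y) (M e : R) (U : set_system nat) : UltraFilter U ->
  (forall k, AC BY T (b k) (db k)) -> (forall k, snorm (ipI BY I) (db k) <= M) -> 0 < e ->
  exists2 A, U A & forall k l, A k -> A l -> forall t v, 0 <= t <= T -> fmem X v ->
    `|p (b k t - b l t) v| <= e * NX v.
Proof.
move=> uU ab dbM e0; have pU := @ultra_proper _ _ uU; have K0 := fr_K F.
have M0 : 0 <= M := le_trans (snorm_ge0 _ _) (dbM 0%N).
have mb k t : 0 <= t <= T -> fmem Y (b k t) by have [] := ab k => + _ _ _ ? ; apply.
pose Q := Num.sqrt T * M; have Q0 : 0 <= Q by rewrite mulr_ge0 ?sqrtr_ge0.
have bQ k t : 0 <= t <= T -> NY (b k t) <= Q.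
  move=> tT; apply: le_trans (AC_bound HY (ab k) tT) _.
  by apply: ler_wpM2l (dbM k); exact: sqrtr_ge0.
(* The difference of two controls has norm at most 2 [Q], so this precision of the net costs at most
   e/2. *)
pose e1 := e / (4 * (Q + 1)); have e10 : 0 < e1 by rewrite divr_gt0// mulr_gt0// ltr_wpDl.
have [J [z [mz zP]]] := fr_net F e10.
pose W := \sum_j NX (z j); have W0 : 0 <= W by apply: sumr_ge0 => j _; exact: snorm_ge0.
have zW j : NX (z j) <= W by rewrite /W (bigD1 j)//= lerDl sumr_ge0// => *; exact: snorm_ge0.
(* A bound for the square root of the grid step: over one step a pairing with a net point changes by
   at most K W M [sg], below e/8. *)
pose sg := e / (8 * (K * W * M + 1)).
have k1 : 0 < K * W * M + 1 by rewrite ltr_wpDl// !mulr_ge0.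
have sg0 : 0 < sg by rewrite divr_gt0// mulr_gt0.
pose n := (Num.bound (T / sg ^+ 2)).+1; pose h := T / n%:R.
have n0 : 0 < n%:R :> R by rewrite ltr0n.
have h0 : 0 < h by rewrite divr_gt0.
have hsg : Num.sqrt h <= sg.
  rewrite -[leRHS]gtr0_norm// -sqrtr_sqr; apply: ler_wsqrtr.
  rewrite /h ler_pdivrMr// mulrC -ler_pdivrMr ?exprn_gt0//.
  have th : 0 <= T / sg ^+ 2 := divr_ge0 (ltW T0) (sqr_ge0 sg).
  by apply: le_trans (ltW (archi_boundP th)) _; rewrite ler_nat.
pose ti (i : 'I_n.+1) := h * i%:R.
have tiT i : 0 <= ti i <= T.
  rewrite /ti mulr_ge0 ?(ltW h0)//= /h mulrAC ler_pdivrMr// ler_pM2l// ler_nat.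
  by rewrite -ltnS ltn_ord.
have e4 : 0 < e / 4 by rewrite divr_gt0.
have ex (ij : 'I_n.+1 * J) : exists A, U A /\ forall k l, A k -> A l ->
    `|p (b k (ti ij.1)) (z ij.2) - p (b l (ti ij.1)) (z ij.2)| <= e / 4.
  have [k|A UA AP] := @ultra_bounded R U (fun k => p (b k (ti ij.1)) (z ij.2)) (K * Q * W) _ uU _ e4.
    apply: le_trans (fr_pB F (mb _ _ (tiT _)) (mz _)) _.
    apply: ler_pM; rewrite ?mulr_ge0 ?snorm_ge0//.
    by apply: ler_wpM2l => //; exact: bQ.
  by exists A.
have [A AP] := choice ex.
exists [set k | forall ij, A ij k].
  by apply: filter_forall => ij; have [] := AP ij.
move=> k l /= Ak Al t v tT mv; have [t0 tT'] : 0 <= t /\ t <= T by apply/andP.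
pose i := Num.truncn (t / h).
have ith : 0 <= t / h := divr_ge0 t0 (ltW h0).
have /andP[i1 i2] := truncn_itv ith.
have iln : (i < n.+1)%N.
  rewrite ltnS -(ler_nat R); apply: le_trans i1 _.
  by rewrite /h invfM invrK mulrA mulrAC ler_pdivrMr// mulrC ler_pM2l.
pose s := ti (Ordinal iln).
have sE : s = h * i%:R by [].
have st : s <= t by rewrite sE mulrC -ler_pdivlMr.
have tsh : t - s <= h.
  rewrite lerBlDl sE -[X in _ + X]mulr1 -mulrDr natr1 mulrC -ler_pdivrMr//; exact: ltW.
have sT := tiT (Ordinal iln); have [s0 _] : 0 <= s /\ s <= T by apply/andP.
have mk := mb k t tT; have ml := mb l t tT; have mks := mb k s sT; have mls := mb l s sT.
have mB := smemB SY mk ml.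
have bs q : NY (b q t - b q s) <= sg * M.
  apply: le_trans (AC_holder HY (ab q) s0 st tT') _.
  apply: ler_pM; rewrite ?sqrtr_ge0 ?snorm_ge0//.
  by apply: le_trans hsg; exact: ler_wsqrtr.
have unit_ball w : fmem X w -> NX w <= 1 -> `|p (b k t - b l t) w| <= e.
  move=> mw w1; have [j jP] := zP w mw w1; have mzj := mz j.
  have h1 : `|p (b k t - b l t) (w - z j)| <= e / 2.
    apply: le_trans (jP _ mB) _.
    apply: (@le_trans _ _ (e1 * (2 * (Q + 1)))); last first.
      rewrite /e1 le_eqVlt; apply/orP; left; apply/eqP; field.
      by rewrite gt_eqF// ltr_wpDl.
    apply: ler_wpM2l; first exact: ltW.
    apply: le_trans (snorm_trans SY mk (smem0 SY) ml) _.
    rewrite subr0 sub0r (snormN SY ml).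
    apply: le_trans (lerD (bQ k t tT) (bQ l t tT)) _.
    by rewrite mulr_natl mulr2n; apply: lerD; rewrite lerDl.
  have ts q : `|p (b q t) (z j) - p (b q s) (z j)| <= e / 8.
    have mq := mb q t tT; have mqs := mb q s sT.
    rewrite -(fr_plB HY F mq mqs mzj); apply: le_trans (fr_pB F (smemB SY mq mqs) mzj) _.
    apply: (@le_trans _ _ (K * (sg * M) * W)).
      apply: ler_pM; rewrite ?mulr_ge0 ?snorm_ge0//.
      by apply: ler_wpM2l.
    rewrite (_ : _ * W = sg * (K * W * M)); last by ring.
    apply: (@le_trans _ _ (sg * (K * W * M + 1))); first by rewrite ler_pM2l// lerDl.
    rewrite /sg le_eqVlt; apply/orP; left; apply/eqP; field.
    by rewrite gt_eqF.
  have h2 := (AP (Ordinal iln, j)).2 k l (Ak _) (Al _); rewrite /= -/s in h2.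
  have -> : p (b k t - b l t) w = p (b k t - b l t) (w - z j) +
      ((p (b k t) (z j) - p (b k s) (z j)) - (p (b l t) (z j) - p (b l s) (z j))) +
      (p (b k s) (z j) - p (b l s) (z j)).
    by rewrite (fr_prB HX F mB mw mzj) (fr_plB HY F mk ml mzj); ring.
  have h3 := ts k; have h4 := ts l.
  apply: le_trans (ler_normD _ _) _; apply: le_trans (lerD (ler_normD _ _) h2) _.
  apply: le_trans (lerD (lerD h1 (ler_normB _ _)) (lexx _)) _.
  apply: le_trans (lerD (lerD (lexx _) (lerD h3 h4)) (lexx _)) _.
  by rewrite le_eqVlt; apply/orP; left; apply/eqP; field.
have [v0|v0] := eqVneq (NX v) 0.
  by apply: le_trans (fr_pB F mB mv) _; rewrite v0 !mulr0.
have vp : 0 < NX v by rewrite lt_neqAle eq_sym v0 snorm_ge0.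
have := unit_ball _ (smemZ SX (NX v)^-1 mv); rewrite (snormZ SX _ mv).
rewrite (fr_prZ HX F _ mB mv) normrM gtr0_norm ?invr_gt0// mulVf// lexx => /(_ isT).
by rewrite mulrC ler_pdivrMr.
Qed.

End friction_limits.

(** * Passage to the limit in the evolution *)

Section friction_existence.
Context {R : realType} (X Y : fspace R) (BX : X -> X -> R) (BY : Y -> Y -> R).
Hypotheses (HX : hilbert BX) (HY : hilbert BY).
Variable T : R.
Hypothesis T0 : 0 < T.
Notation mu := (@lebesgue_measure R).
Notation SX := (hinner HX).
Notation SY := (hinner HY).
Notation NX := (snorm BX).
Notation NY := (snorm BY).
Notation I := (`]0, T[%classic : set (measurableTypeR R)).
Notation ACX := (AC BX T).
Notation ACY := (AC BY T).
Variables (p : Y -> X -> R) (D : X -> R) (K C : R).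
Hypothesis F : friction BX BY p D K C.
Notation solution := (solution BX BY T p D).

Let mI : measurable I := mI T.
Let finI : (mu I < +oo)%E := finI T.
Let SIX : semi_inner (sqsm BX I) (ipI BX I) := sqsm_semi_inner HX mI.
Let SIY : semi_inner (sqsm BY I) (ipI BY I) := sqsm_semi_inner HY mI.

(** Stability passes to the limit by uniform convergence. In the energy inequality of index k the
    limits first replace [b k] and [c k]; only then are convex combinations of the [dc k] taken, the
    right side being affine in them up to an error and [D] convex. *)
Lemma solution_limit (c dc : nat -> R -> X) (b db : nat -> R -> Y) (M : R) :
  (forall k, solution (c k) (dc k) (b k) (db k)) -> (forall k, snorm (ipI BY I) (db k) <= M) ->
  (forall n k, (n <= k)%N -> forall t v, 0 <= t <= T -> fmem X v ->
     `|p (b n t - b k t) v| <= (2^-1 ^+ n) ^+ 2 * NX v) ->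
  exists c' dc' b' db', [/\ solution c' dc' b' db',
    exists2 r : nat -> R, r @ \oo --> 0 &
      forall k t, 0 <= t <= T -> NX (c k t - c' t) <= r k
    & exists (N : nat -> nat) (l : nat -> nat -> R) (g : nat -> R),
      [/\ forall n, tail_weights n (N n) (l n), g @ \oo --> 0
        & forall n, snorm (ipI BY I) (cvx (N n) (l n) b - b') <= g n /\
                    snorm (ipI BY I) (cvx (N n) (l n) db - db') <= g n]].
Proof.
move=> sol dbM bdual; have K0 := fr_K F.
have M0 : 0 <= M := le_trans (snorm_ge0 _ _) (dbM 0%N).
have acX k : ACX (c k) (dc k) by have [] := sol k.
have acY k : ACY (b k) (db k) by have [] := sol k.
have qdc k : sqsm BX I (dc k) by have [] := acX k.
have qdb k : sqsm BY I (db k) by have [] := acY k.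
have mc k t : 0 <= t <= T -> fmem X (c k t) by have [h _ _ _] := acX k; exact: h.
have mb k t : 0 <= t <= T -> fmem Y (b k t) by have [h _ _ _] := acY k; exact: h.
have dcM k : snorm (ipI BX I) (dc k) <= K * M.
  by apply: le_trans (solution_rate HX HY T0 F (sol k)) _; exact: ler_wpM2l.
pose L0 := Num.sqrt T * (K * M + K * M).
have L00 : 0 <= L0 by rewrite mulr_ge0 ?sqrtr_ge0 ?addr_ge0 ?mulr_ge0.
pose e n : R := 2^-1 ^+ n.
have e0 n : 0 <= e n by rewrite exprn_ge0.
have ec : e n @[n --> \oo] --> 0 by exact: cvg_geometric0.
(* [solution_dist] bounds the squared distance of states by 2 [L0] times the squared rate [e n ^+ 2]
   of the controls. *)
pose r n := Num.sqrt (2 * L0) * e n.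
have rc : r n @[n --> \oo] --> 0 by exact: cvg0M.
have r0 n : 0 <= r n by rewrite mulr_ge0 ?sqrtr_ge0.
have cc n k t : (n <= k)%N -> 0 <= t <= T -> NX (c n t - c k t) <= r n.
  move=> nk tT; have e20 : 0 <= e n ^+ 2 by exact: sqr_ge0.
  have := solution_dist HX HY F e20 (sol n) (sol k) (bdual n k nk) tT.
  have h1 := Rintegral_norm_le HX T0 (smemB SIX (qdc n) (qdc k)).
  have h2 : snorm (ipI BX I) (dc n - dc k) <= K * M + K * M.
    apply: le_trans (snorm_trans SIX (qdc n) (smem0 SIX) (qdc k)) _.
    by rewrite subr0 sub0r (snormN SIX (qdc k)); apply: lerD.
  have h3 : \int[mu]_(s in I) NX (dc n s - dc k s) <= L0.
    by apply: le_trans h1 _; apply: ler_wpM2l h2; exact: sqrtr_ge0.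
  move=> /le_trans/(_ (ler_wpM2l (ler0n R 2) (ler_wpM2l e20 h3))).
  have -> : 2 * (e n ^+ 2 * L0) = r n ^+ 2.
    have s2 : Num.sqrt (2 * L0) ^+ 2 = 2 * L0 by apply: sqr_sqrtr; exact: mulr_ge0.
    by rewrite /r [RHS]exprMn s2 mulrCA [RHS]mulrC.
  by rewrite ler_sqr ?nnegrE ?snorm_ge0.
(* Both derivatives must be averaged with the same weights, as the limit curves are their primitives
   and the controls are averaged along with the states. *)
have SP := pair_semi_inner SIX SIY.
have qP k : (sqsm BX I `*` sqsm BY I) (dc k, db k) := conj (qdc k) (qdb k).
have bP k : pair_ip (B := ipI BX I) (B' := ipI BY I) (dc k, db k) (dc k, db k) <=
    (K * M) ^+ 2 + M ^+ 2.
  rewrite /pair_ip /= -(sqr_snorm SIX (qdc k)) -(sqr_snorm SIY (qdb k)).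
  by apply: lerD; rewrite ler_sqr ?nnegrE ?snorm_ge0// ?mulr_ge0.
have [N [l [lP fast]]] := mazur SP qP bP.
pose u n := cvx (N n) (l n) dc; pose v n := cvx (N n) (l n) db.
have qu n : sqsm BX I (u n) := cvx_mem SIX (N n) (l n) qdc.
have qv n : sqsm BY I (v n) := cvx_mem SIY (N n) (l n) qdb.
have fu n : snorm (ipI BX I) (u n.+1 - u n) <= e n.
  rewrite (snormBC SIX (qu _) (qu _)); apply: le_trans (fast n n.+1 (leqnSn n)).
  rewrite !cvx_pair; apply: (snorm_fst (P := sqsm BX I) SIY (x := (u n - u n.+1, v n - v n.+1))).
    exact: (smemB SIX (qu _) (qu _)).
  exact: (smemB SIY (qv _) (qv _)).
have fv n : snorm (ipI BY I) (v n.+1 - v n) <= e n.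
  rewrite (snormBC SIY (qv _) (qv _)); apply: le_trans (fast n n.+1 (leqnSn n)).
  rewrite !cvx_pair; apply: (snorm_snd (Q := sqsm BY I) SIX (x := (u n - u n.+1, v n - v n.+1))).
    exact: (smemB SIX (qu _) (qu _)).
  exact: (smemB SIY (qv _) (qv _)).
have [dc' [qdc' udc' aeu]] := sqsm_complete HX mI finI qu fu.
have [db' [qdb' vdb' _]] := sqsm_complete HY mI finI qv fv.
have [c' ac'] := AC_primitive HX qdc'; have [b' ab'] := AC_primitive HY qdb'.
have mc' t : 0 <= t <= T -> fmem X (c' t) by have [h _ _ _] := ac'; exact: h.
have mb' t : 0 <= t <= T -> fmem Y (b' t) by have [h _ _ _] := ab'; exact: h.
pose g n := Num.sqrt T * (2 * e n).
have gc : g n @[n --> \oo] --> 0 by apply: cvg0M; exact: cvg0M.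
have g0 n : 0 <= g n by rewrite !mulr_ge0 ?sqrtr_ge0.
have cu n t : 0 <= t <= T -> NX (cvx (N n) (l n) (fun k => c k t) - c' t) <= g n.
  move=> tT; rewrite -cvx_app.
  apply: le_trans (AC_sub_bound HX (AC_cvx HX (N n) (l n) acX) ac' tT) _.
  by apply: ler_wpM2l (udc' n); exact: sqrtr_ge0.
have bv n t : 0 <= t <= T -> NY (cvx (N n) (l n) (fun k => b k t) - b' t) <= g n.
  move=> tT; rewrite -cvx_app.
  apply: le_trans (AC_sub_bound HY (AC_cvx HY (N n) (l n) acY) ab' tT) _.
  by apply: ler_wpM2l (vdb' n); exact: sqrtr_ge0.
have cr k t : 0 <= t <= T -> NX (c k t - c' t) <= r k.
  (* [c k] is within [r k] of every later state, hence of every convex combination of later states,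
     hence of their limit [c']. *)
  move=> tT; have mk := mc k t tT; apply: (le_cvg0 (k := k) gc) => n kn.
  have mcv := cvx_mem SX (N n) (l n) (fun j => mc j t tT).
  apply: le_trans (snorm_trans SX mk mcv (mc' t tT)) _.
  apply: lerD (cu n t tT); rewrite (snormBC SX mk mcv) (cvx_subl _ _ (lP n)).
  have mj j : fmem X (c j t - c k t) := smemB SX (mc j t tT) mk.
  apply: le_trans (snorm_cvx SX (lP n) mj) _; apply: (ler_cvx_cst (a := fun j => NX (c j t - c k t)) (lP n)) => j nj.
  by rewrite (snormBC SX (mc j t tT) mk); apply: cc => //; exact: leq_trans nj.
have br k t w : 0 <= t <= T -> fmem X w -> `|p (b k t - b' t) w| <= e k ^+ 2 * NX w.
  move=> tT mw; have mk := mb k t tT.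
  have gK : K * g n * NX w @[n --> \oo] --> 0.
    rewrite (_ : (fun n => _) = fun n => (K * NX w) * g n); first exact: cvg0M.
    by apply/funext => n; ring.
  apply: (le_cvg0 (k := k) gK) => n kn.
  have mj j : fmem Y (b j t - b k t) := smemB SY (mb j t tT) mk.
  have mcv := cvx_mem SY (N n) (l n) (fun j => mb j t tT).
  have -> : p (b k t - b' t) w = - p (cvx (N n) (l n) (fun j => b j t) - b k t) w +
      p (cvx (N n) (l n) (fun j => b j t) - b' t) w.
    rewrite (fr_plB HY F mk (mb' t tT) mw) (fr_plB HY F mcv mk mw).
    by rewrite (fr_plB HY F mcv (mb' t tT) mw); ring.
  apply: le_trans (ler_normD _ _) _; rewrite normrN; apply: lerD; last first.
    apply: le_trans (fr_pB F (smemB SY mcv (mb' t tT)) mw) _.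
    by apply: ler_wpM2r; [exact: snorm_ge0|apply: ler_wpM2l => //; exact: bv].
  rewrite (cvx_subl _ _ (lP n)) (fr_pl_cvx HY F _ _ mj mw).
  have [l0 _ _] := lP n.
  apply: le_trans (ler_norm_sum _ _ _) _.
  under eq_bigr do rewrite normrM ger0_norm//.
  apply: (ler_cvx_cst (a := fun j => `|p (b j t - b k t) w|) (lP n)) => j nj.
  have := bdual k j (leq_trans kn nj) t w tT mw.
  by rewrite (fr_plB HY F (mb j t tT) mk mw) (fr_plB HY F mk (mb j t tT) mw) distrC.
have st' t : 0 <= t <= T -> stable BX p D (b' t) (c' t).
  move=> tT w mw.
  have gw : (e k ^+ 2 + r k) * NX w @[k --> \oo] --> 0.
    rewrite (_ : (fun k => _) = fun k => NX w * (e k * e k + r k)).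
      apply: cvg0M; apply: cvg0D => //; rewrite -(mulr0 (0 : R)); exact: cvgM.
    by apply/funext => k; rewrite mulrC expr2.
  apply: (le_cvg0 (k := 0%N) gw) => k _.
  have := solution_stable HX HY T0 F (sol k) tT mw.
  have := br k t w tT mw; rewrite (fr_plB HY F (mb k t tT) (mb' t tT) mw) => h1.
  have h2 := cauchy_schwarz SX (smemB SX (mc k t tT) (mc' t tT)) mw.
  rewrite (sipBl SX (mc k t tT) (mc' t tT) mw) in h2.
  have h3 := le_trans h2 (ler_wpM2r (snorm_ge0 _ _) (cr k t tT)).
  rewrite mulrDl; move: h1 h3; rewrite !ler_norml => /andP[h4 _] /andP[_ h5] h6.
  move: h4 h5 h6; set q1 := p _ w; set q2 := p _ w; set q3 := BX _ w; set q4 := BX _ w.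
  move: (e k ^+ 2 * NX w) (r k * NX w) (D w) => x1 x2 x3 h4 h5 h6.
  rewrite lerBlDr; apply: le_trans (_ : q1 + x1 <= _); first by rewrite -lerBlDl -opprB lerNl.
  rewrite -(lerD2r (- q3)) addrAC; apply: le_trans (lerD h6 (lexx x1)) _.
  rewrite -subr_ge0; move: h5; rewrite -subr_ge0; congr (0 <= _); ring.
exists c', dc', b', db'; split; last 1 first.
- exists N, l, (fun n => Num.sqrt T * g n + 2 * e n); split=> //.
    by apply: cvg0D; exact: cvg0M.
  move=> n; split; last first.
    by apply: le_trans (vdb' n) _; rewrite lerDr mulr_ge0 ?sqrtr_ge0.
  apply: (@le_trans _ _ (Num.sqrt T * g n)); last by rewrite lerDl mulr_ge0.
  have acv := AC_cvx HY (N n) (l n) acY.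
  apply: (snorm_ipI_sup HY T0) => //.
    exact: (smemB SIY (ccont_sqsm HY (AC_ccont HY acv)) (ccont_sqsm HY (AC_ccont HY ab'))).
  move=> t It; rewrite -[X in NY X]/(cvx (N n) (l n) b t - b' t) cvx_app; apply: bv.
  by move: It; rewrite /= in_itv/= => /andP[? ?]; rewrite !ltW.
- split=> //.
  (* The cost of replacing [b k] and [c k] by the limits in the energy inequality. Its L2 norm
     decays geometrically, so the series over k converges at almost every time. *)
  pose a k t := (e k ^+ 2 + r k) * NX (dc k t).
  have f0 k : 0 <= e k ^+ 2 + r k by rewrite addr_ge0// sqr_ge0.
  have fe k : e k ^+ 2 + r k <= (1 + Num.sqrt (2 * L0)) * e k.
    rewrite mulrDl mul1r lerD2r expr2 ler_piMl// exprn_ile1// ?invr_ge0// invf_le1// ler1n.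
    by [].
  pose Z := ((1 + Num.sqrt (2 * L0)) * (K * M)) ^+ 2.
  have aP k : (\int[mu]_(t in I) (a k t ^+ 2)%:E <= (Z * (2^-1 ^+ k) ^+ 2)%:E)%E.
    have sa : sqint mu I (a k) by exact: (sqintZ mI _ (qdc k).2).
    rewrite (sqint_ereal mI sa) lee_fin.
    have -> : snorm (sqint_ip mu I) (a k) = (e k ^+ 2 + r k) * snorm (ipI BX I) (dc k).
      rewrite (ipI_snorm HX (qdc k)) -[X in X * _]ger0_norm//.
      by rewrite -(snormZ (sqint_semi_inner mu mI) _ (qdc k).2).
    have x0 : 0 <= (e k ^+ 2 + r k) * snorm (ipI BX I) (dc k) := mulr_ge0 (f0 k) (snorm_ge0 _ _).
    have xy : (e k ^+ 2 + r k) * snorm (ipI BX I) (dc k) <=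
        (1 + Num.sqrt (2 * L0)) * (K * M) * e k.
      by rewrite mulrAC; exact: (ler_pM (f0 k) (snorm_ge0 _ _) (fe k) (dcM k)).
    rewrite /Z -exprMn -/(e k).
    by rewrite (ler_sqr (_ : _ \in Num.nneg) (_ : _ \in Num.nneg)) ?nnegrE//; exact: le_trans x0 xy.
  have ma k : measurable_fun I (a k : measurableTypeR R -> R).
    by apply: measurable_funM => //; exact: (sm_measurable_norm HX (qdc k).1).
  have a0 k t : 0 <= a k t by rewrite mulr_ge0// snorm_ge0.
  have aes : {ae mu, forall t k, I t -> stable BX p D (b k t) (c k t) /\
      D (dc k t) <= p (b k t) (dc k t) - BX (c k t) (dc k t)}.
    by apply: (ae_forall (mu := mu)) => k; have [] := sol k.
  apply: (ae_imp (mu := mu)) (ae_and aeu (ae_and aes (ae_summable_sqr mI finI ma a0 aP))).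
  move=> t [ut [st sum]] It; have {}ut := ut It; have [g' g'c sumP] := sum It.
  have tT : 0 <= t <= T by move: It; rewrite /= in_itv/= => /andP[? ?]; rewrite !ltW.
  have mbt := mb' t tT; have mct := mc' t tT; have mdt := sm_mem qdc'.1 It.
  split; first exact: st'.
  have mdk k : fmem X (dc k t) := sm_mem (qdc k).1 It.
  have mut n : fmem X (u n t) := sm_mem (qu n).1 It.
  (* A bound common to the whole tail survives convex combinations with weights supported there. *)
  have ak n k : (n <= k)%N -> a k t <= g' n.
    move=> nk; apply: le_trans (sumP n k.+1 (leqW nk)); rewrite big_nat_recr//=.
    by rewrite lerDr; apply: sumr_ge0 => j _; exact: a0.
  have en k : D (dc k t) <= p (b' t) (dc k t) - BX (c' t) (dc k t) + a k t.
    have [_ h0] := st k It; apply: le_trans h0 _.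
    have := br k t (dc k t) tT (mdk k); rewrite (fr_plB HY F (mb k t tT) mbt (mdk k)) => h1.
    have h2 := cauchy_schwarz SX (smemB SX (mc k t tT) mct) (mdk k).
    rewrite (sipBl SX (mc k t tT) mct (mdk k)) in h2.
    have h3 := le_trans h2 (ler_wpM2r (snorm_ge0 _ _) (cr k t tT)).
    rewrite /a mulrDl; move: h1 h3; rewrite !ler_norml => /andP[_ h4] /andP[h5 _].
    move: h4 h5; set q1 := p _ _; set q2 := p _ _; set q3 := BX _ _; set q4 := BX _ _.
    move: (e k ^+ 2 * _) (r k * _) => x1 x2 h4 h5.
    rewrite -subr_ge0; move: h4 h5; rewrite -subr_ge0 => h4; rewrite -subr_ge0 => h5.
    have := addr_ge0 h4 h5; congr (0 <= _); ring.
  have Du n : D (u n t) <= p (b' t) (u n t) - BX (c' t) (u n t) + g' n.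
    rewrite /u cvx_app; apply: le_trans (fr_D_cvx HX F (lP n) mdk) _.
    apply: le_trans (ler_cvx (lP n) (fun k _ => en k)) _.
    rewrite (fr_pr_cvx HX F _ _ mdk mbt).
    have -> : BX (c' t) (cvx (N n) (l n) (fun k => dc k t)) = \sum_(k < N n) l n k * BX (c' t) (dc k t).
      rewrite (sipC SX mct (cvx_mem SX (N n) (l n) mdk)) (sip_suml SX) //; last first.
        by move=> k; exact: (smemZ SX).
      by apply: eq_bigr => k _; rewrite (sipZl SX (l n k) (mdk k) mct) (sipC SX (mdk k) mct).
    rewrite -sumrB; under eq_bigr do rewrite mulrDr mulrBr.
    by rewrite big_split/=; apply: lerD => //; apply: (ler_cvx_cst (a := fun k => a k t) (lP n)) => k; exact: ak.
  (* The sum of the Lipschitz constants of the three terms that change when [u n t] is exchanged for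
     its limit [dc' t]. *)
  pose h := C + K * NY (b' t) + NX (c' t).
  have hc : g' n + h * NX (u n t - dc' t) @[n --> \oo] --> 0 by apply: cvg0D => //; exact: cvg0M.
  apply: (le_cvg0 (k := 0%N) hc) => n _.
  have mB := smemB SX (mut n) mdt; have mB' := smemB SX mdt (mut n).
  have h1 : D (dc' t) <= D (u n t) + C * NX (u n t - dc' t).
    rewrite -[X in D X <= _](subrK (u n t)) addrC.
    apply: le_trans (fr_DD F (mut n) mB') _; rewrite lerD2l (snormBC SX (mut n) mdt).
    exact: (fr_DB F mB').
  have h2 := le_trans (ler_norm _) (fr_pB F mbt mB).
  rewrite (fr_prB HX F mbt (mut n) mdt) in h2.
  have h3 := cauchy_schwarz SX mct mB; rewrite (sipBr SX mct (mut n) mdt) ler_norml in h3.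
  have /andP[{}h3 _] := h3; have h4 := Du n.
  rewrite /h !mulrDl; move: h1 h2 h3 h4.
  move: (C * _) (K * _ * _) (NX (c' t) * _) (D _) (D _) (p _ _) (p _ _) (BX _ _) (BX _ _) (g' n).
  move=> x1 x2 x3 x4 x5 x6 x7 x8 x9 x10 h1 h2 h3 h4.
  rewrite -subr_ge0; move: h1 h2 h3 h4; rewrite -subr_ge0 => h1; rewrite -subr_ge0 => h2.
  rewrite -subr_ge0 => h3; rewrite -subr_ge0 => h4.
  have := addr_ge0 (addr_ge0 h1 h2) (addr_ge0 h3 h4); congr (0 <= _); ring.
- by exists r.
Qed.

End friction_existence.

(** * Existence of a minimizer *)

Section friction_minimizer.
Context {R : realType} (X Y : fspace R) (BX : X -> X -> R) (BY : Y -> Y -> R).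
Hypotheses (HX : hilbert BX) (HY : hilbert BY).
Variable T : R.
Hypothesis T0 : 0 < T.
Notation mu := (@lebesgue_measure R).
Notation SX := (hinner HX).
Notation SY := (hinner HY).
Notation NX := (snorm BX).
Notation NY := (snorm BY).
Notation I := (`]0, T[%classic : set (measurableTypeR R)).
Variables (p : Y -> X -> R) (D : X -> R) (K C : R).
Hypothesis F : friction BX BY p D K C.
Notation solution := (solution BX BY T p D).
Variables (Fn : (R -> X) -> R) (m : R).
Hypothesis Fb : forall c dc, AC BX T c dc -> m <= Fn c.
Hypothesis Fc : forall (ck dck : nat -> R -> X) c dc (r : nat -> R),
  (forall k, AC BX T (ck k) (dck k)) -> AC BX T c dc -> r @ \oo --> 0 ->
  (forall k t, 0 <= t <= T -> NX (ck k t - c t) <= r k) ->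
  Fn (ck k) @[k --> \oo] --> Fn c.

Let mI : measurable I := mI T.
Let finI : (mu I < +oo)%E := finI T.
Let SIY : semi_inner (sqsm BY I) (ipI BY I) := sqsm_semi_inner HY mI.
Let SP := pair_semi_inner SIY SIY.

Definition cost c b db := Fn c + 2^-1 * (ipI BY I b b + ipI BY I db db).

Lemma AC_0 (Z : fspace R) (BZ : Z -> Z -> R) : hilbert BZ -> AC BZ T (fun=> 0) (fun=> 0).
Proof.
move=> HZ; have := AC_affine HZ T (smem0 (hinner HZ)).
by rewrite (_ : (fun t : R => t *: 0) = fun=> 0)//; apply/funext => t; rewrite scaler0.
Qed.

Lemma solution_0 : solution (fun=> 0) (fun=> 0) (fun=> 0) (fun=> 0).
Proof.
split; [exact: AC_0|exact: AC_0|apply: aeW => t _; split].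
  move=> v mv; rewrite (fr_pl0 HY F mv) (sip0l SX mv) subr0; exact: (fr_D0 F mv).
rewrite (fr_pl0 HY F (smem0 SX)) (sip0l SX (smem0 SX)) subr0.
by have := fr_DZ F 0 (smem0 SX); rewrite scale0r normr0 mul0r => ->.
Qed.

Let AC_sq b db : AC BY T b db -> sqsm BY I b /\ sqsm BY I db.
Proof.
by move=> ab; split; [exact: (ccont_sqsm HY (AC_ccont HY ab))|have [] := ab].
Qed.

(** The zero solution makes the infimum one over a nonempty set. The part [Fn] of the cost converges
    along the selected indices, and the quadratic part is carried over by convex combinations of
    late controls. *)
Theorem friction_minimizer : exists c dc b db, solution c dc b db /\
  forall c2 dc2 b2 db2, solution c2 dc2 b2 db2 -> cost c b db <= cost c2 b2 db2.
Proof.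
pose E := [set x | exists c dc b db, solution c dc b db /\ x = cost c b db].
have lbE : lbound E m.
  move=> _ [c [dc [b [db [[ac ab _] ->]]]]]; have [qb qdb] := AC_sq ab.
  rewrite /cost -[m]addr0; apply: lerD; first exact: Fb ac.
  by rewrite mulr_ge0// addr_ge0// (sip_ge0 SIY).
have infE : has_inf E.
  split; last by exists m.
  by exists (cost (fun=> 0) (fun=> 0) (fun=> 0)); do 4 eexists; split; [exact: solution_0|].
pose e n : R := 2^-1 ^+ n.
have e0 n : 0 < e n by rewrite exprn_gt0.
have e1 n : e n <= 1 by rewrite exprn_ile1// invf_le1// ler1n.
have emono n k : (n <= k)%N -> e k <= e n.
  by move=> nk; apply: ler_wiXn2l => //; rewrite invf_le1// ler1n.
have ec : e n @[n --> \oo] --> 0 by exact: cvg_geometric0.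
have ex k : exists x : (R -> X) * (R -> X) * ((R -> Y) * (R -> Y)),
    solution x.1.1 x.1.2 x.2.1 x.2.2 /\ cost x.1.1 x.2.1 x.2.2 <= inf E + e k.
  have [_ [c [dc [b [db [s ->]]]]] h] := inf_adherent (e0 k) infE.
  by exists ((c, dc), (b, db)); split=> //; exact: ltW.
have [y yP] := choice ex.
pose b k := (y k).2.1; pose db k := (y k).2.2.
have acY k : AC BY T (b k) (db k) by have [[]] := yP k.
have G0 k : 0 <= ipI BY I (b k) (b k) by apply: (sip_ge0 SIY); have [] := AC_sq (acY k).
have costG k : ipI BY I (b k) (b k) + ipI BY I (db k) (db k) <=
    2 * (inf E + e k - Fn (y k).1.1).
  have [_] := yP k; rewrite /cost -/(b k) -/(db k).
  move: (ipI _ _ _ _ + _) (inf E) (e k) (Fn _) => x1 x2 x3 x4; lra.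
(* The cost is at most [inf E + 1] along the sequence and [Fn] at least [m]; the difference bounds
   half the squared H^1 norm of the controls. *)
pose M := Num.sqrt (2 * (inf E + 1 - m)).
have dbM k : snorm (ipI BY I) (db k) <= M.
  apply: ler_wsqrtr; apply: le_trans (le_trans (costG k) _).
    by rewrite lerDr.
  apply: ler_wpM2l => //; apply: lerB; first by rewrite lerD2l.
  by have [[ac _ _] _] := yP k; exact: Fb ac.
have [U [uU UF]] := ultraFilterLemma (F := \oo) _.
have pU := @ultra_proper _ _ uU.
have exA n : exists A, U A /\ forall k l, A k -> A l -> forall t v, 0 <= t <= T -> fmem X v ->
    `|p (b k t - b l t) v| <= e n ^+ 2 * NX v.
  have e20 : 0 < e n ^+ 2 by rewrite exprn_gt0.
  by have [A UA AP] := dual_cauchy HX HY T0 F uU acY dbM e20; exists A.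
have [A AP] := choice exA.
(* The second set forces the selected index to be at least [n]; the intersections [Cn] make every
   later selection lie in all earlier [A n]. *)
pose Bn n := A n `&` [set k | (n <= k)%N].
have UB n : U (Bn n).
  apply: filterI; first by have [] := AP n.
  by apply: UF; exists n.
pose Cn := fix Cn n := if n is k.+1 then Cn k `&` Bn k.+1 else Bn 0%N.
have UC n : U (Cn n) by elim: n => [|n IH] /=; [exact: UB|exact: filterI].
have CB n k : (n <= k)%N -> Cn k `<=` Bn n.
  elim: k => [|k IH]; first by rewrite leqn0 => /eqP ->.
  rewrite leq_eqVlt => /predU1P[->|]; first by move=> x [].
  by rewrite ltnS => /IH h x [/h].
have exs n : exists k, Cn n k by exact: (@filter_ex _ U pU _ (UC n)).
have [s sP] := choice exs.
have ns n : (n <= s n)%N by have [] := CB n n (leqnn n) _ (sP n).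
have bd n k : (n <= k)%N -> forall t v, 0 <= t <= T -> fmem X v ->
    `|p (b (s n) t - b (s k) t) v| <= (2^-1 ^+ n) ^+ 2 * NX v.
  move=> nk; apply: (AP n).2.
    by have [] := CB n n (leqnn n) _ (sP n).
  by have [] := CB n k nk _ (sP k).
have [c' [dc' [b' [db' [sol' [r rc rP] [N [l [g [lP gc gP]]]]]]]]] :=
  solution_limit HX HY T0 F (fun k => (yP (s k)).1) (fun k => dbM (s k)) bd.
exists c', dc', b', db'; split=> // c2 dc2 b2 db2 sol2.
have [ac' ab' _] := sol'; have [qb' qdb'] := AC_sq ab'.
have mbd : (sqsm BY I `*` sqsm BY I) (b', db') := conj qb' qdb'.
suff key h : 0 < h -> cost c' b' db' <= inf E + h.
  apply/ler_addgt0Pr => h h0; apply: le_trans (key h h0) _; rewrite lerD2r.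
  by apply: ge_inf; [exists m|exists c2, dc2, b2, db2].
move=> h0; have h4 : 0 < h / 4 by rewrite divr_gt0.
have acs k : AC BX T (y (s k)).1.1 (y (s k)).1.2 by have [[]] := yP (s k).
have cF := Fc acs ac' rc rP.
have [n1 n1P] : exists n1, forall k, (n1 <= k)%N ->
    Fn c' - Fn (y (s k)).1.1 <= h / 4 /\ e k <= h / 4.
  have a1 : \forall k \near \oo, `|Fn c' - Fn (y (s k)).1.1| <= h / 4.
    by move/cvgrPdist_le: cF; apply.
  have a2 : \forall k \near \oo, e k < h / 4 by exact: (cvgr_lt 0).
  case: a1 => i1 _ i1P; case: a2 => i2 _ i2P; exists (maxn i1 i2) => k.
  rewrite geq_max => /andP[/i1P h1 /i2P h2]; split; last exact: ltW.
  exact: le_trans (ler_norm _) h1.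
(* Late controls have squared norm at most [rho]: one h/4 for the excess over the infimum, another
   for replacing [Fn] by its limit. *)
pose rho := 2 * (inf E + h / 2 - Fn c').
have G1 k : (n1 <= k)%N -> pair_ip (B := ipI BY I) (B' := ipI BY I)
    (b (s k), db (s k)) (b (s k), db (s k)) <= rho.
  move=> /n1P[h1 h2]; have h3 := emono _ _ (ns k); have := costG (s k).
  rewrite /pair_ip /= /rho; move: h1 h2 h3.
  move: (ipI _ _ _ _ + _) (inf E) (e k) (e (s k)) (Fn c') (Fn _) => x1 x2 x3 x4 x5 x6; lra.
have qs k : (sqsm BY I `*` sqsm BY I) (b (s k), db (s k)) := AC_sq (acY (s k)).
have rho0 : 0 <= rho by apply: le_trans (G1 n1 (leqnn n1)); exact: (sip_ge0 SP (qs n1)).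
(* Convex combinations of late controls stay in the ball of squared radius [rho], and so does their
   limit. This is the lower semicontinuity of the control cost. *)
have limP : snorm (pair_ip (B := ipI BY I) (B' := ipI BY I)) (b', db') <= Num.sqrt rho.
  have gg : g n + g n @[n --> \oo] --> 0 by exact: cvg0D.
  apply: (le_cvg0 (k := n1) gg) => n n1n.
  pose z k := (b (s k), db (s k)).
  have mz : (sqsm BY I `*` sqsm BY I) (cvx (N n) (l n) z) := cvx_mem SP (N n) (l n) qs.
  have := snorm_trans SP mbd mz (smem0 SP); rewrite !subr0 => /le_trans; apply.
  rewrite addrC; apply: lerD.
    apply: le_trans (snorm_cvx SP (lP n) qs) _.
    apply: (ler_cvx_cst (a := fun k => snorm (pair_ip (B := ipI BY I) (B' := ipI BY I)) (z k)) (lP n)).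
    by move=> k nk; apply: ler_wsqrtr; apply: G1; exact: leq_trans nk.
  rewrite (snormBC SP mbd mz) /z cvx_pair; have [g1 g2] := gP n.
  have mb := cvx_mem SIY (N n) (l n) (fun k => (qs k).1).
  have md := cvx_mem SIY (N n) (l n) (fun k => (qs k).2).
  apply: le_trans (snorm_pair_le SIY SIY (x := (cvx (N n) (l n) (fun k => b (s k)) - b',
    cvx (N n) (l n) (fun k => db (s k)) - db')) _ _) (lerD g1 g2).
    exact: (smemB SIY mb qb').
  exact: (smemB SIY md qdb').
have G' : ipI BY I b' b' + ipI BY I db' db' <= rho.
  rewrite -[leLHS]/(pair_ip (B := ipI BY I) (B' := ipI BY I) (b', db') (b', db')).
  rewrite -(sqr_snorm SP mbd) -(sqr_sqrtr rho0).
  by rewrite ler_sqr ?nnegrE ?snorm_ge0 ?sqrtr_ge0.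
rewrite /cost; move: G'; rewrite /rho.
move: (ipI _ _ _ _ + _) (inf E) (Fn c') => x1 x2 x3; lra.
Qed.

End friction_minimizer.

(** * The control problem *)

Section frechet.
Context {R : realType} (X : fspace R).
Hypothesis norm_ge0 : forall h : X, 0 <= fnorm X h.

Lemma frechet_cvg (j : X -> R) (u : X) (h : nat -> X) : cont_frechet_diff X j -> fmem X u ->
  (forall k, fmem X (h k)) -> fnorm X (h k) @[k --> \oo] --> 0 ->
  j (u + h k) @[k --> \oo] --> j u.
Proof.
move=> [dj [djP _]] mu_ mh h0; have [[_ [C AC]] fd] := djP u mu_.
have [d d0 dP] := fd 1 ltr01.
have gc : (`|C| + 1) * fnorm X (h k) @[k --> \oo] --> 0 by exact: cvg0M.
apply/cvgrPdist_le => e e0.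
have a1 : \forall k \near \oo, fnorm X (h k) < d by exact: (cvgr_lt 0).
have a2 : \forall k \near \oo, (`|C| + 1) * fnorm X (h k) < e by exact: (cvgr_lt 0).
case: a1 => i1 _ i1P; case: a2 => i2 _ i2P; exists (maxn i1 i2) => //= k /=.
rewrite geq_max => /andP[/i1P/= h1 /i2P/= h2]; rewrite distrC.
have h3 := dP _ (mh k) h1; have h4 := AC _ (mh k).
have h5 : C * fnorm X (h k) <= `|C| * fnorm X (h k) by rewrite ler_wpM2r// ler_norm.
rewrite -(subrK (dj u (h k)) (j (u + h k) - j u)).
apply: le_trans (ler_normD _ _) _; apply: le_trans (ltW h2).
by rewrite mulrDl addrC; apply: lerD => //; exact: le_trans h4 h5.
Qed.

(** The functionals act on representatives; this makes them well defined on classes. A perturbation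
    of norm 0, repeated as a constant sequence, tends to 0. *)
Lemma frechet_inv (j : X -> R) (u h : X) : cont_frechet_diff X j -> fmem X u -> fmem X h ->
  fnorm X h = 0 -> j (u + h) = j u.
Proof.
move=> fj mu_ mh h0.
have : j (u + h) @[k --> \oo] --> j u.
  by apply: (@frechet_cvg j u (fun=> h)) => //; rewrite h0; exact: cvg_cst.
by move=> /cvg_lim -/(_ (@Rhausdorff R)); rewrite lim_cst//; exact: Rhausdorff.
Qed.
End frechet.

Lemma bounded_in_cube (R : realType) (n : nat) (Omega : set 'rV[R]_n) : bounded_set Omega ->
  exists2 M : R, 0 <= M & Omega `<=` cube M n.
Proof.
move=> [M [_ MP]]; exists (`|M| + 1); first by rewrite addr_ge0.
move=> x Ox i; have MM : M < `|M| + 1 by rewrite (le_lt_trans (ler_norm _))// ltrDl.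
have xM : mx_norm x <= `|M| + 1 := MP _ MM _ Ox; rewrite mx_normrE in xM.
rewrite !mxE -ler_norml; apply: le_trans xM.
exact: (le_bigmax _ (fun ij : 'I_1 * 'I_n => `|x ij.1 ij.2|) (0, i)).
Qed.

Lemma mulrB_addr (R : pzRingType) (a b c e f : R) :
  a * b + e - (a * c + f) = a * (b - c) + (e - f).
Proof. by rewrite mulrBr opprD addrACA. Qed.

(** * Translation between the control problem and the abstract evolution *)

Section control.
Context {R : realType} {n : nat}.
Variables (Omega : set 'rV[R]_n) (M : R).
Hypotheses (M0 : 0 <= M) (OM : Omega `<=` cube M n) (oO : open Omega) (n0 : (0 < n)%N).
Variable T : R.
Hypothesis T0 : 0 < T.
Notation mu := (@lebesgue_rV R n).
Notation leb := (@lebesgue_measure R).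
Notation ip := (sqint_ip mu Omega).
Notation dir := (dirichlet Omega).
Notation X := (H10 Omega).
Notation Y := (L2 Omega).
Notation dis := (@dissipation R n Omega).
Notation I := (`]0, T[%classic : set (measurableTypeR R)).
Notation K := (M *+ 2 + 2).

Let mO : measurable Omega := open_measurable_rV oO.
Let Olty : (mu Omega < +oo)%E := Omega_lty OM oO.
Let HX : hilbert (X := X) dir := H10_hilbert M0 OM oO n0.
Let HY : hilbert (X := Y) ip := L2_hilbert OM oO.
Let SX : semi_inner (fmem X) dir := hinner HX.
Let SY : semi_inner (fmem Y) ip := hinner HY.
Let mI : measurable I := mI T.
Let TT : 0 <= T <= T. Proof. by rewrite lexx ltW. Qed.

Definition l2_pairing (y : Y) (v : X) : R := ip y v.
Notation p := l2_pairing.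

Let L2m v : fmem X v -> fmem Y v. Proof. by move=> [[]]. Qed.

Let iabs v : fmem X v -> mu.-integrable Omega (EFin \o (fun x => `|(v : 'rV[R]_n -> R) x|)).
Proof. by move=> /L2m mv; apply: (sqint_integrable mO Olty); exact: (sqint_abs mO mv). Qed.

(** The bounds come from Cauchy-Schwarz in L2 and the Poincare constant [K], with the constant
    function 1 for the dissipation. The net is that of Rellich's theorem. *)
Lemma dissipation_friction : friction (X := X) (Y := Y) dir ip p dis K (K * snorm ip (fun=> 1)).
Proof.
have K0 : 0 <= K by rewrite addr_ge0// mulrn_wge0.
split; first exact: K0.
- by move=> a y z v my mz /L2m mv; exact: (sipl SY).
- move=> a y v w my /L2m mv /L2m mw; rewrite /p (sipC SY my (smemL SY a mv mw)).
  by rewrite (sipl SY a mv mw my) (sipC SY mv my) (sipC SY mw my).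
- move=> y v my mv; apply: le_trans (cauchy_schwarz SY my (L2m mv)) _.
  apply: le_trans (ler_wpM2l (snorm_ge0 ip y) (H10_poincare M0 OM oO n0 mv)) _.
  by rewrite mulrCA mulrA.
- by move=> v mv; apply: Rintegral_ge0 => x _; exact: normr_ge0.
- move=> a v mv; rewrite /dissipation -RintegralZl//; last exact: iabs.
  by apply: eq_Rintegral => x _; rewrite !fctE normrM.
- move=> v w mv mw; rewrite /dissipation -RintegralD//; [|exact: iabs..].
  apply: le_Rintegral => //; first exact: (iabs (smemD SX mv mw)).
    by apply: (integrable_EFinD mO); exact: iabs.
  by move=> x _; rewrite !fctE; exact: ler_normD.
- move=> v mv; have m1 : fmem Y (fun=> 1) := sqint_cst mO Olty 1.
  have ma : fmem Y (fun x => `|(v : 'rV[R]_n -> R) x|) := sqint_abs mO (L2m mv).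
  have := le_trans (ler_norm _) (cauchy_schwarz SY ma m1).
  rewrite (_ : ip _ _ = dis v); last by apply: eq_Rintegral => x _; rewrite mulr1.
  have -> : snorm ip (fun x => `|(v : 'rV[R]_n -> R) x|) = snorm ip v.
    congr Num.sqrt; apply: eq_Rintegral => x _.
    by rewrite -normrM ger0_norm// -expr2 sqr_ge0.
  move=> /le_trans; apply.
  apply: le_trans (ler_wpM2r (snorm_ge0 ip _) (H10_poincare M0 OM oO n0 mv)) _.
  by rewrite mulrAC.
move=> e e0; have [J [v [mv vP]]] := H10_net M0 OM oO n0 e0.
exists J, v; split; [exact: mv|move=> z mz z1; have [j zj] := vP z mz z1; exists j => y my].
apply: le_trans (cauchy_schwarz SY my (L2m (smemB SX mz (mv j)))) _; rewrite mulrC.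
by apply: ler_wpM2r zj; exact: snorm_ge0.
Qed.

Variables (j1 : L2I X T -> R) (j2 : X -> R).
Hypotheses (hj1 : cont_frechet_diff (L2I X T) j1) (hj2 : cont_frechet_diff X j2).

Definition state_cost (c : R -> X) : R := j1 c + j2 (c T).
Notation Fn := state_cost.

Let nL2I (h : L2I X T) : 0 <= fnorm (L2I X T) h. Proof. exact: sqrtr_ge0. Qed.
Let nX (h : X) : 0 <= fnorm X h. Proof. exact: sqrtr_ge0. Qed.

Let xiB (y : Y) (x v w : X) : fmem Y y -> fmem X x -> fmem X v -> fmem X w ->
  p y (v - w) - dir x (v - w) = (p y v - dir x v) - (p y w - dir x w).
Proof.
move=> my mx mv mw; rewrite (sipBr SX mx mv mw) (fr_prB HX dissipation_friction my mv mw).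
by rewrite !opprD !opprK addrACA.
Qed.

Lemma j1_ae (u v : R -> X) : sqsm (X := X) dir I u -> sqsm (X := X) dir I v ->
  {ae leb, forall t, I t -> snorm dir (u t - v t) = 0} -> j1 v = j1 u.
Proof.
move=> qu qv uv; have SI := sqsm_semi_inner HX mI.
have quv := smemB SI qv qu.
have aevu : {ae leb, forall t, I t -> snorm dir ((v - u) t) = 0}.
  apply: (ae_imp (mu := leb)) uv => t h It; rewrite -(h It).
  by apply: (snormBC SX); [exact: (sm_mem qv.1 It)|exact: (sm_mem qu.1 It)].
have e : v = u + (v - u) by rewrite addrC subrK.
rewrite {1}e; apply: (frechet_inv nL2I hj1).
- by apply/(L2I_memP HX T).
- by apply/(L2I_memP HX T).
- by rewrite (L2I_normE HX quv); exact: (sqsm_ae0 HX quv aevu).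
Qed.

Lemma j2_eq (x y : X) : fmem X x -> fmem X y -> snorm dir (y - x) = 0 -> j2 y = j2 x.
Proof.
move=> mx my yx; have e : y = x + (y - x) by rewrite addrC subrK.
by rewrite {1}e; exact: (frechet_inv nX hj2 mx (smemB SX my mx)).
Qed.

(** State and control are replaced by their continuous representatives, which changes neither the
    pairings at almost every time nor the objective. *)
Lemma feasible_solution z g : feasible T z g -> exists c dc b db,
  solution (X := X) (Y := Y) dir ip T p dis c dc b db /\ objective j1 j2 z g = cost (X := X) (Y := Y) ip T Fn c b db.
Proof.
move=> [hz hg se tg].
have [c [ac wz aec trc]] := H1star_AC HX T0 hz.
have [b [ab wg aeb trb]] := H1star_AC HY T0 (conj hg tg).
have qz := (L2I_memP HX T z).1 hz.1.1; have qg := (L2I_memP HY T g).1 hg.1.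
have [mc _ qdz _] := ac; have [mb _ qdg _] := ab.
have qc := ccont_sqsm HX (AC_ccont HX ac); have qb := ccont_sqsm HY (AC_ccont HY ab).
exists c, (weak_derivI T z), b, (weak_derivI T g); split.
  split=> //; apply: (ae_imp (mu := leb)) (ae_and se (ae_and aec aeb)) => t [h1 [h2 h3]] It.
  have [_ ineq] := h1 It; have cz := h2 It; have bg := h3 It.
  have tT : 0 <= t <= T by move: It; rewrite /= in_itv/= => /andP[? ?]; rewrite !ltW.
  have mct := mc t tT; have mbt := mb t tT; have mzt := sm_mem qz.1 It; have mgt := sm_mem qg.1 It.
  set dz := weak_derivI T z t in ineq *; have mdz : fmem X dz := sm_mem qdz.1 It.
  have E v : fmem X v -> (laplacian (z t) + @L2_dual R n Omega (g t)) v = p (b t) v - dir (c t) v.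
    move=> mv; have := snorm0_sip SX (smemB SX mct mzt) mv cz.
    rewrite (sipBl SX mct mzt mv) => /eqP; rewrite subr_eq0 => /eqP ->.
    have := snorm0_sip SY (smemB SY mbt mgt) (L2m mv) bg.
    rewrite (sipBl SY mbt mgt (L2m mv)) => /eqP; rewrite subr_eq0 => /eqP.
    by rewrite /p => ->; rewrite addrC.
  have ineq' v : fmem X v -> dis dz + ((p (b t) v - dir (c t) v) - (p (b t) dz - dir (c t) dz)) <= dis v.
    by move=> mv; have := ineq v mv; rewrite (E _ (smemB SX mv mdz)) xiB.
  have x0 : p (b t) 0 - dir (c t) 0 = 0.
    by rewrite (fr_pr0 HX dissipation_friction mbt) (sip0r SX mct) subrr.
  have d0 : dis 0 = 0.
    by have := fr_DZ dissipation_friction 0 (smem0 SX); rewrite scale0r normr0 mul0r.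
  (* The subdifferential inequality is tested with 0 here and with twice [dz] next; the resulting
     equality turns the inequality for general [v] into stability. *)
  have en : dis dz <= p (b t) dz - dir (c t) dz.
    by have := ineq' 0 (smem0 SX); rewrite x0 d0 sub0r subr_le0.
  have en' : p (b t) dz - dir (c t) dz <= dis dz.
    have := ineq' _ (smemD SX mdz mdz); rewrite (fr_prD dissipation_friction mbt mdz mdz).
    rewrite (sipDr SX mct mdz mdz) => h; have := le_trans h (fr_DD dissipation_friction mdz mdz).
    by move: h; rewrite lerD2l opprD addrACA addrK.
  split=> // v mv; have h := ineq' v mv; apply: le_trans h.
  by rewrite addrCA lerDl subr_ge0.
rewrite /objective /cost /Fn (j1_ae qc qz aec).
have tr : is_trace T z T (trace T z T) := xgetPex 0 (ex_intro _ (c T) (trc T TT)).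
have [my mcT yc] := trace_unique HX T0 qz.1 TT tr (trc T TT).
rewrite (j2_eq mcT my yc); congr (_ + _ * _).
rewrite (_ : fnorm (H1I Y T) g = Num.sqrt (fnorm (L2I Y T) g ^+ 2 +
    fnorm (L2I Y T) (weak_derivI T g) ^+ 2))//.
rewrite !(L2I_normE HY)// sqr_sqrtr; last by rewrite addr_ge0// sqr_ge0.
have SI := sqsm_semi_inner HY mI.
by rewrite -(sqsm_ae_eq HY qb qg aeb) (sqr_snorm SI qb) (sqr_snorm SI qdg).
Qed.

(** The state equation speaks of the chosen [weak_derivI], which agrees with [dc] only up to norm 0.
    Energy and stability are moved across this difference before they are added to the
    subdifferential inequality. *)
Lemma solution_feasible c dc b db : solution (X := X) (Y := Y) dir ip T p dis c dc b db ->
  feasible T c b /\ objective j1 j2 c b = cost (X := X) (Y := Y) ip T Fn c b db.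
Proof.
move=> [ac ab ae]; have [hc trc] := AC_H1star HX T0 ac; have [hb trb] := AC_H1star HY T0 ab.
have F := dissipation_friction.
have [mc _ qdc _] := ac; have [mb _ qdb _] := ab.
have qc := ccont_sqsm HX (AC_ccont HX ac).
split; first split; [exact: hc|exact: hb.1| |exact: hb.2|].
  apply: (ae_imp (mu := leb)) (ae_and (AC_weak_derivI HX ac) ae) => t [h1 h2] It.
  have [mw wdc] := h1 It; have [st en] := h2 It.
  have tT : 0 <= t <= T by move: It => /itvP h; rewrite !h.
  have mct := mc t tT; have mbt := mb t tT; have mdc := sm_mem qdc.1 It.
  set w := weak_derivI T c t in mw wdc *; have mwd := smemB SX mw mdc.
  have E v : (laplacian (c t) + @L2_dual R n Omega (b t)) v = p (b t) v - dir (c t) v.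
    by rewrite addrC.
  split; first split.
  - move=> a x y mx my; rewrite !E (fr_pr F a mbt mx my).
    rewrite (sipDr SX mct (smemZ SX a mx) my) (sipZr SX a mct mx).
    exact: mulrB_addr.
  - exists (K * snorm ip (b t) + snorm dir (c t)) => x mx; rewrite E mulrDl.
    apply: le_trans (ler_normB _ _) _; apply: lerD; first exact: (fr_pB F mbt mx).
    exact: (cauchy_schwarz SX mct mx).
  move=> v mv; rewrite E (xiB mbt mct mv mw).
  have mwc := smemB SX mw mdc.
  (* The dissipation is bounded by a multiple of the norm, so a vector of norm 0 has none, and
     subadditivity gives the comparison of [w] with [dc t]. *)
  have D0 : dis (w - dc t) <= 0 by rewrite (le_trans (fr_DB F mwc))// wdc mulr0.
  have Dw : dis w <= dis (dc t).
    rewrite -[w](subrK (dc t)) addrC; apply: le_trans (fr_DD F mdc mwc) _.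
    by rewrite gerDl.
  have x0 : p (b t) (w - dc t) - dir (c t) (w - dc t) = 0.
    rewrite (sipC SX mct mwc) (snorm0_sip SX mwc mct wdc) subr0.
    by apply/eqP; rewrite -normr_le0 (le_trans (fr_pB F mbt mwc))// wdc mulr0.
  move: x0; rewrite (xiB mbt mct mw mdc) => /eqP; rewrite subr_eq0 => /eqP ->.
  by apply: le_trans (lerD (le_trans Dw en) (lexx _)) _; rewrite addrC subrK; exact: st.
rewrite /objective /cost /Fn (AC_H1I_norm HY ab).
have tr : is_trace T c T (trace T c T) := xgetPex 0 (ex_intro _ (c T) (trc T TT)).
have [my mcT yc] := trace_unique HX T0 qc.1 TT tr (trc T TT).
by rewrite (j2_eq mcT my yc).
Qed.

Hypotheses (hj1b : bounded_below (L2I X T) j1) (hj2b : bounded_below X j2).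

Lemma optimal_control_exists : exists (z : R -> X) (g : R -> Y), feasible T z g /\
  forall z2 g2, feasible T z2 g2 -> objective j1 j2 z g <= objective j1 j2 z2 g2.
Proof.
have [m1 m1P] := hj1b; have [m2 m2P] := hj2b.
have acL c dc : AC (X := X) dir T c dc -> fmem (L2I X T) c.
  by move=> ac; apply/(L2I_memP HX T); exact: (ccont_sqsm HX (AC_ccont HX ac)).
have acT c dc : AC (X := X) dir T c dc -> fmem X (c T) by move=> [mc _ _ _]; exact: mc.
have Fb c dc : AC (X := X) dir T c dc -> m1 + m2 <= Fn c.
  by move=> ac; apply: lerD; [apply: m1P (acL _ _ ac)|apply: m2P (acT _ _ ac)].
have Fc (ck dck : nat -> R -> X) c dc (r : nat -> R) :
    (forall k, AC (X := X) dir T (ck k) (dck k)) -> AC (X := X) dir T c dc -> r @ \oo --> 0 ->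
    (forall k t, 0 <= t <= T -> snorm (V := X) dir (ck k t - c t) <= r k) ->
    Fn (ck k) @[k --> \oo] --> Fn c.
  move=> ack ac r0 rP; have SI := sqsm_semi_inner HX mI.
  have q k : sqsm (X := X) dir I (ck k - c).
    apply: (smemB SI); [exact: (ccont_sqsm HX (AC_ccont HX (ack k)))|].
    exact: (ccont_sqsm HX (AC_ccont HX ac)).
  have r_ge0 k : 0 <= r k by apply: le_trans (rP k T TT); exact: snorm_ge0.
  apply: cvgD.
    have e k : ck k = c + (ck k - c) by rewrite addrC subrK.
    under eq_fun do rewrite e.
    apply: (frechet_cvg nL2I hj1 (acL _ _ ac)); first by move=> k; apply/(L2I_memP HX T).
    apply: (@squeeze_cvgr _ _ _ _ (fun=> 0) (fun k => Num.sqrt T * r k)).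
    - apply: nearW => k; apply/andP; split; first exact: nL2I.
      rewrite (L2I_normE HX (q k)).
      apply: (snorm_ipI_sup HX T0 (q k)) => // t It; apply: rP.
      by move: It; rewrite /= in_itv/= => /andP[? ?]; rewrite !ltW.
    - exact: cvg_cst.
    - exact: cvg0M.
  have e k : ck k T = c T + (ck k T - c T) by rewrite addrC subrK.
  under eq_fun do rewrite e.
  apply: (frechet_cvg nX hj2 (acT _ _ ac)); first by move=> k; apply: (smemB SX); [exact: acT (ack k)|exact: acT ac].
  apply: (@squeeze_cvgr _ _ _ _ (fun=> 0) r) => //; last exact: cvg_cst.
  by apply: nearW => k; apply/andP; split; [exact: nX|exact: (rP k T TT)].
have [c [dc [b [db [s sP]]]]] := friction_minimizer HX HY T0 dissipation_friction Fb Fc.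
have [fs oE] := solution_feasible s; exists c, b; split; first exact: fs.
move=> z g /feasible_solution [c2 [dc2 [b2 [db2 [s2 o2E]]]]].
by rewrite oE o2E; exact: (sP _ _ _ _ s2).
Qed.
End control.

Theorem lemma3p5 (R : realType) (d : nat) (hd : (0 < d)%N)
  (Omega : set 'rV[R]_d) (hOmega : bounded_lipschitz_domain Omega)
  (T : R) (hT : 0 < T)
  (j1 : L2I (H10 Omega) T -> R) (j2 : H10 Omega -> R)
  (hj1 : cont_frechet_diff (L2I (H10 Omega) T) j1)
  (hj1b : bounded_below (L2I (H10 Omega) T) j1)
  (hj2 : cont_frechet_diff (H10 Omega) j2)
  (hj2b : bounded_below (H10 Omega) j2) :
  exists (zbar : R -> H10 Omega) (gbar : R -> L2 Omega),
    feasible T zbar gbar /\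
    forall (z : R -> H10 Omega) (g : R -> L2 Omega), feasible T z g ->
      objective j1 j2 zbar gbar <= objective j1 j2 z g.
Proof.
have [oO _ _ bO _] := hOmega; have [M M0 OM] := bounded_in_cube bO.
exact: (optimal_control_exists M0 OM oO hd hT hj1 hj2 hj1b hj2b).
Qed.
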